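(* Let $\psi=\Gamma'/\Gamma$ denote the digamma function and $\gamma$ the Euler constant. For $x>0$ define $$\phi_{\log}(x):=\sum_{n=1}^{\infty}\left(\psi(nx)+\frac{1}{2nx}-\log(nx)\right)\log(n\sqrt{x}),$$ and, for $x>0$ and any fixed $0<c<1$, $$\mathscr{H}(x):=\frac{1}{2\pi i}\int_{c-i\infty}^{c+i\infty}\frac{\pi\,\zeta(w)\,\zeta(1-w)}{\sin(\pi w)}\left(\pi\cot\left(\frac{\pi w}{2}\right)\right)x^{-w}\,dw,$$ where $\zeta$ is the Riemann zeta function. Define $$\mathscr{G}(x):=\phi_{\log}(x)-\frac{1}{2}\mathscr{H}(x)-\frac{1}{48x}\left(12\gamma^2-5\pi^2\right)+\frac{1}{4x}\left(\gamma\log(x)+\log(2\pi)\log(2\pi x)\right).$$ Then for any $\alpha,\beta>0$ with $\alpha\beta=1$, $$\sqrt{\alpha}\,\mathscr{G}(\alpha)=\sqrt{\beta}\,\mathscr{G}(\beta).$$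
   Context: The series defining $\phi_{\log}(x)$ converges absolutely for $x>0$. The line integral defining $\mathscr{H}(x)$ is taken along the vertical line $\mathrm{Re}(w)=c$ with $0<c<1$. *)

(* Defs.v *)
From Stdlib Require Export Reals.
From Coquelicot Require Export Coquelicot.

Open Scope R_scope.

Definition Gamma (x : R) : R :=
  RInt_gen (fun t => Rpower t (x - 1) * exp (- t))
    (at_right 0) (Rbar_locally p_infty).

Definition digamma (x : R) : R := Derive Gamma x / Gamma x.

Definition euler_gamma : R :=
  real (Lim_seq (fun n => sum_f_R0 (fun k => / INR (S k)) n - ln (INR (S n)))).

Definition Cexp (z : C) : C := (exp (Re z) * (cos (Im z), sin (Im z)))%C.
Definition Csin (z : C) : C := ((Cexp (Ci * z) - Cexp (- (Ci * z))) / (2 * Ci))%C.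
Definition Ccos (z : C) : C := ((Cexp (Ci * z) + Cexp (- (Ci * z))) / 2)%C.
Definition Ccot (z : C) : C := (Ccos z / Csin z)%C.

(* [x ^ w] with the principal value of the logarithm; meaningful for [0 < x]. *)
Definition RCpow (x : R) (w : C) : C := Cexp (w * ln x).

Definition analytic_at (f : C -> C) (s : C) : Prop :=
  exists (a : nat -> C) (r : R), 0 < r /\
    forall z : C, Cmod (z - s) < r ->
      is_pseries (K := C_AbsRing) (V := C_NormedModule) a (z - s)%C (f z).

(* The analytic continuation of the Dirichlet series [sum_(n >= 1) n ^ -s] to
   the complex plane minus the point 1.  It determines [zeta] everywhere except
   at the pole 1, where the value is left arbitrary. *)
Definition is_riemann_zeta (zeta : C -> C) : Prop :=
  (forall s : C, s <> RtoC 1 -> analytic_at zeta s) /\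
  (forall s : C, 1 < Re s ->
     is_series (K := C_AbsRing) (V := C_NormedModule)
       (fun k : nat => RCpow (INR (S k)) (- s)) (zeta s)).

(* Along [w = c + i t] one has [dw = i dt]; the bounds at [-oo] and [+oo] are
   taken independently, not as a principal value. *)
Definition vertical_integral (c : R) (f : C -> C) : C :=
  (Ci * RInt_gen (V := C_R_CompleteNormedModule) (fun t : R => f (c, t))
          (Rbar_locally m_infty) (Rbar_locally p_infty))%C.

Definition phi_log (x : R) : R :=
  Series (fun k : nat => let n := INR (S k) in
    (digamma (n * x) + 1 / (2 * n * x) - ln (n * x)) * ln (n * sqrt x)).

Definition scrH (zeta : C -> C) (c x : R) : C :=
  (1 / (2 * PI * Ci) *
   vertical_integral c (fun w =>
     PI * zeta w * zeta (1 - w) / Csin (PI * w)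
     * (PI * Ccot (PI * w / 2)) * RCpow x (- w)))%C.

Definition scrG (zeta : C -> C) (c x : R) : C :=
  (phi_log x - 1 / 2 * scrH zeta c x
   - RtoC (1 / (48 * x) * (12 * euler_gamma ^ 2 - 5 * PI ^ 2))
   + RtoC (1 / (4 * x)
       * (euler_gamma * ln x + ln (2 * PI) * ln (2 * PI * x))))%C.

(* Main.v *)
(* On the line Re w = c the kernel pi / sin (pi w) * pi cot (pi w / 2) equals
   pi^2 / (2 sin^2 (pi w / 2)), and zeta(w) is the limit of its Dirichlet partial
   sums corrected by N^(1-w) / (1-w).  Replacing both zeta factors by these
   approximations turns H(x) - H(1/x)/x into -2 lim TM, where TM is a double sum
   of ln (x i / j) / (j + x i) plus boundary terms in a primitive of ln y / (1+y).
   Summing over one index produces the digamma function, since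
   sum_(n <= M) 1/(n+y) - ln ((M+y)/y) = g(y) - g(y+M) with g(y) = ln y - psi(y+1);
   hence lim TM is the antisymmetrised phi_log up to constants.  These constants are
   regularised moments of g and ln y * g(y).  They are read off the Laurent expansion
   at s = 1 of the Mellin transform of g(y) + 1/(2y), which is computed from
   g(y) + 1/(2y) = int_0^oo exp(-y t) (1/(e^t - 1) - 1/t + 1/2) dt and the partial
   fractions of the integrand. *)

Require Import Defs.
From Stdlib Require Import Reals Lra Lia Psatz Factorial.
From Coquelicot Require Import Coquelicot.

Open Scope R_scope.

(** * Improper integrals over the real line *)

(** [is_riemann_zeta] fixes zeta only by analyticity and the Dirichlet series, so on [0 < Re s] it
    is first identified with [1 + 1/(s-1) - s] times a fractional-part integral, whose truncations
    are Dirichlet polynomials. Everything then rests on one explicit integral, the kernel times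
    [x ^ (-w)]; it is moved to [Re w = 1], where the kernel is a real multiple of
    [1 / cosh (PI t / 2) ^ 2]. The weights do not match at once: the double sum yields [ln n + ln x]
    at [x] and [ln n] at [1/x], whereas [phi_log] has [ln n + ln x / 2] and [ln n - ln x / 2]. The
    excess [ln x / 2] is traded by the reflection formula for unweighted digamma sums, which comes
    from the same limits by varying a free constant [a]. In the constants, [5 PI^2 / 48] is
    [PI^2 / 24] from Gamma plus [PI^2 / 16] from the sech integral; [gamma^2 / 4] from Gamma and
    [- gamma^2 / 2] from the cross term of Gamma and zeta leave [- gamma^2 / 4]; the first Stieltjes
    constant cancels. *)

Notation RN := R_NormedModule.
Notation RC := R_CompleteNormedModule.

Lemma continuous_of_ex_derive (f : R -> R) (x : R) : ex_derive f x -> continuous f x.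
Proof. apply (ex_derive_continuous (V := RN)). Qed.

Notation continuous_multR := (continuous_mult (K := R_AbsRing)).

Lemma one_plus_sqr_pos (t : R) : 0 < 1 + t ^ 2.
Proof. nra. Qed.

Lemma is_RInt_atan (a b C : R) :
  is_RInt (fun t => C / (1 + t ^ 2)) a b (C * (atan b - atan a)).
Proof.
  replace (C * (atan b - atan a)) with (minus (C * atan b) (C * atan a))
    by (unfold minus, plus, opp; simpl; ring).
  apply (is_RInt_derive (fun t => C * atan t)).
  - intros t _. auto_derive; [easy|]. field. nra.
  - intros t _. apply (ex_derive_continuous (fun t => C / (1 + t ^ 2))).
    auto_derive. nra.
Qed.

Lemma plus_cancel_minus {G : AbelianGroup} (x y z : G) :
  plus x z = minus (plus x (plus y z)) y.
Proof.
  unfold minus. rewrite (plus_comm y z), (plus_assoc x z y).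
  now rewrite <- (plus_assoc (plus x z)), plus_opp_r, plus_zero_r.
Qed.

Section Dominated.
Context {V : CompleteNormedModule R_AbsRing}.

Lemma ex_RInt_cont (f : R -> V) (a b : R) :
  (forall t, continuous f t) -> ex_RInt f a b.
Proof. intros H. apply (ex_RInt_continuous f). intros; apply H. Qed.

(** [C / (1 + t ^ 2)] is the standard majorant below; its primitive [C * atan t] is bounded, which
    turns domination into an estimate at finite and infinite ends alike. The absolute value covers
    either order of [a] and [b]. *)
Lemma norm_RInt_atan (f : R -> V) (C a b : R) :
  (forall t, continuous f t) ->
  (forall t, Rmin a b <= t <= Rmax a b -> norm (f t) <= C / (1 + t ^ 2)) ->
  norm (RInt f a b) <= C * Rabs (atan b - atan a).
Proof.
  intros Hc Hd.
  assert (HC : 0 <= C).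
  { assert (Rmin a b <= a <= Rmax a b) by (split; [apply Rmin_l | apply Rmax_l]).
    specialize (Hd a H). pose proof (norm_ge_0 (f a)).
    pose proof (one_plus_sqr_pos a).
    apply Rmult_le_reg_r with (/ (1 + a ^ 2)); [now apply Rinv_0_lt_compat|].
    unfold Rdiv in Hd. lra. }
  assert (Hle : forall u v, u <= v ->
    (forall t, u <= t <= v -> norm (f t) <= C / (1 + t ^ 2)) ->
    norm (RInt f u v) <= C * Rabs (atan v - atan u)).
  { intros u v Huv H.
    apply Rle_trans with (C * (atan v - atan u)).
    - apply (norm_RInt_le f (fun t => C / (1 + t ^ 2)) u v); auto.
      + apply (RInt_correct f), ex_RInt_cont, Hc.
      + apply is_RInt_atan.
    - apply Rmult_le_compat_l; [easy | apply Rle_abs]. }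
  destruct (Rle_dec a b) as [Hab | Hab].
  - apply Hle; [easy|]. rewrite Rmin_left, Rmax_right in Hd; auto.
  - rewrite <- (opp_RInt_swap f) by apply ex_RInt_cont, Hc.
    rewrite (norm_opp (V := V)), Rabs_minus_sym.
    rewrite Rmin_right, Rmax_left in Hd by lra. apply Hle; auto; lra.
Qed.

(** The integrals over [[a, b]] are Cauchy along the two filters because [atan] converges along each
    of them. The filters are left general to serve the line and the half-line at once; the
    order-convex set [P] confines the majorant to the region that the endpoints reach, so on the
    half-line nothing beyond continuity is asked of [f] at negative [t]. *)
Lemma dominated_RInt_gen (Fa Fb : (R -> Prop) -> Prop) {FFa : ProperFilter Fa}
    {FFb : ProperFilter Fb} (P : R -> Prop) (f : R -> V) (C la lb : R) :
  (forall x y z, P x -> P y -> Rmin x y <= z <= Rmax x y -> P z) -> Fa P -> Fb P ->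
  filterlim atan Fa (locally la) -> filterlim atan Fb (locally lb) ->
  (forall t, continuous f t) ->
  (forall t, P t -> norm (f t) <= C / (1 + t ^ 2)) ->
  exists l, is_RInt_gen f Fa Fb l /\ norm l <= C * Rabs (lb - la).
Proof.
  intros HP HPa HPb Hla Hlb Hc Hd.
  assert (HC : 0 <= C).
  { destruct (filter_ex P HPa) as [a Ha].
    specialize (Hd a Ha). pose proof (norm_ge_0 (f a)).
    pose proof (one_plus_sqr_pos a).
    apply Rmult_le_reg_r with (/ (1 + a ^ 2)); [now apply Rinv_0_lt_compat|].
    unfold Rdiv in Hd. lra. }
  assert (Hnorm : forall x y, P x -> P y ->
    norm (RInt f x y) <= C * Rabs (atan y - atan x)).
  { intros x y Hx Hy. apply norm_RInt_atan; auto.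
    intros t Ht. apply Hd. now apply (HP x y). }
  assert (Hex : exists l, filterlim (fun ab => RInt f (fst ab) (snd ab))
      (filter_prod Fa Fb) (locally l)).
  { apply filterlim_locally_cauchy. intros eps.
    (* With [d] this radius, each endpoint moves [atan] by at most [2 d], so the two end pieces add
       up to at most [4 C d], which is below [eps]. *)
    assert (He : 0 < eps / (4 * (C + 1))).
    { apply Rdiv_lt_0_compat; [apply cond_pos | lra]. }
    exists (fun ab => (P (fst ab) /\ ball la (mkposreal _ He) (atan (fst ab))) /\
                      (P (snd ab) /\ ball lb (mkposreal _ He) (atan (snd ab)))).
    split.
    - apply (Filter_prod _ _ _ (fun a => P a /\ ball la (mkposreal _ He) (atan a))
        (fun b => P b /\ ball lb (mkposreal _ He) (atan b))); auto.
      + apply filter_and; auto. apply Hla. now exists (mkposreal _ He).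
      + apply filter_and; auto. apply Hlb. now exists (mkposreal _ He).
    - intros [a b] [a' b'] [[Pa Ba] [Pb Bb]] [[Pa' Ba'] [Pb' Bb']]; simpl in *.
      apply (norm_compat1 (V := V)).
      assert (Hm : minus (RInt f a' b') (RInt f a b)
        = plus (RInt f a' a) (RInt f b b')).
      { assert (Hg : forall x y z : V, plus x z = minus (plus x (plus y z)) y).
          { intros x y z. exact (plus_cancel_minus (G := V) x y z). }
          rewrite (Hg _ (RInt f a b)). f_equal. symmetry.
          rewrite (RInt_Chasles f a b b') by (apply ex_RInt_cont; auto).
          apply RInt_Chasles; apply ex_RInt_cont; auto. }
      eapply Rle_lt_trans; [apply Req_le, (f_equal norm Hm)|].
      eapply Rle_lt_trans; [apply (norm_triangle (V := V))|].
      eapply Rle_lt_trans; [apply Rplus_le_compat; apply Hnorm; auto|].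
      change (Rabs (atan a - la) < eps / (4 * (C + 1))) in Ba.
      change (Rabs (atan b - lb) < eps / (4 * (C + 1))) in Bb.
      change (Rabs (atan a' - la) < eps / (4 * (C + 1))) in Ba'.
      change (Rabs (atan b' - lb) < eps / (4 * (C + 1))) in Bb'.
      set (d := eps / (4 * (C + 1))) in *.
      assert (Rabs (atan a - atan a') <= 2 * d).
      { replace (atan a - atan a') with ((atan a - la) - (atan a' - la)) by ring.
        eapply Rle_trans; [apply Rabs_triang|]. rewrite Rabs_Ropp. lra. }
      assert (Rabs (atan b' - atan b) <= 2 * d).
      { replace (atan b' - atan b) with ((atan b' - lb) - (atan b - lb)) by ring.
        eapply Rle_trans; [apply Rabs_triang|]. rewrite Rabs_Ropp. lra. }
      assert (d * (4 * (C + 1)) = eps) by (unfold d; field; lra).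
      pose proof (cond_pos eps). nra. }
  destruct Hex as [l Hl]. exists l.
  split.
  - intros Q HQ. specialize (Hl Q HQ). unfold filtermap in Hl. unfold filtermapi.
    eapply filter_imp; [|exact Hl]. intros [a b] HQ'. simpl in *.
    exists (RInt f a b). split; auto. apply (RInt_correct f), ex_RInt_cont, Hc.
  - apply (filterlim_le (F := filter_prod Fa Fb)
      (fun ab => norm (RInt f (fst ab) (snd ab)))
      (fun ab => C * Rabs (atan (snd ab) - atan (fst ab))) (norm l)
      (C * Rabs (lb - la))).
    + apply (Filter_prod _ _ _ P P); auto.
    + eapply filterlim_comp; [exact Hl | apply (filterlim_norm (V := V))].
    + apply (filterlim_comp _ _ _ (fun ab => (atan (snd ab), atan (fst ab)))
        (fun xy => C * Rabs (fst xy - snd xy)) _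
        (filter_prod (locally lb) (locally la))).
      * apply filterlim_pair.
        -- eapply filterlim_comp; [apply filterlim_snd | exact Hlb].
        -- eapply filterlim_comp; [apply filterlim_fst | exact Hla].
      * apply (filterlim_comp _ _ _ (fun xy => fst xy - snd xy)
          (fun z => C * Rabs z) _ (locally (lb - la))).
        -- apply (filterlim_comp_2 fst (fun xy => opp (snd xy)) plus
             (G := locally lb) (H := locally (opp la))).
           ++ apply filterlim_fst.
           ++ eapply filterlim_comp; [apply filterlim_snd | apply (filterlim_opp la)].
           ++ apply (filterlim_plus lb (opp la)).
        -- apply (continuous_comp Rabs (fun z => C * z)).
           ++ apply continuous_Rabs.
           ++ apply (continuous_scal_r C (fun z : R => z)), continuous_id.
Qed.
End Dominated.

Lemma minus_minus {G : AbelianGroup} (x y : G) : minus y (minus y x) = x.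
Proof.
  unfold minus at 1. rewrite opp_minus. unfold minus.
  now rewrite plus_comm, <- plus_assoc, plus_opp_l, plus_zero_r.
Qed.

Definition is_RInt_R {V : NormedModule R_AbsRing} (f : R -> V) (l : V) :=
  is_RInt_gen f (Rbar_locally m_infty) (Rbar_locally p_infty) l.

Lemma atan_p_infty : filterlim atan (Rbar_locally p_infty) (locally (PI / 2)).
Proof.
  intros P [eps HP].
  set (d := Rmin eps (PI / 2) / 2).
  assert (Hd : 0 < d /\ d < PI / 2 /\ d < eps).
  { unfold d. pose proof PI_RGT_0. pose proof (cond_pos eps).
    assert (0 < Rmin eps (PI / 2)) by (apply Rmin_pos; lra).
    pose proof (Rmin_l eps (PI / 2)). pose proof (Rmin_r eps (PI / 2)). lra. }
  exists (tan (PI / 2 - d)). intros t Ht. apply HP.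
  change (Rabs (atan t - PI / 2) < eps).
  assert (PI / 2 - d < atan t).
  { rewrite <- (atan_tan (PI / 2 - d)) by lra. now apply atan_increasing. }
  pose proof (atan_bound t). apply Rabs_def1; lra.
Qed.

Lemma atan_m_infty : filterlim atan (Rbar_locally m_infty) (locally (- PI / 2)).
Proof.
  intros P [eps HP].
  destruct (atan_p_infty (ball (PI / 2) eps) (locally_ball _ eps)) as [M HM].
  exists (- M). intros t Ht. apply HP.
  specialize (HM (- t) ltac:(lra)).
  change (Rabs (atan (- t) - PI / 2) < eps) in HM.
  change (Rabs (atan t - - PI / 2) < eps).
  rewrite atan_opp in HM. rewrite <- Rabs_Ropp.
  replace (- (atan t - - PI / 2)) with (- atan t - PI / 2) by field. exact HM.
Qed.

Lemma atan_at_point (a : R) : filterlim atan (at_point a) (locally (atan a)).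
Proof. intros P HP. exact (locally_singleton _ _ HP). Qed.

Lemma prod_m_p_infty (Q : R * R -> Prop) :
  (exists A, forall a b, a < - A -> A < b -> Q (a, b)) ->
  filter_prod (Rbar_locally m_infty) (Rbar_locally p_infty) Q.
Proof.
  intros [A HA].
  apply (Filter_prod _ _ _ (fun a => a < - A) (fun b => A < b)).
  - now exists (- A).
  - now exists A.
  - auto.
Qed.

Lemma is_RInt_R_cauchy_weight (C : R) :
  is_RInt_R (fun t => C / (1 + t ^ 2)) (C * PI).
Proof.
  intros P HP. unfold filtermapi.
  assert (Hl : filterlim (fun ab => C * (atan (snd ab) - atan (fst ab)))
    (filter_prod (Rbar_locally m_infty) (Rbar_locally p_infty)) (locally (C * PI))).
  { apply (filterlim_comp _ _ _ (fun ab => (atan (snd ab), atan (fst ab)))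
      (fun xy => C * (fst xy - snd xy)) _
      (filter_prod (locally (PI / 2)) (locally (- PI / 2)))).
    - apply filterlim_pair.
      + eapply filterlim_comp; [apply filterlim_snd | exact atan_p_infty].
      + eapply filterlim_comp; [apply filterlim_fst | exact atan_m_infty].
    - apply (filterlim_comp _ _ _ (fun xy => fst xy - snd xy)
        (fun z => C * z) _ (locally PI)).
      + replace PI with (PI / 2 + - (- PI / 2)) at 3 by field.
        apply (filterlim_comp_2 fst (fun xy => opp (snd xy)) plus
             (G := locally (PI / 2)) (H := locally (opp (- PI / 2)))).
        * apply filterlim_fst.
        * eapply filterlim_comp; [apply filterlim_snd | apply (filterlim_opp (- PI / 2))].
        * apply (filterlim_plus (PI / 2) (opp (- PI / 2))).
      + apply (continuous_scal_r C (fun z : R => z)), continuous_id. }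
  specialize (Hl P HP). eapply filter_imp; [|exact Hl].
  intros [a b] H. simpl in *. exists (C * (atan b - atan a)).
  split; [apply is_RInt_atan | exact H].
Qed.

Lemma is_RInt_R_norm_le {V : CompleteNormedModule R_AbsRing} (f : R -> V) (g : R -> R)
    (lf : V) (lg : R) :
  is_RInt_R f lf -> is_RInt_R g lg -> (forall t, norm (f t) <= g t) ->
  norm lf <= lg.
Proof.
  intros Hf Hg H.
  apply (RInt_gen_norm (V := V) (Fa := Rbar_locally m_infty) (Fb := Rbar_locally p_infty) f g);
    auto; apply prod_m_p_infty; exists 0; intros a b Ha Hb; simpl; [lra | auto].
Qed.

Lemma is_RInt_R_bound {V : CompleteNormedModule R_AbsRing} (f : R -> V) (l : V) (C : R) :
  is_RInt_R f l -> (forall t, norm (f t) <= C / (1 + t ^ 2)) -> norm l <= C * PI.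
Proof.
  intros Hf H. apply (is_RInt_R_norm_le f _ l (C * PI) Hf (is_RInt_R_cauchy_weight C) H).
Qed.

Lemma is_RInt_R_ex {V : CompleteNormedModule R_AbsRing} (f : R -> V) (C : R) :
  (forall t, continuous f t) -> (forall t, norm (f t) <= C / (1 + t ^ 2)) ->
  exists l, is_RInt_R f l.
Proof.
  intros Hc Hd.
  destruct (dominated_RInt_gen (Rbar_locally m_infty) (Rbar_locally p_infty)
    (fun _ => True) f C (- PI / 2) (PI / 2)) as [l [Hl _]]; auto.
  - apply filter_true.
  - apply filter_true.
  - apply atan_m_infty.
  - apply atan_p_infty.
  - now exists l.
Qed.

Lemma is_RInt_R_unique {V : CompleteNormedModule R_AbsRing} (f : R -> V) (l1 l2 : V) :
  is_RInt_R f l1 -> is_RInt_R f l2 -> l1 = l2.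
Proof.
  intros H1 H2. now rewrite <- (is_RInt_gen_unique f l1 H1), <- (is_RInt_gen_unique f l2 H2).
Qed.

Lemma is_RInt_R_ext {V : NormedModule R_AbsRing} (f g : R -> V) (l : V) :
  (forall t, f t = g t) -> is_RInt_R f l -> is_RInt_R g l.
Proof.
  intros H. apply (is_RInt_gen_ext (V := V)).
  apply filter_forall. intros; apply H.
Qed.

Lemma is_RInt_R_plus {V : NormedModule R_AbsRing} (f g : R -> V) (lf lg : V) :
  is_RInt_R f lf -> is_RInt_R g lg ->
  is_RInt_R (fun t => plus (f t) (g t)) (plus lf lg).
Proof. intros; now apply (is_RInt_gen_plus (V := V)). Qed.

Lemma is_RInt_R_minus {V : NormedModule R_AbsRing} (f g : R -> V) (lf lg : V) :
  is_RInt_R f lf -> is_RInt_R g lg ->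
  is_RInt_R (fun t => minus (f t) (g t)) (minus lf lg).
Proof. intros; now apply (is_RInt_gen_minus (V := V)). Qed.

Lemma is_RInt_R_scal {V : NormedModule R_AbsRing} (f : R -> V) (k : R) (l : V) :
  is_RInt_R f l -> is_RInt_R (fun t => scal k (f t)) (scal k l).
Proof. intros; now apply (is_RInt_gen_scal (V := V)). Qed.

Lemma is_RInt_R_lift {V : NormedModule R_AbsRing} (f : R -> V) (l : V) :
  (forall eps : posreal, exists A, forall a b, a < - A -> A < b ->
     exists y, is_RInt f a b y /\ ball l eps y) -> is_RInt_R f l.
Proof.
  intros H P [eps HP]. unfold filtermapi.
  apply prod_m_p_infty. destruct (H eps) as [A HA]. exists A.
  intros a b Ha Hb. destruct (HA a b Ha Hb) as [y [H1 H2]]. exists y. split; auto.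
Qed.

Lemma is_RInt_R_elim {V : NormedModule R_AbsRing} (f : R -> V) (l : V) :
  is_RInt_R f l -> forall eps : posreal, exists A, forall a b, a < - A -> A < b ->
     exists y, is_RInt f a b y /\ ball l eps y.
Proof.
  intros H eps. specialize (H (ball l eps) (locally_ball l eps)).
  destruct H as [Q S [M1 HM1] [M2 HM2] HQS].
  exists (Rmax (- M1) M2). intros a b Ha Hb.
  apply (HQS a b).
  - apply HM1. pose proof (Rmax_l (- M1) M2). lra.
  - apply HM2. pose proof (Rmax_r (- M1) M2). lra.
Qed.

Lemma is_RInt_R_translate {V : NormedModule R_AbsRing} (f : R -> V) (c : R) (l : V) :
  is_RInt_R f l -> is_RInt_R (fun t => f (t + c)) l.
Proof.
  intros H. apply is_RInt_R_lift. intros eps.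
  destruct (is_RInt_R_elim f l H eps) as [A HA].
  exists (A + Rabs c). intros a b Ha Hb.
  pose proof (Rle_abs c). pose proof (Rle_abs (- c)). rewrite Rabs_Ropp in H1.
  destruct (HA (a + c) (b + c)) as [y [H2 H3]]; [lra | lra |].
  exists y; split; auto.
  apply (is_RInt_ext (fun t => scal 1 (f (1 * t + c)))).
  - intros t _. etransitivity; [apply (scal_one (f (1 * t + c)))|]. f_equal. ring.
  - apply (is_RInt_comp_lin f 1 c a b).
    now replace (1 * a + c) with (a + c) by ring; replace (1 * b + c) with (b + c) by ring.
Qed.

Lemma is_RInt_R_reflect {V : NormedModule R_AbsRing} (f : R -> V) (l : V) :
  is_RInt_R f l -> is_RInt_R (fun t => f (- t)) l.
Proof.
  intros H. apply is_RInt_R_lift. intros eps.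
  destruct (is_RInt_R_elim f l H eps) as [A HA].
  exists A. intros a b Ha Hb.
  destruct (HA (- b) (- a)) as [y [H2 H3]]; [lra | lra |].
  exists y; split; auto.
  apply is_RInt_swap in H2.
  replace y with (opp (opp y)) by apply opp_opp.
  apply (is_RInt_ext (fun t => opp (scal (-1) (f (-1 * t + 0))))).
  - intros t _. rewrite <- scal_opp_l.
    transitivity (scal 1 (f (-1 * t + 0))); [f_equal; unfold opp; simpl; ring|].
    etransitivity; [apply (scal_one (f (-1 * t + 0)))|]. f_equal. ring.
  - apply (is_RInt_opp (V := V)).
    apply (is_RInt_comp_lin f (-1) 0 a b).
    now replace (-1 * a + 0) with (- a) by ring; replace (-1 * b + 0) with (- b) by ring.
Qed.

Lemma is_RInt_R_derive {V : CompleteNormedModule R_AbsRing} (F f : R -> V) (la lb : V) :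
  (forall t, is_derive F t (f t)) -> (forall t, continuous f t) ->
  filterlim F (Rbar_locally m_infty) (locally la) ->
  filterlim F (Rbar_locally p_infty) (locally lb) ->
  is_RInt_R f (minus lb la).
Proof.
  intros HF Hc Ha Hb P HP. unfold filtermapi.
  assert (Hl : filterlim (fun ab => minus (F (snd ab)) (F (fst ab)))
    (filter_prod (Rbar_locally m_infty) (Rbar_locally p_infty)) (locally (minus lb la))).
  { unfold minus.
    apply (filterlim_comp_2 (fun ab => F (snd ab)) (fun ab => opp (F (fst ab))) plus
             (G := locally lb) (H := locally (opp la))).
    - eapply filterlim_comp; [apply filterlim_snd | exact Hb].
    - eapply filterlim_comp; [| apply (filterlim_opp (V := V) la)].
      eapply filterlim_comp; [apply filterlim_fst | exact Ha].
    - apply (filterlim_plus (V := V) lb (opp la)). }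
  specialize (Hl P HP). eapply filter_imp; [|exact Hl].
  intros [a b] H. simpl in *. exists (minus (F b) (F a)).
  split; [|exact H]. apply (is_RInt_derive F f); auto.
Qed.

(** Dominated convergence to zero under locally uniform convergence: beyond [T] the common majorant
    leaves at most [C (PI / 2 - atan T)] on each side, and on [[-T, T]] uniform smallness
    suffices. *)
Lemma is_RInt_R_dominated_0 {V : CompleteNormedModule R_AbsRing}
    (f : nat -> R -> V) (l : nat -> V) (C : R) :
  (forall n, is_RInt_R (f n) (l n)) ->
  (forall n t, norm (f n t) <= C / (1 + t ^ 2)) ->
  (forall T eps, 0 < eps -> exists N, forall n t, (N <= n)%nat -> Rabs t <= T ->
     norm (f n t) <= eps) ->
  is_lim_seq (fun n => norm (l n)) 0.
Proof.
  intros Hf Hd H0. apply is_lim_seq_spec. intros eps.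
  assert (HC : 0 <= C).
  { specialize (Hd O 0). pose proof (norm_ge_0 (f O 0)).
    replace (C / (1 + 0 ^ 2)) with C in Hd by field. lra. }
  (* Each tail costs at most [C d], hence both together at most [eps / 4]; the central piece takes
     another [eps / 4], and the passage from a finite interval to the improper integral a third. *)
  set (d := eps / 8 / (C + 1)).
  assert (Hd0 : 0 < d).
  { unfold d. pose proof (cond_pos eps). apply Rdiv_lt_0_compat; lra. }
  assert (Hat : exists T, 0 < T /\ PI / 2 - atan T <= d).
  { destruct (atan_p_infty (ball (PI / 2) (mkposreal _ Hd0)) (locally_ball _ _))
      as [M HM].
    exists (Rmax 0 M + 1). split; [pose proof (Rmax_l 0 M); lra|].
    assert (M < Rmax 0 M + 1) by (pose proof (Rmax_r 0 M); lra).
    specialize (HM _ H).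
    change (Rabs (atan (Rmax 0 M + 1) - PI / 2) < d) in HM.
    apply Rabs_def2 in HM. lra. }
  destruct Hat as [T [HT HTd]].
  destruct (H0 T (eps / 8 / T)) as [N HN].
  { pose proof (cond_pos eps). apply Rdiv_lt_0_compat; lra. }
  exists N. intros n Hn.
  rewrite Rminus_0_r, Rabs_pos_eq by apply norm_ge_0.
  (* Balls and norms agree only up to [norm_factor], which is divided out here. *)
  destruct (is_RInt_R_elim (V := V) (f n) (l n) (Hf n) (mkposreal (eps / 4 / norm_factor (V := V))
    (Rdiv_lt_0_compat _ _ (Rdiv_lt_0_compat _ 4 (cond_pos eps) ltac:(lra))
      (norm_factor_gt_0 (V := V)))))
    as [A HA].
  set (a := - (Rmax A T + 1)). set (b := Rmax A T + 1).
  assert (a < - A) by (unfold a; pose proof (Rmax_l A T); lra).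
  assert (A < b) by (unfold b; pose proof (Rmax_l A T); lra).
  assert (a < - T) by (unfold a; pose proof (Rmax_r A T); lra).
  assert (T < b) by (unfold b; pose proof (Rmax_r A T); lra).
  destruct (HA a b H H1) as [y [Hy Hby]].
  assert (Hy2 : norm y <= eps / 2).
  { assert (Hex : ex_RInt (f n) a b) by now exists y.
    assert (Hex1 : ex_RInt (f n) a (- T))
      by (apply (ex_RInt_Chasles_1 (f n) a (- T) b); auto; lra).
    assert (Hex2 : ex_RInt (f n) (- T) b)
      by (apply (ex_RInt_Chasles_2 (f n) a (- T) b); auto; lra).
    assert (Hex3 : ex_RInt (f n) (- T) T)
      by (apply (ex_RInt_Chasles_1 (f n) (- T) T b); auto; lra).
    assert (Hex4 : ex_RInt (f n) T b)
      by (apply (ex_RInt_Chasles_2 (f n) (- T) T b); auto; lra).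
    rewrite <- (is_RInt_unique _ _ _ _ Hy).
    rewrite <- (RInt_Chasles (f n) a (- T) b), <- (RInt_Chasles (f n) (- T) T b) by auto.
    eapply Rle_trans; [apply (norm_triangle (V := V))|].
    assert (norm (RInt (f n) a (- T)) <= C * (atan (- T) - atan a)).
    { apply (norm_RInt_le (f n) (fun t => C / (1 + t ^ 2)) a (- T)); [lra | auto | |].
      - now apply (RInt_correct (f n)).
      - apply is_RInt_atan. }
    assert (norm (RInt (f n) T b) <= C * (atan b - atan T)).
    { apply (norm_RInt_le (f n) (fun t => C / (1 + t ^ 2)) T b); [lra | auto | |].
      - now apply (RInt_correct (f n)).
      - apply is_RInt_atan. }
    assert (norm (RInt (f n) (- T) T) <= (T - - T) * (eps / 8 / T)).
    { apply (norm_RInt_le_const (f n) (- T) T); [lra | |].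
      - intros t Ht. apply HN; auto. apply Rabs_le; lra.
      - now apply (RInt_correct (f n)). }
    assert ((T - - T) * (eps / 8 / T) = eps / 4) by (field; lra).
    pose proof (norm_triangle (V := V) (RInt (f n) (- T) T) (RInt (f n) T b)).
    assert (C * (atan (- T) - atan a) <= C * d).
    { apply Rmult_le_compat_l; auto. rewrite atan_opp.
      pose proof (atan_bound a). lra. }
    assert (C * (atan b - atan T) <= C * d).
    { apply Rmult_le_compat_l; auto. pose proof (atan_bound b). lra. }
    assert (d * (C + 1) = eps / 8) by (unfold d; field; lra).
    eapply Rle_trans; [apply Rplus_le_compat_l; eassumption|].
    nra. }
  pose proof (norm_compat2 (V := V) _ _ _ Hby) as Hn2. simpl in Hn2.
  assert (norm_factor (V := V) * (eps / 4 / norm_factor (V := V)) = eps / 4).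
  { field. apply Rgt_not_eq, norm_factor_gt_0. }
  rewrite H4 in Hn2.
  assert (norm (l n) <= norm y + norm (minus y (l n))).
  { replace (l n) with (minus y (minus y (l n))) at 1.
    - eapply Rle_trans; [apply (norm_triangle (V := V))|].
      rewrite (norm_opp (V := V)). lra.
    - apply (minus_minus (G := V)). }
  pose proof (cond_pos eps). lra.
Qed.

Lemma is_derive_quadratic {V : NormedModule R_AbsRing} (I : R -> V) (v : R) (D : V) (C r : R) :
  0 < r ->
  (forall h, Rabs h < r ->
     norm (minus (minus (I (v + h)) (I v)) (scal h D)) <= C * h ^ 2) ->
  is_derive I v D.
Proof.
  intros Hr H. split; [apply is_linear_scal_l|].
  intros x Hx. rewrite <- (is_filter_lim_locally_unique _ _ Hx). clear x Hx.
  intros eps.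
  assert (HC : 0 <= C).
  { specialize (H (r / 2)). rewrite Rabs_pos_eq in H by lra.
    pose proof (norm_ge_0 (minus (minus (I (v + r / 2)) (I v)) (scal (r / 2) D))).
    assert (0 <= C * (r / 2) ^ 2) by (eapply Rle_trans; [exact H0 | apply H; lra]).
    assert (0 < (r / 2) ^ 2) by (apply pow_lt; lra). nra. }
  assert (Hd : 0 < Rmin r (eps / (C + 1))).
  { apply Rmin_pos; auto. pose proof (cond_pos eps). apply Rdiv_lt_0_compat; lra. }
  exists (mkposreal _ Hd). intros y Hy.
  change (Rabs (y - v) < Rmin r (eps / (C + 1))) in Hy.
  assert (Hy1 : Rabs (y - v) < r) by (eapply Rlt_le_trans; [exact Hy | apply Rmin_l]).
  assert (Hy2 : Rabs (y - v) < eps / (C + 1))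
    by (eapply Rlt_le_trans; [exact Hy | apply Rmin_r]).
  specialize (H (y - v) Hy1).
  replace (v + (y - v)) with (y : R) in H by (simpl in *; lra).
  change (minus y v) with (y - v).
  eapply Rle_trans; [exact H|]. change (norm (y - v)) with (Rabs (y - v)).
  rewrite <- (pow2_abs (y - v)).
  assert (Rabs (y - v) * (C + 1) <= eps).
  { apply Rmult_le_reg_r with (/ (C + 1)); [apply Rinv_0_lt_compat; lra|].
    rewrite Rmult_assoc, Rinv_r, Rmult_1_r by lra. unfold Rdiv in Hy2. lra. }
  pose proof (Rabs_pos (y - v)). nra.
Qed.

(** A pointwise second-order remainder [C h ^ 2 / (1 + t ^ 2)] integrates to [PI C h ^ 2], which is
    all that differentiability of the integral requires. Differentiation under the integral sign
    goes through this form below, with a second-order Taylor estimate supplying the remainder. *)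
Lemma is_derive_RInt_R {V : CompleteNormedModule R_AbsRing} (f : R -> R -> V) (f1 : R -> V)
    (I : R -> V) (I1 : V) (v C r : R) :
  0 < r ->
  (forall h, Rabs h < r -> is_RInt_R (f (v + h)) (I (v + h))) ->
  is_RInt_R f1 I1 ->
  (forall h t, Rabs h < r ->
     norm (minus (minus (f (v + h) t) (f v t)) (scal h (f1 t))) <= C * h ^ 2 / (1 + t ^ 2)) ->
  is_derive I v I1.
Proof.
  intros Hr Hf Hf1 Hd.
  apply (is_derive_quadratic (V := V) I v I1 (C * PI) r); auto.
  intros h Hh.
  assert (H0 : is_RInt_R (f v) (I v)).
  { replace v with (v + 0) by ring. apply Hf. now rewrite Rabs_R0. }
  replace (C * PI * h ^ 2) with (C * h ^ 2 * PI) by ring.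
  eapply (is_RInt_R_bound (V := V)).
  - apply (is_RInt_R_minus (V := V)); [apply (is_RInt_R_minus (V := V))|].
    + apply Hf, Hh.
    + exact H0.
    + apply (is_RInt_R_scal (V := V)), Hf1.
  - intros t. apply Hd, Hh.
Qed.

(** * Complex-valued functions of a real variable *)

Notation CR := C_R_CompleteNormedModule.
Notation is_deriveC := (is_derive (V := CR)).
Notation continuousC := (continuous (U := CR)).
Notation is_RIntC := (is_RInt (V := CR)).
Notation is_RInt_RC := (is_RInt_R (V := CR)).

Lemma norm_CR (z : CR) : norm z = Cmod z.
Proof.
  change (norm z) with (sqrt (Rabs (fst z) ^ 2 + Rabs (snd z) ^ 2)).
  unfold Cmod. now rewrite !pow2_abs.
Qed.

Lemma scal_CR (r : R) (z : CR) : scal r z = (RtoC r * z)%C.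
Proof.
  apply injective_projections; simpl; unfold scal; simpl; unfold mult; simpl; ring.
Qed.

Ltac cr_eq :=
  apply injective_projections; unfold scal, plus, Re, Im; simpl;
  unfold scal, plus, mult, Re, Im; simpl; unfold mult; simpl; ring.

Lemma is_derive_CR (f : R -> C) (x a b : R) :
  is_derive (fun t => Re (f t)) x a -> is_derive (fun t => Im (f t)) x b ->
  is_deriveC f x ((a, b) : C).
Proof.
  intros Ha Hb.
  assert (H : is_deriveC
    (fun t => plus (scal (Re (f t)) ((1, 0) : CR)) (scal (Im (f t)) ((0, 1) : CR))) x
    (plus (scal a ((1, 0) : CR)) (scal b ((0, 1) : CR)))).
  { apply (is_derive_plus (V := CR)); apply (is_derive_scal_l (V := CR)); auto. }
  replace ((a, b) : CR) with (plus (scal a ((1, 0) : CR)) (scal b ((0, 1) : CR))).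
  - eapply (is_derive_ext (V := CR)); [|exact H].
    intros t. cr_eq.
  - cr_eq.
Qed.

Lemma Re_mult (x y : C) : Re (x * y) = Re x * Re y - Im x * Im y.
Proof. reflexivity. Qed.
Lemma C_eta (z : C) : z = (Re z, Im z).
Proof. now destruct z. Qed.

Lemma is_derive_CR_Re (f : R -> C) (x : R) (l : C) :
  is_deriveC f x l -> is_derive (fun t => Re (f t)) x (Re l).
Proof.
  intros H.
  assert (L : is_linear (K := R_AbsRing) (U := CR) (V := RN) (fun z => Re z)).
  { apply (is_linear_fst (K := R_AbsRing) (U := RN) (V := RN)). }
  pose proof (filterdiff_comp (U := RN) (V := CR) f (fun z => Re z) _ _ H
    (filterdiff_linear _ L)) as H'.
  apply (filterdiff_ext_lin _ _ _ H'). intros y. reflexivity.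
Qed.

Lemma is_derive_CR_Im (f : R -> C) (x : R) (l : C) :
  is_deriveC f x l -> is_derive (fun t => Im (f t)) x (Im l).
Proof.
  intros H.
  assert (L : is_linear (K := R_AbsRing) (U := CR) (V := RN) (fun z => Im z)).
  { apply (is_linear_snd (K := R_AbsRing) (U := RN) (V := RN)). }
  pose proof (filterdiff_comp (U := RN) (V := CR) f (fun z => Im z) _ _ H
    (filterdiff_linear _ L)) as H'.
  apply (filterdiff_ext_lin _ _ _ H'). intros y. reflexivity.
Qed.

Lemma is_derive_CR_mult (f g : R -> C) (x : R) (df dg : C) :
  is_deriveC f x df -> is_deriveC g x dg ->
  is_deriveC (fun t => f t * g t)%C x (df * g x + f x * dg)%C.
Proof.
  intros Hf Hg.
  pose proof (is_derive_CR_Re _ _ _ Hf). pose proof (is_derive_CR_Im _ _ _ Hf).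
  pose proof (is_derive_CR_Re _ _ _ Hg). pose proof (is_derive_CR_Im _ _ _ Hg).
  rewrite (C_eta (df * g x + f x * dg)). apply is_derive_CR.
  - eapply (is_derive_ext (fun t => Re (f t) * Re (g t) - Im (f t) * Im (g t)));
      [reflexivity|].
    replace (Re (df * g x + f x * dg)) with
      ((Re df * Re (g x) + Re (f x) * Re dg) - (Im df * Im (g x) + Im (f x) * Im dg))
      by (unfold Re, Im; simpl; ring).
    apply (is_derive_minus (V := RN));
      apply Derive.is_derive_mult; auto.
  - eapply (is_derive_ext (fun t => Re (f t) * Im (g t) + Im (f t) * Re (g t)));
      [reflexivity|].
    replace (Im (df * g x + f x * dg)) with
      ((Re df * Im (g x) + Re (f x) * Im dg) + (Im df * Re (g x) + Im (f x) * Re dg))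
      by (unfold Re, Im; simpl; ring).
    apply (is_derive_plus (V := RN));
      apply Derive.is_derive_mult; auto.
Qed.

Lemma is_derive_CR_const (c : C) (x : R) : is_deriveC (fun _ => c) x (RtoC 0).
Proof. apply (is_derive_const (V := CR)). Qed.

Lemma is_derive_CR_scal_l (k : C) (f : R -> C) (x : R) (df : C) :
  is_deriveC f x df -> is_deriveC (fun t => k * f t)%C x (k * df)%C.
Proof.
  intros H. replace (k * df)%C with (0 * f x + k * df)%C by ring.
  apply (is_derive_CR_mult (fun _ => k)); [apply is_derive_CR_const | exact H].
Qed.

Lemma is_derive_CR_plus (f g : R -> C) (x : R) (df dg : C) :
  is_deriveC f x df -> is_deriveC g x dg ->
  is_deriveC (fun t => f t + g t)%C x (df + dg)%C.
Proof. intros; now apply (is_derive_plus (V := CR)). Qed.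

Lemma is_derive_CR_minus (f g : R -> C) (x : R) (df dg : C) :
  is_deriveC f x df -> is_deriveC g x dg ->
  is_deriveC (fun t => f t - g t)%C x (df - dg)%C.
Proof. intros; now apply (is_derive_minus (V := CR)). Qed.

Lemma is_derive_RtoC (f : R -> R) (x l : R) :
  is_derive f x l -> is_deriveC (fun t => RtoC (f t)) x (RtoC l).
Proof.
  intros H. apply (is_derive_CR (fun t => RtoC (f t))); [exact H|].
  apply (is_derive_const (V := RN) (0 : R)).
Qed.

Lemma continuous_CR (f : R -> C) (x : R) :
  continuous (fun t => Re (f t)) x -> continuous (fun t => Im (f t)) x ->
  continuousC f x.
Proof.
  intros Ha Hb.
  apply (continuous_ext (U := CR)
    (fun t => plus (scal (Re (f t)) ((1, 0) : CR)) (scal (Im (f t)) ((0, 1) : CR)))).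
  { intros t. cr_eq. }
  apply (continuous_plus (V := CR)); apply (continuous_scal_l (V := CR)); auto.
Qed.

Lemma continuous_CR_Re (f : R -> C) (x : R) :
  continuousC f x -> continuous (fun t => Re (f t)) x.
Proof.
  intros H. apply (continuous_comp (U := R_UniformSpace) (V := CR) f (fun z => Re z)); auto.
  apply (continuous_fst (U := R_UniformSpace) (V := R_UniformSpace)).
Qed.

Lemma continuous_CR_Im (f : R -> C) (x : R) :
  continuousC f x -> continuous (fun t => Im (f t)) x.
Proof.
  intros H. apply (continuous_comp (U := R_UniformSpace) (V := CR) f (fun z => Im z)); auto.
  apply (continuous_snd (U := R_UniformSpace) (V := R_UniformSpace)).
Qed.

Lemma continuous_CR_mult (f g : R -> C) (x : R) :
  continuousC f x -> continuousC g x ->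
  continuousC (fun t => f t * g t)%C x.
Proof.
  intros Hf Hg.
  pose proof (continuous_CR_Re _ _ Hf). pose proof (continuous_CR_Im _ _ Hf).
  pose proof (continuous_CR_Re _ _ Hg). pose proof (continuous_CR_Im _ _ Hg).
  apply continuous_CR.
  - apply (continuous_ext (fun t => Re (f t) * Re (g t) - Im (f t) * Im (g t)));
      [reflexivity|].
    apply (continuous_minus (V := RN));
      apply continuous_multR; auto.
  - apply (continuous_ext (fun t => Re (f t) * Im (g t) + Im (f t) * Re (g t)));
      [reflexivity|].
    apply (continuous_plus (V := RN));
      apply continuous_multR; auto.
Qed.

Lemma is_derive_CR_continuous (f : R -> C) (x : R) (l : C) :
  is_deriveC f x l -> continuousC f x.
Proof. intros H. apply (ex_derive_continuous (V := CR)). now exists l. Qed.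

(** * The complex exponential and inverse along a real parameter *)

Lemma Cexp_plus (x y : C) : Cexp (x + y) = (Cexp x * Cexp y)%C.
Proof.
  unfold Cexp. simpl Re. simpl Im.
  change (fst x + fst y) with (Re x + Re y). change (snd x + snd y) with (Im x + Im y).
  rewrite exp_plus, cos_plus, sin_plus.
  apply injective_projections; simpl; ring.
Qed.

Lemma Cexp_0 : Cexp 0 = 1%C.
Proof.
  unfold Cexp; simpl. rewrite exp_0, cos_0, sin_0.
  apply injective_projections; simpl; ring.
Qed.

Lemma Cmod_Cexp (z : C) : Cmod (Cexp z) = exp (Re z).
Proof.
  unfold Cexp. rewrite Cmod_mult, Cmod_R, Rabs_pos_eq by (left; apply exp_pos).
  replace (Cmod (cos (Im z), sin (Im z))) with 1; [ring|].
  unfold Cmod; simpl fst; simpl snd.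
  replace (cos (Im z) ^ 2 + sin (Im z) ^ 2) with 1; [now rewrite sqrt_1|].
  pose proof (sin2_cos2 (Im z)). unfold Rsqr in H. lra.
Qed.

Lemma Cexp_RtoC (r : R) : Cexp (RtoC r) = RtoC (exp r).
Proof.
  unfold Cexp; simpl. rewrite cos_0, sin_0. apply injective_projections; simpl; ring.
Qed.

Lemma is_derive_Cexp (g : R -> C) (x : R) (dg : C) :
  is_deriveC g x dg ->
  is_deriveC (fun t => Cexp (g t)) x (dg * Cexp (g x))%C.
Proof.
  intros H.
  pose proof (is_derive_CR_Re _ _ _ H) as Hr. pose proof (is_derive_CR_Im _ _ _ H) as Hi.
  assert (E1 : is_derive (fun t => exp (Re (g t))) x (Re dg * exp (Re (g x)))).
  { apply (is_derive_comp (V := RN) exp (fun t => Re (g t))); auto.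
    apply is_derive_exp. }
  assert (E2 : is_derive (fun t => cos (Im (g t))) x (Im dg * - sin (Im (g x)))).
  { apply (is_derive_comp (V := RN) cos (fun t => Im (g t))); auto.
    apply is_derive_cos. }
  assert (E3 : is_derive (fun t => sin (Im (g t))) x (Im dg * cos (Im (g x)))).
  { apply (is_derive_comp (V := RN) sin (fun t => Im (g t))); auto.
    apply is_derive_sin. }
  rewrite (C_eta (dg * Cexp (g x))). apply is_derive_CR.
  - apply (is_derive_ext (fun t => exp (Re (g t)) * cos (Im (g t)))).
    { intros t. unfold Cexp, Re, Im; simpl. ring. }
    replace (Re (dg * Cexp (g x))) with
      (Re dg * exp (Re (g x)) * cos (Im (g x)) + exp (Re (g x)) * (Im dg * - sin (Im (g x))))
      by (unfold Cexp, Re, Im; simpl; ring).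
    apply (Derive.is_derive_mult (fun t => exp (Re (g t))) (fun t => cos (Im (g t)))); auto.
  - apply (is_derive_ext (fun t => exp (Re (g t)) * sin (Im (g t)))).
    { intros t. unfold Cexp, Re, Im; simpl. ring. }
    replace (Im (dg * Cexp (g x))) with
      (Re dg * exp (Re (g x)) * sin (Im (g x)) + exp (Re (g x)) * (Im dg * cos (Im (g x))))
      by (unfold Cexp, Re, Im; simpl; ring).
    apply (Derive.is_derive_mult (fun t => exp (Re (g t))) (fun t => sin (Im (g t)))); auto.
Qed.

Lemma is_derive_Cinv (g : R -> C) (x : R) (dg : C) :
  is_deriveC g x dg -> g x <> 0%C ->
  is_deriveC (fun t => / g t)%C x (- dg / (g x * g x))%C.
Proof.
  intros H H0.
  pose proof (is_derive_CR_Re _ _ _ H) as Hr. pose proof (is_derive_CR_Im _ _ _ H) as Hi.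
  assert (Hd : 0 < Re (g x) ^ 2 + Im (g x) ^ 2).
  { apply Cmod_gt_0 in H0. rewrite <- Cmod2_alt. now apply pow_lt. }
  assert (Hm : is_derive (fun t => Re (g t) ^ 2 + Im (g t) ^ 2) x
    (2 * Re (g x) * Re dg + 2 * Im (g x) * Im dg)).
  { replace (2 * Re (g x) * Re dg + 2 * Im (g x) * Im dg)
      with ((INR 2 * Re dg * Re (g x) ^ pred 2) + (INR 2 * Im dg * Im (g x) ^ pred 2))
      by (simpl; ring).
    apply (is_derive_plus (V := RN)); apply is_derive_pow; auto. }
  rewrite (C_eta (- dg / (g x * g x))). apply is_derive_CR.
  - apply (is_derive_ext (fun t => Re (g t) / (Re (g t) ^ 2 + Im (g t) ^ 2)));
      [reflexivity|].
    replace (Re (- dg / (g x * g x))) with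
      ((Re dg * (Re (g x) ^ 2 + Im (g x) ^ 2)
        - Re (g x) * (2 * Re (g x) * Re dg + 2 * Im (g x) * Im dg))
        / (Re (g x) ^ 2 + Im (g x) ^ 2) ^ 2).
    + apply (is_derive_div (fun t => Re (g t)) (fun t => Re (g t) ^ 2 + Im (g t) ^ 2)); auto.
      lra.
    + unfold Cdiv, Cinv. simpl. unfold Re, Im in *. destruct (g x) as [a b], dg as [c d].
      simpl in *. field. split; nra.
  - apply (is_derive_ext (fun t => - Im (g t) / (Re (g t) ^ 2 + Im (g t) ^ 2)));
      [reflexivity|].
    replace (Im (- dg / (g x * g x))) with
      ((- Im dg * (Re (g x) ^ 2 + Im (g x) ^ 2)
        - (- Im (g x)) * (2 * Re (g x) * Re dg + 2 * Im (g x) * Im dg))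
        / (Re (g x) ^ 2 + Im (g x) ^ 2) ^ 2).
    + apply (is_derive_div (fun t => - Im (g t)) (fun t => Re (g t) ^ 2 + Im (g t) ^ 2)); auto.
      * now apply (is_derive_opp (V := RN)).
      * lra.
    + unfold Cdiv, Cinv. simpl. unfold Re, Im in *. destruct (g x) as [a b], dg as [c d].
      simpl in *. field. split; nra.
Qed.

Lemma is_RInt_CR (f : R -> C) (a b : R) (l : C) :
  is_RInt (fun t => Re (f t)) a b (Re l) -> is_RInt (fun t => Im (f t)) a b (Im l) ->
  is_RIntC f a b l.
Proof.
  intros H1 H2. rewrite (C_eta l).
  apply (is_RInt_fct_extend_pair (U := RN) (V := RN)); auto.
Qed.

Lemma is_RInt_CR_Re (f : R -> C) (a b : R) (l : C) :
  is_RIntC f a b l -> is_RInt (fun t => Re (f t)) a b (Re l).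
Proof. apply (is_RInt_fct_extend_fst (U := RN) (V := RN)). Qed.

Lemma is_RInt_CR_Im (f : R -> C) (a b : R) (l : C) :
  is_RIntC f a b l -> is_RInt (fun t => Im (f t)) a b (Im l).
Proof. apply (is_RInt_fct_extend_snd (U := RN) (V := RN)). Qed.

Lemma is_RInt_CR_scal (k : C) (f : R -> C) (a b : R) (l : C) :
  is_RIntC f a b l -> is_RIntC (fun t => k * f t)%C a b (k * l)%C.
Proof.
  intros H. pose proof (is_RInt_CR_Re _ _ _ _ H) as H1.
  pose proof (is_RInt_CR_Im _ _ _ _ H) as H2.
  apply is_RInt_CR.
  - apply (is_RInt_ext (fun t => minus (scal (Re k) (Re (f t))) (scal (Im k) (Im (f t)))));
      [reflexivity|].
    apply (is_RInt_minus (V := RN)); apply (is_RInt_scal (V := RN)); auto.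
  - apply (is_RInt_ext (fun t => plus (scal (Re k) (Im (f t))) (scal (Im k) (Re (f t)))));
      [reflexivity|].
    apply (is_RInt_plus (V := RN)); apply (is_RInt_scal (V := RN)); auto.
Qed.

Lemma ball_CR (x y : C) (e : posreal) : Cmod (y - x) < e -> ball (M := CR) x e y.
Proof. intros H. apply (norm_compat1 (V := CR)). rewrite norm_CR. exact H. Qed.

Lemma Cmod_le_Re_Im (z : C) : Cmod z <= Rabs (Re z) + Rabs (Im z).
Proof.
  rewrite (C_eta z) at 1.
  replace ((Re z, Im z) : C) with (RtoC (Re z) + Ci * RtoC (Im z))%C
    by (apply injective_projections; simpl; ring).
  eapply Rle_trans; [apply Cmod_triangle|].
  rewrite Cmod_mult, Cmod_Ci, !Cmod_R. lra.
Qed.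

Lemma ball_CR_inv (x y : C) (e : posreal) :
  ball (M := CR) x e y -> Cmod (y - x) < 2 * e.
Proof.
  intros [H1 H2]. eapply Rle_lt_trans; [apply Cmod_le_Re_Im|].
  change (Rabs (Re (y - x)) < e) in H1. change (Rabs (Im (y - x)) < e) in H2. lra.
Qed.

(** The normed module [CR] is real, so the general lemma provides real factors only. A complex
    factor mixes the two components; multiplicativity of [Cmod] and the factor 2 between balls and
    [Cmod] control the error. *)
Lemma is_RInt_R_CR_scal (k : C) (f : R -> C) (l : C) :
  is_RInt_RC f l -> is_RInt_RC (fun t => k * f t)%C (k * l)%C.
Proof.
  intros H. apply (is_RInt_R_lift (V := CR)). intros eps.
  assert (Hp : 0 < eps / (2 * (Cmod k + 1))).
  { pose proof (Cmod_ge_0 k). pose proof (cond_pos eps). apply Rdiv_lt_0_compat; lra. }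
  destruct (is_RInt_R_elim (V := CR) f l H (mkposreal _ Hp)) as [A HA].
  exists A. intros a b Ha Hb. destruct (HA a b Ha Hb) as [y [H1 H2]].
  exists (k * y)%C. split; [now apply is_RInt_CR_scal|].
  apply ball_CR. apply ball_CR_inv in H2. simpl in H2.
  replace (k * y - k * l)%C with (k * (y - l))%C by ring.
  rewrite Cmod_mult.
  pose proof (Cmod_ge_0 k). pose proof (Cmod_ge_0 (y - l)).
  assert (Cmod (y - l) < 2 * (eps / (2 * (Cmod k + 1)))) by nra.
  assert (2 * (eps / (2 * (Cmod k + 1))) * (Cmod k + 1) = eps) by (field; lra).
  nra.
Qed.

Lemma is_RInt_R_CR (f : R -> C) (l : C) :
  is_RInt_R (fun t => Re (f t)) (Re l) -> is_RInt_R (fun t => Im (f t)) (Im l) ->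
  is_RInt_RC f l.
Proof.
  intros H1 H2. apply (is_RInt_R_lift (V := CR)). intros eps.
  destruct (is_RInt_R_elim (V := RN) _ _ H1 eps) as [A1 HA1].
  destruct (is_RInt_R_elim (V := RN) _ _ H2 eps) as [A2 HA2].
  exists (Rmax A1 A2). intros a b Ha Hb.
  pose proof (Rmax_l A1 A2). pose proof (Rmax_r A1 A2).
  destruct (HA1 a b) as [y1 [H3 H4]]; [lra | lra |].
  destruct (HA2 a b) as [y2 [H5 H6]]; [lra | lra |].
  exists ((y1, y2) : C). split; [now apply is_RInt_CR | now split].
Qed.

Lemma is_RInt_R_CR_minus (f g : R -> C) (lf lg : C) :
  is_RInt_RC f lf -> is_RInt_RC g lg ->
  is_RInt_RC (fun t => f t - g t)%C (lf - lg)%C.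
Proof. apply (is_RInt_R_minus (V := CR)). Qed.

Lemma is_RInt_R_CR_plus (f g : R -> C) (lf lg : C) :
  is_RInt_RC f lf -> is_RInt_RC g lg ->
  is_RInt_RC (fun t => f t + g t)%C (lf + lg)%C.
Proof. apply (is_RInt_R_plus (V := CR)). Qed.

Lemma im_le_Cmod (z : C) : Rabs (Im z) <= Cmod z.
Proof. eapply Rle_trans; [|apply Rmax_Cmod]. apply Rmax_r. Qed.

(** The mean value theorem holds for real functions, so it is applied to the real and imaginary
    parts separately; this costs the factor 2. *)
Lemma CR_mean_value (f df : R -> C) (a b K : R) :
  (forall t, Rmin a b <= t <= Rmax a b -> is_deriveC f t (df t)) ->
  (forall t, Rmin a b <= t <= Rmax a b -> Cmod (df t) <= K) ->
  Cmod (f b - f a) <= 2 * K * Rabs (b - a).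
Proof.
  intros Hd HK.
  assert (HR : forall (p : C -> R), (forall z, Rabs (p z) <= Cmod z) ->
    (forall t, Rmin a b <= t <= Rmax a b -> is_derive (fun t => p (f t)) t (p (df t))) ->
    Rabs (p (f b) - p (f a)) <= K * Rabs (b - a)).
  { intros p Hp Hpd.
    destruct (MVT_gen (fun t => p (f t)) a b (fun t => p (df t))) as [c [Hc Heq]].
    - intros x Hx. apply Hpd. lra.
    - intros x Hx. apply continuity_pt_filterlim.
      apply continuous_of_ex_derive. eexists. now apply Hpd.
    - rewrite Heq, Rabs_mult. apply Rmult_le_compat_r; [apply Rabs_pos|].
      eapply Rle_trans; [apply Hp | now apply HK]. }
  assert (H1 := HR Re re_le_Cmod (fun t Ht => is_derive_CR_Re _ _ _ (Hd t Ht))).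
  assert (H2 := HR Im im_le_Cmod (fun t Ht => is_derive_CR_Im _ _ _ (Hd t Ht))).
  eapply Rle_trans; [apply Cmod_le_Re_Im|].
  replace (Re (f b - f a)) with (Re (f b) - Re (f a)) by reflexivity.
  replace (Im (f b - f a)) with (Im (f b) - Im (f a)) by reflexivity. lra.
Qed.

(** Two applications of [CR_mean_value], first to [df] and then to [f t - t * df a], give the
    constant [4 = 2 * 2]; only the order [h ^ 2] matters later. *)
Lemma CR_taylor2 (f df ddf : R -> C) (a h K : R) :
  (forall t, Rabs (t - a) <= Rabs h -> is_deriveC f t (df t)) ->
  (forall t, Rabs (t - a) <= Rabs h -> is_deriveC df t (ddf t)) ->
  (forall t, Rabs (t - a) <= Rabs h -> Cmod (ddf t) <= K) ->
  Cmod (f (a + h)%R - f a - h * df a) <= 4 * K * h ^ 2.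
Proof.
  intros H1 H2 H3.
  assert (Hin : forall t x, Rabs (x - a) <= Rabs h -> Rmin a x <= t <= Rmax a x ->
    Rabs (t - a) <= Rabs (x - a)).
  { intros t x Hx Ht. unfold Rmin, Rmax in Ht.
    destruct (Rle_dec a x); unfold Rabs; repeat destruct Rcase_abs; lra. }
  assert (HK : 0 <= K).
  { eapply Rle_trans; [apply Cmod_ge_0 | apply (H3 a)].
    rewrite Rminus_diag, Rabs_R0. apply Rabs_pos. }
  assert (Hah : Rabs (a + h - a) <= Rabs h) by (right; f_equal; ring).
  assert (Hd : forall t, Rabs (t - a) <= Rabs h -> Cmod (df t - df a) <= 2 * K * Rabs h).
  { intros t Ht. eapply Rle_trans.
    - apply (CR_mean_value df ddf a t K).
      + intros u Hu. apply H2. eapply Rle_trans; [apply (Hin u t Ht Hu) | exact Ht].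
      + intros u Hu. apply H3. eapply Rle_trans; [apply (Hin u t Ht Hu) | exact Ht].
    - apply Rmult_le_compat_l; [nra | exact Ht]. }
  pose proof (CR_mean_value (fun t => f t - RtoC t * df a)%C (fun t => df t - 1 * df a)%C
    a (a + h) (2 * K * Rabs h)) as HM.
  replace (f (a + h)%R - f a - h * df a)%C with
    ((f (a + h)%R - RtoC (a + h) * df a) - (f a - RtoC a * df a))%C
    by (rewrite RtoC_plus; ring).
  eapply Rle_trans.
  - apply HM.
    + intros t Ht. apply is_derive_CR_minus.
      * apply H1. eapply Rle_trans; [apply (Hin t (a + h)); auto | exact Hah].
      * replace (1 * df a)%C with (1 * df a + RtoC t * 0)%C by ring.
        apply (is_derive_CR_mult (fun t => RtoC t) (fun _ => df a)).
        -- apply (is_derive_RtoC (fun t => t)), (is_derive_id (K := R_AbsRing)).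
        -- apply is_derive_CR_const.
    + intros t Ht. rewrite Cmult_1_l. apply Hd.
      eapply Rle_trans; [apply (Hin t (a + h)); auto | exact Hah].
  - replace (a + h - a) with h by ring. right.
    rewrite <- (pow2_abs h). ring.
Qed.

(** * Finite sums and the identity theorem *)

(** The indices run below [n]. The library sums include the index [n], hence the shift by one in
    [sum_n_csum] and its analogues. *)
Fixpoint csum (f : nat -> C) (n : nat) : C :=
  match n with O => RtoC 0 | S n => (csum f n + f n)%C end.

Fixpoint rsum (f : nat -> R) (n : nat) : R :=
  match n with O => 0 | S n => rsum f n + f n end.

Lemma csum_plus (f g : nat -> C) (n : nat) :
  csum (fun k => f k + g k)%C n = (csum f n + csum g n)%C.
Proof. induction n as [|n IH]; simpl; [ring | rewrite IH; ring]. Qed.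

Lemma csum_minus (f g : nat -> C) (n : nat) :
  csum (fun k => f k - g k)%C n = (csum f n - csum g n)%C.
Proof. induction n as [|n IH]; simpl; [ring | rewrite IH; ring]. Qed.

Lemma csum_scal (c : C) (f : nat -> C) (n : nat) :
  csum (fun k => c * f k)%C n = (c * csum f n)%C.
Proof. induction n as [|n IH]; simpl; [ring | rewrite IH; ring]. Qed.

Lemma csum_ext (f g : nat -> C) (n : nat) :
  (forall k, (k < n)%nat -> f k = g k) -> csum f n = csum g n.
Proof.
  induction n as [|n IH]; intros H; simpl; [reflexivity|].
  rewrite IH, H; auto.
Qed.

Lemma rsum_ext (f g : nat -> R) (n : nat) :
  (forall k, (k < n)%nat -> f k = g k) -> rsum f n = rsum g n.
Proof.
  induction n as [|n IH]; intros H; simpl; [reflexivity|].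
  rewrite IH, H; auto.
Qed.

Lemma rsum_plus (f g : nat -> R) (n : nat) :
  rsum (fun k => f k + g k) n = rsum f n + rsum g n.
Proof. induction n as [|n IH]; simpl; [ring | rewrite IH; ring]. Qed.

Lemma rsum_minus (f g : nat -> R) (n : nat) :
  rsum (fun k => f k - g k) n = rsum f n - rsum g n.
Proof. induction n as [|n IH]; simpl; [ring | rewrite IH; ring]. Qed.

Lemma rsum_scal (c : R) (f : nat -> R) (n : nat) :
  rsum (fun k => c * f k) n = c * rsum f n.
Proof. induction n as [|n IH]; simpl; [ring | rewrite IH; ring]. Qed.

Lemma rsum_le (f g : nat -> R) (n : nat) :
  (forall k, (k < n)%nat -> f k <= g k) -> rsum f n <= rsum g n.
Proof.
  induction n as [|n IH]; intros H; simpl; [lra|].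
  apply Rplus_le_compat; auto.
Qed.

Lemma rsum_abs_le (f b : nat -> R) (n : nat) :
  (forall k, Rabs (f k) <= b k) -> Rabs (rsum f n) <= rsum b n.
Proof.
  intros Hb. induction n as [|n IH]; simpl; [rewrite Rabs_R0; lra|].
  eapply Rle_trans; [apply Rabs_triang|]. specialize (Hb n). lra.
Qed.

Lemma rsum_telescope (p : nat -> R) (n : nat) :
  rsum (fun k => p k - p (S k)) n = p O - p n.
Proof. induction n as [|n IH]; simpl; [ring | rewrite IH; ring]. Qed.

Lemma csum_RtoC (f : nat -> R) (n : nat) :
  csum (fun k => RtoC (f k)) n = RtoC (rsum f n).
Proof. induction n as [|n IH]; simpl; [reflexivity | now rewrite IH, RtoC_plus]. Qed.

Lemma csum_exchange (f : nat -> nat -> C) (m n : nat) :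
  csum (fun i => csum (f i) n) m = csum (fun j => csum (fun i => f i j) m) n.
Proof.
  induction m as [|m IH]; simpl.
  - induction n as [|n IHn]; simpl; [reflexivity | rewrite <- IHn; ring].
  - now rewrite IH, <- csum_plus.
Qed.

Lemma rsum_exchange (f : nat -> nat -> R) (m n : nat) :
  rsum (fun i => rsum (f i) n) m = rsum (fun j => rsum (fun i => f i j) m) n.
Proof.
  induction m as [|m IH]; simpl.
  - induction n as [|n IHn]; simpl; [reflexivity | rewrite <- IHn; ring].
  - now rewrite IH, <- rsum_plus.
Qed.

Lemma sum_n_rsum (f : nat -> R) (n : nat) : sum_n f n = rsum f (S n).
Proof.
  induction n as [|n IH].
  - rewrite sum_O. simpl. ring.
  - rewrite sum_Sn, IH. reflexivity.
Qed.

Lemma sum_n_csum (f : nat -> C) (n : nat) :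
  sum_n (G := C_NormedModule) f n = csum f (S n).
Proof.
  induction n as [|n IH].
  - rewrite sum_O. simpl. ring.
  - rewrite sum_Sn, IH. reflexivity.
Qed.

Lemma sum_f_R0_rsum (f : nat -> R) (n : nat) : sum_f_R0 f n = rsum f (S n).
Proof.
  induction n as [|n IH]; simpl; [ring|]. rewrite IH. reflexivity.
Qed.

(** * Limits of complex sequences *)

Definition is_Clim (u : nat -> C) (l : C) :=
  forall eps : posreal, exists N, forall n, (N <= n)%nat -> Cmod (u n - l) < eps.

Definition Clim (u : nat -> C) : C :=
  (real (Lim_seq (fun n => Re (u n))), real (Lim_seq (fun n => Im (u n)))).

Lemma is_Clim_Re (u : nat -> C) (l : C) :
  is_Clim u l -> is_lim_seq (fun n => Re (u n)) (Re l).
Proof.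
  intros H. apply is_lim_seq_spec. intros eps.
  destruct (H eps) as [N HN]. exists N. intros n Hn.
  eapply Rle_lt_trans; [|apply (HN n Hn)]. exact (re_le_Cmod (u n - l)).
Qed.

Lemma is_Clim_Im (u : nat -> C) (l : C) :
  is_Clim u l -> is_lim_seq (fun n => Im (u n)) (Im l).
Proof.
  intros H. apply is_lim_seq_spec. intros eps.
  destruct (H eps) as [N HN]. exists N. intros n Hn.
  eapply Rle_lt_trans; [|apply (HN n Hn)]. exact (im_le_Cmod (u n - l)).
Qed.

Lemma is_Clim_components (u : nat -> C) (l : C) :
  is_lim_seq (fun n => Re (u n)) (Re l) -> is_lim_seq (fun n => Im (u n)) (Im l) ->
  is_Clim u l.
Proof.
  intros H1 H2 eps. apply is_lim_seq_spec in H1. apply is_lim_seq_spec in H2.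
  destruct (H1 (pos_div_2 eps)) as [N1 HN1]. destruct (H2 (pos_div_2 eps)) as [N2 HN2].
  exists (Nat.max N1 N2). intros n Hn.
  eapply Rle_lt_trans; [apply Cmod_le_Re_Im|].
  specialize (HN1 n ltac:(lia)). specialize (HN2 n ltac:(lia)). simpl in HN1, HN2.
  change (Re (u n - l)) with (Re (u n) - Re l).
  change (Im (u n - l)) with (Im (u n) - Im l). lra.
Qed.

Lemma Clim_unique (u : nat -> C) (l : C) : is_Clim u l -> Clim u = l.
Proof.
  intros H. unfold Clim.
  rewrite (is_lim_seq_unique _ _ (is_Clim_Re _ _ H)).
  rewrite (is_lim_seq_unique _ _ (is_Clim_Im _ _ H)). now destruct l.
Qed.

Lemma is_Clim_uniq (u : nat -> C) (l1 l2 : C) : is_Clim u l1 -> is_Clim u l2 -> l1 = l2.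
Proof. intros H1 H2. now rewrite <- (Clim_unique _ _ H1), <- (Clim_unique _ _ H2). Qed.

Lemma is_Clim_plus (u v : nat -> C) (a b : C) :
  is_Clim u a -> is_Clim v b -> is_Clim (fun n => u n + v n)%C (a + b)%C.
Proof.
  intros H1 H2. apply is_Clim_components.
  - apply (is_lim_seq_plus' (fun n => Re (u n)) (fun n => Re (v n)) (Re a) (Re b));
      now apply is_Clim_Re.
  - apply (is_lim_seq_plus' (fun n => Im (u n)) (fun n => Im (v n)) (Im a) (Im b));
      now apply is_Clim_Im.
Qed.

Lemma is_Clim_scal (k : C) (u : nat -> C) (a : C) :
  is_Clim u a -> is_Clim (fun n => k * u n)%C (k * a)%C.
Proof.
  intros H eps.
  assert (Hp : 0 < eps / (Cmod k + 1)).
  { pose proof (Cmod_ge_0 k). pose proof (cond_pos eps). apply Rdiv_lt_0_compat; lra. }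
  destruct (H (mkposreal _ Hp)) as [N HN]. exists N. intros n Hn.
  specialize (HN n Hn). simpl in HN.
  replace (k * u n - k * a)%C with (k * (u n - a))%C by ring. rewrite Cmod_mult.
  pose proof (Cmod_ge_0 k). pose proof (Cmod_ge_0 (u n - a)).
  assert (eps / (Cmod k + 1) * (Cmod k + 1) = eps) by (field; lra). nra.
Qed.

Lemma is_Clim_const (a : C) : is_Clim (fun _ => a) a.
Proof.
  intros eps. exists O. intros. replace (a - a)%C with (RtoC 0) by ring.
  rewrite Cmod_0. apply cond_pos.
Qed.

Lemma is_Clim_minus (u v : nat -> C) (a b : C) :
  is_Clim u a -> is_Clim v b -> is_Clim (fun n => u n - v n)%C (a - b)%C.
Proof.
  intros H1 H2. replace (a - b)%C with (a + -1 * b)%C by ring.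
  intros eps.
  destruct (is_Clim_plus u (fun n => -1 * v n)%C a (-1 * b)%C H1 (is_Clim_scal _ _ _ H2) eps)
    as [N HN].
  exists N. intros n Hn. specialize (HN n Hn).
  now replace (u n - v n)%C with (u n + -1 * v n)%C by ring.
Qed.

Lemma is_Clim_ext (u v : nat -> C) (a : C) :
  (forall n, u n = v n) -> is_Clim u a -> is_Clim v a.
Proof.
  intros H Hu eps. destruct (Hu eps) as [N HN]. exists N. intros n Hn.
  rewrite <- H. now apply HN.
Qed.

Lemma is_Clim_csum (f : nat -> nat -> C) (l : nat -> C) (K : nat) :
  (forall j, is_Clim (fun n => f n j) (l j)) ->
  is_Clim (fun n => csum (f n) K) (csum l K).
Proof.
  intros H. induction K as [|K IH]; simpl.
  - apply is_Clim_const.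
  - now apply is_Clim_plus.
Qed.

Lemma is_Clim_le (u : nat -> C) (l : C) (B : R) :
  is_Clim u l -> (forall n, Cmod (u n) <= B) -> Cmod l <= B.
Proof.
  intros H HB. apply Rnot_lt_le. intros Hlt.
  assert (Hp : 0 < Cmod l - B) by lra.
  destruct (H (mkposreal _ Hp)) as [N HN]. specialize (HN N (Nat.le_refl _)). simpl in HN.
  specialize (HB N).
  assert (Cmod l <= Cmod (u N) + Cmod (u N - l)).
  { replace l with (u N - (u N - l))%C at 1 by ring.
    eapply Rle_trans; [apply Cmod_triangle|]. rewrite Cmod_opp. lra. }
  lra.
Qed.

Lemma is_Clim_of_bound (u : nat -> C) (l : C) (b : nat -> R) :
  is_lim_seq b 0 -> (forall n, Cmod (u n - l) <= b n) -> is_Clim u l.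
Proof.
  intros Hb H eps. apply is_lim_seq_spec in Hb. destruct (Hb eps) as [N HN].
  exists N. intros n Hn. eapply Rle_lt_trans; [apply H|].
  specialize (HN n Hn). rewrite Rminus_0_r in HN.
  eapply Rle_lt_trans; [apply Rle_abs | exact HN].
Qed.

Lemma Cmod_csum_le (x : nat -> C) (b : nat -> R) (n : nat) :
  (forall k, Cmod (x k) <= b k) -> Cmod (csum x n) <= rsum b n.
Proof.
  intros H. induction n as [|n IH]; simpl.
  - rewrite Cmod_0. lra.
  - eapply Rle_trans; [apply Cmod_triangle|]. specialize (H n). lra.
Qed.

Lemma csum_shift (x : nat -> C) (N m : nat) :
  csum x (N + m) = (csum x N + csum (fun k => x (N + k)%nat) m)%C.
Proof.
  induction m as [|m IH]; simpl.
  - rewrite Nat.add_0_r. ring.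
  - rewrite Nat.add_succ_r. simpl. rewrite IH. ring.
Qed.

(** A telescoping majorant serves as convergence test and as tail estimate at once, since [p N] is
    the sum of the majorants from [N] on. The limits of the cells of zeta, of the Fourier series and
    of the logarithmic sums are obtained this way. *)
Lemma csum_telescope_conv (x : nat -> C) (p : nat -> R) :
  (forall k, Cmod (x k) <= p k - p (S k)) -> is_lim_seq p 0 ->
  is_Clim (csum x) (Clim (csum x)) /\
  forall N, Cmod (Clim (csum x) - csum x N) <= p N.
Proof.
  intros Hx Hp.
  assert (Hdec : forall n m, p (n + m)%nat <= p n).
  { intros n m. induction m as [|m IH]; [rewrite Nat.add_0_r; lra|].
    rewrite Nat.add_succ_r. specialize (Hx (n + m)%nat).
    pose proof (Cmod_ge_0 (x (n + m)%nat)). lra. }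
  assert (Hpos : forall n, 0 <= p n).
  { intros n. apply (is_lim_seq_le (fun m => p (n + m)%nat) (fun _ => p n) 0 (p n)).
    - intros m. apply Hdec.
    - apply (is_lim_seq_ext (fun m => p (m + n)%nat)).
      + intros m. f_equal. lia.
      + now apply is_lim_seq_incr_n.
    - apply is_lim_seq_const. }
  assert (Hdiff : forall N m, Cmod (csum x (N + m) - csum x N) <= p N).
  { intros N m. rewrite csum_shift.
    replace (csum x N + csum (fun k => x (N + k)%nat) m - csum x N)%C
      with (csum (fun k => x (N + k)%nat) m) by ring.
    eapply Rle_trans.
    - apply (Cmod_csum_le _ (fun k => p (N + k)%nat - p (N + S k)%nat)).
      intros k. rewrite Nat.add_succ_r. apply Hx.
    - rewrite (rsum_telescope (fun k => p (N + k)%nat)), Nat.add_0_r.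
      pose proof (Hpos (N + m)%nat). lra. }
  assert (Hc : forall q : C -> R, (forall z, Rabs (q z) <= Cmod z) ->
    (forall a b, q (a - b)%C = q a - q b) -> ex_finite_lim_seq (fun n => q (csum x n))).
  { intros q Hq Hl. apply ex_lim_seq_cauchy_corr. intros eps.
    apply is_lim_seq_spec in Hp. destruct (Hp (pos_div_2 eps)) as [N HN].
    exists N. intros n m Hn Hm.
    assert (HA : forall n, (N <= n)%nat -> Rabs (q (csum x n) - q (csum x N)) < eps / 2).
    { intros n0 Hn0. rewrite <- Hl. eapply Rle_lt_trans; [apply Hq|].
      replace n0 with (N + (n0 - N))%nat by lia.
      eapply Rle_lt_trans; [apply Hdiff|].
      specialize (HN N (Nat.le_refl _)). rewrite Rminus_0_r in HN.
      eapply Rle_lt_trans; [apply Rle_abs | exact HN]. }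
    pose proof (HA n Hn) as H1. pose proof (HA m Hm) as H2.
    apply Rabs_def2 in H1. apply Rabs_def2 in H2. apply Rabs_def1; lra. }
  assert (Hlim : is_Clim (csum x) (Clim (csum x))).
  { apply is_Clim_components; apply Lim_seq_correct'; apply Hc; auto.
    - apply re_le_Cmod.
    - apply im_le_Cmod. }
  split; auto. intros N.
  apply (is_Clim_le (fun m => csum x (N + m) - csum x N)%C).
  - apply is_Clim_minus; [|apply is_Clim_const].
    intros eps. destruct (Hlim eps) as [M HM]. exists M. intros n Hn. apply HM. lia.
  - intros m. apply Hdiff.
Qed.

(* Taylor expansion with a geometric remainder: all that the identity theorem needs. *)
Definition taylor_at (h : C -> C) (s : C) : Prop :=
  exists (a : nat -> C) (r D : R), 0 < r /\
    forall (z : C) (K : nat), Cmod z < r ->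
      Cmod (h (s + z) - csum (fun j => a j * z ^ j) K)%C <= D * (Cmod z / r) ^ K.

Lemma taylor_at_minus (f g : C -> C) (s : C) :
  taylor_at f s -> taylor_at g s -> taylor_at (fun z => f z - g z)%C s.
Proof.
  intros (a & r1 & D1 & Hr1 & H1) (b & r2 & D2 & Hr2 & H2).
  assert (HD1 : 0 <= D1).
  { specialize (H1 0%C O). rewrite Cmod_0 in H1. simpl in H1.
    specialize (H1 Hr1). pose proof (Cmod_ge_0 (f (s + 0)%C - 0)%C). lra. }
  assert (HD2 : 0 <= D2).
  { specialize (H2 0%C O). rewrite Cmod_0 in H2. simpl in H2.
    specialize (H2 Hr2). pose proof (Cmod_ge_0 (g (s + 0)%C - 0)%C). lra. }
  exists (fun j => a j - b j)%C, (Rmin r1 r2), (D1 + D2).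
  split; [now apply Rmin_pos|]. intros z K Hz.
  pose proof (Rmin_l r1 r2). pose proof (Rmin_r r1 r2).
  assert (0 < Rmin r1 r2) by now apply Rmin_pos.
  rewrite (csum_ext _ (fun j => a j * z ^ j - b j * z ^ j)%C) by (intros; ring).
  rewrite csum_minus.
  replace (f (s + z) - g (s + z) -
     (csum (fun j => a j * z ^ j) K - csum (fun j => b j * z ^ j) K))%C
  with ((f (s + z) - csum (fun j => a j * z ^ j) K)
    - (g (s + z) - csum (fun j => b j * z ^ j) K))%C by ring.
  eapply Rle_trans; [apply Cmod_triangle|]. rewrite Cmod_opp.
  specialize (H1 z K ltac:(lra)). specialize (H2 z K ltac:(lra)).
  pose proof (Cmod_ge_0 z).
  assert (forall r, 0 < r -> Rmin r1 r2 <= r ->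
    (Cmod z / r) ^ K <= (Cmod z / Rmin r1 r2) ^ K).
  { intros r Hr Hle. apply pow_incr. split.
    - apply Rdiv_le_0_compat; lra.
    - apply Rmult_le_compat_l; auto. apply Rinv_le_contravar; lra. }
  pose proof (H5 r1 Hr1 H). pose proof (H5 r2 Hr2 H0).
  nra.
Qed.

Lemma taylor_at_mul_id (f : C -> C) (s : C) :
  taylor_at f s -> taylor_at (fun z => z * f z)%C s.
Proof.
  intros (a & r & D & Hr & H).
  assert (HD : 0 <= D).
  { specialize (H 0%C O). rewrite Cmod_0 in H. simpl in H.
    specialize (H Hr). pose proof (Cmod_ge_0 (f (s + 0)%C - 0)%C). lra. }
  (* The coefficients of [(s + z) f (s + z)]: [s] times the old ones plus the old ones shifted. In
     the remainder a factor [Cmod z] is [r] times [Cmod z / r], whence [Cmod s + r]. *)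
  exists (fun j => s * a j + match j with O => 0 | S i => a i end)%C, r, ((Cmod s + r) * D).
  split; auto. intros z K Hz.
  pose proof (Cmod_ge_0 z). pose proof (Cmod_ge_0 s).
  destruct K as [|K].
  - simpl csum. specialize (H z O Hz). simpl in H.
    replace ((s + z) * f (s + z) - 0)%C with ((s + z) * (f (s + z) - 0))%C by ring.
    rewrite Cmod_mult. simpl pow.
    pose proof (Cmod_triangle s z). pose proof (Cmod_ge_0 (s + z)).
    pose proof (Cmod_ge_0 (f (s + z)%C - 0)%C). nra.
  - rewrite (csum_ext _ (fun j => s * (a j * z ^ j)
      + match j with O => 0 | S i => a i * z ^ j end)%C).
    2:{ intros [|k] _; ring. }
    rewrite csum_plus, csum_scal.
    assert (E : forall n, csum (fun j => match j with O => 0 | S i => a i * z ^ j end)%C (S n)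
      = (z * csum (fun j => a j * z ^ j) n)%C).
    { induction n as [|n IHn]; [simpl; ring|].
      change (csum (fun j => match j with O => 0 | S i => a i * z ^ j end)%C (S n)
        + a n * z ^ S n = z * (csum (fun j => a j * z ^ j) n + a n * z ^ n))%C.
      rewrite IHn. simpl. ring. }
    rewrite E.
    replace ((s + z) * f (s + z) - (s * csum (fun j => a j * z ^ j) (S K)
       + z * csum (fun j => a j * z ^ j) K))%C
    with (s * (f (s + z) - csum (fun j => a j * z ^ j) (S K))
       + z * (f (s + z) - csum (fun j => a j * z ^ j) K))%C by ring.
    eapply Rle_trans; [apply Cmod_triangle|]. rewrite !Cmod_mult.
    pose proof (H z (S K) Hz) as H2. pose proof (H z K Hz) as H3.
    replace ((Cmod s + r) * D * (Cmod z / r) ^ S K) with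
      (Cmod s * (D * (Cmod z / r) ^ S K) + Cmod z * (D * (Cmod z / r) ^ K)).
    2:{ simpl. field. lra. }
    apply Rplus_le_compat; apply Rmult_le_compat_l; auto.
Qed.

Lemma Cdiv_geometric (d z : C) (K : nat) : d <> 0%C -> (d + z)%C <> 0%C ->
  (/ (d + z) - csum (fun j => / d * (- / d) ^ j * z ^ j) K = (- z / d) ^ K / (d + z))%C.
Proof.
  intros Hd Hz. induction K as [|K IH]; simpl.
  - field. auto.
  - replace (/ (d + z) - (csum (fun j => / d * (- / d) ^ j * z ^ j) K
      + / d * (- / d) ^ K * z ^ K))%C
    with ((/ (d + z) - csum (fun j => / d * (- / d) ^ j * z ^ j) K)
      - / d * ((- / d) ^ K * z ^ K))%C by ring.
    rewrite IH.
    replace ((- / d) ^ K * z ^ K)%C with ((- z / d) ^ K)%C.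
    + field. auto.
    + rewrite <- Cpow_mult_l. f_equal. field. auto.
Qed.

(** Geometric expansion about [s] with quotient [- z / (s - 1)]. On the disc of half the distance to
    1 the denominator stays at least half of [Cmod (s - 1)]. *)
Lemma taylor_at_pole (s : C) : s <> 1%C -> taylor_at (fun z => / (z - 1))%C s.
Proof.
  intros Hs. set (d := (s - 1)%C).
  assert (Hd : d <> 0%C).
  { intros E. apply Hs. unfold d in E. replace s with (s - 1 + 1)%C by ring. rewrite E. ring. }
  assert (Hd0 : 0 < Cmod d) by now apply Cmod_gt_0.
  exists (fun j => / d * (- / d) ^ j)%C, (Cmod d / 2), (2 / Cmod d).
  split; [lra|]. intros z K Hz.
  assert (Hdz : Cmod d / 2 <= Cmod (d + z)).
  { assert (Cmod d <= Cmod (d + z) + Cmod z).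
    { replace d with ((d + z) - z)%C at 1 by ring.
      eapply Rle_trans; [apply Cmod_triangle|]. rewrite Cmod_opp. lra. }
    lra. }
  assert (Hdz0 : (d + z)%C <> 0%C) by (apply Cmod_gt_0; lra).
  replace (s + z - 1)%C with (d + z)%C by (unfold d; ring).
  rewrite Cdiv_geometric by auto.
  rewrite Cmod_div by auto. rewrite Cmod_pow, Cmod_div, Cmod_opp by auto.
  assert (0 <= Cmod z) by apply Cmod_ge_0.
  assert (H1 : (Cmod z / Cmod d) ^ K <= (Cmod z / (Cmod d / 2)) ^ K).
  { apply pow_incr. split; [apply Rdiv_le_0_compat; lra|].
    apply Rmult_le_compat_l; auto. apply Rinv_le_contravar; lra. }
  assert (H2 : / Cmod (d + z) <= 2 / Cmod d).
  { replace (2 / Cmod d) with (/ (Cmod d / 2)) by (field; lra).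
    apply Rinv_le_contravar; lra. }
  unfold Rdiv at 1. rewrite Rmult_comm.
  apply Rmult_le_compat; auto.
  - left. apply Rinv_0_lt_compat. lra.
  - apply pow_le, Rdiv_le_0_compat; lra.
Qed.

Lemma taylor_at_const (c s : C) : taylor_at (fun _ => c) s.
Proof.
  exists (fun j => match j with O => c | _ => RtoC 0 end), 1, (Cmod c). split; [lra|].
  intros z [|K] Hz.
  - simpl. replace (c - 0)%C with c by ring. lra.
  - assert (E : csum (fun j => match j with O => c | _ => RtoC 0 end * z ^ j)%C (S K) = c).
    { induction K as [|K IH]; [simpl; ring|].
      change (csum (fun j => match j with O => c | _ => RtoC 0 end * z ^ j)%C (S K)
        + 0 * z ^ S K = c)%C. rewrite IH. ring. }
    rewrite E. replace (c - c)%C with (RtoC 0) by ring. rewrite Cmod_0.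
    apply Rmult_le_pos; [apply Cmod_ge_0 | apply pow_le].
    apply Rdiv_le_0_compat; [apply Cmod_ge_0 | lra].
Qed.

(** The coefficients vanish one after the other: if those below [K] are zero, the remainder bound at
    a zero [x d] reads [Cmod (a K) x ^ K <= D (x / r) ^ S K], impossible for small [x] unless [a K]
    is zero. Zeros along a single segment issuing from [s] thus suffice. *)
Lemma taylor_at_vanish (h : C -> C) (s d : C) (eta : R) :
  taylor_at h s -> Cmod d = 1 -> 0 < eta ->
  (forall x, 0 < x < eta -> h (s + x * d)%C = 0%C) ->
  exists r, 0 < r /\ forall z, Cmod z < r -> h (s + z)%C = 0%C.
Proof.
  intros (a & r & D & Hr & H) Hd Heta H0.
  assert (HD : 0 <= D).
  { specialize (H 0%C O). rewrite Cmod_0 in H. simpl in H.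
    specialize (H Hr). pose proof (Cmod_ge_0 (h (s + 0)%C - 0)%C). lra. }
  assert (Hxd : forall x, 0 < x -> Cmod (RtoC x * d) = x).
  { intros x Hx. rewrite Cmod_mult, Hd, Cmod_R, Rabs_pos_eq; lra. }
  assert (Ha : forall K j, (j < K)%nat -> a j = 0%C).
  { induction K as [|K IH]; [lia|].
    intros j Hj. destruct (Nat.eq_dec j K) as [->|Hne]; [|apply IH; lia].
    apply Cmod_eq_0. apply Rle_antisym; [|apply Cmod_ge_0].
    apply Rnot_lt_le. intros Hpos.
    (* The second entry makes [D x / r ^ S K] at most half of [Cmod (a K)], the contradiction
       sought. *)
    set (x := Rmin (Rmin r eta / 2) (Cmod (a K) * r ^ S K / (2 * (D + 1)))).
    assert (Hrk : 0 < r ^ S K) by now apply pow_lt.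
    assert (0 < Rmin r eta) by now apply Rmin_pos.
    assert (0 < Cmod (a K) * r ^ S K / (2 * (D + 1))).
    { apply Rdiv_lt_0_compat; [nra | lra]. }
    assert (Hx : 0 < x) by (unfold x; apply Rmin_pos; lra).
    assert (Hx1 : x <= Rmin r eta / 2) by (unfold x; apply Rmin_l).
    assert (Hx2 : x <= Cmod (a K) * r ^ S K / (2 * (D + 1))) by (unfold x; apply Rmin_r).
    pose proof (Rmin_l r eta). pose proof (Rmin_r r eta).
    specialize (H (x * d)%C (S K)). rewrite Hxd in H by auto.
    specialize (H ltac:(lra)). rewrite H0 in H by lra.
    simpl csum in H.
    rewrite (csum_ext _ (fun _ => 0 * 0)%C) in H.
    2:{ intros k Hk. rewrite (IH k Hk). ring. }
    rewrite csum_scal in H.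
    replace (0 - (0 * csum (fun _ => 0) K + a K * (x * d) ^ K))%C
      with (- (a K * (x * d) ^ K))%C in H by ring.
    rewrite Cmod_opp, Cmod_mult, Cmod_pow, Hxd in H by auto.
    assert (Hxk : 0 < x ^ K) by now apply pow_lt.
    assert (E : D * (x / r) ^ S K = x ^ K * (D * x / r ^ S K)).
    { unfold Rdiv. rewrite Rpow_mult_distr, pow_inv. simpl. ring. }
    rewrite E in H.
    assert (Cmod (a K) <= D * x / r ^ S K).
    { apply Rmult_le_reg_l with (x ^ K); lra. }
    assert (D * x <= D * (Cmod (a K) * r ^ S K / (2 * (D + 1))))
      by now apply Rmult_le_compat_l.
    assert (Cmod (a K) * r ^ S K <= D * x).
    { apply Rmult_le_reg_r with (/ r ^ S K); [now apply Rinv_0_lt_compat|].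
      rewrite Rmult_assoc, Rinv_r by lra. unfold Rdiv in H5. lra. }
    assert (D * (Cmod (a K) * r ^ S K / (2 * (D + 1)))
      = (D / (2 * (D + 1))) * (Cmod (a K) * r ^ S K)) by (field; lra).
    assert (D / (2 * (D + 1)) <= 1 / 2).
    { apply Rmult_le_reg_r with (2 * (D + 1)); [lra|].
      unfold Rdiv at 1. rewrite Rmult_assoc, Rinv_l by lra. lra. }
    assert (0 < Cmod (a K) * r ^ S K) by nra. nra. }
  exists (r / 2). split; [lra|]. intros z Hz.
  apply Cmod_eq_0. apply Rle_antisym; [|apply Cmod_ge_0].
  assert (HK : forall K, Cmod (h (s + z)%C) <= D * (Cmod z / r) ^ K).
  { intros K. specialize (H z K ltac:(lra)).
    rewrite (csum_ext _ (fun _ => 0 * 0)%C) in H.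
    2:{ intros k Hk. rewrite (Ha (S k) k) by lia. ring. }
    rewrite csum_scal in H.
    now replace (h (s + z) - 0 * csum (fun _ => 0) K)%C with (h (s + z)%C) in H by ring. }
  apply (is_lim_seq_le (fun _ => Cmod (h (s + z)%C)) (fun K => D * (Cmod z / r) ^ K)
    (Cmod (h (s + z)%C)) 0 HK); [apply is_lim_seq_const|].
  replace (Finite 0) with (Rbar_mult D 0) by (simpl; f_equal; ring).
  apply is_lim_seq_scal_l, is_lim_seq_geom.
  rewrite Rabs_pos_eq.
  - apply Rmult_lt_reg_r with r; auto. unfold Rdiv. rewrite Rmult_assoc, Rinv_l; lra.
  - apply Rdiv_le_0_compat; [apply Cmod_ge_0 | lra].
Qed.

(** The identity theorem along one horizontal half-line, by a supremum: to the right of the supremum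
    [m] of the points where [h] is nonzero, [h] vanishes, hence by [taylor_at_vanish] also in a disc
    around [m], which pushes the supremum to the left. *)
Lemma taylor_at_horizontal (h : C -> C) (t : R) :
  (forall x, 0 < x -> taylor_at h (x, t)) -> (forall x, 1 < x -> h (x, t) = 0%C) ->
  forall x, 0 < x -> h (x, t) = 0%C.
Proof.
  intros Hh H1 x Hx.
  destruct (Req_dec (Cmod (h (x, t))) 0) as [E|Hne]; [now apply Cmod_eq_0|].
  exfalso.
  assert (Hx1 : x <= 1).
  { apply Rnot_lt_le. intros Hlt. apply Hne. rewrite H1 by auto. apply Cmod_0. }
  destruct (completeness (fun y => x <= y <= 1 /\ h (y, t) <> 0%C)) as [m [Hub Hlub]].
  - exists 1. intros y [Hy _]. lra.
  - exists x. split; [lra|]. intros E. apply Hne. rewrite E. apply Cmod_0.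
  - assert (Hxm : x <= m).
    { apply Hub. split; [lra|]. intros E. apply Hne. rewrite E. apply Cmod_0. }
    assert (Hm1 : m <= 1) by (apply Hlub; intros y [Hy _]; lra).
    assert (Habove : forall y, m < y -> h (y, t) = 0%C).
    { intros y Hy. destruct (Rle_dec y 1) as [Hy1|Hy1]; [|apply H1; lra].
      destruct (Req_dec (Cmod (h (y, t))) 0) as [E|E]; [now apply Cmod_eq_0|].
      exfalso. assert (y <= m); [|lra]. apply Hub. split; [lra|].
      intros E'. apply E. rewrite E'. apply Cmod_0. }
    destruct (taylor_at_vanish h (m, t) 1%C 1 (Hh m ltac:(lra)) Cmod_1 Rlt_0_1) as [r [Hr Hz]].
    { intros y Hy. replace ((m, t) + RtoC y * 1)%C with ((m + y, t) : C)
        by (apply injective_projections; simpl; ring).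
      apply Habove. lra. }
    assert (Hbelow : m <= m - r / 2).
    { apply Hlub. intros y [Hy Hy0]. apply Rnot_lt_le. intros Hlt.
      apply Hy0. destruct (Rlt_dec m y) as [Hmy|Hmy]; [now apply Habove|].
      replace ((y, t) : C) with ((m, t) + RtoC (y - m))%C
        by (apply injective_projections; simpl; ring).
      apply Hz. rewrite Cmod_R. rewrite Rabs_left1; lra. }
    lra.
Qed.

(** Convergence at radius [rho] bounds the terms [Cmod (a n) * rho ^ n]; on a smaller disc the tail
    is then dominated by a geometric series. *)
Lemma taylor_at_analytic (f : C -> C) (s : C) : analytic_at f s -> taylor_at f s.
Proof.
  intros (a & r & Hr & H).
  set (rho := r / 2).
  assert (Hps : forall z, Cmod z < r -> is_Clim (fun n => csum (fun j => a j * z ^ j)%C (S n)) (f (s + z)%C)).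
  { intros z Hz. specialize (H (s + z)%C). replace (s + z - s)%C with z in H by ring.
    specialize (H Hz). intros eps.
    pose proof (norm_factor_gt_0 (V := C_NormedModule)) as Hnf.
    pose proof (Rdiv_lt_0_compat _ _ (cond_pos eps) Hnf) as Heps.
    specialize (H (ball (M := C_NormedModule) (f (s + z)%C) (mkposreal _ Heps))
      (locally_ball _ _)).
    destruct H as [N HN]. exists N. intros n Hn. specialize (HN n Hn).
    apply (norm_compat2 (V := C_NormedModule)) in HN.
    assert (HN2 : Cmod (minus (sum_n (G := C_NormedModule)
      (fun k => scal (pow_n z k) (a k)) n) (f (s + z)%C)) < eps).
    { refine (Rlt_le_trans _ _ _ HN _). right.
      cbn [pos]. field. lra. }
    rewrite sum_n_csum in HN2.
    rewrite (csum_ext _ (fun k => scal (pow_n z k) (a k))).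
    - exact HN2.
    - intros k _. rewrite (Cmult_comm (a k)).
      change (z ^ k * a k = pow_n (K := C_AbsRing) z k * a k)%C. reflexivity. }
  assert (HM : exists M, forall n, Cmod (a n) * rho ^ n <= M).
  { assert (Hrho : Cmod (RtoC rho) < r).
    { rewrite Cmod_R, Rabs_pos_eq; unfold rho; lra. }
    specialize (Hps _ Hrho).
    assert (Hbd : exists B, forall n, Cmod (csum (fun j => a j * RtoC rho ^ j)%C (S n)) <= B).
    { destruct (Hps (mkposreal 1 Rlt_0_1)) as [N HN].
      assert (HB : forall m, exists B, forall n, (n <= m)%nat ->
        Cmod (csum (fun j => a j * RtoC rho ^ j)%C (S n)) <= B).
      { induction m as [|m [B IH]].
        - eexists. intros n Hn. replace n with O by lia. apply Rle_refl.
        - exists (Rmax B (Cmod (csum (fun j => a j * RtoC rho ^ j)%C (S (S m))))).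
          intros n Hn. destruct (Nat.eq_dec n (S m)) as [->|Hne].
          + apply Rmax_r.
          + eapply Rle_trans; [apply IH; lia | apply Rmax_l]. }
      destruct (HB N) as [B HBN].
      exists (Rmax B (1 + Cmod (f (s + rho)%C))). intros n.
      destruct (Nat.le_gt_cases n N) as [Hn|Hn].
      - eapply Rle_trans; [now apply HBN | apply Rmax_l].
      - eapply Rle_trans; [|apply Rmax_r].
        specialize (HN n ltac:(lia)). cbv beta in HN. cbn [pos] in HN.
        replace (csum (fun j => a j * RtoC rho ^ j)%C (S n)) with
          ((csum (fun j => a j * RtoC rho ^ j)%C (S n) - f (s + rho)) + f (s + rho))%C by ring.
        eapply Rle_trans; [apply Cmod_triangle|]. lra. }
    destruct Hbd as [B HB]. exists (B + B). intros n.
    assert (E : (a n * RtoC rho ^ n)%C = (csum (fun j => a j * RtoC rho ^ j) (S n)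
      - csum (fun j => a j * RtoC rho ^ j) n)%C) by (simpl; ring).
    replace (Cmod (a n) * rho ^ n) with (Cmod (a n * RtoC rho ^ n)).
    2:{ rewrite Cmod_mult, Cmod_pow, Cmod_R, Rabs_pos_eq; [reflexivity | unfold rho; lra]. }
    rewrite E. eapply Rle_trans; [apply Cmod_triangle|]. rewrite Cmod_opp.
    apply Rplus_le_compat; [apply HB|].
    destruct n as [|n]; [|apply HB].
    simpl. rewrite Cmod_0. eapply Rle_trans; [apply Cmod_ge_0 | apply (HB O)]. }
  destruct HM as [M HM].
  assert (HM0 : 0 <= M).
  { eapply Rle_trans; [|apply (HM O)]. simpl. rewrite Rmult_1_r. apply Cmod_ge_0. }
  assert (Hrho : 0 < rho) by (unfold rho; lra).
  (* For [Cmod z < rho / 2] the ratio [Cmod z / rho] is at most [1 / 2], so a geometric tail is at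
     most twice its first term: hence [2 * M]. *)
  exists a, (rho / 2), (2 * M). split; [lra|].
  intros z K Hz.
  assert (Hz0 : 0 <= Cmod z) by apply Cmod_ge_0.
  set (q := Cmod z / rho).
  assert (Hq : 0 <= q <= 1 / 2).
  { unfold q. split; [apply Rdiv_le_0_compat; lra|].
    apply Rmult_le_reg_r with rho; auto. unfold Rdiv at 1. rewrite Rmult_assoc, Rinv_l; lra. }
  assert (Hterm : forall n, Cmod (a n * z ^ n) <= M * q ^ n).
  { intros n. rewrite Cmod_mult, Cmod_pow.
    replace (Cmod z ^ n) with (rho ^ n * q ^ n).
    - rewrite <- Rmult_assoc. apply Rmult_le_compat_r; auto. apply pow_le; lra.
    - rewrite <- Rpow_mult_distr. f_equal. unfold q. field. lra. }
  assert (Hgeo : forall m, Cmod (csum (fun k => a (K + k)%nat * z ^ (K + k))%C m)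
    <= 2 * M * q ^ K).
  { intros m. eapply Rle_trans.
    - apply (Cmod_csum_le _ (fun k => 2 * M * q ^ (K + k) - 2 * M * q ^ (K + S k))).
      intros k. eapply Rle_trans; [apply Hterm|].
      rewrite Nat.add_succ_r. simpl.
      assert (0 <= M * q ^ (K + k)) by (apply Rmult_le_pos; auto; apply pow_le; lra).
      nra.
    - rewrite (rsum_telescope (fun k => 2 * M * q ^ (K + k))), Nat.add_0_r.
      assert (0 <= M * q ^ (K + m)) by (apply Rmult_le_pos; auto; apply pow_le; lra). lra. }
  assert (Hfin : Cmod (f (s + z) - csum (fun j => a j * z ^ j) K)%C <= 2 * M * q ^ K).
  { apply (is_Clim_le (fun m => csum (fun j => a j * z ^ j) (K + S m)
      - csum (fun j => a j * z ^ j) K)%C).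
    - apply is_Clim_minus; [|apply is_Clim_const].
      intros eps. destruct (Hps z ltac:(unfold rho in *; lra) eps) as [N HN]. exists N.
      intros n Hn. replace (K + S n)%nat with (S (K + n)) by lia. apply HN. lia.
    - intros m. rewrite csum_shift.
      replace (csum (fun j => a j * z ^ j) K + csum (fun k => a (K + k)%nat * z ^ (K + k)) (S m)
        - csum (fun j => a j * z ^ j) K)%C
      with (csum (fun k => a (K + k)%nat * z ^ (K + k))%C (S m)) by ring.
      apply Hgeo. }
  eapply Rle_trans; [exact Hfin|].
  apply Rmult_le_compat_l; [lra|]. apply pow_incr. split; [lra|].
  unfold q. apply Rmult_le_compat_l; auto. apply Rinv_le_contravar; lra.
Qed.

(** * The zeta function in the half-plane of positive real part *)

Ltac eq_C := match goal with |- @eq _ ?a ?b => change (@eq C a b) end.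

Lemma RCpow_plus (u : R) (a b : C) : RCpow u (a + b) = (RCpow u a * RCpow u b)%C.
Proof. unfold RCpow. rewrite <- Cexp_plus. f_equal. ring. Qed.

Lemma RCpow_RtoC (u r : R) : RCpow u (RtoC r) = RtoC (Rpower u r).
Proof. unfold RCpow, Rpower. now rewrite <- RtoC_mult, Cexp_RtoC. Qed.

Lemma RCpow_m1 (u : R) : 0 < u -> RCpow u (- (1)) = RtoC (/ u).
Proof.
  intros Hu. replace (- (1))%C with (RtoC (-1)) by (apply injective_projections; simpl; ring).
  rewrite RCpow_RtoC. f_equal. replace (-1) with (Ropp 1) by ring.
  rewrite Rpower_Ropp, Rpower_1; auto.
Qed.

Lemma RCpow_1 (u : R) : 0 < u -> RCpow u 1 = RtoC u.
Proof. intros Hu. rewrite RCpow_RtoC. f_equal. now apply Rpower_1. Qed.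

Lemma RCpow_pred (u : R) (w : C) : 0 < u -> RCpow u (w - 1) = (RCpow u w * / u)%C.
Proof.
  intros Hu. unfold Cminus. rewrite RCpow_plus, RCpow_m1 by auto.
  rewrite RtoC_inv; [reflexivity | lra].
Qed.

Lemma Cmod_RCpow (u : R) (w : C) : Cmod (RCpow u w) = Rpower u (Re w).
Proof.
  unfold RCpow, Rpower. rewrite Cmod_Cexp. f_equal. rewrite Re_mult.
  simpl. unfold Re. ring.
Qed.

Lemma RCpow_1_l (w : C) : RCpow 1 w = 1%C.
Proof. unfold RCpow. rewrite ln_1, Cmult_0_r. apply Cexp_0. Qed.

Lemma is_derive_RCpow (u : R) (w : C) :
  0 < u -> is_deriveC (fun u => RCpow u w) u (w * RCpow u (w - 1))%C.
Proof.
  intros Hu. rewrite RCpow_pred by auto.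
  replace (w * (RCpow u w * / u))%C with (w * RtoC (/ u) * Cexp (w * ln u))%C.
  - apply (is_derive_Cexp (fun u => w * RtoC (ln u))%C).
    apply is_derive_CR_scal_l. apply (is_derive_RtoC ln). apply is_derive_ln; auto.
  - rewrite RtoC_inv by lra. unfold RCpow. ring.
Qed.

Lemma is_derive_CR_linear (x : C) (t : R) :
  is_deriveC (fun t => RtoC t * x)%C t x.
Proof.
  pose proof (is_derive_CR_mult (fun t => RtoC t) (fun _ => x) t _ _
    (is_derive_RtoC (fun t => t) t _ (is_derive_id (K := R_AbsRing) t))
    (is_derive_CR_const x t)) as H.
  assert (E : (RtoC 1 * x + RtoC t * 0)%C = x) by ring.
  exact (eq_ind _ (fun l => is_deriveC (fun t => RtoC t * x)%C t l) H _ E).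
Qed.

Lemma is_derive_Rpower (u p : R) :
  0 < u -> is_derive (fun u => Rpower u p) u (p * Rpower u (p - 1)).
Proof.
  intros Hu. unfold Rpower. auto_derive; auto.
  replace ((p - 1) * ln u) with (p * ln u + - ln u) by ring.
  rewrite exp_plus, exp_Ropp, exp_ln by auto. field. lra.
Qed.

Lemma is_RInt_csum (f : nat -> R -> C) (l : nat -> C) (a b : R) (K : nat) :
  (forall j, is_RIntC (f j) a b (l j)) ->
  is_RIntC (fun u => csum (fun j => f j u) K) a b (csum l K).
Proof.
  intros H. induction K as [|K IH]; simpl.
  - assert (E : scal (b - a) (RtoC 0 : CR) = RtoC 0)
      by (etransitivity; [apply scal_CR | apply Cmult_0_r]).
    pose proof (is_RInt_const (V := CR) a b (RtoC 0)) as H'.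
    exact (eq_ind _ (fun l => is_RIntC (fun _ => RtoC 0) a b l) H' _ E).
  - apply (is_RInt_plus (V := CR)); auto.
Qed.

(** Induction on [K]: along [t x] the derivative of the remainder of order [S K] is [x] times that
    of order [K], so integrating from 0 to 1 raises the order and produces the next factorial. *)
Lemma Cexp_taylor (x : C) (K : nat) :
  Cmod (Cexp x - csum (fun j => RtoC (/ INR (fact j)) * x ^ j) K)%C
  <= Cmod x ^ K / INR (fact K) * exp (Cmod x).
Proof.
  revert x. induction K as [|K IH]; intros x.
  - simpl. replace (Cexp x - 0)%C with (Cexp x) by ring. rewrite Cmod_Cexp.
    unfold Rdiv. rewrite Rinv_1, !Rmult_1_l.
    destruct (Rle_lt_or_eq_dec (Re x) (Cmod x)) as [H|H].
    + eapply Rle_trans; [apply Rle_abs | apply re_le_Cmod].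
    + left. now apply exp_increasing.
    + right. now rewrite H.
  - set (P := fun K (y : C) => csum (fun j => RtoC (/ INR (fact j)) * y ^ j)%C K).
    assert (HP : forall K t, is_deriveC (fun t => P (S K) (RtoC t * x)%C) t
      (x * P K (RtoC t * x))%C).
    { clear. induction K as [|K IH]; intros t.
      - apply (is_derive_ext (V := CR) (fun _ => RtoC 1)).
        { intros u. eq_C. unfold P. simpl. rewrite Rinv_1. ring. }
        unfold P. simpl. rewrite Cmult_0_r. apply is_derive_CR_const.
      - change (is_deriveC (fun t => P (S K) (RtoC t * x) +
          RtoC (/ INR (fact (S K))) * (RtoC t * x) ^ S K)%C t
          (x * (P K (RtoC t * x) + RtoC (/ INR (fact K)) * (RtoC t * x) ^ K))%C).
        rewrite Cmult_plus_distr_l. apply is_derive_CR_plus; [apply IH|].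
        apply (is_derive_ext (V := CR)
          (fun t => (RtoC (/ INR (fact (S K))) * x ^ S K) * RtoC (t ^ S K))%C).
        { intros u. eq_C. rewrite Cpow_mult_l, RtoC_pow. ring. }
        replace (x * (RtoC (/ INR (fact K)) * (RtoC t * x) ^ K))%C
          with ((RtoC (/ INR (fact (S K))) * x ^ S K) * RtoC (INR (S K) * t ^ K))%C.
        + apply is_derive_CR_scal_l. apply is_derive_RtoC.
          replace (INR (S K) * t ^ K) with (INR (S K) * 1 * t ^ pred (S K)) by (simpl pred; ring).
          apply (is_derive_pow (fun t => t)). apply (is_derive_id (K := R_AbsRing)).
        + rewrite Cpow_mult_l, <- RtoC_pow. simpl Cpow.
          rewrite RtoC_mult.
          assert (E : RtoC (/ INR (fact K)) = (RtoC (/ INR (fact (S K))) * RtoC (INR (S K)))%C).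
          { rewrite <- RtoC_mult. f_equal. rewrite fact_simpl, mult_INR. field.
            split; [apply INR_fact_neq_0 | apply not_0_INR; lia]. }
          rewrite E. ring. }
    assert (HR : is_RIntC (fun t => x * (Cexp (RtoC t * x) - P K (RtoC t * x)))%C 0 1
      (Cexp x - P (S K) x)%C).
    { replace (Cexp x - P (S K) x)%C with
        (minus ((fun t : R => Cexp (RtoC t * x) - P (S K) (RtoC t * x))%C 1 : CR)
          ((fun t : R => Cexp (RtoC t * x) - P (S K) (RtoC t * x))%C 0 : CR)).
      2:{ change (((Cexp (1 * x) - P (S K) (1 * x)) - (Cexp (0 * x) - P (S K) (0 * x)))%C
            = (Cexp x - P (S K) x)%C).
          rewrite Cmult_1_l, Cmult_0_l, Cexp_0.
          assert (E : P (S K) 0%C = 1%C).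
          { unfold P. clear. induction K as [|K IH].
            - simpl. rewrite Rinv_1. ring.
            - change ((csum (fun j => RtoC (/ INR (fact j)) * 0 ^ j)%C (S K) +
                RtoC (/ INR (fact (S K))) * 0 ^ S K)%C = 1%C). rewrite IH. simpl. ring. }
          rewrite E. ring. }
      assert (Hd : forall t : R, is_deriveC
        (fun t : R => Cexp (RtoC t * x) - P (S K) (RtoC t * x))%C t
        (x * (Cexp (RtoC t * x) - P K (RtoC t * x)))%C).
      { intros t.
        replace (x * (Cexp (RtoC t * x) - P K (RtoC t * x)))%C with
          (x * Cexp (RtoC t * x) - x * P K (RtoC t * x))%C by ring.
        apply is_derive_CR_minus; [|apply HP].
        apply (is_derive_Cexp (fun t => RtoC t * x)%C).
        apply is_derive_CR_linear. }
      apply (is_RInt_derive (V := CR)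
        (fun t : R => Cexp (RtoC t * x) - P (S K) (RtoC t * x))%C
        (fun t : R => x * (Cexp (RtoC t * x) - P K (RtoC t * x)))%C 0 1);
        [intros; apply Hd|].
      intros t _. apply continuous_CR_mult; [apply (continuous_const (U := R_UniformSpace) (V := CR))|].
      apply (continuous_minus (V := CR)).
      - eapply is_derive_CR_continuous. apply (is_derive_Cexp (fun t => RtoC t * x)%C).
        apply is_derive_CR_linear.
      - destruct K as [|K].
        + apply (continuous_const (U := R_UniformSpace) (V := CR)).
        + eapply is_derive_CR_continuous. apply HP. }
    fold (P (S K) x).
    set (c := Cmod x ^ S K / INR (fact K) * exp (Cmod x)).
    assert (Hf : 0 < INR (fact K)) by apply INR_fact_lt_0.
    assert (Hx : 0 <= Cmod x) by apply Cmod_ge_0.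
    rewrite <- norm_CR.
    apply (norm_RInt_le (V := CR) (fun t : R => x * (Cexp (RtoC t * x) - P K (RtoC t * x)))%C
      (fun t => c * t ^ K) 0 1 (Cexp x - P (S K) x)%C
      (Cmod x ^ S K / INR (fact (S K)) * exp (Cmod x)) Rle_0_1).
    + intros t Ht. rewrite norm_CR, Cmod_mult.
      replace (c * t ^ K) with (Cmod x * ((t * Cmod x) ^ K / INR (fact K) * exp (Cmod x))).
      2:{ unfold c. rewrite Rpow_mult_distr. simpl. field. lra. }
      apply Rmult_le_compat_l; auto.
      eapply Rle_trans; [apply IH|].
      rewrite Cmod_mult, Cmod_R, Rabs_pos_eq by lra.
      apply Rmult_le_compat_l.
      * apply Rdiv_le_0_compat; auto. apply pow_le. nra.
      * destruct (Rle_lt_or_eq_dec (t * Cmod x) (Cmod x)) as [H|H]; [nra| |].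
        -- left. now apply exp_increasing.
        -- right. now rewrite H.
    + exact HR.
    + replace (Cmod x ^ S K / INR (fact (S K)) * exp (Cmod x))
        with (c / INR (S K) * 1 ^ S K - c / INR (S K) * 0 ^ S K).
      * apply (is_RInt_derive (V := RC) (fun t => c / INR (S K) * t ^ S K)
          (fun t => c * t ^ K) 0 1).
        -- intros t _. auto_derive; auto. change (match K with O => 1 | S _ => INR K + 1 end)
             with (INR (S K)). field. apply not_0_INR. lia.
        -- intros t _. apply continuous_of_ex_derive. auto_derive. auto.
      * rewrite pow1, pow_i by lia. unfold c. rewrite fact_simpl, mult_INR.
        field. split; apply not_0_INR; [apply fact_neq_0 | lia].
Qed.

Lemma pow_div_fact_le_exp (x : R) (K : nat) : 0 <= x -> x ^ K / INR (fact K) <= exp x.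
Proof.
  intros Hx. eapply Rle_trans; [|apply (exp_ge_taylor x K Hx)].
  destruct K as [|K]; [apply Rle_refl|]. rewrite tech5.
  assert (0 <= sum_f_R0 (fun k => x ^ k / INR (fact k)) K).
  { apply cond_pos_sum. intros n. apply Rdiv_le_0_compat; [now apply pow_le | apply INR_fact_lt_0]. }
  lra.
Qed.

(** * The fractional-part integral that continues zeta *)

Lemma is_lim_seq_Rpower_neg (d : R) : 0 < d ->
  is_lim_seq (fun k => Rpower (INR (S k)) (- d)) 0.
Proof.
  intros Hd. unfold Rpower.
  apply (is_lim_comp_seq exp (fun k => - d * ln (INR (S k))) m_infty 0).
  - apply is_lim_exp_m.
  - exists O. intros n _. discriminate.
  - replace m_infty with (Rbar_mult (- d) p_infty).
    + apply is_lim_seq_scal_l.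
      apply (is_lim_comp_seq ln (fun k => INR (S k)) p_infty p_infty).
      * apply is_lim_ln_p.
      * exists O. intros n _. discriminate.
      * apply (is_lim_seq_incr_1 INR). apply is_lim_seq_INR.
    + simpl. destruct (Rle_dec 0 (- d)) as [H|H]; [exfalso; lra | reflexivity].
Qed.

(** With [n = k + 1] this is the integral of the fractional part of [u] times [u ^ (-s-1)] over
    [[n, n + 1]]. Summed over [k] it enters [zeta s = 1 + 1 / (s - 1) - s * zeta_tail s]. *)
Definition zeta_cell (k : nat) (s : C) : C :=
  RInt (V := CR) (fun u => RtoC (u - INR (S k)) * RCpow u (- s - 1))%C
    (INR (S k)) (INR (S (S k))).

Definition zeta_tail (s : C) : C := Clim (csum (fun k => zeta_cell k s)).

Lemma INR_S_ge_1 (k : nat) : 1 <= INR (S k).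
Proof. rewrite S_INR. pose proof (pos_INR k). lra. Qed.

Lemma continuous_RCpow (u : R) (w : C) : 0 < u -> continuousC (fun u => RCpow u w) u.
Proof. intros Hu. eapply is_derive_CR_continuous. now apply is_derive_RCpow. Qed.

Lemma continuous_affine_CR (a u : R) : continuousC (fun u => RtoC (u - a)) u.
Proof.
  eapply is_derive_CR_continuous. apply (is_derive_RtoC (fun u => u - a)).
  auto_derive; auto.
Qed.

Lemma zeta_cell_correct (k : nat) (s : C) :
  is_RIntC (fun u => RtoC (u - INR (S k)) * RCpow u (- s - 1))%C
    (INR (S k)) (INR (S (S k))) (zeta_cell k s).
Proof.
  apply (RInt_correct (V := CR)). apply (ex_RInt_continuous (V := CR)). intros u Hu.
  pose proof (INR_S_ge_1 k). pose proof (S_INR (S k)).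
  rewrite Rmin_left in Hu by lra.
  apply continuous_CR_mult; [apply continuous_affine_CR | apply continuous_RCpow; lra].
Qed.

(** Integration by parts; the boundary values are what telescopes in [dirichlet_partial]. *)
Lemma zeta_cell_mul (k : nat) (s : C) : s <> 1%C ->
  (s * zeta_cell k s = - RCpow (INR (S (S k))) (- s)
    + (RCpow (INR (S (S k))) (1 - s) - RCpow (INR (S k)) (1 - s)) / (1 - s))%C.
Proof.
  intros Hs.
  assert (H1s : (1 - s)%C <> 0%C).
  { intros E. apply Hs. replace s with (1 - (1 - s))%C by ring. rewrite E. ring. }
  pose proof (is_RInt_CR_scal s _ _ _ _ (zeta_cell_correct k s)) as H1.
  set (F := fun u : R => (- (RtoC (u - INR (S k)) * RCpow u (- s))
    + / (1 - s) * RCpow u (1 - s))%C).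
  pose proof (INR_S_ge_1 k) as Hk. pose proof (S_INR (S k)) as HSk.
  assert (H2 : is_RIntC (fun u => s * (RtoC (u - INR (S k)) * RCpow u (- s - 1)))%C
    (INR (S k)) (INR (S (S k))) (minus (F (INR (S (S k))) : CR) (F (INR (S k))))).
  { apply (is_RInt_derive (V := CR)).
    - intros u Hu. rewrite Rmin_left in Hu by lra.
      replace (s * (RtoC (u - INR (S k)) * RCpow u (- s - 1)))%C with
        (- (1 * RCpow u (- s) + RtoC (u - INR (S k)) * (- s * RCpow u (- s - 1)))
          + / (1 - s) * ((1 - s) * RCpow u (1 - s - 1)))%C.
      2:{ replace (1 - s - 1)%C with (- s)%C by ring. field. auto. }
      apply is_derive_CR_plus.
      + apply (is_derive_opp (V := CR)). apply (is_derive_CR_mult (fun u => RtoC (u - INR (S k)))).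
        * apply (is_derive_RtoC (fun u => u - INR (S k))). auto_derive; auto; ring.
        * apply is_derive_RCpow. lra.
      + apply is_derive_CR_scal_l, is_derive_RCpow. lra.
    - intros u Hu. rewrite Rmin_left in Hu by lra.
      apply continuous_CR_mult; [apply (continuous_const (U := R_UniformSpace) (V := CR))|].
      apply continuous_CR_mult; [apply continuous_affine_CR | apply continuous_RCpow; lra]. }
  rewrite <- (is_RInt_unique (V := CR) _ _ _ _ H1), (is_RInt_unique (V := CR) _ _ _ _ H2).
  change ((F (INR (S (S k))) - F (INR (S k)))%C = (- RCpow (INR (S (S k))) (- s)
    + (RCpow (INR (S (S k))) (1 - s) - RCpow (INR (S k)) (1 - s)) / (1 - s))%C).
  unfold F. replace (INR (S (S k)) - INR (S k)) with 1 by lra.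
  rewrite Rminus_diag. field. auto.
Qed.

(** An exact identity for every [N]. For [1 < Re s] its correction term tends to zero, which
    identifies the Dirichlet series; for [0 < Re s < 1] it shows that the left side still converges,
    and this corrected sum is the approximation of zeta on which the double sums rest. *)
Lemma dirichlet_partial (s : C) (N : nat) : s <> 1%C ->
  (csum (fun k => RCpow (INR (S k)) (- s)) (S N) - RCpow (INR (S N)) (1 - s) / (1 - s)
   = 1 + / (s - 1) - s * csum (fun k => zeta_cell k s) N)%C.
Proof.
  intros Hs.
  assert (H1s : (1 - s)%C <> 0%C).
  { intros E. apply Hs. replace s with (1 - (1 - s))%C by ring. rewrite E. ring. }
  assert (Hs1 : (s - 1)%C <> 0%C).
  { intros E. apply Hs. replace s with ((s - 1) + 1)%C by ring. rewrite E. ring. }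
  induction N as [|N IH].
  - simpl. rewrite !RCpow_1_l. field. auto.
  - change (csum (fun k => RCpow (INR (S k)) (- s)) (S (S N))) with
      (csum (fun k => RCpow (INR (S k)) (- s)) (S N) + RCpow (INR (S (S N))) (- s))%C.
    change (csum (fun k => zeta_cell k s) (S N)) with
      (csum (fun k => zeta_cell k s) N + zeta_cell N s)%C.
    replace (1 + / (s - 1) - s * (csum (fun k => zeta_cell k s) N + zeta_cell N s))%C
      with ((1 + / (s - 1) - s * csum (fun k => zeta_cell k s) N) - s * zeta_cell N s)%C by ring.
    rewrite <- IH, (zeta_cell_mul N s Hs). field. auto.
Qed.

Lemma RInt_Rpower_cell (k : nat) (d : R) : d <> 0 ->
  is_RInt (fun u => Rpower u (- d - 1)) (INR (S k)) (INR (S (S k)))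
    (Rpower (INR (S k)) (- d) / d - Rpower (INR (S (S k))) (- d) / d).
Proof.
  intros Hd. pose proof (INR_S_ge_1 k) as Hk. pose proof (S_INR (S k)) as HSk.
  replace (Rpower (INR (S k)) (- d) / d - Rpower (INR (S (S k))) (- d) / d)
    with (- / d * Rpower (INR (S (S k))) (- d) - - / d * Rpower (INR (S k)) (- d))
    by (field; auto).
  apply (is_RInt_derive (V := RC) (fun u => - / d * Rpower u (- d))
    (fun u => Rpower u (- d - 1)) (INR (S k)) (INR (S (S k)))).
  - intros u Hu. rewrite Rmin_left in Hu by lra.
    replace (Rpower u (- d - 1)) with (- / d * (- d * Rpower u (- d - 1))) by (field; auto).
    apply is_derive_scal, is_derive_Rpower. lra.
  - intros u Hu. rewrite Rmin_left in Hu by lra.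
    apply continuous_of_ex_derive. eexists. apply is_derive_Rpower. lra.
Qed.

(** The fractional part is at most 1, and [u ^ (- Re s - 1)] integrates to a telescoping
    difference. *)
Lemma Cmod_zeta_cell (k : nat) (s : C) : 0 < Re s ->
  Cmod (zeta_cell k s) <= Rpower (INR (S k)) (- Re s) / Re s
    - Rpower (INR (S (S k))) (- Re s) / Re s.
Proof.
  intros Hs. pose proof (INR_S_ge_1 k) as Hk. pose proof (S_INR (S k)) as HSk.
  rewrite <- norm_CR.
  apply (norm_RInt_le (V := CR) (fun u => RtoC (u - INR (S k)) * RCpow u (- s - 1))%C
    (fun u => Rpower u (- Re s - 1)) (INR (S k)) (INR (S (S k)))); [lra | | |].
  - intros u Hu. rewrite norm_CR, Cmod_mult, Cmod_RCpow, Cmod_R, Rabs_pos_eq by lra.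
    replace (Re (- s - 1)) with (- Re s - 1) by reflexivity.
    rewrite <- (Rmult_1_l (Rpower u (- Re s - 1))) at 2.
    apply Rmult_le_compat_r; [left; apply exp_pos | lra].
  - apply zeta_cell_correct.
  - apply RInt_Rpower_cell. lra.
Qed.

Lemma is_lim_seq_Rpower_neg_div (d : R) : 0 < d ->
  is_lim_seq (fun k => Rpower (INR (S k)) (- d) / d) 0.
Proof.
  intros Hd. apply (is_lim_seq_ext (fun k => / d * Rpower (INR (S k)) (- d))).
  { intros k. unfold Rdiv. ring. }
  replace (Finite 0) with (Rbar_mult (/ d) 0) by (simpl; f_equal; ring).
  apply is_lim_seq_scal_l. now apply is_lim_seq_Rpower_neg.
Qed.

Lemma zeta_tail_bound (s : C) : 0 < Re s ->
  is_Clim (csum (fun k => zeta_cell k s)) (zeta_tail s) /\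
  forall N, Cmod (zeta_tail s - csum (fun k => zeta_cell k s) N)
    <= Rpower (INR (S N)) (- Re s) / Re s.
Proof.
  intros Hs.
  apply (csum_telescope_conv (fun k => zeta_cell k s)
    (fun k => Rpower (INR (S k)) (- Re s) / Re s)).
  - intros k. now apply Cmod_zeta_cell.
  - now apply is_lim_seq_Rpower_neg_div.
Qed.

(** The coefficient of [z ^ j] in [zeta_cell k (s + z)], from expanding [u ^ (- z)] in powers of
    [- z * ln u]. *)
Definition zeta_cell_coef (s : C) (k j : nat) : C :=
  RInt (V := CR) (fun u => RtoC (u - INR (S k)) * RCpow u (- s - 1)
    * RtoC ((- ln u) ^ j / INR (fact j)))%C (INR (S k)) (INR (S (S k))).

Lemma zeta_cell_coef_correct (s : C) (k j : nat) :
  is_RIntC (fun u => RtoC (u - INR (S k)) * RCpow u (- s - 1)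
    * RtoC ((- ln u) ^ j / INR (fact j)))%C (INR (S k)) (INR (S (S k)))
    (zeta_cell_coef s k j).
Proof.
  apply (RInt_correct (V := CR)). apply (ex_RInt_continuous (V := CR)). intros u Hu.
  pose proof (INR_S_ge_1 k). pose proof (S_INR (S k)).
  rewrite Rmin_left in Hu by lra.
  apply continuous_CR_mult; [apply continuous_CR_mult|].
  - apply continuous_affine_CR.
  - apply continuous_RCpow; lra.
  - eapply is_derive_CR_continuous. apply (is_derive_RtoC (fun u => (- ln u) ^ j / INR (fact j))).
    auto_derive; [lra | reflexivity].
Qed.

Lemma exp_le (x y : R) : x <= y -> exp x <= exp y.
Proof. intros [H | ->]; [left; now apply exp_increasing | right; reflexivity]. Qed.

(** A quarter of [Re s] is spent on each of two losses: [(r ln u) ^ K / fact K] is at most [u ^ r],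
    and [exp (Cmod z * ln u)] is at most [u ^ r]. Out of [u ^ (- 4 r - 1)] there remains the
    summable [u ^ (- 2 r - 1)]. *)
Lemma zeta_cell_taylor (s z : C) (r : R) (k K : nat) :
  0 < r -> Re s = 4 * r -> Cmod z <= r ->
  Cmod (zeta_cell k (s + z) - csum (fun j => zeta_cell_coef s k j * z ^ j) K)%C
  <= (Cmod z / r) ^ K * (Rpower (INR (S k)) (- (2 * r)) / (2 * r))
    - (Cmod z / r) ^ K * (Rpower (INR (S (S k))) (- (2 * r)) / (2 * r)).
Proof.
  intros Hr Hs Hz. pose proof (INR_S_ge_1 k) as Hk. pose proof (S_INR (S k)) as HSk.
  rewrite <- norm_CR.
  apply (norm_RInt_le (V := CR)
    (fun u => RtoC (u - INR (S k)) * RCpow u (- (s + z) - 1)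
      - csum (fun j => z ^ j * (RtoC (u - INR (S k)) * RCpow u (- s - 1)
          * RtoC ((- ln u) ^ j / INR (fact j)))) K)%C
    (fun u => (Cmod z / r) ^ K * Rpower u (- (2 * r) - 1)) (INR (S k)) (INR (S (S k))));
    [lra | | |].
  - intros u Hu. rewrite norm_CR.
    rewrite (csum_ext _ (fun j => (RtoC (u - INR (S k)) * RCpow u (- s - 1))
      * (RtoC (/ INR (fact j)) * (- z * RtoC (ln u)) ^ j))%C).
    2:{ intros j _. replace (- z * RtoC (ln u))%C with (z * RtoC (- ln u))%C
          by (rewrite RtoC_opp; ring).
        unfold Rdiv. rewrite Cpow_mult_l, RtoC_mult, RtoC_pow. ring. }
    rewrite csum_scal.
    replace (RCpow u (- (s + z) - 1)) with (RCpow u (- s - 1) * Cexp (- z * RtoC (ln u)))%C.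
    2:{ change (Cexp (- z * RtoC (ln u))) with (RCpow u (- z)). rewrite <- RCpow_plus.
        f_equal. ring. }
    replace (RtoC (u - INR (S k)) * (RCpow u (- s - 1) * Cexp (- z * RtoC (ln u))) -
       RtoC (u - INR (S k)) * RCpow u (- s - 1) *
       csum (fun j => RtoC (/ INR (fact j)) * (- z * RtoC (ln u)) ^ j) K)%C
    with (RtoC (u - INR (S k)) * (RCpow u (- s - 1) * (Cexp (- z * RtoC (ln u)) -
       csum (fun j => RtoC (/ INR (fact j)) * (- z * RtoC (ln u)) ^ j) K)))%C by ring.
    rewrite Cmod_mult, Cmod_R, Rabs_pos_eq by lra.
    rewrite Cmod_mult, Cmod_RCpow.
    replace (Re (- s - 1)) with (- Re s - 1) by reflexivity. rewrite Hs.
    set (X := Cmod (Cexp (- z * RtoC (ln u)) - _)%C).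
    assert (HL : 0 <= ln u).
    { rewrite <- ln_1. destruct (Req_dec u 1) as [->|]; [lra|].
      left. apply ln_increasing; lra. }
    assert (Hz0 : 0 <= Cmod z) by apply Cmod_ge_0.
    assert (HX : X <= (Cmod z / r) ^ K * exp (2 * r * ln u)).
    { unfold X. eapply Rle_trans; [apply Cexp_taylor|].
      rewrite Cmod_mult, Cmod_opp, Cmod_R, Rabs_pos_eq by auto.
      replace (2 * r * ln u) with (r * ln u + r * ln u) by ring. rewrite exp_plus.
      replace ((Cmod z * ln u) ^ K / INR (fact K)) with
        ((Cmod z / r) ^ K * ((r * ln u) ^ K / INR (fact K))).
      2:{ unfold Rdiv. rewrite !Rpow_mult_distr, pow_inv. field.
          split; [apply INR_fact_neq_0 | apply pow_nonzero; lra]. }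
      rewrite !Rmult_assoc. apply Rmult_le_compat_l.
      { apply pow_le, Rdiv_le_0_compat; lra. }
      apply Rmult_le_compat.
      - apply Rdiv_le_0_compat; [apply pow_le; nra | apply INR_fact_lt_0].
      - left. apply exp_pos.
      - apply pow_div_fact_le_exp. nra.
      - apply exp_le. nra. }
    assert (HX0 : 0 <= X) by apply Cmod_ge_0.
    replace (Rpower u (- (2 * r) - 1)) with
      (Rpower u (- (4 * r) - 1) * exp (2 * r * ln u)).
    2:{ unfold Rpower. rewrite <- exp_plus. f_equal. ring. }
    assert (0 < Rpower u (- (4 * r) - 1)) by apply exp_pos.
    apply Rle_trans with (1 * (Rpower u (- (4 * r) - 1) * X)).
    + apply Rmult_le_compat_r; [nra | lra].
    + rewrite Rmult_1_l. replace ((Cmod z / r) ^ K * (Rpower u (- (4 * r) - 1) * exp (2 * r * ln u)))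
        with (Rpower u (- (4 * r) - 1) * ((Cmod z / r) ^ K * exp (2 * r * ln u))) by ring.
      apply Rmult_le_compat_l; lra.
  - apply (is_RInt_minus (V := CR)).
    + apply zeta_cell_correct.
    + rewrite (csum_ext _ (fun j => z ^ j * zeta_cell_coef s k j)%C) by (intros; ring).
      apply (is_RInt_csum (fun j u => z ^ j * (RtoC (u - INR (S k)) * RCpow u (- s - 1)
          * RtoC ((- ln u) ^ j / INR (fact j))))%C).
      intros j. apply is_RInt_CR_scal, zeta_cell_coef_correct.
  - rewrite <- Rmult_minus_distr_l.
    apply (is_RInt_scal (V := RN)). apply RInt_Rpower_cell. lra.
Qed.

Lemma Cmod_zeta_cell_coef (s : C) (r : R) (k j : nat) :
  0 < r -> Re s = 4 * r ->
  Cmod (zeta_cell_coef s k j)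
  <= / r ^ j * (Rpower (INR (S k)) (- (2 * r)) / (2 * r))
    - / r ^ j * (Rpower (INR (S (S k))) (- (2 * r)) / (2 * r)).
Proof.
  intros Hr Hs. pose proof (INR_S_ge_1 k) as Hk. pose proof (S_INR (S k)) as HSk.
  assert (Hrj : 0 < r ^ j) by now apply pow_lt.
  rewrite <- norm_CR.
  apply (norm_RInt_le (V := CR)
    (fun u => RtoC (u - INR (S k)) * RCpow u (- s - 1)
          * RtoC ((- ln u) ^ j / INR (fact j)))%C
    (fun u => / r ^ j * Rpower u (- (2 * r) - 1)) (INR (S k)) (INR (S (S k))));
    [lra | | |].
  - intros u Hu. rewrite norm_CR.
    rewrite !Cmod_mult, Cmod_RCpow, !Cmod_R, (Rabs_pos_eq (u - INR (S k))) by lra.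
    replace (Re (- s - 1)) with (- Re s - 1) by reflexivity. rewrite Hs.
    assert (HL : 0 <= ln u).
    { rewrite <- ln_1. destruct (Req_dec u 1) as [->|]; [lra|].
      left. apply ln_increasing; lra. }
    assert (Hf : 0 < INR (fact j)) by apply INR_fact_lt_0.
    unfold Rdiv at 1. rewrite Rabs_mult, <- RPow_abs, Rabs_Ropp, (Rabs_pos_eq (ln u)) by auto.
    rewrite (Rabs_pos_eq (/ INR (fact j))) by (left; now apply Rinv_0_lt_compat).
    replace (Rpower u (- (2 * r) - 1)) with
      (Rpower u (- (4 * r) - 1) * (exp (r * ln u) * exp (r * ln u))).
    2:{ unfold Rpower. rewrite <- !exp_plus. f_equal. ring. }
    assert (Hp : 0 < Rpower u (- (4 * r) - 1)) by apply exp_pos.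
    assert (H1 : ln u ^ j * / INR (fact j) <= / r ^ j * exp (r * ln u)).
    { replace (ln u ^ j * / INR (fact j)) with (/ r ^ j * ((r * ln u) ^ j / INR (fact j))).
      - apply Rmult_le_compat_l; [left; now apply Rinv_0_lt_compat|].
        apply pow_div_fact_le_exp. nra.
      - rewrite Rpow_mult_distr. field. split; lra. }
    assert (H2 : 1 <= exp (r * ln u)).
    { rewrite <- exp_0. apply exp_le. nra. }
    assert (H3 : 0 <= ln u ^ j * / INR (fact j)).
    { apply Rmult_le_pos; [now apply pow_le | left; now apply Rinv_0_lt_compat]. }
    set (p := Rpower u (- (4 * r) - 1)) in *. set (e := exp (r * ln u)) in *.
    set (q := ln u ^ j * / INR (fact j)) in *. set (ri := / r ^ j) in *.
    assert (0 < ri) by (now apply Rinv_0_lt_compat).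
    apply Rle_trans with (1 * p * q).
    + apply Rmult_le_compat_r; auto. apply Rmult_le_compat_r; lra.
    + apply Rle_trans with (p * (ri * e)).
      * rewrite Rmult_1_l. apply Rmult_le_compat_l; lra.
      * replace (ri * (p * (e * e))) with (p * (ri * e) * e) by ring.
        rewrite <- (Rmult_1_r (p * (ri * e))) at 1.
        apply Rmult_le_compat_l; auto. apply Rmult_le_pos; [lra|].
        apply Rmult_le_pos; lra.
  - apply zeta_cell_coef_correct.
  - rewrite <- Rmult_minus_distr_l.
    apply (is_RInt_scal (V := RN)). apply RInt_Rpower_cell. lra.
Qed.

Definition zeta_tail_coef (s : C) (j : nat) : C := Clim (csum (fun k => zeta_cell_coef s k j)).

Lemma is_Clim_zeta_tail_coef (s : C) (j : nat) : 0 < Re s ->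
  is_Clim (csum (fun k => zeta_cell_coef s k j)) (zeta_tail_coef s j).
Proof.
  intros Hs. set (r := Re s / 4). assert (Hr : 0 < r) by (unfold r; lra).
  apply (csum_telescope_conv (fun k => zeta_cell_coef s k j)
    (fun k => / r ^ j * (Rpower (INR (S k)) (- (2 * r)) / (2 * r)))).
  - intros k. apply Cmod_zeta_cell_coef; unfold r; lra.
  - replace (Finite 0) with (Rbar_mult (/ r ^ j) 0) by (simpl; f_equal; ring).
    apply is_lim_seq_scal_l. apply is_lim_seq_Rpower_neg_div. lra.
Qed.

(** The cell estimates telescope to [1 / (2 r) = 2 / Re s], and the finite sum over [j] may be
    exchanged with the limit over the cells. *)
Lemma zeta_tail_taylor (s : C) (z : C) (K : nat) : 0 < Re s -> Cmod z < Re s / 4 ->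
  Cmod (zeta_tail (s + z) - csum (fun j => zeta_tail_coef s j * z ^ j) K)%C
  <= 2 / Re s * (Cmod z / (Re s / 4)) ^ K.
Proof.
  intros Hs Hz. set (r := Re s / 4) in *. assert (Hr : 0 < r) by (unfold r; lra).
  assert (Hsz : 0 < Re (s + z)).
  { change (Re (s + z)) with (Re s + Re z).
    pose proof (re_le_Cmod z). pose proof (Rle_abs (- Re z)). rewrite Rabs_Ropp in H0.
    unfold r in Hz. lra. }
  apply (is_Clim_le (fun N => csum (fun k => zeta_cell k (s + z)
    - csum (fun j => zeta_cell_coef s k j * z ^ j) K)%C N)).
  - apply (is_Clim_ext (fun N => csum (fun k => zeta_cell k (s + z)) N
      - csum (fun j => csum (fun k => zeta_cell_coef s k j) N * z ^ j)%C K)%C).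
    + intros N. rewrite csum_minus, csum_exchange. apply (f_equal2 Cminus); [reflexivity|].
      apply csum_ext. intros j _.
      rewrite (csum_ext (fun i => zeta_cell_coef s i j * z ^ j)%C
        (fun i => z ^ j * zeta_cell_coef s i j)%C) by (intros; ring).
      rewrite csum_scal. ring.
    + apply is_Clim_minus; [now apply zeta_tail_bound|].
      apply (is_Clim_csum (fun N j => csum (fun k => zeta_cell_coef s k j) N * z ^ j)%C).
      intros j.
      apply (is_Clim_ext (fun N => z ^ j * csum (fun k => zeta_cell_coef s k j) N)%C);
        [intros; ring|].
      rewrite (Cmult_comm _ (z ^ j)). apply is_Clim_scal, is_Clim_zeta_tail_coef, Hs.
  - intros N.
    set (p := fun k => (Cmod z / r) ^ K * (Rpower (INR (S k)) (- (2 * r)) / (2 * r))).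
    eapply Rle_trans.
    + apply (Cmod_csum_le _ (fun k => p k - p (S k))).
      intros k. apply zeta_cell_taylor; auto; unfold r in *; lra.
    + rewrite rsum_telescope. unfold p.
      assert (0 <= (Cmod z / r) ^ K).
      { apply pow_le, Rdiv_le_0_compat; [apply Cmod_ge_0 | lra]. }
      assert (0 <= (Cmod z / r) ^ K * (Rpower (INR (S N)) (- (2 * r)) / (2 * r))).
      { apply Rmult_le_pos; auto. apply Rdiv_le_0_compat; [left; apply exp_pos | lra]. }
      assert (E : Rpower (INR 1) (- (2 * r)) = 1).
      { unfold Rpower. simpl INR. rewrite ln_1, Rmult_0_r. apply exp_0. }
      rewrite E.
      assert (E2 : 1 / (2 * r) = 2 / Re s) by (unfold r; field; lra).
      rewrite E2. lra.
Qed.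

Lemma taylor_at_zeta_tail (s : C) : 0 < Re s -> taylor_at zeta_tail s.
Proof.
  intros Hs. exists (zeta_tail_coef s), (Re s / 4), (2 / Re s). split; [lra|].
  intros z K Hz. now apply zeta_tail_taylor.
Qed.

Definition zeta_ext (s : C) : C := (1 + / (s - 1) - s * zeta_tail s)%C.

Lemma taylor_at_zeta_ext (s : C) : 0 < Re s -> s <> 1%C -> taylor_at zeta_ext s.
Proof.
  intros Hs H1.
  assert (H : taylor_at (fun s => (1 - (0 - / (s - 1))) - s * zeta_tail s)%C s).
  { apply (taylor_at_minus (fun s => 1 - (0 - / (s - 1)))%C (fun s => s * zeta_tail s)%C).
    - apply (taylor_at_minus (fun _ => 1%C) (fun s => 0 - / (s - 1))%C).
      + apply taylor_at_const.
      + apply (taylor_at_minus (fun _ => 0%C) (fun s => / (s - 1))%C).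
        * apply taylor_at_const.
        * now apply taylor_at_pole.
    - now apply taylor_at_mul_id, taylor_at_zeta_tail. }
  destruct H as (a & r & D & Hr & H). exists a, r, D. split; auto.
  intros z K Hz. specialize (H z K Hz). unfold zeta_ext.
  now replace (1 + / (s + z - 1) - (s + z) * zeta_tail (s + z))%C with
    (1 - (0 - / (s + z - 1)) - (s + z) * zeta_tail (s + z))%C by ring.
Qed.

Lemma Re_gt_1_neq (s : C) : 1 < Re s -> s <> 1%C.
Proof. intros H E. rewrite E in H. simpl in H. lra. Qed.

Lemma dirichlet_limit (s : C) : 1 < Re s ->
  is_Clim (fun N => csum (fun k => RCpow (INR (S k)) (- s)) (S N)) (zeta_ext s).
Proof.
  intros Hs. pose proof (Re_gt_1_neq s Hs) as Hs1.
  apply (is_Clim_ext (fun N => (1 + / (s - 1) - s * csum (fun k => zeta_cell k s) N)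
    + / (1 - s) * RCpow (INR (S N)) (1 - s))%C).
  { intros N. rewrite <- dirichlet_partial by auto. unfold Cdiv. ring. }
  replace (zeta_ext s) with (zeta_ext s + / (1 - s) * 0)%C by ring.
  apply is_Clim_plus.
  - unfold zeta_ext. apply is_Clim_minus; [apply is_Clim_const|].
    apply is_Clim_scal. apply zeta_tail_bound. lra.
  - apply is_Clim_scal.
    apply (is_Clim_of_bound _ _ (fun N => Rpower (INR (S N)) (- (Re s - 1)))).
    + apply is_lim_seq_Rpower_neg. lra.
    + intros N. replace (RCpow (INR (S N)) (1 - s) - 0)%C with (RCpow (INR (S N)) (1 - s)) by ring.
      rewrite Cmod_RCpow. right. f_equal. change (Re (1 - s)) with (1 - Re s). ring.
Qed.

(** * Identification with the given zeta function *)

Lemma series_csum_limit (a : nat -> C) (l : C) :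
  is_series (K := C_AbsRing) (V := C_NormedModule) a l -> is_Clim (fun N => csum a (S N)) l.
Proof.
  intros H eps.
  pose proof (norm_factor_gt_0 (V := C_NormedModule)) as Hnf.
  pose proof (Rdiv_lt_0_compat _ _ (cond_pos eps) Hnf) as Heps.
  specialize (H (ball (M := C_NormedModule) l (mkposreal _ Heps)) (locally_ball _ _)).
  destruct H as [N HN]. exists N. intros n Hn. specialize (HN n Hn).
  apply (norm_compat2 (V := C_NormedModule)) in HN.
  rewrite <- sum_n_csum.
  refine (Rlt_le_trans _ _ _ HN _). right. cbn [pos]. field. lra.
Qed.

(** The pole blocks the real half-line, so the identity theorem is first run along horizontal lines
    of nonzero ordinate, starting from [1 < Re s]. A real point other than 1 is then reached from
    above, through [taylor_at_vanish] with direction [Ci]. *)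
Lemma zeta_unique (zeta : C -> C) : is_riemann_zeta zeta ->
  forall s, 0 < Re s -> s <> 1%C -> zeta s = zeta_ext s.
Proof.
  intros [Han Hser].
  assert (Hd : forall s, 0 < Re s -> s <> 1%C -> taylor_at (fun z => zeta z - zeta_ext z)%C s).
  { intros s Hs H1. apply taylor_at_minus.
    - now apply taylor_at_analytic, Han.
    - now apply taylor_at_zeta_ext. }
  assert (Hgt : forall s, 1 < Re s -> (zeta s - zeta_ext s)%C = 0%C).
  { intros s Hs.
    rewrite (is_Clim_uniq _ (zeta s) (zeta_ext s) (series_csum_limit _ _ (Hser s Hs))
      (dirichlet_limit s Hs)). ring. }
  assert (Hoff : forall x t, 0 < x -> t <> 0 -> (zeta (x, t) - zeta_ext (x, t))%C = 0%C).
  { intros x t Hx Ht.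
    apply (taylor_at_horizontal (fun z => zeta z - zeta_ext z)%C t); auto.
    - intros y Hy. apply Hd; [exact Hy|]. intros E. apply Ht. now injection E. }
  assert (Hall : forall s, 0 < Re s -> s <> 1%C -> (zeta s - zeta_ext s)%C = 0%C).
  { intros s Hs H1. destruct (Req_dec (Im s) 0) as [E|Hne].
    - destruct (taylor_at_vanish (fun z => zeta z - zeta_ext z)%C s Ci 1 (Hd s Hs H1)
        Cmod_Ci Rlt_0_1) as [r [Hr Hv]].
      + intros x Hx. rewrite (C_eta (s + x * Ci)%C).
        replace (Re (s + x * Ci)) with (Re s) by (unfold Re; simpl; ring).
        replace (Im (s + x * Ci)) with x by (unfold Im in *; simpl; lra).
        apply Hoff; lra.
      + replace s with (s + 0)%C by ring. apply Hv. now rewrite Cmod_0.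
    - rewrite (C_eta s). now apply Hoff. }
  intros s Hs H1. specialize (Hall s Hs H1).
  replace (zeta s) with ((zeta s - zeta_ext s) + zeta_ext s)%C by ring.
  rewrite Hall. ring.
Qed.

(** * Fourier series and partial fractions *)

Lemma rsum_telescope_conv (x p : nat -> R) :
  (forall k, Rabs (x k) <= p k - p (S k)) -> is_lim_seq p 0 ->
  exists l : R, is_lim_seq (rsum x) l /\ forall N, Rabs (l - rsum x N) <= p N.
Proof.
  intros Hx Hp.
  destruct (csum_telescope_conv (fun k => RtoC (x k)) p) as [H1 H2]; auto.
  { intros k. rewrite Cmod_R. apply Hx. }
  exists (Re (Clim (csum (fun k => RtoC (x k))))). split.
  - apply (is_lim_seq_ext (fun n => Re (csum (fun k => RtoC (x k)) n))).
    + intros n. now rewrite csum_RtoC.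
    + now apply is_Clim_Re.
  - intros N. eapply Rle_trans; [|apply (H2 N)].
    rewrite csum_RtoC. exact (re_le_Cmod (Clim (csum (fun k => RtoC (x k))) - RtoC (rsum x N))).
Qed.

Lemma is_lim_seq_uniq (u : nat -> R) (a b : R) :
  is_lim_seq u a -> is_lim_seq u b -> a = b.
Proof.
  intros Ha Hb. apply is_lim_seq_unique in Ha. apply is_lim_seq_unique in Hb.
  assert (E : Finite a = Finite b) by congruence. now injection E.
Qed.

Lemma is_derive_rsum (f df : nat -> R -> R) (N : nat) (u : R) :
  (forall k, is_derive (f k) u (df k u)) ->
  is_derive (fun u => rsum (fun k => f k u) N) u (rsum (fun k => df k u) N).
Proof.
  intros H. induction N as [|N IH]; simpl.
  - apply (is_derive_const (V := RN) (0 : R)).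
  - apply (is_derive_plus (V := RN)); auto.
Qed.

Definition freq (k : nat) : R := 2 * PI * INR (S k).

Lemma freq_pos (k : nat) : 0 < freq k.
Proof. unfold freq. pose proof PI_RGT_0. pose proof (INR_S_ge_1 k). nra. Qed.

Lemma dirichlet_kernel (v : R) (N : nat) :
  sin (PI * v) * rsum (fun k => 2 * cos (freq k * v)) N
  = sin ((2 * INR N + 1) * (PI * v)) - sin (PI * v).
Proof.
  induction N as [|N IH].
  - simpl. replace ((2 * 0 + 1) * (PI * v)) with (PI * v) by ring. ring.
  - change (rsum (fun k => 2 * cos (freq k * v)) (S N)) with
      (rsum (fun k => 2 * cos (freq k * v)) N + 2 * cos (freq N * v)).
    rewrite Rmult_plus_distr_l, IH.
    assert (E : sin ((2 * INR (S N) + 1) * (PI * v)) - sin ((2 * INR N + 1) * (PI * v))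
      = 2 * sin (PI * v) * cos (freq N * v)).
    { unfold freq. rewrite S_INR.
      replace ((2 * (INR N + 1) + 1) * (PI * v)) with (2 * PI * (INR N + 1) * v + PI * v) by ring.
      replace ((2 * INR N + 1) * (PI * v)) with (2 * PI * (INR N + 1) * v - PI * v) by ring.
      rewrite sin_plus, sin_minus. ring. }
    lra.
Qed.

(** Partial Fourier sum of [1 / 2 - u] on the open unit interval. *)
Definition sawtooth (N : nat) (u : R) : R := rsum (fun k => 2 * sin (freq k * u) / freq k) N.

Lemma is_derive_sawtooth (N : nat) (u : R) :
  is_derive (sawtooth N) u (rsum (fun k => 2 * cos (freq k * u)) N).
Proof.
  apply (is_derive_rsum (fun k u => 2 * sin (freq k * u) / freq k)
    (fun k u => 2 * cos (freq k * u))).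
  intros k. pose proof (freq_pos k). auto_derive; auto. field. lra.
Qed.

Lemma sin_INR_PI (k : nat) : sin (PI * INR k) = 0.
Proof.
  induction k as [|k IH]; [simpl; rewrite Rmult_0_r; apply sin_0|].
  rewrite S_INR, Rmult_plus_distr_l, Rmult_1_r, sin_plus, IH, sin_PI. ring.
Qed.

Lemma cos_odd_PI2 (N : nat) : cos ((2 * INR N + 1) * (PI * (1 / 2))) = 0.
Proof.
  replace ((2 * INR N + 1) * (PI * (1 / 2))) with (PI * INR N + PI / 2) by field.
  rewrite cos_plus, sin_INR_PI, cos_PI2. ring.
Qed.

Lemma sin_PI_between (u v : R) : 0 < u < 1 -> Rmin u (1 / 2) <= v <= Rmax u (1 / 2) ->
  0 < sin (PI * u) <= sin (PI * v).
Proof.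
  intros Hu Hv. pose proof PI_RGT_0 as HP.
  split; [apply sin_gt_0; nra|].
  destruct (Rle_dec u (1 / 2)) as [H|H].
  - rewrite Rmin_left, Rmax_right in Hv by lra. apply sin_incr_1; nra.
  - rewrite Rmin_right, Rmax_left in Hv by lra. apply sin_decr_1; nra.
Qed.

(** Pointwise convergence with a rate, but one that degenerates at 0 and 1 like the inverse square
    of [sin (PI * u)]. *)
Lemma sawtooth_bound (N : nat) (u : R) : 0 < u < 1 ->
  Rabs (sawtooth N u - (1 / 2 - u)) <= / (2 * INR N + 1) * (/ sin (PI * u)) ^ 2.
Proof.
  intros Hu. pose proof PI_RGT_0 as HP. pose proof PI2_3_2 as HP3.
  set (m := 2 * INR N + 1).
  assert (Hm : 0 < m) by (unfold m; pose proof (pos_INR N); lra).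
  (* The derivative of the error is [sin (m PI u) / sin (PI u)] by [dirichlet_kernel]. The cosine
     term removes it up to a remainder of size [1 / m], as one integration by parts would; at
     [u = 1 / 2] everything vanishes because [m] is odd. *)
  set (G := fun u => sawtooth N u - (1 / 2 - u) + cos (m * (PI * u)) / (m * PI * sin (PI * u))).
  set (dG := fun u => - cos (m * (PI * u)) * cos (PI * u) / (m * sin (PI * u) ^ 2)).
  assert (HG : forall v, Rmin u (1 / 2) <= v <= Rmax u (1 / 2) -> is_derive G v (dG v)).
  { intros v Hv. pose proof (sin_PI_between u v Hu Hv) as Hs.
    unfold G, dG.
    assert (E : - cos (m * (PI * v)) * cos (PI * v) / (m * sin (PI * v) ^ 2) =
      (rsum (fun k => 2 * cos (freq k * v)) N - -1)
      + (- (m * PI) * sin (m * (PI * v)) / (m * PI * sin (PI * v))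
         - cos (m * (PI * v)) * (m * PI * (PI * cos (PI * v))) / (m * PI * sin (PI * v)) ^ 2)).
    { pose proof (dirichlet_kernel v N) as HD. fold m in HD.
      assert (E2 : rsum (fun k => 2 * cos (freq k * v)) N
        = (sin (m * (PI * v)) - sin (PI * v)) / sin (PI * v)).
      { rewrite <- HD. field. lra. }
      rewrite E2. field. lra. }
    rewrite E. apply (is_derive_plus (V := RN)).
    - apply (is_derive_minus (V := RN)); [apply is_derive_sawtooth|].
      auto_derive; auto; ring.
    - auto_derive.
      + apply Rgt_not_eq. assert (0 < m * PI) by nra. nra.
      + field. lra. }
  assert (HdG : forall v, Rmin u (1 / 2) <= v <= Rmax u (1 / 2) ->
    Rabs (dG v) <= / m * (/ sin (PI * u)) ^ 2).
  { intros v Hv. pose proof (sin_PI_between u v Hu Hv) as Hs.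
    unfold dG.
    replace (- cos (m * (PI * v)) * cos (PI * v) / (m * sin (PI * v) ^ 2))
      with ((- cos (m * (PI * v)) * cos (PI * v)) * (/ m * (/ sin (PI * v)) ^ 2))
      by (field; lra).
    rewrite Rabs_mult, (Rabs_pos_eq (/ m * _)).
    2:{ apply Rmult_le_pos; [left; now apply Rinv_0_lt_compat | apply pow2_ge_0]. }
    rewrite Rabs_mult, Rabs_Ropp.
    assert (forall x, Rabs (cos x) <= 1).
    { intros x. apply Rabs_le. pose proof (COS_bound x). lra. }
    apply Rle_trans with (1 * (/ m * (/ sin (PI * v)) ^ 2)).
    - apply Rmult_le_compat_r.
      + apply Rmult_le_pos; [left; now apply Rinv_0_lt_compat | apply pow2_ge_0].
      + rewrite <- (Rmult_1_l 1). apply Rmult_le_compat; auto; apply Rabs_pos.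
    - rewrite Rmult_1_l. apply Rmult_le_compat_l; [left; now apply Rinv_0_lt_compat|].
      apply pow_incr. split; [left; apply Rinv_0_lt_compat; lra|].
      apply Rinv_le_contravar; lra. }
  destruct (MVT_gen G u (1 / 2) dG) as [c [Hc Heq]].
  - intros x Hx. apply HG. lra.
  - intros x Hx. apply continuity_pt_filterlim.
    apply continuous_of_ex_derive. eexists. now apply HG.
  - assert (E0 : G (1 / 2) = 0).
    { unfold G. unfold m. rewrite cos_odd_PI2.
      assert (Es : sawtooth N (1 / 2) = 0).
      { unfold sawtooth. rewrite (rsum_ext _ (fun _ => 0 * 0)).
        - rewrite rsum_scal. ring.
        - intros k _. unfold freq at 1.
          replace (2 * PI * INR (S k) * (1 / 2)) with (PI * INR (S k)) by field.
          rewrite sin_INR_PI. unfold Rdiv. ring. }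
      rewrite Es. unfold Rdiv. ring. }
    pose proof (sin_PI_between u u Hu ltac:(split; [apply Rmin_l | apply Rmax_l])) as Hs.
    set (q := / sin (PI * u)).
    assert (Hs1 : sin (PI * u) <= 1) by apply SIN_bound.
    assert (Hq : 1 <= q).
    { unfold q. rewrite <- Rinv_1. apply Rinv_le_contravar; lra. }
    assert (H1 : Rabs (G u) <= / 2 * (/ m * q ^ 2)).
    { replace (G u) with (- (G (1 / 2) - G u)) by (rewrite E0; ring).
      rewrite Rabs_Ropp, Heq, Rabs_mult, Rmult_comm.
      apply Rmult_le_compat; try apply Rabs_pos; auto.
      apply Rabs_le. lra. }
    replace (sawtooth N u - (1 / 2 - u)) with
      (G u - cos (m * (PI * u)) / (m * PI * sin (PI * u))) by (unfold G; ring).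
    eapply Rle_trans; [apply Rabs_triang|]. rewrite Rabs_Ropp.
    assert (H2 : Rabs (cos (m * (PI * u)) / (m * PI * sin (PI * u))) <= / 2 * (/ m * q ^ 2)).
    { replace (cos (m * (PI * u)) / (m * PI * sin (PI * u)))
        with (cos (m * (PI * u)) * (/ m * q * / PI)) by (unfold q; field; lra).
      rewrite Rabs_mult.
      assert (0 < / m) by now apply Rinv_0_lt_compat.
      assert (0 < / PI) by now apply Rinv_0_lt_compat.
      assert (/ PI <= / 2) by (apply Rinv_le_contravar; lra).
      assert (0 < / m * q * / PI) by (apply Rmult_lt_0_compat; nra).
      rewrite (Rabs_pos_eq (/ m * q * / PI)) by lra.
      apply Rle_trans with (1 * (/ m * q * / PI)).
      - apply Rmult_le_compat_r; [lra|]. apply Rabs_le. pose proof (COS_bound (m * (PI * u))). lra.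
      - assert (/ m * q <= / m * q ^ 2) by (apply Rmult_le_compat_l; nra).
        assert (0 < / m * q) by nra. nra. }
    lra.
Qed.

(** Partial Fourier sum of the second Bernoulli polynomial [u ^ 2 - u + 1 / 6]. Unlike the sawtooth
    it converges uniformly, so it can be integrated against other functions. *)
Definition bern (N : nat) (u : R) : R := rsum (fun k => 4 * cos (freq k * u) / (freq k) ^ 2) N.

Lemma is_derive_bern (N : nat) (u : R) : is_derive (bern N) u (- 2 * sawtooth N u).
Proof.
  unfold sawtooth. rewrite <- rsum_scal.
  apply (is_derive_rsum (fun k u => 4 * cos (freq k * u) / (freq k) ^ 2)
    (fun k u => - 2 * (2 * sin (freq k * u) / freq k))).
  intros k. pose proof (freq_pos k). auto_derive; auto. field. lra.
Qed.

(** Tail bound from [1 / n ^ 2 <= 2 / (n (n + 1))], which telescopes. *)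
Definition bern_err (N : nat) : R := 2 / (PI ^ 2 * INR (S N)).

Lemma bern_err_lim : is_lim_seq bern_err 0.
Proof.
  pose proof PI_RGT_0 as HP.
  apply (is_lim_seq_ext (fun n => 2 / PI ^ 2 * / INR (S n))).
  { intros n. unfold bern_err. field. split; [apply not_0_INR; lia | lra]. }
  replace (Finite 0) with (Rbar_mult (2 / PI ^ 2) 0) by (simpl; f_equal; ring).
  apply is_lim_seq_scal_l.
  replace (Finite 0) with (Rbar_inv p_infty) by reflexivity.
  apply is_lim_seq_inv.
  - apply (is_lim_seq_incr_1 INR). apply is_lim_seq_INR.
  - discriminate.
Qed.

Lemma bern_term_bound (u : R) (k : nat) :
  Rabs (4 * cos (freq k * u) / (freq k) ^ 2) <= bern_err k - bern_err (S k).
Proof.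
  pose proof PI_RGT_0 as HP. pose proof (freq_pos k) as Hf. pose proof (INR_S_ge_1 k) as Hk.
  pose proof (S_INR (S k)) as HSk.
  replace (4 * cos (freq k * u) / freq k ^ 2) with (cos (freq k * u) * (4 / freq k ^ 2)) by (field; lra).
  rewrite Rabs_mult.
  assert (0 < 4 / freq k ^ 2) by (apply Rdiv_lt_0_compat; [lra | now apply pow_lt]).
  rewrite (Rabs_pos_eq (4 / freq k ^ 2)) by lra.
  apply Rle_trans with (1 * (4 / freq k ^ 2)).
  - apply Rmult_le_compat_r; [lra|]. apply Rabs_le. pose proof (COS_bound (freq k * u)). lra.
  - unfold bern_err, freq. set (n := INR (S k)) in *. rewrite HSk.
    replace (2 / (PI ^ 2 * n) - 2 / (PI ^ 2 * (n + 1))) with (/ PI ^ 2 * (2 / (n * (n + 1))))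
      by (field; lra).
    replace (1 * (4 / (2 * PI * n) ^ 2)) with (/ PI ^ 2 * / n ^ 2) by (field; lra).
    apply Rmult_le_compat_l; [left; apply Rinv_0_lt_compat, pow_lt; lra|].
    apply Rmult_le_reg_r with (n ^ 2 * (n + 1)); [apply Rmult_lt_0_compat; [apply pow_lt; lra | lra]|].
    replace (/ n ^ 2 * (n ^ 2 * (n + 1))) with (n + 1) by (field; lra).
    replace (2 / (n * (n + 1)) * (n ^ 2 * (n + 1))) with (2 * n) by (field; lra). lra.
Qed.

Lemma bern_limit (u : R) : exists l : R, is_lim_seq (fun N => bern N u) l /\
  forall N, Rabs (l - bern N u) <= bern_err N.
Proof.
  apply (rsum_telescope_conv (fun k => 4 * cos (freq k * u) / (freq k) ^ 2) bern_err).
  - intros k. apply bern_term_bound.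
  - apply bern_err_lim.
Qed.

Lemma is_lim_seq_le_0 (u b : nat -> R) (l : R) :
  (forall n, Rabs (u n - l) <= b n) -> is_lim_seq b 0 -> is_lim_seq u l.
Proof.
  intros H Hb. apply is_lim_seq_spec. intros eps. apply is_lim_seq_spec in Hb.
  destruct (Hb eps) as [N HN]. exists N. intros n Hn. eapply Rle_lt_trans; [apply H|].
  specialize (HN n Hn). rewrite Rminus_0_r in HN. eapply Rle_lt_trans; [apply Rle_abs | exact HN].
Qed.

Lemma is_lim_seq_inv_odd : is_lim_seq (fun N => / (2 * INR N + 1)) 0.
Proof.
  replace (Finite 0) with (Rbar_inv p_infty) by reflexivity.
  apply is_lim_seq_inv; [|discriminate].
  apply (is_lim_seq_le_p_loc INR).
  - exists O. intros n _. pose proof (pos_INR n). lra.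
  - apply is_lim_seq_INR.
Qed.

(** Integrating the sawtooth between [u] and [1 / 2] gives only differences of the limit; its
    constant is fixed below by duplication and continuity at 0. *)
Lemma bern_open (u b bh : R) : 0 < u < 1 ->
  is_lim_seq (fun N => bern N u) b -> is_lim_seq (fun N => bern N (1 / 2)) bh ->
  b - bh = u ^ 2 - u + 1 / 4.
Proof.
  intros Hu Hb Hh.
  assert (Hl : is_lim_seq (fun N => bern N u - bern N (1 / 2)) (u ^ 2 - u + 1 / 4)).
  { set (K := 2 * (/ sin (PI * u)) ^ 2).
    apply (is_lim_seq_le_0 _ (fun N => K * / (2 * INR N + 1))).
    2:{ replace (Finite 0) with (Rbar_mult K 0) by (simpl; f_equal; ring).
        apply is_lim_seq_scal_l, is_lim_seq_inv_odd. }
    intros N.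
    set (G := fun u => bern N u - (u ^ 2 - u)).
    destruct (MVT_gen G u (1 / 2) (fun v => - 2 * (sawtooth N v - (1 / 2 - v))))
      as [c [Hc Heq]].
    - intros v _. unfold G.
      replace (- 2 * (sawtooth N v - (1 / 2 - v))) with (- 2 * sawtooth N v - (2 * v - 1)) by field.
      apply (is_derive_minus (V := RN)); [apply is_derive_bern|].
      auto_derive; auto; ring.
    - intros v _. apply continuity_pt_filterlim.
      apply continuous_of_ex_derive. eexists. unfold G.
      apply (is_derive_minus (V := RN)); [apply is_derive_bern|].
      auto_derive; auto; ring.
    - replace (bern N u - bern N (1 / 2) - (u ^ 2 - u + 1 / 4)) with (- (G (1 / 2) - G u))
        by (unfold G; field).
      rewrite Rabs_Ropp, Heq, !Rabs_mult.
      pose proof (sin_PI_between u c Hu Hc) as Hs.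
      assert (Hc01 : 0 < c < 1).
      { unfold Rmin, Rmax in Hc. destruct (Rle_dec u (1 / 2)); lra. }
      pose proof (sawtooth_bound N c Hc01) as HS.
      assert (Hm : 0 < / (2 * INR N + 1)).
      { apply Rinv_0_lt_compat. pose proof (pos_INR N). lra. }
      assert (Hq : (/ sin (PI * c)) ^ 2 <= (/ sin (PI * u)) ^ 2).
      { apply pow_incr. split; [left; apply Rinv_0_lt_compat; lra|]. apply Rinv_le_contravar; lra. }
      assert (Rabs (-2) = 2) by (rewrite Rabs_left; lra).
      assert (Rabs (1 / 2 - u) <= 1) by (apply Rabs_le; lra).
      rewrite H. unfold K.
      assert (Rabs (sawtooth N c - (1 / 2 - c)) <= / (2 * INR N + 1) * (/ sin (PI * u)) ^ 2).
      { eapply Rle_trans; [exact HS|]. apply Rmult_le_compat_l; lra. }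
      pose proof (Rabs_pos (sawtooth N c - (1 / 2 - c))). pose proof (Rabs_pos (1 / 2 - u)).
      nra. }
  pose proof (is_lim_seq_minus' _ _ _ _ Hb Hh) as H2.
  symmetry. apply (is_lim_seq_uniq _ _ _ Hl H2).
Qed.

(** Between 0 and [1 / 2] the odd multiples of the base frequency cancel and the even ones double.
    In the limit this is [b0 + bh = b0 / 2], a relation that helps to fix the constant before the
    sum of inverse squares is known. *)
Lemma bern_double (N : nat) : bern (2 * N) 0 + bern (2 * N) (1 / 2) = 1 / 2 * bern N 0.
Proof.
  pose proof PI_RGT_0 as HP.
  induction N as [|N IH]; [simpl; unfold bern; simpl; ring|].
  replace (2 * S N)%nat with (S (S (2 * N))) by lia.
  assert (E : forall M u, bern (S M) u = bern M u + 4 * cos (freq M * u) / (freq M) ^ 2)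
    by reflexivity.
  rewrite !E. rewrite !Rmult_0_r, cos_0.
  assert (E1 : forall k, freq k * (1 / 2) = PI * INR (S k)) by (intros; unfold freq; field).
  rewrite !E1.
  assert (Hc : forall k, cos (PI * INR k) = (-1) ^ k).
  { induction k as [|k IHk]; [simpl; rewrite Rmult_0_r; apply cos_0|].
    rewrite S_INR, Rmult_plus_distr_l, Rmult_1_r, cos_plus, IHk, cos_PI, sin_PI. simpl. ring. }
  rewrite !Hc.
  replace ((-1) ^ S (2 * N)) with (-1) by (rewrite <- tech_pow_Rmult, pow_1_even; ring).
  replace ((-1) ^ S (S (2 * N))) with 1 by (rewrite <- !tech_pow_Rmult, pow_1_even; ring).
  assert (E2 : freq (S (2 * N)) = 2 * freq N).
  { unfold freq. rewrite !S_INR, mult_INR. simpl. ring. }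
  rewrite E2. pose proof (freq_pos N). pose proof (freq_pos (2 * N)).
  rewrite Rmult_plus_distr_l, <- IH. field. lra.
Qed.

Lemma bern_half_zero (b0 bh : R) :
  is_lim_seq (fun N => bern N 0) b0 -> is_lim_seq (fun N => bern N (1 / 2)) bh ->
  bh = - (1 / 2) * b0.
Proof.
  intros H0 Hh.
  assert (Hs : forall u l, is_lim_seq u l -> is_lim_seq (fun N => u (2 * N)%nat) l).
  { intros u l Hu. apply (is_lim_seq_subseq u l (fun N => (2 * N)%nat)); auto.
    apply eventually_subseq. intros n. lia. }
  pose proof (is_lim_seq_plus' _ _ _ _ (Hs _ _ H0) (Hs _ _ Hh)) as H1.
  pose proof (is_lim_seq_scal_l _ (1 / 2) _ H0) as H2.
  apply (is_lim_seq_ext _ _ _ (fun N => eq_sym (bern_double N))) in H2.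
  simpl in H2. pose proof (is_lim_seq_uniq _ _ _ H1 H2). lra.
Qed.

Lemma is_lim_seq_inv_INR_SS : is_lim_seq (fun n => / INR (S (S n))) 0.
Proof.
  replace (Finite 0) with (Rbar_inv p_infty) by reflexivity.
  apply is_lim_seq_inv; [|discriminate].
  apply (is_lim_seq_incr_1 (fun n => INR (S n))), (is_lim_seq_incr_1 INR).
  apply is_lim_seq_INR.
Qed.

Lemma inv_INR_SS_range (n : nat) : 0 < / INR (S (S n)) < 1.
Proof.
  assert (1 < INR (S (S n))) by (apply lt_1_INR; lia).
  split; [apply Rinv_0_lt_compat; lra|].
  rewrite <- Rinv_1. apply Rinv_lt_contravar; lra.
Qed.

(** The estimate of [bern_open] blows up at 0. Uniform convergence carries the limit there: at fixed
    [N], [bern N] is continuous, and [bern_err N] controls the tails at both points. With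
    [bern_half_zero] this gives [b0 = 1 / 6]. *)
Lemma bern_continuous_0 (b0 bh : R) :
  is_lim_seq (fun N => bern N 0) b0 -> is_lim_seq (fun N => bern N (1 / 2)) bh ->
  b0 - bh = 1 / 4.
Proof.
  intros H0 Hh.
  assert (HN : forall N, Rabs (b0 - bh - 1 / 4) <= 2 * bern_err N).
  { intros N.
    assert (Hu : forall u, 0 < u < 1 ->
      Rabs (b0 - bh - (u ^ 2 - u + 1 / 4)) <= 2 * bern_err N + Rabs (bern N u - bern N 0)).
    { intros u Hu. destruct (bern_limit u) as [b [Hb HbN]].
      destruct (bern_limit 0) as [b0' [Hb0 Hb0N]].
      assert (b0' = b0).
      { apply (is_lim_seq_uniq _ _ _ Hb0 H0). }
      subst b0'. rewrite <- (bern_open u b bh Hu Hb Hh).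
      replace (b0 - bh - (b - bh)) with ((b0 - bern N 0) - (b - bern N u) - (bern N u - bern N 0)) by ring.
      eapply Rle_trans; [apply Rabs_triang|]. rewrite Rabs_Ropp.
      apply Rplus_le_compat_r. eapply Rle_trans; [apply Rabs_triang|]. rewrite Rabs_Ropp.
      specialize (HbN N). specialize (Hb0N N). lra. }
    assert (Hc : is_lim_seq (fun n => 2 * bern_err N + Rabs (bern N (/ INR (S (S n))) - bern N 0))
      (2 * bern_err N + Rabs (bern N 0 - bern N 0))).
    { apply is_lim_seq_plus'; [apply is_lim_seq_const|].
      apply (is_lim_seq_abs _ (bern N 0 - bern N 0)).
      apply is_lim_seq_minus'; [|apply is_lim_seq_const].
      apply (is_lim_seq_continuous (bern N)).
      - apply continuity_pt_filterlim. apply continuous_of_ex_derive.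
        eexists. apply is_derive_bern.
      - apply is_lim_seq_inv_INR_SS. }
    assert (Hl : is_lim_seq (fun n => Rabs (b0 - bh - ((/ INR (S (S n))) ^ 2 - / INR (S (S n)) + 1 / 4)))
      (Rabs (b0 - bh - (0 * 0 - 0 + 1 / 4)))).
    { apply (is_lim_seq_abs _ (b0 - bh - (0 * 0 - 0 + 1 / 4))).
      apply is_lim_seq_minus'; [apply is_lim_seq_const|].
      pose proof is_lim_seq_inv_INR_SS as Hi.
      apply is_lim_seq_plus'; [|apply is_lim_seq_const].
      apply is_lim_seq_minus'; [|exact Hi].
      apply (is_lim_seq_ext (fun n => / INR (S (S n)) * / INR (S (S n)))); [intros; ring|].
      now apply is_lim_seq_mult'. }
    pose proof (is_lim_seq_le _ _ _ _ (fun n => Hu _ (inv_INR_SS_range n)) Hl Hc) as Hle.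
    simpl in Hle. replace (0 * 0 - 0 + 1 / 4) with (1 / 4) in Hle by ring.
    rewrite Rminus_diag, Rabs_R0 in Hle. lra. }
  assert (Hz : Rabs (b0 - bh - 1 / 4) <= 0).
  { apply (is_lim_seq_le (fun _ => Rabs (b0 - bh - 1 / 4)) (fun N => 2 * bern_err N)
      (Rabs (b0 - bh - 1 / 4)) 0 HN); [apply is_lim_seq_const|].
    replace (Finite 0) with (Rbar_mult 2 0) by (simpl; f_equal; ring).
    apply is_lim_seq_scal_l, bern_err_lim. }
  pose proof (Rabs_pos (b0 - bh - 1 / 4)).
  destruct (Req_dec (b0 - bh - 1 / 4) 0) as [E|E]; [lra|].
  apply Rabs_pos_lt in E. lra.
Qed.

Lemma bern_bound (N : nat) (u : R) : 0 <= u <= 1 ->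
  Rabs (u ^ 2 - u + 1 / 6 - bern N u) <= bern_err N.
Proof.
  intros Hu.
  destruct (bern_limit 0) as [b0 [Hb0 Hb0N]].
  destruct (bern_limit (1 / 2)) as [bh [Hbh HbhN]].
  pose proof (bern_continuous_0 b0 bh Hb0 Hbh) as E1.
  pose proof (bern_half_zero b0 bh Hb0 Hbh) as E2.
  assert (E3 : b0 = 1 / 6) by lra.
  assert (H1 : forall N, bern N 1 = bern N 0).
  { intros M. unfold bern. apply rsum_ext. intros k _. f_equal. f_equal.
    unfold freq. rewrite Rmult_1_r, Rmult_0_r, cos_0.
    rewrite <- cos_0, <- (cos_period 0 (S k)). f_equal. ring. }
  destruct (Req_dec u 0) as [->|Hu0].
  { replace (0 ^ 2 - 0 + 1 / 6) with b0 by (rewrite E3; ring). apply Hb0N. }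
  destruct (Req_dec u 1) as [->|Hu1].
  { rewrite H1. replace (1 ^ 2 - 1 + 1 / 6) with b0 by (rewrite E3; ring). apply Hb0N. }
  destruct (bern_limit u) as [b [Hb HbN]].
  pose proof (bern_open u b bh ltac:(lra) Hb Hbh) as E4.
  replace (u ^ 2 - u + 1 / 6) with b by lra. apply HbN.
Qed.

Lemma bern_lim (u : R) : 0 <= u <= 1 -> is_lim_seq (fun N => bern N u) (u ^ 2 - u + 1 / 6).
Proof.
  intros Hu. apply (is_lim_seq_le_0 _ bern_err).
  - intros N. rewrite Rabs_minus_sym. now apply bern_bound.
  - apply bern_err_lim.
Qed.

Lemma basel : is_lim_seq (rsum (fun k => / INR (S k) ^ 2)) (PI ^ 2 / 6).
Proof.
  pose proof PI_RGT_0.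
  apply (is_lim_seq_ext (fun N => PI ^ 2 * bern N 0)).
  - intros N. unfold bern. rewrite <- rsum_scal. apply rsum_ext. intros k _.
    rewrite Rmult_0_r, cos_0. unfold freq. field. split; [apply not_0_INR; lia | lra].
  - replace (PI ^ 2 / 6) with (PI ^ 2 * (0 ^ 2 - 0 + 1 / 6)) by field.
    apply (is_lim_seq_scal_l (fun N => bern N 0) (PI ^ 2) (0 ^ 2 - 0 + 1 / 6)).
    apply bern_lim. lra.
Qed.

(** The Bernoulli series is integrated against [cosh (a (u - 1 / 2))], once termwise and once in
    closed form. The terms come out with [1 / (f ^ 2 (a ^ 2 + f ^ 2))]; subtracting them from the
    series at [u = 0] leaves [1 / (a ^ 2 + f ^ 2)] by partial fractions. *)
Lemma coth_partial_fractions (a : R) : 0 < a ->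
  is_lim_seq (rsum (fun k => 2 * a / (a ^ 2 + freq k ^ 2)))
    (1 / (exp a - 1) - 1 / a + 1 / 2).
Proof.
  intros Ha. pose proof PI_RGT_0 as HP.
  set (s := sinh (a / 2)). set (c := cosh (a / 2)).
  assert (Hs : 0 < s) by (unfold s; apply sinh_pos || (rewrite <- sinh_0; apply sinh_lt; lra)).
  assert (Hterm : forall k, is_RInt (fun u => 4 * cos (freq k * u) / freq k ^ 2 * cosh (a * (u - 1 / 2)))
    0 1 (4 / freq k ^ 2 * (2 * a * s / (a ^ 2 + freq k ^ 2)))).
  { intros k. pose proof (freq_pos k) as Hf.
    set (A := fun u => 4 / freq k ^ 2 * ((a * cos (freq k * u) * sinh (a * (u - 1 / 2))
      + freq k * sin (freq k * u) * cosh (a * (u - 1 / 2))) / (a ^ 2 + freq k ^ 2))).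
    replace (4 / freq k ^ 2 * (2 * a * s / (a ^ 2 + freq k ^ 2))) with (A 1 - A 0).
    - apply (is_RInt_derive (V := RC) A).
      + intros u _. unfold A, sinh, cosh. auto_derive; [nra|]. unfold Rminus. field.
        split; nra.
      + intros u _. apply continuous_of_ex_derive.
        unfold cosh. auto_derive. nra.
    - unfold A. rewrite Rmult_1_r, Rmult_0_r, sin_0, cos_0.
      assert (E1 : cos (freq k) = 1).
      { unfold freq. rewrite <- cos_0, <- (cos_period 0 (S k)). f_equal. ring. }
      assert (E2 : sin (freq k) = 0).
      { unfold freq. rewrite <- sin_0, <- (sin_period 0 (S k)). f_equal. ring. }
      rewrite E1, E2. replace (a * (1 - 1 / 2)) with (a / 2) by field.
      replace (a * (0 - 1 / 2)) with (- (a / 2)) by field.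
      assert (E3 : sinh (- (a / 2)) = - s) by (unfold s, sinh; rewrite Ropp_involutive; field).
      rewrite E3. fold s. field. split; nra. }
  assert (HbN : forall N, is_RInt (fun u => bern N u * cosh (a * (u - 1 / 2))) 0 1
    (rsum (fun k => 4 / freq k ^ 2 * (2 * a * s / (a ^ 2 + freq k ^ 2))) N)).
  { induction N as [|N IH].
    - apply (is_RInt_ext (fun _ => 0)); [intros; unfold bern; simpl; ring|].
      replace (rsum (fun k => 4 / freq k ^ 2 * (2 * a * s / (a ^ 2 + freq k ^ 2))) 0)
        with (scal (1 - 0) (0 : R)) by (unfold scal; simpl; unfold mult; simpl; ring).
      apply (is_RInt_const (V := RN)).
    - apply (is_RInt_ext (fun u => plus (bern N u * cosh (a * (u - 1 / 2)))
        (4 * cos (freq N * u) / freq N ^ 2 * cosh (a * (u - 1 / 2))))).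
      + intros u _. unfold plus; simpl. unfold bern; simpl. ring.
      + apply (is_RInt_plus (V := RN)); auto. }
  assert (HB : is_RInt (fun u => (u ^ 2 - u + 1 / 6) * cosh (a * (u - 1 / 2))) 0 1
    (s / (3 * a) - 2 * c / a ^ 2 + 4 * s / a ^ 3)).
  { set (A := fun u => (u ^ 2 - u + 1 / 6) * sinh (a * (u - 1 / 2)) / a
      - (2 * u - 1) * cosh (a * (u - 1 / 2)) / a ^ 2 + 2 * sinh (a * (u - 1 / 2)) / a ^ 3).
    replace (s / (3 * a) - 2 * c / a ^ 2 + 4 * s / a ^ 3) with (A 1 - A 0).
    - apply (is_RInt_derive (V := RC) A).
      + intros u _. unfold A, sinh, cosh. auto_derive; [lra|]. unfold Rminus. field. lra.
      + intros u _. apply continuous_of_ex_derive.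
        unfold cosh. auto_derive. auto.
    - unfold A. replace (a * (1 - 1 / 2)) with (a / 2) by field.
      replace (a * (0 - 1 / 2)) with (- (a / 2)) by field.
      assert (E3 : sinh (- (a / 2)) = - s) by (unfold s, sinh; rewrite Ropp_involutive; field).
      assert (E4 : cosh (- (a / 2)) = c) by (unfold c, cosh; rewrite Ropp_involutive; field).
      rewrite E3, E4. fold s c. field. lra. }
  assert (Hdiff : forall N, Rabs ((s / (3 * a) - 2 * c / a ^ 2 + 4 * s / a ^ 3)
    - rsum (fun k => 4 / freq k ^ 2 * (2 * a * s / (a ^ 2 + freq k ^ 2))) N) <= c * bern_err N).
  { intros N.
    pose proof (is_RInt_minus (V := RN) _ _ _ _ _ _ HB (HbN N)) as H.
    replace (c * bern_err N) with ((1 - 0) * (c * bern_err N)) by ring.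
    apply (norm_RInt_le_const (V := RN) _ 0 1 _ (c * bern_err N) Rle_0_1) in H; auto.
    intros u Hu.
    change (Rabs ((u ^ 2 - u + 1 / 6) * cosh (a * (u - 1 / 2)) - bern N u * cosh (a * (u - 1 / 2)))
      <= c * bern_err N).
    rewrite <- Rmult_minus_distr_r, Rabs_mult, Rmult_comm.
    assert (Hch : forall x, 0 < cosh x).
    { intros x. unfold cosh. pose proof (exp_pos x). pose proof (exp_pos (- x)). lra. }
    apply Rmult_le_compat; try apply Rabs_pos.
    - rewrite Rabs_pos_eq by (left; apply Hch).
      unfold c, cosh.
      (* [cosh] grows with the absolute value, so on the unit interval the weight is at most its
         value [cosh (a / 2)] at the ends. *)
      assert (Hconv : forall x y, - y <= x <= y -> exp x + exp (- x) <= exp y + exp (- y)).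
      { intros x y Hxy.
        assert (H1 : 0 <= (exp y - exp x) * (1 - exp (- y) * exp (- x))).
        { apply Rmult_le_pos.
          - assert (exp x <= exp y) by (apply exp_le; lra). lra.
          - rewrite <- exp_plus. assert (exp (- y + - x) <= exp 0) by (apply exp_le; lra).
            rewrite exp_0 in H0. lra. }
        assert (H2 : exp y * exp (- y) = 1) by (rewrite <- exp_plus, Rplus_opp_r; apply exp_0).
        assert (H3 : exp x * exp (- x) = 1) by (rewrite <- exp_plus, Rplus_opp_r; apply exp_0).
        assert (E : (exp y - exp x) * (1 - exp (- y) * exp (- x))
          = exp y - exp x - exp y * exp (- y) * exp (- x) + exp x * exp (- x) * exp (- y)) by ring.
        rewrite E, H2, H3 in H1. lra. }
      specialize (Hconv (a * (u - 1 / 2)) (a / 2)). nra.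
    - now apply bern_bound. }
  assert (Hsum : is_lim_seq (rsum (fun k => 4 / freq k ^ 2 * (2 * a * s / (a ^ 2 + freq k ^ 2))))
    (s / (3 * a) - 2 * c / a ^ 2 + 4 * s / a ^ 3)).
  { apply (is_lim_seq_le_0 _ (fun N => c * bern_err N)).
    - intros N. rewrite Rabs_minus_sym. apply Hdiff.
    - replace (Finite 0) with (Rbar_mult c 0) by (simpl; f_equal; ring).
      apply is_lim_seq_scal_l, bern_err_lim. }
  pose proof (bern_lim 0 ltac:(lra)) as H0.
  apply (is_lim_seq_ext (fun N => 2 * a * (1 / 4) * bern N 0
    - a ^ 2 / (4 * s) * rsum (fun k => 4 / freq k ^ 2 * (2 * a * s / (a ^ 2 + freq k ^ 2))) N)).
  { intros N. unfold bern. rewrite <- !rsum_scal, <- rsum_minus. apply rsum_ext. intros k _.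
    pose proof (freq_pos k). rewrite Rmult_0_r, cos_0. field. repeat split; nra. }
  replace (1 / (exp a - 1) - 1 / a + 1 / 2) with
    (2 * a * (1 / 4) * (0 ^ 2 - 0 + 1 / 6)
     - a ^ 2 / (4 * s) * (s / (3 * a) - 2 * c / a ^ 2 + 4 * s / a ^ 3)).
  - apply is_lim_seq_minus'.
    + apply (is_lim_seq_scal_l _ (2 * a * (1 / 4)) (0 ^ 2 - 0 + 1 / 6) H0).
    + apply (is_lim_seq_scal_l _ (a ^ 2 / (4 * s)) _ Hsum).
  - assert (E : 1 / (exp a - 1) + 1 / 2 = c / (2 * s)).
    { unfold c, s, cosh, sinh.
      assert (E1 : exp a = exp (a / 2) * exp (a / 2)) by (rewrite <- exp_plus; f_equal; field).
      assert (E2 : exp (- (a / 2)) = / exp (a / 2)) by apply exp_Ropp.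
      rewrite E1, E2. pose proof (exp_pos (a / 2)).
      assert (1 < exp (a / 2)) by (rewrite <- exp_0; apply exp_increasing; lra).
      field. repeat split; nra. }
    replace (1 / (exp a - 1) - 1 / a + 1 / 2) with (1 / (exp a - 1) + 1 / 2 - 1 / a) by ring.
    rewrite E. field. split; lra.
Qed.

(** One more integration of the Bernoulli series, evaluated at [u = 1 / 4]: there the even multiples
    of the base frequency drop out and the odd ones alternate in sign. The primitive
    [u ^ 3 / 3 - u ^ 2 / 2 + u / 6] takes the value [1 / 64]. *)
Lemma alternating_cubes :
  is_lim_seq (rsum (fun j => (-1) ^ j / (2 * INR j + 1) ^ 3)) (PI ^ 3 / 32).
Proof.
  pose proof PI_RGT_0 as HP.
  set (s3 := fun N u => rsum (fun k => 4 * sin (freq k * u) / freq k ^ 3) N).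
  assert (Hd : forall N u, is_derive (s3 N) u (bern N u)).
  { intros N u.
    apply (is_derive_rsum (fun k u => 4 * sin (freq k * u) / (freq k) ^ 3)
      (fun k u => 4 * cos (freq k * u) / freq k ^ 2)).
    intros k. pose proof (freq_pos k). auto_derive; auto. field. lra. }
  assert (Hl : is_lim_seq (fun N => s3 N (1 / 4)) (1 / 64)).
  { apply (is_lim_seq_le_0 _ bern_err); [|apply bern_err_lim]. intros N.
    set (G := fun u => s3 N u - (u ^ 3 / 3 - u ^ 2 / 2 + u / 6)).
    assert (HG : forall v, is_derive G v (bern N v - (v ^ 2 - v + 1 / 6))).
    { intros v. apply (is_derive_minus (V := RN)); [apply Hd|].
      auto_derive; auto. field. }
    destruct (MVT_gen G 0 (1 / 4) (fun v => bern N v - (v ^ 2 - v + 1 / 6))) as [c [Hc Heq]].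
    - intros v _. apply HG.
    - intros v _. apply continuity_pt_filterlim.
      apply continuous_of_ex_derive. eexists. apply HG.
    - rewrite Rmin_left, Rmax_right in Hc by lra.
      assert (E0 : G 0 = 0).
      { unfold G, s3. rewrite (rsum_ext _ (fun _ => 0 * 0)).
        - rewrite rsum_scal. field.
        - intros k _. rewrite Rmult_0_r, sin_0. unfold Rdiv. ring. }
      replace (s3 N (1 / 4) - 1 / 64) with (G (1 / 4) - G 0) by (rewrite E0; unfold G; field).
      rewrite Heq, Rabs_mult, (Rabs_pos_eq (1 / 4 - 0)) by lra.
      pose proof (bern_bound N c ltac:(lra)) as HB. rewrite Rabs_minus_sym in HB.
      pose proof (Rabs_pos (bern N c - (c ^ 2 - c + 1 / 6))). lra. }
  assert (Hs : is_lim_seq (fun N => 2 * PI ^ 3 * s3 (2 * N)%nat (1 / 4)) (2 * PI ^ 3 * (1 / 64))).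
  { apply (is_lim_seq_scal_l _ (2 * PI ^ 3) (1 / 64)).
    apply (is_lim_seq_subseq (fun N => s3 N (1 / 4)) (1 / 64) (fun N => (2 * N)%nat)); auto.
    apply eventually_subseq. intros n. lia. }
  replace (PI ^ 3 / 32) with (2 * PI ^ 3 * (1 / 64)) by field.
  eapply is_lim_seq_ext; [|exact Hs].
  induction n as [|n IH]; [unfold s3; simpl; ring|].
  replace (2 * S n)%nat with (S (S (2 * n))) by lia.
  assert (E : forall M, s3 (S M) (1 / 4) = s3 M (1 / 4) + 4 * sin (freq M * (1 / 4)) / (freq M) ^ 3)
    by reflexivity.
  rewrite !E.
  change (rsum (fun j => (-1) ^ j / (2 * INR j + 1) ^ 3) (S n)) with
    (rsum (fun j => (-1) ^ j / (2 * INR j + 1) ^ 3) n + (-1) ^ n / (2 * INR n + 1) ^ 3).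
  rewrite <- IH.
  assert (E1 : sin (freq (S (2 * n)) * (1 / 4)) = 0).
  { rewrite <- (sin_INR_PI (S n)). f_equal. unfold freq. rewrite !S_INR, mult_INR. simpl. field. }
  assert (E2 : sin (freq (2 * n) * (1 / 4)) = (-1) ^ n).
  { replace (freq (2 * n) * (1 / 4)) with (PI * INR n + PI / 2)
      by (unfold freq; rewrite !S_INR, mult_INR; simpl; field).
    rewrite sin_plus, cos_PI2, sin_PI2.
    assert (Hc : forall k, cos (PI * INR k) = (-1) ^ k).
    { induction k as [|k IHk]; [simpl; rewrite Rmult_0_r; apply cos_0|].
      rewrite S_INR, Rmult_plus_distr_l, Rmult_1_r, cos_plus, IHk, cos_PI, sin_PI. simpl. ring. }
    rewrite Hc. ring. }
  rewrite E1, E2. unfold freq. rewrite S_INR, mult_INR. simpl INR.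
  pose proof (pos_INR n). pose proof (freq_pos (S (2 * n))). unfold freq in H0. field.
  repeat split; try lra; apply Rgt_not_eq; simpl in *; nra.
Qed.

(** * Integrals over the half-line *)

Definition is_RInt_H (f : R -> R) (l : R) :=
  is_RInt_gen f (at_point 0) (Rbar_locally p_infty) l.

Lemma prod_0_p_infty (Q : R * R -> Prop) :
  (exists A, forall b, A < b -> Q (0, b)) ->
  filter_prod (at_point 0) (Rbar_locally p_infty) Q.
Proof.
  intros [A HA].
  apply (Filter_prod _ _ _ (fun a => a = 0) (fun b => A < b)).
  - reflexivity.
  - now exists A.
  - intros a b -> Hb. now apply HA.
Qed.

Lemma is_RInt_H_lift (f : R -> R) (l : R) :
  (forall eps : posreal, exists A, forall b, A < b ->
     exists y, is_RInt f 0 b y /\ Rabs (y - l) < eps) -> is_RInt_H f l.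
Proof.
  intros H P [eps HP]. unfold filtermapi.
  apply prod_0_p_infty. destruct (H eps) as [A HA]. exists A.
  intros b Hb. destruct (HA b Hb) as [y [H1 H2]]. exists y. split; auto.
Qed.

Lemma is_RInt_H_elim (f : R -> R) (l : R) :
  is_RInt_H f l -> forall eps : posreal, exists A, forall b, A < b ->
     exists y, is_RInt f 0 b y /\ Rabs (y - l) < eps.
Proof.
  intros H eps. specialize (H (ball l eps) (locally_ball l eps)).
  destruct H as [Q S HQ [M2 HM2] HQS].
  exists M2. intros b Hb. apply (HQS 0 b); auto.
Qed.

Lemma is_RInt_H_norm_le (f g : R -> R) (lf lg : R) :
  is_RInt_H f lf -> is_RInt_H g lg -> (forall t, 0 <= t -> Rabs (f t) <= g t) ->
  Rabs lf <= lg.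
Proof.
  intros Hf Hg H.
  apply (RInt_gen_norm (V := RC) (Fa := at_point 0)
    (Fb := Rbar_locally p_infty) f g); auto.
  - apply prod_0_p_infty. exists 0. intros b Hb; simpl; lra.
  - apply prod_0_p_infty. exists 0. intros b Hb t Ht; simpl in *. apply H. lra.
Qed.

Lemma is_RInt_H_ext (f g : R -> R) (l : R) :
  (forall t, 0 < t -> f t = g t) -> is_RInt_H f l -> is_RInt_H g l.
Proof.
  intros H Hf. unfold is_RInt_H in *.
  refine (is_RInt_gen_ext (V := RN) f g l _ Hf).
  apply prod_0_p_infty. exists 0. intros b Hb t Ht. simpl in Ht.
  rewrite Rmin_left in Ht by lra. apply H. lra.
Qed.

Lemma is_RInt_H_plus (f g : R -> R) (lf lg : R) :
  is_RInt_H f lf -> is_RInt_H g lg -> is_RInt_H (fun t => f t + g t) (lf + lg).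
Proof. intros H1 H2. exact (is_RInt_gen_plus (V := RN) f g lf lg H1 H2). Qed.

Lemma is_RInt_H_minus (f g : R -> R) (lf lg : R) :
  is_RInt_H f lf -> is_RInt_H g lg -> is_RInt_H (fun t => f t - g t) (lf - lg).
Proof. intros H1 H2. exact (is_RInt_gen_minus (V := RN) f g lf lg H1 H2). Qed.

Lemma is_RInt_H_scal (f : R -> R) (k l : R) :
  is_RInt_H f l -> is_RInt_H (fun t => k * f t) (k * l).
Proof. intros H1. exact (is_RInt_gen_scal (V := RN) f k l H1). Qed.

Lemma is_RInt_H_rsum (f : nat -> R -> R) (l : nat -> R) (N : nat) :
  (forall k, is_RInt_H (f k) (l k)) ->
  is_RInt_H (fun t => rsum (fun k => f k t) N) (rsum l N).
Proof.
  intros H. induction N as [|N IH]; simpl.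
  - pose proof (is_RInt_H_scal (f O) 0 _ (H O)) as H0. rewrite Rmult_0_l in H0.
    revert H0. apply is_RInt_H_ext. intros; ring.
  - now apply is_RInt_H_plus.
Qed.

Lemma is_RInt_H_ex (f : R -> R) (C : R) :
  (forall t, continuous f t) -> (forall t, 0 <= t -> Rabs (f t) <= C / (1 + t ^ 2)) ->
  exists l, is_RInt_H f l.
Proof.
  intros Hc Hd.
  destruct (dominated_RInt_gen (V := RC) (at_point 0)
    (Rbar_locally p_infty) (fun t => 0 <= t) f C (atan 0) (PI / 2)) as [l [Hl _]]; auto.
  - intros x y z Hx Hy Hz. unfold Rmin in Hz. destruct (Rle_dec x y); lra.
  - unfold at_point. lra.
  - exists 0. intros; lra.
  - apply atan_at_point.
  - apply atan_p_infty.
  - now exists l.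
Qed.

Lemma is_RInt_H_derive (F f : R -> R) (l : R) :
  (forall t, 0 <= t -> is_derive F t (f t)) -> (forall t, 0 <= t -> continuous f t) ->
  filterlim F (Rbar_locally p_infty) (locally l) -> is_RInt_H f (l - F 0).
Proof.
  intros HF Hc Hl. apply is_RInt_H_lift. intros eps.
  destruct (Hl (ball l eps) (locally_ball l eps)) as [M HM].
  exists (Rmax 0 M). intros b Hb. pose proof (Rmax_l 0 M). pose proof (Rmax_r 0 M).
  exists (F b - F 0). split.
  - apply (is_RInt_derive (V := RC) F f);
      intros t Ht; rewrite Rmin_left in Ht by lra; [apply HF | apply Hc]; lra.
  - replace (F b - F 0 - (l - F 0)) with (F b - l) by ring. apply HM. lra.
Qed.

Lemma is_RInt_R_halves (f : R -> R) (a b : R) :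
  is_RInt_H (fun t => f (- t)) a -> is_RInt_H f b -> is_RInt_R f (a + b).
Proof.
  intros Ha Hb. apply (is_RInt_R_lift (V := RN)). intros eps.
  assert (He : 0 < eps / 2) by (pose proof (cond_pos eps); lra).
  destruct (is_RInt_H_elim _ _ Ha (mkposreal _ He)) as [A1 H1].
  destruct (is_RInt_H_elim _ _ Hb (mkposreal _ He)) as [A2 H2].
  exists (Rmax A1 A2). intros u v Hu Hv.
  pose proof (Rmax_l A1 A2). pose proof (Rmax_r A1 A2).
  destruct (H1 (- u) ltac:(lra)) as [y1 [Hy1 Hb1]]. destruct (H2 v ltac:(lra)) as [y2 [Hy2 Hb2]].
  simpl in Hb1, Hb2. exists (y1 + y2). split.
  - apply (is_RInt_Chasles (V := RN) f u 0 v); [|exact Hy2].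
    assert (H3 : is_RInt (fun t => opp (f (- - t))) 0 u y1).
    { apply (is_RInt_comp_opp (V := RN) (fun t => f (- t))). rewrite Ropp_0. exact Hy1. }
    apply (is_RInt_opp (V := RN)), (is_RInt_swap (V := RN)) in H3.
    rewrite opp_opp in H3.
    eapply (is_RInt_ext (V := RN)); [|exact H3].
    intros t _. cbv beta. rewrite opp_opp, Ropp_involutive. reflexivity.
  - change (Rabs (y1 + y2 - (a + b)) < eps). apply Rabs_def2 in Hb1. apply Rabs_def2 in Hb2.
    apply Rabs_def1; lra.
Qed.

Lemma is_RInt_R_even (f : R -> R) (l : R) :
  (forall t, f (- t) = f t) -> is_RInt_H f l -> is_RInt_R f (2 * l).
Proof.
  intros He Hf. replace (2 * l) with (l + l) by ring.
  apply is_RInt_R_halves; [|exact Hf]. now apply (is_RInt_H_ext f).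
Qed.

(** * Exponential integrals and the Fourier transform of sech squared *)

Lemma filterlim_exp_neg (c : R) : 0 < c ->
  filterlim (fun t => exp (- (c * t))) (Rbar_locally p_infty) (locally 0).
Proof.
  intros Hc P [eps HP].
  exists (/ c * - ln eps). intros t Ht. apply HP.
  change (Rabs (exp (- (c * t)) - 0) < eps). rewrite Rminus_0_r, Rabs_pos_eq by (left; apply exp_pos).
  rewrite <- (exp_ln eps) by apply cond_pos. apply exp_increasing.
  apply (Rmult_lt_compat_l c) in Ht; auto.
  rewrite <- Rmult_assoc, Rinv_r, Rmult_1_l in Ht by lra. lra.
Qed.

Lemma filterlim_0_bound (f g : R -> R) (F : (R -> Prop) -> Prop) {FF : Filter F} :
  F (fun t => Rabs (f t) <= g t) -> filterlim g F (locally 0) -> filterlim f F (locally 0).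
Proof.
  intros H Hg P [eps HP].
  assert (H2 : F (fun t => ball 0 eps (g t))) by (apply Hg, locally_ball).
  unfold filtermap. eapply filter_imp; [|apply (filter_and _ _ H H2)].
  intros t [H3 H4]. apply HP. change (Rabs (f t - 0) < eps).
  change (Rabs (g t - 0) < eps) in H4. rewrite Rminus_0_r in *.
  eapply Rle_lt_trans; [exact H3|]. eapply Rle_lt_trans; [apply Rle_abs | exact H4].
Qed.

Lemma is_RInt_H_exp (c : R) : 0 < c -> is_RInt_H (fun t => exp (- (c * t))) (/ c).
Proof.
  intros Hc. set (F := fun t => - (/ c * exp (- (c * t)))).
  replace (/ c) with (0 - F 0).
  2:{ unfold F. rewrite Rmult_0_r, Ropp_0, exp_0. ring. }
  apply is_RInt_H_derive.
  - intros t _. unfold F. auto_derive; auto. field. lra.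
  - intros t _. apply continuous_of_ex_derive. auto_derive. auto.
  - apply (filterlim_0_bound F (fun t => / c * exp (- (c * t))) (Rbar_locally p_infty)).
    + exists 0. intros t _. unfold F. rewrite Rabs_Ropp, Rabs_pos_eq; [lra|].
      apply Rmult_le_pos; [left; now apply Rinv_0_lt_compat | left; apply exp_pos].
    + replace 0 with (/ c * 0) by ring.
      apply (filterlim_comp _ _ _ (fun t => exp (- (c * t))) (fun z => / c * z) _ (locally 0)).
      * now apply filterlim_exp_neg.
      * apply (continuous_scal_r (/ c) (fun z : R => z)), continuous_id.
Qed.

Lemma is_RInt_H_sin_exp (a c : R) : 0 < c ->
  is_RInt_H (fun t => sin (a * t) * exp (- (c * t))) (a / (a ^ 2 + c ^ 2)).
Proof.
  intros Hc. assert (Hd : 0 < a ^ 2 + c ^ 2) by nra.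
  set (F := fun t => - ((a * cos (a * t) + c * sin (a * t)) * exp (- (c * t)) / (a ^ 2 + c ^ 2))).
  replace (a / (a ^ 2 + c ^ 2)) with (0 - F 0).
  2:{ unfold F. rewrite !Rmult_0_r, Ropp_0, exp_0, sin_0, cos_0. field. lra. }
  apply is_RInt_H_derive.
  - intros t _. unfold F. auto_derive; [simpl in *; lra|]. field. simpl in *; lra.
  - intros t _. apply continuous_of_ex_derive. auto_derive. auto.
  - set (K := (Rabs a + c) / (a ^ 2 + c ^ 2)).
    apply (filterlim_0_bound F (fun t => K * exp (- (c * t))) (Rbar_locally p_infty)).
    + exists 0. intros t _. unfold F, K. rewrite Rabs_Ropp. unfold Rdiv.
      rewrite !Rabs_mult, (Rabs_pos_eq (exp _)) by (left; apply exp_pos).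
      rewrite (Rabs_pos_eq (/ _)) by (left; now apply Rinv_0_lt_compat).
      replace ((Rabs a + c) * / (a ^ 2 + c ^ 2) * exp (- (c * t))) with
        ((Rabs a + c) * exp (- (c * t)) * / (a ^ 2 + c ^ 2)) by ring.
      apply Rmult_le_compat_r; [left; now apply Rinv_0_lt_compat|].
      apply Rmult_le_compat_r; [left; apply exp_pos|].
      eapply Rle_trans; [apply Rabs_triang|]. rewrite !Rabs_mult, (Rabs_pos_eq c) by lra.
      assert (Rabs (cos (a * t)) <= 1) by (apply Rabs_le; pose proof (COS_bound (a * t)); lra).
      assert (Rabs (sin (a * t)) <= 1) by (apply Rabs_le; pose proof (SIN_bound (a * t)); lra).
      pose proof (Rabs_pos a). nra.
    + replace 0 with (K * 0) by ring.
      apply (filterlim_comp _ _ _ (fun t => exp (- (c * t))) (fun z => K * z) _ (locally 0)).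
      * now apply filterlim_exp_neg.
      * apply (continuous_scal_r K (fun z : R => z)), continuous_id.
Qed.

Lemma exp_INR_mult (n : nat) (x : R) : exp (INR n * x) = exp x ^ n.
Proof.
  induction n as [|n IH]; [simpl; rewrite Rmult_0_l; apply exp_0|].
  rewrite S_INR, Rmult_plus_distr_r, exp_plus, IH, Rmult_1_l. simpl. ring.
Qed.

Lemma geometric_remainder (x : R) (K : nat) : 0 <= x ->
  2 * x / (1 + x) = rsum (fun k => 2 * (-1) ^ k * x ^ S k) K + 2 * (-1) ^ K * x ^ S K / (1 + x).
Proof.
  intros Hx. induction K as [|K IH]; [simpl; field; lra|].
  rewrite IH. simpl rsum. simpl pow. field. lra.
Qed.

(** From [1 + z ^ 2 / 2 <= exp z]. It lets exponential decay feed the lemmas stated for the majorant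
    [C / (1 + t ^ 2)]. *)
Lemma exp_neg_le_cauchy (k t : R) : 0 < k -> exp (- (k * Rabs t)) <= (1 + 2 / k ^ 2) / (1 + t ^ 2).
Proof.
  intros Hk. pose proof (Rabs_pos t) as Ht.
  assert (H1 : 1 + (k * Rabs t) ^ 2 / 2 <= exp (k * Rabs t)).
  { pose proof (exp_ge_taylor (k * Rabs t) 2) as H. simpl in H.
    assert (0 <= k * Rabs t) by nra. specialize (H H0). simpl. lra. }
  rewrite exp_Ropp. rewrite <- (pow2_abs t).
  apply Rmult_le_reg_r with (exp (k * Rabs t) * (1 + Rabs t ^ 2)).
  { apply Rmult_lt_0_compat; [apply exp_pos | nra]. }
  pose proof (exp_pos (k * Rabs t)).
  replace (/ exp (k * Rabs t) * (exp (k * Rabs t) * (1 + Rabs t ^ 2))) with (1 + Rabs t ^ 2)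
    by (field; lra).
  replace ((1 + 2 / k ^ 2) / (1 + Rabs t ^ 2) * (exp (k * Rabs t) * (1 + Rabs t ^ 2)))
    with ((1 + 2 / k ^ 2) * exp (k * Rabs t)) by (field; split; nra).
  assert (0 < 2 / k ^ 2) by (apply Rdiv_lt_0_compat; [lra | now apply pow_lt]).
  assert ((1 + 2 / k ^ 2) * (1 + (k * Rabs t) ^ 2 / 2) = 1 + Rabs t ^ 2 + 2 / k ^ 2 + (k * Rabs t) ^ 2 / 2)
    by (field; lra).
  assert (0 <= (k * Rabs t) ^ 2 / 2) by (pose proof (pow2_ge_0 (k * Rabs t)); lra).
  nra.
Qed.

Lemma cosh_pos (x : R) : 0 < cosh x.
Proof. unfold cosh. pose proof (exp_pos x). pose proof (exp_pos (- x)). lra. Qed.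

Lemma sinh_pos_lt (x : R) : 0 < x -> 0 < sinh x.
Proof. intros Hx. rewrite <- sinh_0. apply sinh_lt. lra. Qed.

(** The alternating series is the full one minus twice its terms at even multiples of the base
    frequency, and the latter, doubled, make up the full series for [a / 2]. So [L] is the
    difference of two instances of [coth_partial_fractions]. *)
Lemma alternating_coth (a : R) (L : R) : 0 < a ->
  is_lim_seq (rsum (fun k => (-1) ^ k * (2 * a / (a ^ 2 + freq k ^ 2)))) L ->
  L = 1 / a - 1 / (2 * sinh (a / 2)).
Proof.
  intros Ha HL.
  assert (H2 : is_lim_seq (fun N => rsum (fun k => (-1) ^ k * (2 * a / (a ^ 2 + freq k ^ 2))) (2 * N)) L).
  { apply (is_lim_seq_subseq (rsum (fun k => (-1) ^ k * (2 * a / (a ^ 2 + freq k ^ 2)))) L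
      (fun N => (2 * N)%nat)); auto. apply eventually_subseq. intros n. lia. }
  pose proof (coth_partial_fractions a Ha) as H3.
  assert (H4 : is_lim_seq (fun N => rsum (fun k => 2 * a / (a ^ 2 + freq k ^ 2)) (2 * N))
    (1 / (exp a - 1) - 1 / a + 1 / 2)).
  { apply (is_lim_seq_subseq (rsum (fun k => 2 * a / (a ^ 2 + freq k ^ 2))) _
      (fun N => (2 * N)%nat)); auto. apply eventually_subseq. intros n. lia. }
  pose proof (coth_partial_fractions (a / 2) ltac:(lra)) as H5.
  pose proof (is_lim_seq_minus' _ _ _ _ H4 H5) as H6.
  assert (E : L = 1 / (exp a - 1) - 1 / a + 1 / 2 - (1 / (exp (a / 2) - 1) - 1 / (a / 2) + 1 / 2)).
  { apply (is_lim_seq_uniq _ _ _ H2). eapply is_lim_seq_ext; [|exact H6].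
    intros N. cbv beta. induction N as [|N IH]; [simpl; ring|].
    replace (2 * S N)%nat with (S (S (2 * N))) by lia.
    assert (Er : forall (f : nat -> R) M, rsum f (S M) = rsum f M + f M) by reflexivity.
    rewrite !Er. rewrite <- (tech_pow_Rmult (-1)), pow_1_even.
    assert (E2 : freq (S (2 * N)) = 2 * freq N).
    { unfold freq. rewrite !S_INR, mult_INR. simpl. ring. }
    rewrite E2, <- IH. pose proof (freq_pos N). pose proof (freq_pos (2 * N)).
    field. repeat split; nra. }
  rewrite E. unfold sinh.
  assert (E1 : exp a = exp (a / 2) * exp (a / 2)) by (rewrite <- exp_plus; f_equal; field).
  rewrite exp_Ropp, E1. pose proof (exp_pos (a / 2)).
  assert (1 < exp (a / 2)) by (rewrite <- exp_0; apply exp_increasing; lra).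
  field. repeat split; nra.
Qed.

(** Expansion of [2 / (exp (PI t) + 1)] in powers of [exp (- PI t)], with the exact remainder of a
    geometric sum. The terms integrate to twice the alternating partial fractions with [a = 2 l];
    the remainder is at most [2 exp (- PI (K + 1) t)], with integral of order [1 / K]. *)
Lemma fermi_sin_integral (l : R) : 0 < l ->
  is_RInt_H (fun t => sin (l * t) * (2 / (exp (PI * t) + 1))) (1 / l - 1 / sinh l).
Proof.
  intros Hl. pose proof PI_RGT_0 as HP.
  destruct (is_RInt_H_ex (fun t => sin (l * t) * (2 / (exp (PI * t) + 1)))
    (2 * (1 + 2 / PI ^ 2))) as [J HJ].
  { intros t. apply continuous_of_ex_derive. auto_derive.
    pose proof (exp_pos (PI * t)). lra. }
  { intros t Ht. pose proof (exp_pos (PI * t)).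
    rewrite Rabs_mult, (Rabs_pos_eq (2 / _)) by (apply Rdiv_le_0_compat; lra).
    assert (Rabs (sin (l * t)) <= 1) by (apply Rabs_le; pose proof (SIN_bound (l * t)); lra).
    pose proof (exp_neg_le_cauchy PI t HP) as He. rewrite (Rabs_pos_eq t Ht), exp_Ropp in He.
    assert (2 / (exp (PI * t) + 1) <= 2 * / exp (PI * t)).
    { apply Rmult_le_compat_l; [lra|]. apply Rinv_le_contravar; lra. }
    assert (0 < 2 / (exp (PI * t) + 1)) by (apply Rdiv_lt_0_compat; lra).
    pose proof (Rabs_pos (sin (l * t))).
    replace (2 * (1 + 2 / PI ^ 2) / (1 + t ^ 2)) with (2 * ((1 + 2 / PI ^ 2) / (1 + t ^ 2)))
      by (unfold Rdiv; ring). nra. }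
  replace (1 / l - 1 / sinh l) with J; [exact HJ|].
  set (x := fun k => (-1) ^ k * (2 * (2 * l) / ((2 * l) ^ 2 + freq k ^ 2))).
  assert (Hlim : is_lim_seq (rsum x) (J / 2)).
  { apply (is_lim_seq_le_0 _ (fun K => 2 / PI * / INR (S K))).
    2:{ replace (Finite 0) with (Rbar_mult (2 / PI) 0) by (simpl; f_equal; ring).
        apply is_lim_seq_scal_l.
        replace (Finite 0) with (Rbar_inv p_infty) by reflexivity.
        apply is_lim_seq_inv; [|discriminate].
        apply (is_lim_seq_incr_1 INR). apply is_lim_seq_INR. }
    intros K.
    assert (HS : is_RInt_H (fun t => rsum (fun k => 2 * (-1) ^ k *
       (sin (l * t) * exp (- (freq k / 2 * t)))) K) (2 * rsum x K)).
    { rewrite <- rsum_scal.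
      apply (is_RInt_H_rsum (fun k t => 2 * (-1) ^ k * (sin (l * t) * exp (- (freq k / 2 * t))))).
      intros k. pose proof (freq_pos k).
      replace (2 * x k) with (2 * (-1) ^ k * (l / (l ^ 2 + (freq k / 2) ^ 2)))
        by (unfold x; field; repeat split; nra).
      apply is_RInt_H_scal, is_RInt_H_sin_exp. lra. }
    pose proof (is_RInt_H_minus _ _ _ _ HJ HS) as HD.
    assert (HE : is_RInt_H (fun t => 2 * exp (- (PI * INR (S K) * t))) (2 * / (PI * INR (S K)))).
    { apply is_RInt_H_scal, is_RInt_H_exp. pose proof (INR_S_ge_1 K). nra. }
    assert (HB : Rabs (J - 2 * rsum x K) <= 2 * / (PI * INR (S K))).
    { apply (is_RInt_H_norm_le _ _ _ _ HD HE). intros t Ht.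
      set (y := exp (- (PI * t))). assert (Hy : 0 < y) by apply exp_pos.
      assert (Hyk : forall k, exp (- (freq k / 2 * t)) = y ^ S k).
      { intros k. unfold y. rewrite <- exp_INR_mult. f_equal. unfold freq. field. }
      assert (Hyk2 : exp (- (PI * INR (S K) * t)) = y ^ S K).
      { unfold y. rewrite <- exp_INR_mult. f_equal. ring. }
      rewrite Hyk2.
      rewrite (rsum_ext (fun k => 2 * (-1) ^ k * (sin (l * t) * exp (- (freq k / 2 * t))))
        (fun k => sin (l * t) * (2 * (-1) ^ k * y ^ S k))).
      2:{ intros k _. rewrite Hyk. ring. }
      rewrite rsum_scal.
      assert (E : 2 / (exp (PI * t) + 1) = 2 * y / (1 + y)).
      { unfold y. rewrite exp_Ropp. pose proof (exp_pos (PI * t)). field. lra. }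
      rewrite E, (geometric_remainder y K) by lra.
      replace (sin (l * t) * (rsum (fun k => 2 * (-1) ^ k * y ^ S k) K + 2 * (-1) ^ K * y ^ S K / (1 + y))
        - sin (l * t) * rsum (fun k => 2 * (-1) ^ k * y ^ S k) K)
        with ((sin (l * t) * (-1) ^ K) * (2 * y ^ S K * / (1 + y))) by (field; lra).
      rewrite Rabs_mult.
      assert (Hp : 0 < y ^ S K) by now apply pow_lt.
      assert (Hi : 0 < / (1 + y)) by (apply Rinv_0_lt_compat; lra).
      assert (Hi1 : / (1 + y) <= 1) by (rewrite <- Rinv_1; apply Rinv_le_contravar; lra).
      rewrite (Rabs_pos_eq (2 * _ * _)) by nra.
      rewrite Rabs_mult, <- RPow_abs.
      replace (Rabs (-1)) with 1 by (rewrite Rabs_left; lra). rewrite pow1, Rmult_1_r.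
      assert (Rabs (sin (l * t)) <= 1) by (apply Rabs_le; pose proof (SIN_bound (l * t)); lra).
      pose proof (Rabs_pos (sin (l * t))).
      apply Rle_trans with (1 * (2 * y ^ S K * 1)); [|lra].
      apply Rmult_le_compat; try lra; nra. }
    replace (rsum x K - J / 2) with (- (/ 2 * (J - 2 * rsum x K))) by field.
    rewrite Rabs_Ropp, Rabs_mult, (Rabs_pos_eq (/ 2)) by lra.
    replace (2 / PI * / INR (S K)) with (2 * / (PI * INR (S K)))
      by (field; split; [apply not_0_INR; lia | lra]).
    assert (0 < 2 * / (PI * INR (S K))).
    { apply Rmult_lt_0_compat; [lra|]. apply Rinv_0_lt_compat. pose proof (INR_S_ge_1 K). nra. }
    lra. }
  apply alternating_coth in Hlim; [|lra].
  replace (2 * l / 2) with l in Hlim by field.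
  pose proof (sinh_pos_lt l Hl).
  replace J with (2 * (J / 2)) by field. rewrite Hlim. field. lra.
Qed.

(** [2 / (exp (PI t) + 1)] has derivative [- (PI / 2) / cosh (PI t / 2) ^ 2], so integration by
    parts reduces the cosine transform to [fermi_sin_integral]; the boundary term at 0 contributes
    1. *)
Lemma sech2_fourier (l : R) : 0 < l ->
  is_RInt_R (fun t => cos (l * t) * (PI / 2 / cosh (PI * t / 2) ^ 2)) (2 * (l / sinh l)).
Proof.
  intros Hl. pose proof PI_RGT_0 as HP. pose proof (sinh_pos_lt l Hl) as Hs.
  apply is_RInt_R_even.
  { intros t. replace (l * - t) with (- (l * t)) by ring. rewrite cos_neg.
    replace (PI * - t / 2) with (- (PI * t / 2)) by field.
    unfold cosh. rewrite Ropp_involutive. now rewrite (Rplus_comm (exp (- _))). }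
  set (F := fun t => - (cos (l * t) * (2 / (exp (PI * t) + 1)))).
  set (f := fun t => l * (sin (l * t) * (2 / (exp (PI * t) + 1)))
     + cos (l * t) * (PI / 2 / cosh (PI * t / 2) ^ 2)).
  assert (H1 : is_RInt_H f (0 - F 0)).
  { apply is_RInt_H_derive.
    - intros t _. unfold F, f, cosh.
      assert (E1 : exp (PI * t) = exp (PI * t / 2) * exp (PI * t / 2))
        by (rewrite <- exp_plus; f_equal; field).
      pose proof (exp_pos (PI * t / 2)).
      auto_derive.
      + pose proof (exp_pos (PI * t)). lra.
      + rewrite E1, exp_Ropp. field. repeat split; nra.
    - intros t _. unfold f, cosh. apply continuous_of_ex_derive. auto_derive.
      pose proof (exp_pos (PI * t)). pose proof (exp_pos (PI * t / 2)).
      pose proof (exp_pos (- (PI * t / 2))). unfold Rdiv in *. simpl. repeat split; nra.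
    - apply (filterlim_0_bound F (fun t => 2 * exp (- (PI * t))) (Rbar_locally p_infty)).
      + exists 0. intros t _. unfold F. rewrite Rabs_Ropp, Rabs_mult.
        pose proof (exp_pos (PI * t)).
        rewrite (Rabs_pos_eq (2 / _)) by (apply Rdiv_le_0_compat; lra).
        assert (Rabs (cos (l * t)) <= 1) by (apply Rabs_le; pose proof (COS_bound (l * t)); lra).
        assert (2 / (exp (PI * t) + 1) <= 2 * / exp (PI * t)).
        { apply Rmult_le_compat_l; [lra|]. apply Rinv_le_contravar; lra. }
        assert (0 < 2 / (exp (PI * t) + 1)) by (apply Rdiv_lt_0_compat; lra).
        pose proof (Rabs_pos (cos (l * t))). rewrite exp_Ropp. nra.
      + replace 0 with (2 * 0) by ring.
        apply (filterlim_comp _ _ _ (fun t => exp (- (PI * t))) (fun z => 2 * z) _ (locally 0)).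
        * now apply filterlim_exp_neg.
        * apply (continuous_scal_r 2 (fun z : R => z)), continuous_id. }
  pose proof (is_RInt_H_scal _ l _ (fermi_sin_integral l Hl)) as H2.
  pose proof (is_RInt_H_minus _ _ _ _ H1 H2) as H3.
  replace (l / sinh l) with (0 - F 0 - l * (1 / l - 1 / sinh l)).
  - eapply is_RInt_H_ext; [|exact H3]. intros t _. unfold f. cbv beta. ring.
  - unfold F. rewrite !Rmult_0_r, cos_0, exp_0. field. lra.
Qed.

(** * The kernel on vertical lines *)

Ltac eq_R := match goal with |- @eq _ ?a ?b => change (@eq R a b) end.

Lemma mean_value (f df : R -> R) (a b : R) :
  (forall x, is_derive f x (df x)) ->
  exists c, Rmin a b <= c <= Rmax a b /\ f b - f a = df c * (b - a).
Proof.
  intros H. apply MVT_gen.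
  - intros x _. apply H.
  - intros x _. apply continuity_pt_filterlim.
    apply (ex_derive_continuous (V := RN) f). exists (df x). apply H.
Qed.

Lemma Csin_eq (a b : R) : Csin (a, b) = (sin a * cosh b, cos a * sinh b).
Proof.
  unfold Csin, Cexp, cosh, sinh. simpl.
  replace (0 * a - 1 * b) with (- b) by ring. replace (0 * b + 1 * a) with a by ring.
  replace (- (0 * a - 1 * b)) with b by ring. replace (- (0 * b + 1 * a)) with (- a) by ring.
  replace (- - b) with b by ring.
  rewrite cos_neg, sin_neg. apply injective_projections; simpl; field.
Qed.

Lemma Ccos_eq (a b : R) : Ccos (a, b) = (cos a * cosh b, - (sin a * sinh b)).
Proof.
  unfold Ccos, Cexp, cosh, sinh. simpl.
  replace (0 * a - 1 * b) with (- b) by ring. replace (0 * b + 1 * a) with a by ring.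
  replace (- (0 * a - 1 * b)) with b by ring. replace (- (0 * b + 1 * a)) with (- a) by ring.
  replace (- - b) with b by ring.
  rewrite cos_neg, sin_neg. apply injective_projections; simpl; field.
Qed.

Definition sn (w : C) : C := Csin (PI * w / 2).
Definition cs (w : C) : C := Ccos (PI * w / 2).

Lemma half_PI_mul (s t : R) : (PI * (s, t) / 2)%C = (PI * s / 2, PI * t / 2).
Proof. apply injective_projections; simpl; field. Qed.

Lemma cosh2_sinh2 (b : R) : cosh b ^ 2 - sinh b ^ 2 = 1.
Proof.
  unfold cosh, sinh.
  assert (H : exp b * exp (- b) = 1) by (rewrite <- exp_plus, Rplus_opp_r; apply exp_0).
  replace (((exp b + exp (- b)) / 2) ^ 2 - ((exp b - exp (- b)) / 2) ^ 2)
    with (exp b * exp (- b)) by field. exact H.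
Qed.

Lemma Cmod_sn_ge (s t m : R) : 0 <= m <= sin (PI * s / 2) ->
  m * cosh (PI * t / 2) <= Cmod (sn (s, t)).
Proof.
  intros Hm. unfold sn. rewrite half_PI_mul, Csin_eq.
  pose proof (cosh_pos (PI * t / 2)) as Hc.
  apply Rle_trans with (Rabs (sin (PI * s / 2) * cosh (PI * t / 2))).
  - rewrite Rabs_mult, (Rabs_pos_eq (cosh _)), (Rabs_pos_eq (sin _)) by lra.
    apply Rmult_le_compat_r; lra.
  - exact (re_le_Cmod (sin (PI * s / 2) * cosh (PI * t / 2), cos (PI * s / 2) * sinh (PI * t / 2))).
Qed.

Lemma Cmod_cs_le (s t : R) : Cmod (cs (s, t)) <= cosh (PI * t / 2).
Proof.
  unfold cs. rewrite half_PI_mul, Ccos_eq. pose proof (cosh_pos (PI * t / 2)) as Hc.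
  pose proof (cosh2_sinh2 (PI * t / 2)) as H1. pose proof (sin2_cos2 (PI * s / 2)) as H2.
  unfold Rsqr in H2.
  apply Rsqr_incr_0_var; [|lra]. rewrite !Rsqr_pow2, Cmod2_alt. simpl Re; simpl Im.
  unfold Re, Im; simpl fst; simpl snd.
  set (C := cosh (PI * t / 2)) in *. set (S := sinh (PI * t / 2)) in *.
  set (x := sin (PI * s / 2)) in *. set (y := cos (PI * s / 2)) in *.
  assert (S ^ 2 <= C ^ 2) by lra.
  replace ((y * C) ^ 2 + (- (x * S)) ^ 2) with (y ^ 2 * C ^ 2 + x ^ 2 * S ^ 2) by ring.
  assert (x ^ 2 * S ^ 2 <= x ^ 2 * C ^ 2) by (apply Rmult_le_compat_l; [apply pow2_ge_0 | lra]).
  replace (C ^ 2) with ((x * x + y * y) * C ^ 2) at 2 by (rewrite H2; ring). lra.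
Qed.

Lemma cosh_neg (x : R) : cosh (- x) = cosh x.
Proof. unfold cosh. rewrite Ropp_involutive. f_equal. apply Rplus_comm. Qed.

(** By Taylor [cosh z >= 1 + z ^ 2 / 2], and [PI ^ 2 / 8 > 1]. *)
Lemma cosh_ge (t : R) : 1 + t ^ 2 <= cosh (PI * t / 2).
Proof.
  set (x := Rabs (PI * t / 2)).
  assert (Hx : 0 <= x) by apply Rabs_pos.
  assert (E : cosh (PI * t / 2) = cosh x).
  { unfold x, Rabs. destruct (Rcase_abs (PI * t / 2)); auto.
    unfold cosh. rewrite Ropp_involutive. now rewrite Rplus_comm. }
  rewrite E.
  assert (H1 : forall x, 0 <= x -> 0 <= sinh x).
  { intros y [Hy | <-]; [left; now apply sinh_pos_lt | rewrite sinh_0; lra]. }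
  assert (H2 : forall y, 0 <= y -> y <= sinh y).
  { intros y Hy. destruct (Req_dec y 0) as [->|]; [rewrite sinh_0; lra|].
    destruct (mean_value (fun x => sinh x - x) (fun x => cosh x - 1) 0 y) as [c [Hc Heq]].
    - intros z. unfold sinh, cosh. auto_derive; auto. field.
    - rewrite sinh_0 in Heq.
      assert (1 <= cosh c).
      { unfold cosh. pose proof (exp_ineq1_le c). pose proof (exp_ineq1_le (- c)). lra. }
      assert (0 <= (cosh c - 1) * (y - 0)) by (apply Rmult_le_pos; lra). lra. }
  assert (H3 : forall y, 0 <= y -> 1 + y ^ 2 / 2 <= cosh y).
  { intros y Hy.
    destruct (mean_value (fun x => cosh x - x ^ 2 / 2) (fun x => sinh x - x) 0 y) as [c [Hc Heq]].
    - intros z. unfold sinh, cosh. auto_derive; auto. field.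
    - rewrite Rmin_left, Rmax_right in Hc by lra. rewrite cosh_0 in Heq.
      assert (0 <= (sinh c - c) * (y - 0)).
      { apply Rmult_le_pos; [|lra]. specialize (H2 c ltac:(lra)). lra. }
      lra. }
  eapply Rle_trans; [|apply H3, Hx]. unfold x. rewrite pow2_abs.
  pose proof PI2_3_2. assert (9 < PI ^ 2) by nra. pose proof (pow2_ge_0 t).
  replace ((PI * t / 2) ^ 2 / 2) with (PI ^ 2 / 8 * t ^ 2) by field. nra.
Qed.

Lemma sin_strip_ge (c s : R) : 0 < c -> c <= 1 -> c <= s <= 2 - c ->
  0 < sin (PI * c / 2) <= sin (PI * s / 2).
Proof.
  intros Hc Hc1 Hs. pose proof PI_RGT_0 as HP.
  split; [apply sin_gt_0; nra|].
  destruct (Rle_dec s 1) as [H|H].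
  - apply sin_incr_1; nra.
  - rewrite <- (sin_PI_x (PI * s / 2)). apply sin_incr_1; nra.
Qed.

Lemma is_derive_CR_eq (f : R -> C) (x : R) (a b : C) :
  is_deriveC f x a -> a = b -> is_deriveC f x b.
Proof. intros H E. now rewrite <- E. Qed.

Lemma is_derive_Csin (g : R -> C) (x : R) (dg : C) :
  is_deriveC g x dg -> is_deriveC (fun t => Csin (g t)) x (dg * Ccos (g x))%C.
Proof.
  intros H.
  assert (Hi : (2 * Ci)%C <> 0%C).
  { intros E. apply (f_equal Im) in E. unfold Im in E; simpl in E. lra. }
  apply (is_derive_ext (V := CR)
    (fun t => / (2 * Ci) * (Cexp (Ci * g t) - Cexp (- (Ci * g t))))%C).
  { intros t. eq_C. unfold Csin. field. intros E. apply Hi. rewrite E. ring. }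
  eapply is_derive_CR_eq.
  - apply is_derive_CR_scal_l. apply is_derive_CR_minus.
    + apply is_derive_Cexp. apply is_derive_CR_scal_l, H.
    + apply is_derive_Cexp. apply (is_derive_opp (V := CR)). apply is_derive_CR_scal_l, H.
  - unfold Ccos. change (opp (Ci * dg)%C) with (- (Ci * dg))%C.
    assert (Ci <> 0%C). { intros E. apply Hi. rewrite E. ring. }
    field. auto.
Qed.

Lemma is_derive_Ccos (g : R -> C) (x : R) (dg : C) :
  is_deriveC g x dg -> is_deriveC (fun t => Ccos (g t)) x (- dg * Csin (g x))%C.
Proof.
  intros H.
  assert (H2 : RtoC 2 <> 0%C).
  { intros E. apply (f_equal Re) in E. unfold Re in E; simpl in E. lra. }
  assert (Hi : Ci <> 0%C).
  { intros E. apply (f_equal Im) in E. unfold Im in E; simpl in E. lra. }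
  apply (is_derive_ext (V := CR)
    (fun t => / 2 * (Cexp (Ci * g t) + Cexp (- (Ci * g t))))%C).
  { intros t. eq_C. unfold Ccos. field. }
  eapply is_derive_CR_eq.
  - apply is_derive_CR_scal_l. apply is_derive_CR_plus.
    + apply is_derive_Cexp. apply is_derive_CR_scal_l, H.
    + apply is_derive_Cexp. apply (is_derive_opp (V := CR)). apply is_derive_CR_scal_l, H.
  - unfold Csin. change (opp (Ci * dg)%C) with (- (Ci * dg))%C.
    assert (Hc : (Ci * Ci)%C = (- (1))%C) by (apply injective_projections; simpl; ring).
    set (E1 := Cexp (Ci * g x)). set (E2 := Cexp (- (Ci * g x))).
    transitivity (/ 2 * (Ci * Ci) * dg * (E1 - E2) / Ci)%C; [field; auto|].
    rewrite Hc. field. auto.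
Qed.

(** For [l = ln x] this is the integrand of H without its zeta factors, for [l = 0] the bare kernel.
    [kap1] and [kap2] are its first two derivatives in [w]. *)
Definition kap (l : R) (w : C) : C :=
  (RtoC (PI ^ 2 / 2) * Cexp (- (w * l)) * / (sn w * sn w))%C.
Definition kap1 (l : R) (w : C) : C :=
  (kap l w * (- l - PI * (cs w * / sn w)))%C.
Definition kap2 (l : R) (w : C) : C :=
  (kap l w * ((- l - PI * (cs w * / sn w)) * (- l - PI * (cs w * / sn w))
    + PI * PI * / 2 * (1 + cs w * cs w * / (sn w * sn w))))%C.

Lemma RtoC_2_neq_0 : RtoC 2 <> 0%C.
Proof. intros E. apply (f_equal Re) in E. unfold Re in E; simpl in E. lra. Qed.

Lemma is_derive_sn (g : R -> C) (x : R) (dg : C) :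
  is_deriveC g x dg ->
  is_deriveC (fun t => sn (g t)) x (PI * / 2 * dg * cs (g x))%C.
Proof.
  intros H. unfold sn, cs.
  apply (is_derive_Csin (fun t => PI * g t / 2)%C).
  apply (is_derive_ext (V := CR) (fun t => PI * / 2 * g t)%C).
  { intros t. eq_C. field. }
  now apply is_derive_CR_scal_l.
Qed.

Lemma is_derive_cs (g : R -> C) (x : R) (dg : C) :
  is_deriveC g x dg ->
  is_deriveC (fun t => cs (g t)) x (- (PI * / 2 * dg) * sn (g x))%C.
Proof.
  intros H. unfold sn, cs.
  apply (is_derive_Ccos (fun t => PI * g t / 2)%C).
  apply (is_derive_ext (V := CR) (fun t => PI * / 2 * g t)%C).
  { intros t. eq_C. field. }
  now apply is_derive_CR_scal_l.
Qed.

Lemma is_derive_kap (l : R) (g : R -> C) (x : R) (dg : C) :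
  is_deriveC g x dg -> sn (g x) <> 0%C ->
  is_deriveC (fun t => kap l (g t)) x (dg * kap1 l (g x))%C.
Proof.
  intros H H0. pose proof RtoC_2_neq_0 as H2. unfold kap.
  eapply is_derive_CR_eq.
  - apply (is_derive_CR_mult (fun t => RtoC (PI ^ 2 / 2) * Cexp (- (g t * l)))%C
      (fun t => / (sn (g t) * sn (g t)))%C).
    + apply is_derive_CR_scal_l. apply (is_derive_Cexp (fun t => - (g t * l))%C).
      apply (is_derive_ext (V := CR) (fun t => - l * g t)%C).
      { intros t. eq_C. ring. }
      apply is_derive_CR_scal_l, H.
    + apply is_derive_Cinv.
      * apply is_derive_CR_mult; apply is_derive_sn, H.
      * apply Cmult_neq_0; auto.
  - unfold kap1, kap. field. auto.
Qed.

Lemma is_derive_kap1 (l : R) (g : R -> C) (x : R) (dg : C) :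
  is_deriveC g x dg -> sn (g x) <> 0%C ->
  is_deriveC (fun t => kap1 l (g t)) x (dg * kap2 l (g x))%C.
Proof.
  intros H H0. pose proof RtoC_2_neq_0 as H2. unfold kap1.
  eapply is_derive_CR_eq.
  - apply (is_derive_CR_mult (fun t => kap l (g t))
      (fun t => - l - PI * (cs (g t) * / sn (g t)))%C).
    + apply (is_derive_kap l g x dg H H0).
    + apply (is_derive_CR_minus (fun _ => (- l)%C)); [apply is_derive_CR_const|].
      apply is_derive_CR_scal_l. apply is_derive_CR_mult.
      * apply is_derive_cs, H.
      * apply is_derive_Cinv; [apply is_derive_sn, H | exact H0].
  - unfold kap2, kap1. field. auto.
Qed.

(** On the strip [c <= Re w <= 2 - c] one has [Re w <= 2], hence the exponent [2 * Rabs l], and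
    [sin (PI Re w / 2)] is at least its value at [c]. *)
Definition kap_const (c l : R) : R :=
  PI ^ 2 / 2 * exp (2 * Rabs l) * (/ sin (PI * c / 2)) ^ 2.

Lemma kap_const_pos (c l : R) : 0 < c <= 1 -> 0 < kap_const c l.
Proof.
  intros Hc. pose proof PI_RGT_0. unfold kap_const.
  destruct (sin_strip_ge c c) as [H1 _]; try lra.
  apply Rmult_lt_0_compat; [|apply pow_lt; now apply Rinv_0_lt_compat].
  apply Rmult_lt_0_compat; [|apply exp_pos]. assert (0 < PI ^ 2) by now apply pow_lt. lra.
Qed.

Lemma sn_strip (c s t : R) : 0 < c <= 1 -> c <= s <= 2 - c ->
  0 < sin (PI * c / 2) * (1 + t ^ 2) <= Cmod (sn (s, t)).
Proof.
  intros Hc Hs. destruct (sin_strip_ge c s) as [H1 H2]; try lra.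
  pose proof (cosh_ge t). split; [pose proof (pow2_ge_0 t); nra|].
  eapply Rle_trans; [|apply (Cmod_sn_ge s t (sin (PI * c / 2))); lra].
  apply Rmult_le_compat_l; lra.
Qed.

Lemma sn_neq_0 (c s t : R) : 0 < c <= 1 -> c <= s <= 2 - c -> sn (s, t) <> 0%C.
Proof. intros Hc Hs. apply Cmod_gt_0. pose proof (sn_strip c s t Hc Hs). lra. Qed.

(** One factor [1 / (1 + t ^ 2)] secures integrability; the other is kept to absorb the growth of
    the two zeta factors. *)
Lemma Cmod_kap (c l s t : R) : 0 < c <= 1 -> c <= s <= 2 - c ->
  Cmod (kap l (s, t)) <= kap_const c l / (1 + t ^ 2) ^ 2.
Proof.
  intros Hc Hs. pose proof (sn_strip c s t Hc Hs) as Hn.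
  pose proof (sn_neq_0 c s t Hc Hs) as H0.
  destruct (sin_strip_ge c s) as [H1 H2]; try lra.
  pose proof (one_plus_sqr_pos t) as Ht. pose proof PI_RGT_0 as HP.
  unfold kap. rewrite !Cmod_mult, Cmod_inv by now apply Cmult_neq_0.
  rewrite Cmod_mult, Cmod_R, Cmod_Cexp.
  rewrite (Rabs_pos_eq (PI ^ 2 / 2)) by (assert (0 < PI ^ 2) by (now apply pow_lt); lra).
  unfold kap_const.
  replace (PI ^ 2 / 2 * exp (2 * Rabs l) * (/ sin (PI * c / 2)) ^ 2 / (1 + t ^ 2) ^ 2)
    with (PI ^ 2 / 2 * exp (2 * Rabs l) *
      / ((sin (PI * c / 2) * (1 + t ^ 2)) * (sin (PI * c / 2) * (1 + t ^ 2)))) by (field; lra).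
  apply Rmult_le_compat.
  - apply Rmult_le_pos; [assert (0 < PI ^ 2) by (now apply pow_lt); lra | left; apply exp_pos].
  - left. apply Rinv_0_lt_compat. nra.
  - apply Rmult_le_compat_l; [assert (0 < PI ^ 2) by (now apply pow_lt); lra|].
    apply exp_le. replace (Re (- ((s, t) * l))) with (- (s * l)) by (unfold Re; simpl; ring).
    pose proof (Rle_abs (- l)). rewrite Rabs_Ropp in H. pose proof (Rabs_pos l).
    assert (s * (- l) <= s * Rabs l) by (apply Rmult_le_compat_l; lra). nra.
  - apply Rinv_le_contravar; nra.
Qed.

Lemma Cmod_cot (c s t : R) : 0 < c <= 1 -> c <= s <= 2 - c ->
  Cmod (cs (s, t) * / sn (s, t))%C <= / sin (PI * c / 2).
Proof.
  intros Hc Hs. pose proof (sn_neq_0 c s t Hc Hs) as H0.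
  destruct (sin_strip_ge c s) as [H1 H2]; try lra.
  rewrite Cmod_mult, Cmod_inv by auto.
  pose proof (Cmod_cs_le s t) as H3. pose proof (cosh_pos (PI * t / 2)) as H4.
  pose proof (Cmod_sn_ge s t (sin (PI * c / 2)) ltac:(lra)) as H5.
  assert (0 < sin (PI * c / 2) * cosh (PI * t / 2)) by nra.
  apply Rle_trans with (cosh (PI * t / 2) * / (sin (PI * c / 2) * cosh (PI * t / 2))).
  - apply Rmult_le_compat; auto.
    + apply Cmod_ge_0.
    + left. apply Rinv_0_lt_compat. lra.
    + apply Rinv_le_contravar; lra.
  - right. field. lra.
Qed.

Definition kap_ratio (c l : R) : R :=
  (Rabs l + PI * / sin (PI * c / 2)) ^ 2 + PI ^ 2 * (1 + (/ sin (PI * c / 2)) ^ 2).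

Lemma Cmod_kap1_factor (c l s t : R) : 0 < c <= 1 -> c <= s <= 2 - c ->
  Cmod (- l - PI * (cs (s, t) * / sn (s, t)))%C <= Rabs l + PI * / sin (PI * c / 2).
Proof.
  intros Hc Hs. pose proof (Cmod_cot c s t Hc Hs) as H. pose proof PI_RGT_0.
  eapply Rle_trans; [apply Cmod_triangle|].
  rewrite !Cmod_opp, Cmod_R, Cmod_mult, Cmod_R, (Rabs_pos_eq PI) by lra.
  apply Rplus_le_compat_l, Rmult_le_compat_l; lra.
Qed.

Lemma Cmod_kap2 (c l s t : R) : 0 < c <= 1 -> c <= s <= 2 - c ->
  Cmod (kap2 l (s, t)) <= kap_const c l * kap_ratio c l / (1 + t ^ 2).
Proof.
  intros Hc Hs. pose proof (Cmod_kap c l s t Hc Hs) as H1.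
  pose proof (Cmod_kap1_factor c l s t Hc Hs) as H2. pose proof (Cmod_cot c s t Hc Hs) as H3.
  pose proof (one_plus_sqr_pos t) as Ht. pose proof PI_RGT_0 as HP.
  pose proof (kap_const_pos c l Hc) as HK. pose proof (sn_neq_0 c s t Hc Hs) as H0.
  destruct (sin_strip_ge c s) as [Hm _]; try lra.
  assert (Hi : 0 < / sin (PI * c / 2)) by now apply Rinv_0_lt_compat.
  unfold kap2. rewrite Cmod_mult.
  assert (H4 : Cmod ((- l - PI * (cs (s, t) * / sn (s, t))) * (- l - PI * (cs (s, t) * / sn (s, t)))
    + PI * PI * / 2 * (1 + cs (s, t) * cs (s, t) * / (sn (s, t) * sn (s, t))))%C <= kap_ratio c l).
  { eapply Rle_trans; [apply Cmod_triangle|]. unfold kap_ratio.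
    set (m := / sin (PI * c / 2)) in *. set (A := Rabs l + PI * m) in *.
    set (F := (- l - PI * (cs (s, t) * / sn (s, t)))%C) in *.
    replace (cs (s, t) * cs (s, t) * / (sn (s, t) * sn (s, t)))%C
      with ((cs (s, t) * / sn (s, t)) * (cs (s, t) * / sn (s, t)))%C by (field; auto).
    set (G := (cs (s, t) * / sn (s, t))%C) in *.
    pose proof (Cmod_ge_0 F). pose proof (Cmod_ge_0 G).
    apply Rplus_le_compat.
    - rewrite Cmod_mult. simpl. rewrite Rmult_1_r. now apply Rmult_le_compat.
    - rewrite !Cmod_mult, Cmod_inv, !Cmod_R by apply RtoC_2_neq_0.
      rewrite (Rabs_pos_eq PI), (Rabs_pos_eq 2) by lra.
      pose proof (Cmod_triangle 1 (G * G)) as HT. rewrite Cmod_1, Cmod_mult in HT.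
      pose proof (Cmod_ge_0 (1 + G * G)).
      assert (Cmod G * Cmod G <= m * m) by (apply Rmult_le_compat; auto).
      assert (PI * PI * / 2 <= PI ^ 2) by nra.
      apply Rmult_le_compat; try nra. }
  assert (H5 : 0 <= kap_ratio c l) by (eapply Rle_trans; [apply Cmod_ge_0 | exact H4]).
  apply Rle_trans with (kap_const c l / (1 + t ^ 2) ^ 2 * kap_ratio c l).
  - apply Rmult_le_compat; auto; apply Cmod_ge_0.
  - replace (kap_const c l * kap_ratio c l / (1 + t ^ 2))
      with (kap_const c l / (1 + t ^ 2) * kap_ratio c l) by (field; lra).
    apply Rmult_le_compat_r; auto. apply Rmult_le_compat_l; [lra|].
    apply Rinv_le_contravar; auto. pose proof (pow2_ge_0 t). nra.
Qed.

Lemma is_derive_line_Im (s t : R) : is_deriveC (fun t : R => ((s, t) : C)) t Ci.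
Proof.
  apply (is_derive_CR (fun t => (s, t))).
  - apply (is_derive_const (V := RN) (s : R)).
  - apply (is_derive_id (K := R_AbsRing)).
Qed.

Lemma is_derive_line_Re (s t : R) : is_deriveC (fun s : R => ((s, t) : C)) s (RtoC 1).
Proof.
  apply (is_derive_CR (fun s => (s, t))).
  - apply (is_derive_id (K := R_AbsRing)).
  - apply (is_derive_const (V := RN) (t : R)).
Qed.

Lemma continuous_kap (c l s t : R) : 0 < c <= 1 -> c <= s <= 2 - c ->
  continuousC (fun t => kap l (s, t)) t.
Proof.
  intros Hc Hs. eapply is_derive_CR_continuous.
  apply (is_derive_kap l (fun t => (s, t)) t Ci (is_derive_line_Im s t)).
  now apply (sn_neq_0 c).
Qed.

Lemma continuous_kap1 (c l s t : R) : 0 < c <= 1 -> c <= s <= 2 - c ->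
  continuousC (fun t => kap1 l (s, t)) t.
Proof.
  intros Hc Hs. eapply is_derive_CR_continuous.
  apply (is_derive_kap1 l (fun t => (s, t)) t Ci (is_derive_line_Im s t)).
  now apply (sn_neq_0 c).
Qed.

Lemma kap_bound_cauchy (c l s t : R) : 0 < c <= 1 -> c <= s <= 2 - c ->
  Cmod (kap l (s, t)) <= kap_const c l / (1 + t ^ 2).
Proof.
  intros Hc Hs. eapply Rle_trans; [now apply (Cmod_kap c)|].
  pose proof (one_plus_sqr_pos t). pose proof (kap_const_pos c l Hc).
  apply Rmult_le_compat_l; [lra|]. apply Rinv_le_contravar; auto.
  pose proof (pow2_ge_0 t). nra.
Qed.

Lemma kap_integrable (c l s : R) : 0 < c <= 1 -> c <= s <= 2 - c ->
  exists I, is_RInt_RC (fun t => kap l (s, t)) I.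
Proof.
  intros Hc Hs. apply (is_RInt_R_ex (V := CR) _ (kap_const c l)).
  - intros t. now apply (continuous_kap c).
  - intros t. rewrite norm_CR. now apply kap_bound_cauchy.
Qed.

Lemma filterlim_CR_0 (f : R -> C) (K : R) (F : (R -> Prop) -> Prop) {FF : Filter F} :
  (forall t, Cmod (f t) <= K / (1 + t ^ 2)) ->
  (forall M, F (fun t => M < Rabs t)) ->
  filterlim f F (locally (T := CR) (RtoC 0)).
Proof.
  intros Hf HF P [eps HP]. unfold filtermap.
  apply (filter_imp _ _ (fun t Ht => HP (f t) (ball_CR _ _ eps Ht))).
  assert (HK : 0 <= K).
  { specialize (Hf 0). pose proof (Cmod_ge_0 (f 0)).
    replace (K / (1 + 0 ^ 2)) with K in Hf by field. lra. }
  pose proof (cond_pos eps) as He.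
  generalize (HF (1 + K / eps)). apply filter_imp. intros t Ht.
  replace (f t - 0)%C with (f t) by ring.
  eapply Rle_lt_trans; [apply Hf|].
  pose proof (one_plus_sqr_pos t).
  apply Rmult_lt_reg_r with (1 + t ^ 2); auto.
  unfold Rdiv at 1. rewrite Rmult_assoc, Rinv_l, Rmult_1_r by lra.
  rewrite <- (pow2_abs t).
  assert (0 <= K / eps) by (apply Rdiv_le_0_compat; lra).
  assert (E : K = eps * (K / eps)) by (field; lra).
  assert (K / eps < Rabs t) by lra. assert (1 < Rabs t) by lra.
  assert (Rabs t < Rabs t ^ 2) by nra. nra.
Qed.

(** Along the line [kap1] is the [t]-derivative of [kap] divided by [Ci], and [kap] vanishes at both
    ends. This is what makes the line integral of [kap] independent of the abscissa. *)
Lemma kap1_integral (c l s : R) : 0 < c <= 1 -> c <= s <= 2 - c ->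
  is_RInt_RC (fun t => kap1 l (s, t)) (RtoC 0).
Proof.
  intros Hc Hs.
  assert (H : is_RInt_RC (fun t => Ci * kap1 l (s, t))%C (minus (RtoC 0 : CR) (RtoC 0))).
  { apply (is_RInt_R_derive (V := CR) (fun t => kap l (s, t))).
    - intros t. apply (is_derive_kap l (fun t => (s, t)) t Ci (is_derive_line_Im s t)).
      now apply (sn_neq_0 c).
    - intros t. apply continuous_CR_mult.
      + apply (continuous_const (U := R_UniformSpace) (V := CR)).
      + now apply (continuous_kap1 c).
    - apply (filterlim_CR_0 (fun t => kap l (s, t)) (kap_const c l) (Rbar_locally m_infty)).
      + intros t. now apply kap_bound_cauchy.
      + intros M. exists (- Rabs M). intros t Ht. pose proof (Rle_abs M). pose proof (Rabs_pos M).
        rewrite Rabs_left by lra. lra.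
    - apply (filterlim_CR_0 (fun t => kap l (s, t)) (kap_const c l) (Rbar_locally p_infty)).
      + intros t. now apply kap_bound_cauchy.
      + intros M. exists (Rabs M). intros t Ht. pose proof (Rle_abs M). pose proof (Rabs_pos M).
        rewrite Rabs_pos_eq by lra. lra. }
  apply (is_RInt_R_CR_scal (- Ci)%C) in H.
  replace (RtoC 0) with (- Ci * minus (RtoC 0 : CR) (RtoC 0))%C.
  - eapply (is_RInt_R_ext (V := CR)); [|exact H]. intros t. eq_C.
    cbv beta. transitivity (- Ci * Ci * kap1 l (s, t))%C; [ring|].
    replace (- Ci * Ci)%C with (RtoC 1) by (apply injective_projections; simpl; ring).
    ring.
  - change (minus (RtoC 0 : CR) (RtoC 0)) with (0 - 0)%C. ring.
Qed.

(* Cauchy's theorem, by differentiating under the integral in the abscissa. *)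
Lemma kap_shift (c l : R) (I : R -> C) : 0 < c < 1 ->
  (forall s, c / 2 <= s <= 2 - c / 2 -> is_RInt_RC (fun t => kap l (s, t)) (I s)) ->
  I c = I 1.
Proof.
  intros Hc HI.
  apply (eq_is_derive (V := CR)); [|lra]. intros s Hs.
  set (B := kap_const (c / 2) l * kap_ratio (c / 2) l).
  apply (is_derive_RInt_R (V := CR) (fun s t => kap l (s, t)) (fun t => kap1 l (s, t)) I (RtoC 0) s
    (4 * B) (c / 2)); [lra | | |].
  - intros h Hh. apply Rabs_def2 in Hh. apply HI. lra.
  - apply (kap1_integral (c / 2)); lra.
  - intros h t Hh. rewrite norm_CR, scal_CR.
    apply Rabs_def2 in Hh.
    replace (4 * B * h ^ 2 / (1 + t ^ 2)) with (4 * (B / (1 + t ^ 2)) * h ^ 2) by (unfold Rdiv; ring).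
    assert (Hin : forall u, Rabs (u - s) <= Rabs h -> c / 2 <= u <= 2 - c / 2).
    { intros u Hu.
      assert (H : Rabs (u - s) < c / 2) by (eapply Rle_lt_trans; [exact Hu | apply Rabs_def1; lra]).
      apply Rabs_def2 in H. lra. }
    apply (CR_taylor2 (fun s => kap l (s, t)) (fun s => kap1 l (s, t))
      (fun s => kap2 l (s, t)) s h (B / (1 + t ^ 2))).
    + intros u Hu. specialize (Hin u Hu).
      eapply is_derive_CR_eq.
      * apply (is_derive_kap l (fun s => (s, t)) u (RtoC 1) (is_derive_line_Re u t)).
        apply (sn_neq_0 (c / 2)); lra.
      * ring.
    + intros u Hu. specialize (Hin u Hu).
      eapply is_derive_CR_eq.
      * apply (is_derive_kap1 l (fun s => (s, t)) u (RtoC 1) (is_derive_line_Re u t)).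
        apply (sn_neq_0 (c / 2)); lra.
      * ring.
    + intros u Hu. specialize (Hin u Hu). apply Cmod_kap2; lra.
Qed.

(** On [Re w = 1] the sine of [PI w / 2] is the real number [cosh (PI t / 2)]; hence the choice of
    this line. *)
Lemma kap_one (l t : R) :
  kap l (1, t) = (RtoC (PI * exp (- l) * (PI / 2 / cosh (PI * t / 2) ^ 2))
    * (cos (l * t), (- sin (l * t))%R))%C.
Proof.
  pose proof (cosh_pos (PI * t / 2)) as Hc.
  unfold kap, sn. rewrite half_PI_mul, Csin_eq.
  replace (PI * 1 / 2) with (PI / 2) by field. rewrite sin_PI2, cos_PI2, Rmult_0_l, Rmult_1_l.
  set (ch := cosh (PI * t / 2)) in *.
  replace ((ch, 0) : C) with (RtoC ch) by reflexivity.
  rewrite <- RtoC_mult, <- RtoC_inv by nra.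
  replace (- ((1, t) * l))%C with ((- l, - (l * t)) : C) by (apply injective_projections; simpl; ring).
  unfold Cexp. simpl Re. simpl Im. unfold Re, Im; simpl fst; simpl snd.
  rewrite cos_neg, sin_neg. apply injective_projections; simpl; field; lra.
Qed.

(** The line is moved to abscissa 1 by [kap_shift]. There the real part is the transform of
    [sech2_fourier], with the sign of [l] absorbed by parity, and the imaginary part is odd. The
    closed form has no meaning at [l = 0], where it divides by [sinh 0]. *)
Lemma kap_integral (c l : R) : 0 < c < 1 -> l <> 0 ->
  is_RInt_RC (fun t => kap l (c, t)) (RtoC (2 * PI * (exp (- l) * (l / sinh l)))).
Proof.
  intros Hc Hl.
  assert (H1 : is_RInt_RC (fun t => kap l (1, t))
    (RtoC (2 * PI * (exp (- l) * (l / sinh l))))).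
  { assert (Hcos : is_RInt_R (fun t => cos (l * t) * (PI / 2 / cosh (PI * t / 2) ^ 2))
      (2 * (l / sinh l))).
    { destruct (Rlt_dec 0 l) as [Hp|Hn]; [now apply sech2_fourier|].
      pose proof (sech2_fourier (- l) ltac:(lra)) as H.
      replace (l / sinh l) with (- l / sinh (- l)).
      - eapply (is_RInt_R_ext (V := RN)); [|exact H]. intros t. cbv beta.
        replace (- l * t) with (- (l * t)) by ring. now rewrite cos_neg.
      - assert (E : sinh (- l) = - sinh l) by (unfold sinh; rewrite Ropp_involutive; field).
        rewrite E. pose proof (sinh_pos_lt (- l) ltac:(lra)). rewrite E in H0. field. lra. }
    set (k := PI * exp (- l)).
    destruct (is_RInt_R_ex (V := RC)
      (fun t => - sin (l * t) * (PI / 2 / cosh (PI * t / 2) ^ 2)) (PI / 2)) as [m Hm].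
    { intros t. apply continuous_of_ex_derive. unfold cosh. auto_derive.
      pose proof (exp_pos (PI * t / 2)). pose proof (exp_pos (- (PI * t / 2))).
      unfold Rdiv in *. repeat split; nra. }
    { intros t. change (Rabs (- sin (l * t) * (PI / 2 / cosh (PI * t / 2) ^ 2)) <= PI / 2 / (1 + t ^ 2)).
      pose proof (cosh_ge t) as Hge. pose proof (one_plus_sqr_pos t). pose proof PI_RGT_0.
      rewrite Rabs_mult, Rabs_Ropp, (Rabs_pos_eq (_ / _)).
      2:{ apply Rdiv_le_0_compat; [lra | apply pow_lt; lra]. }
      assert (Rabs (sin (l * t)) <= 1) by (apply Rabs_le; pose proof (SIN_bound (l * t)); lra).
      assert (PI / 2 / cosh (PI * t / 2) ^ 2 <= PI / 2 / (1 + t ^ 2)).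
      { apply Rmult_le_compat_l; [lra|]. apply Rinv_le_contravar; auto.
        pose proof (pow2_ge_0 t). nra. }
      assert (0 < PI / 2 / cosh (PI * t / 2) ^ 2).
      { apply Rdiv_lt_0_compat; [lra | apply pow_lt; lra]. }
      pose proof (Rabs_pos (sin (l * t))). nra. }
    (* The imaginary integrand is odd, so its integral equals its own opposite. *)
    assert (E : m = 0).
    { pose proof (is_RInt_R_reflect (V := RN) _ _ Hm) as Hr.
      assert (Ho : is_RInt_R (fun t => -1 * (- sin (l * t) * (PI / 2 / cosh (PI * t / 2) ^ 2))) m).
      { eapply (is_RInt_R_ext (V := RN)); [|exact Hr]. intros t. cbv beta.
        replace (l * - t) with (- (l * t)) by ring. rewrite sin_neg.
        replace (PI * - t / 2) with (- (PI * t / 2)) by field.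
        rewrite cosh_neg. eq_R. ring. }
      pose proof (is_RInt_R_scal (V := RN) _ (-1) _ Hm) as Hs.
      pose proof (is_RInt_R_unique (V := RC) _ _ _ Ho Hs) as Eq.
      change (m = -1 * m) in Eq. lra. }
    subst m.
    apply is_RInt_R_CR.
    - replace (Re (RtoC (2 * PI * (exp (- l) * (l / sinh l))))) with (scal k (2 * (l / sinh l)))
        by (unfold Re, scal; simpl; unfold mult; simpl; unfold k; ring).
      eapply (is_RInt_R_ext (V := RN));
        [|apply (is_RInt_R_scal (V := RN)), Hcos].
      intros t. rewrite kap_one. unfold Re, scal; simpl; unfold mult; simpl; unfold k. ring.
    - replace (Im (RtoC (2 * PI * (exp (- l) * (l / sinh l))))) with (scal k (0 : R))
        by (unfold Im, scal; simpl; unfold mult; simpl; ring).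
      eapply (is_RInt_R_ext (V := RN));
        [|apply (is_RInt_R_scal (V := RN)), Hm].
      intros t. rewrite kap_one. unfold Im, scal; simpl; unfold mult; simpl; unfold k. ring. }
  set (I := fun s => RInt_gen (V := CR) (fun t => kap l (s, t)) (Rbar_locally m_infty) (Rbar_locally p_infty)).
  assert (HI : forall s, c / 2 <= s <= 2 - c / 2 -> is_RInt_RC (fun t => kap l (s, t)) (I s)).
  { intros s Hs. unfold I, is_RInt_R. apply (RInt_gen_correct (V := CR)).
    apply (kap_integrable (c / 2)); lra. }
  pose proof (kap_shift c l I Hc HI) as E.
  pose proof (is_RInt_R_unique (V := CR) _ _ _ (HI 1 ltac:(lra)) H1) as E1.
  rewrite <- E1, <- E. apply HI. lra.
Qed.

(** * Integrals of Dirichlet polynomials against the kernel *)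

Definition is_J (c : R) (F : R -> C) (l : C) :=
  is_RInt_RC (fun t => kap 0 (c, t) * F t)%C l.

Definition Jint (c : R) (F : R -> C) : C :=
  RInt_gen (V := CR) (fun t => kap 0 (c, t) * F t)%C
    (Rbar_locally m_infty) (Rbar_locally p_infty).

(** Half of the decay of the kernel is spent here: integrands may grow like [1 + t ^ 2], which is
    the bound available for the product of the two zeta factors. *)
Lemma kap_mul_bound (c t B : R) (z : C) : 0 < c < 1 -> Cmod z <= B * (1 + t ^ 2) ->
  Cmod (kap 0 (c, t) * z)%C <= kap_const c 0 * B / (1 + t ^ 2).
Proof.
  intros Hc Hz. pose proof (Cmod_kap c 0 c t ltac:(lra) ltac:(lra)) as H.
  pose proof (one_plus_sqr_pos t) as Ht. rewrite Cmod_mult.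
  replace (kap_const c 0 * B / (1 + t ^ 2))
    with (kap_const c 0 / (1 + t ^ 2) ^ 2 * (B * (1 + t ^ 2))) by (field; lra).
  apply Rmult_le_compat; auto; apply Cmod_ge_0.
Qed.

Lemma Jint_correct (c B : R) (F : R -> C) : 0 < c < 1 ->
  (forall t, continuousC F t) -> (forall t, Cmod (F t) <= B * (1 + t ^ 2)) ->
  is_J c F (Jint c F).
Proof.
  intros Hc HF HB. unfold is_J, Jint, is_RInt_R.
  apply (RInt_gen_correct (V := CR)).
  apply (is_RInt_R_ex (V := CR) _ (kap_const c 0 * B)).
  - intros t. apply continuous_CR_mult; auto. apply (continuous_kap c); lra.
  - intros t. rewrite norm_CR. now apply kap_mul_bound.
Qed.

Lemma is_J_unique (c : R) (F : R -> C) (l1 l2 : C) : is_J c F l1 -> is_J c F l2 -> l1 = l2.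
Proof. apply (is_RInt_R_unique (V := CR)). Qed.

Lemma is_J_ext (c : R) (F G : R -> C) (l : C) :
  (forall t, F t = G t) -> is_J c F l -> is_J c G l.
Proof. intros H. apply (is_RInt_R_ext (V := CR)). intros t. now rewrite H. Qed.

Lemma is_J_bound (c B : R) (F : R -> C) (l : C) : 0 < c < 1 -> is_J c F l ->
  (forall t, Cmod (F t) <= B * (1 + t ^ 2)) -> Cmod l <= kap_const c 0 * B * PI.
Proof.
  intros Hc Hl HB. rewrite <- norm_CR. apply (is_RInt_R_bound (V := CR) _ l _ Hl).
  intros t. rewrite norm_CR. now apply kap_mul_bound.
Qed.

Lemma is_J_plus (c : R) (F G : R -> C) (a b : C) :
  is_J c F a -> is_J c G b -> is_J c (fun t => F t + G t)%C (a + b)%C.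
Proof.
  intros Ha Hb. pose proof (is_RInt_R_CR_plus _ _ _ _ Ha Hb) as H.
  revert H. apply (is_RInt_R_ext (V := CR)). intros t. eq_C. ring.
Qed.

Lemma is_J_scal (c : R) (k : C) (F : R -> C) (a : C) :
  is_J c F a -> is_J c (fun t => k * F t)%C (k * a)%C.
Proof.
  intros Ha. pose proof (is_RInt_R_CR_scal k _ _ Ha) as H.
  revert H. apply (is_RInt_R_ext (V := CR)). intros t. eq_C. ring.
Qed.

Lemma is_J_minus (c : R) (F G : R -> C) (a b : C) :
  is_J c F a -> is_J c G b -> is_J c (fun t => F t - G t)%C (a - b)%C.
Proof.
  intros Ha Hb. pose proof (is_RInt_R_CR_minus _ _ _ _ Ha Hb) as H.
  revert H. apply (is_RInt_R_ext (V := CR)). intros t. eq_C. ring.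
Qed.

Lemma is_J_csum (c : R) (F : nat -> R -> C) (a : nat -> C) (N : nat) :
  (forall k, is_J c (F k) (a k)) -> is_J c (fun t => csum (fun k => F k t) N) (csum a N).
Proof.
  intros H. induction N as [|N IH]; simpl.
  - pose proof (is_J_scal c 0 _ _ (H O)) as H0. rewrite Cmult_0_l in H0.
    revert H0. apply is_J_ext. intros t. ring.
  - now apply is_J_plus.
Qed.

(** Common properties of the exponents [w] and [1 - w] on the line, so that each power integral is
    treated once. [ge_pred] bounds the factor [p - 1] in the second derivative of [u ^ p / p]. *)
Record good_exponent (q : R) (p : R -> C) : Prop := {
  ge_q : 0 < q < 1;
  ge_cont : forall t, continuousC p t;
  ge_Re : forall t, Re (p t) = q;
  ge_pred : forall t, Cmod (p t - 1) <= 2 * (1 + t ^ 2) }.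

Lemma Re_pos_neq_0 (z : C) : 0 < Re z -> z <> 0%C.
Proof. intros H E. rewrite E in H. simpl in H. lra. Qed.

Lemma Cmod_line_le (c t : R) : 0 < c < 1 -> Cmod (c, t) <= 2 * (1 + t ^ 2).
Proof.
  intros Hc. eapply Rle_trans; [apply Cmod_le_Re_Im|]. unfold Re, Im; simpl fst; simpl snd.
  rewrite (Rabs_pos_eq c) by lra. rewrite <- (pow2_abs t). pose proof (Rabs_pos t).
  pose proof (pow2_ge_0 (Rabs t - 1)). nra.
Qed.

Lemma continuous_line (c t : R) : continuousC (fun t => ((c, t) : C)) t.
Proof. eapply is_derive_CR_continuous, is_derive_line_Im. Qed.

Lemma continuous_CR_minus (f g : R -> C) (x : R) :
  continuousC f x -> continuousC g x ->
  continuousC (fun t => f t - g t)%C x.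
Proof. intros; now apply (continuous_minus (V := CR)). Qed.

Lemma continuous_CR_const (k : C) (x : R) : continuousC (fun _ : R => k) x.
Proof. apply (continuous_const (U := R_UniformSpace) (V := CR)). Qed.

Lemma Cmod_one_minus_line (c t : R) : 0 < c < 1 -> Cmod (1 - (c, t))%C <= 2 * (1 + t ^ 2).
Proof.
  intros Hc. replace (1 - (c, t))%C with ((1 - c, - t) : C)
    by (apply injective_projections; simpl; ring).
  replace (t ^ 2) with ((- t) ^ 2) by ring. apply Cmod_line_le. lra.
Qed.

Lemma good_exponent_w (c : R) : 0 < c < 1 -> good_exponent c (fun t => (c, t)).
Proof.
  intros Hc. constructor; auto.
  - intros t. apply continuous_line.
  - intros t. rewrite <- Cmod_opp. replace (- ((c, t) - 1))%C with (1 - (c, t))%C by ring.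
    now apply Cmod_one_minus_line.
Qed.

Lemma good_exponent_1w (c : R) : 0 < c < 1 -> good_exponent (1 - c) (fun t => 1 - (c, t))%C.
Proof.
  intros Hc. constructor; [lra| | |].
  - intros t. apply continuous_CR_minus; [apply continuous_CR_const | apply continuous_line].
  - intros t. reflexivity.
  - intros t. rewrite <- Cmod_opp. replace (- (1 - (c, t) - 1))%C with ((c, t) : C) by (generalize ((c, t) : C); intros; ring).
    now apply Cmod_line_le.
Qed.

Lemma continuous_CR_comp_Cexp (g : R -> C) (x : R) :
  continuousC g x -> continuousC (fun t => Cexp (g t)) x.
Proof.
  intros H. pose proof (continuous_CR_Re _ _ H) as Hr. pose proof (continuous_CR_Im _ _ H) as Hi.
  assert (E1 : continuous (fun t => exp (Re (g t))) x).
  { apply (continuous_comp (fun t => Re (g t)) exp); auto.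
    apply continuous_of_ex_derive. auto_derive. auto. }
  assert (E2 : continuous (fun t => cos (Im (g t))) x).
  { apply (continuous_comp (fun t => Im (g t)) cos); auto.
    apply continuous_of_ex_derive. auto_derive. auto. }
  assert (E3 : continuous (fun t => sin (Im (g t))) x).
  { apply (continuous_comp (fun t => Im (g t)) sin); auto.
    apply continuous_of_ex_derive. auto_derive. auto. }
  apply continuous_CR.
  - apply (continuous_ext (fun t => exp (Re (g t)) * cos (Im (g t)))).
    { intros t. unfold Cexp, Re, Im; simpl. ring. }
    now apply continuous_multR.
  - apply (continuous_ext (fun t => exp (Re (g t)) * sin (Im (g t)))).
    { intros t. unfold Cexp, Re, Im; simpl. ring. }
    now apply continuous_multR.
Qed.

Lemma continuous_RCpow_exponent (y : R) (p : R -> C) (t : R) :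
  continuousC p t -> continuousC (fun t => RCpow y (p t)) t.
Proof.
  intros H. unfold RCpow. apply continuous_CR_comp_Cexp.
  apply continuous_CR_mult; auto. apply continuous_CR_const.
Qed.

Lemma continuous_CR_inv (g : R -> C) (x : R) :
  continuousC g x -> g x <> 0%C -> continuousC (fun t => / g t)%C x.
Proof.
  intros H H0. pose proof (continuous_CR_Re _ _ H) as Hr. pose proof (continuous_CR_Im _ _ H) as Hi.
  assert (Hd : 0 < Re (g x) ^ 2 + Im (g x) ^ 2).
  { apply Cmod_gt_0 in H0. rewrite <- Cmod2_alt. now apply pow_lt. }
  assert (Hm : continuous (fun t => / (Re (g t) ^ 2 + Im (g t) ^ 2)) x).
  { apply (continuous_comp (fun t => Re (g t) ^ 2 + Im (g t) ^ 2) Rinv).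
    - apply (continuous_ext (fun t => plus (mult (Re (g t)) (Re (g t))) (mult (Im (g t)) (Im (g t))))).
      { intros t. unfold plus, mult; simpl. ring. }
      apply (continuous_plus (V := RN)); now apply continuous_multR.
    - apply continuous_of_ex_derive. auto_derive. simpl in *; lra. }
  apply continuous_CR.
  - apply (continuous_ext (fun t => mult (Re (g t)) (/ (Re (g t) ^ 2 + Im (g t) ^ 2)))); [reflexivity|].
    now apply continuous_multR.
  - apply (continuous_ext (fun t => mult (opp (Im (g t))) (/ (Re (g t) ^ 2 + Im (g t) ^ 2)))); [reflexivity|].
    apply continuous_multR; auto. now apply (continuous_opp (V := RN)).
Qed.

(** Kernel integrals of [y ^ p / p] and of its [y]-derivative [y ^ (p - 1)]. The former stem from
    the correction terms [N ^ (1 - w) / (1 - w)] of the approximants, the latter from the product of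
    their Dirichlet sums. *)
Definition Pow0 (c : R) (p : R -> C) (y : R) : C := Jint c (fun t => RCpow y (p t) * / p t)%C.
Definition Pow1 (c : R) (p : R -> C) (y : R) : C := Jint c (fun t => RCpow y (p t - 1)%C).

Lemma Rle_mul_one_plus_sqr (B t : R) : 0 <= B -> B <= B * (1 + t ^ 2).
Proof. intros HB. pose proof (pow2_ge_0 t). nra. Qed.

Lemma Cmod_pow_div (q y : R) (p : R -> C) (t : R) : good_exponent q p ->
  Cmod (RCpow y (p t) * / p t)%C <= Rpower y q / q.
Proof.
  intros [Hq Hc Hr Hp].
  assert (H0 : p t <> 0%C) by (apply Re_pos_neq_0; rewrite Hr; lra).
  rewrite Cmod_mult, Cmod_inv, Cmod_RCpow, Hr by auto.
  apply Rmult_le_compat_l; [left; apply exp_pos|].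
  apply Rinv_le_contravar; [lra|]. rewrite <- (Hr t).
  eapply Rle_trans; [apply Rle_abs | apply re_le_Cmod].
Qed.

Lemma is_J_Pow0 (c q y : R) (p : R -> C) : 0 < c < 1 -> good_exponent q p ->
  is_J c (fun t => RCpow y (p t) * / p t)%C (Pow0 c p y).
Proof.
  intros Hc Hp. pose proof (ge_q _ _ Hp) as Hq. pose proof (ge_Re _ _ Hp) as Hr.
  apply (Jint_correct c (Rpower y q / q)); auto.
  - intros t. apply continuous_CR_mult.
    + apply continuous_RCpow_exponent, (ge_cont _ _ Hp).
    + apply continuous_CR_inv; [apply (ge_cont _ _ Hp)|].
      apply Re_pos_neq_0. rewrite Hr. lra.
  - intros t. eapply Rle_trans; [now apply (Cmod_pow_div q)|].
    apply Rle_mul_one_plus_sqr. apply Rdiv_le_0_compat; [left; apply exp_pos | lra].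
Qed.

Lemma is_J_Pow1 (c q y : R) (p : R -> C) : 0 < c < 1 -> good_exponent q p ->
  is_J c (fun t => RCpow y (p t - 1)%C) (Pow1 c p y).
Proof.
  intros Hc Hp. pose proof (ge_q _ _ Hp) as Hq. pose proof (ge_Re _ _ Hp) as Hr.
  apply (Jint_correct c (Rpower y (q - 1))); auto.
  - intros t. apply (continuous_RCpow_exponent y (fun t => (p t - 1)%C)).
    apply continuous_CR_minus; [apply (ge_cont _ _ Hp) | apply continuous_CR_const].
  - intros t. rewrite Cmod_RCpow. change (Re (p t - 1)) with (Re (p t) - 1). rewrite Hr.
    apply Rle_mul_one_plus_sqr. left. apply exp_pos.
Qed.

Lemma Pow0_bound (c q y : R) (p : R -> C) : 0 < c < 1 -> good_exponent q p ->
  Cmod (Pow0 c p y) <= kap_const c 0 * PI / q * Rpower y q.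
Proof.
  intros Hc Hp. pose proof (ge_q _ _ Hp) as Hq.
  replace (kap_const c 0 * PI / q * Rpower y q) with (kap_const c 0 * (Rpower y q / q) * PI)
    by (field; lra).
  apply (is_J_bound c _ _ _ Hc (is_J_Pow0 c q y p Hc Hp)).
  intros t. eapply Rle_trans; [now apply (Cmod_pow_div q)|].
  apply Rle_mul_one_plus_sqr. apply Rdiv_le_0_compat; [left; apply exp_pos | lra].
Qed.

Lemma Rpower_le_neg (a b q : R) : 0 < a <= b -> q <= 0 -> Rpower b q <= Rpower a q.
Proof.
  intros Hab Hq. unfold Rpower. apply exp_le.
  assert (ln a <= ln b).
  { destruct (Req_dec a b) as [->|]; [lra|]. left. apply ln_increasing; lra. }
  nra.
Qed.

Lemma is_derive_Pow0 (c q y : R) (p : R -> C) : 0 < c < 1 -> good_exponent q p -> 0 < y ->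
  is_deriveC (Pow0 c p) y (Pow1 c p y).
Proof.
  intros Hc Hp Hy. pose proof (ge_q _ _ Hp) as Hq. pose proof (ge_Re _ _ Hp) as Hr.
  (* For [u >= y / 2] this bounds the second derivative [(p - 1) u ^ (p - 2)] up to the factor
     [1 + t ^ 2], which the kernel absorbs. *)
  set (B := 2 * Rpower (y / 2) (q - 2)).
  apply (is_derive_RInt_R (V := CR) (fun y t => kap 0 (c, t) * (RCpow y (p t) * / p t))%C
    (fun t => kap 0 (c, t) * RCpow y (p t - 1))%C (Pow0 c p) (Pow1 c p y) y
    (kap_const c 0 * (4 * B)) (y / 2)); [lra | | |].
  - intros h _. now apply (is_J_Pow0 c q).
  - now apply (is_J_Pow1 c q).
  - intros h t Hh. rewrite norm_CR, scal_CR.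
    change (Cmod ((kap 0 (c, t) * (RCpow (y + h) (p t) * / p t)
      - kap 0 (c, t) * (RCpow y (p t) * / p t)) - RtoC h * (kap 0 (c, t) * RCpow y (p t - 1)))%C
      <= kap_const c 0 * (4 * B) * h ^ 2 / (1 + t ^ 2)).
    replace ((kap 0 (c, t) * (RCpow (y + h) (p t) * / p t)
      - kap 0 (c, t) * (RCpow y (p t) * / p t)) - RtoC h * (kap 0 (c, t) * RCpow y (p t - 1)))%C
      with (kap 0 (c, t) * ((RCpow (y + h) (p t) * / p t) - (RCpow y (p t) * / p t)
        - h * RCpow y (p t - 1)))%C by ring.
    replace (kap_const c 0 * (4 * B) * h ^ 2 / (1 + t ^ 2))
      with (kap_const c 0 * (4 * B * h ^ 2) / (1 + t ^ 2)) by (unfold Rdiv; ring).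
    apply kap_mul_bound; auto.
    assert (H0 : p t <> 0%C) by (apply Re_pos_neq_0; rewrite Hr; lra).
    assert (Hin : forall u, Rabs (u - y) <= Rabs h -> y / 2 <= u).
    { intros u Hu. assert (H1 : Rabs (u - y) < y / 2) by lra. apply Rabs_def2 in H1. lra. }
    replace (4 * B * h ^ 2 * (1 + t ^ 2)) with (4 * (B * (1 + t ^ 2)) * h ^ 2) by ring.
    apply (CR_taylor2 (fun u => RCpow u (p t) * / p t)%C (fun u => RCpow u (p t - 1))
      (fun u => (p t - 1) * RCpow u (p t - 1 - 1))%C y h (B * (1 + t ^ 2))).
    + intros u Hu. specialize (Hin u Hu).
      eapply is_derive_CR_eq.
      * apply (is_derive_CR_mult (fun u => RCpow u (p t)) (fun _ => / p t)%C).
        -- apply is_derive_RCpow. lra.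
        -- apply is_derive_CR_const.
      * field. auto.
    + intros u Hu. specialize (Hin u Hu). apply is_derive_RCpow. lra.
    + intros u Hu. specialize (Hin u Hu). rewrite Cmod_mult, Cmod_RCpow.
      change (Re (p t - 1 - 1)) with (Re (p t) - 1 - 1). rewrite Hr.
      unfold B. replace (2 * Rpower (y / 2) (q - 2) * (1 + t ^ 2))
        with (2 * (1 + t ^ 2) * Rpower (y / 2) (q - 2)) by ring.
      apply Rmult_le_compat; [apply Cmod_ge_0 | left; apply exp_pos | apply (ge_pred _ _ Hp) |].
      replace (q - 1 - 1) with (q - 2) by ring. apply Rpower_le_neg; lra.
Qed.

Lemma kap_RCpow (y : R) (w : C) : (kap 0 w * RCpow y (- w) = kap (ln y) w)%C.
Proof.
  unfold kap, RCpow.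
  replace (- (w * 0))%C with (RtoC 0) by ring. rewrite Cexp_0.
  replace (- w * ln y)%C with (- (w * ln y))%C by ring. ring.
Qed.

Lemma Pow1_1w (c y : R) : 0 < c < 1 -> 0 < y -> ln y <> 0 ->
  Pow1 c (fun t => 1 - (c, t))%C y = RtoC (2 * PI * (exp (- ln y) * (ln y / sinh (ln y)))).
Proof.
  intros Hc Hy Hl.
  pose proof (is_J_Pow1 c (1 - c) y _ Hc (good_exponent_1w c Hc)) as H.
  apply (is_RInt_R_unique (V := CR) _ _ _ H).
  eapply (is_RInt_R_ext (V := CR)); [|apply (kap_integral c (ln y) Hc Hl)].
  intros t. eq_C. transitivity (kap 0 (c, t) * RCpow y (- (c, t)))%C; [symmetry; apply kap_RCpow|].
  apply (f_equal (fun z => kap 0 (c, t) * RCpow y z)%C). generalize ((c, t) : C). intros; ring.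
Qed.

Lemma RCpow_inv_l (y : R) (w : C) : 0 < y -> RCpow (/ y) w = RCpow y (- w).
Proof.
  intros Hy. unfold RCpow. rewrite ln_Rinv by auto. f_equal. rewrite RtoC_opp. ring.
Qed.

Lemma RCpow_mul_l (a b : R) (w : C) : 0 < a -> 0 < b ->
  RCpow (a * b) w = (RCpow a w * RCpow b w)%C.
Proof.
  intros Ha Hb. unfold RCpow. rewrite ln_mult, RtoC_plus, <- Cexp_plus by auto. f_equal. ring.
Qed.

Lemma Pow1_w (c y : R) : 0 < c < 1 -> 0 < y ->
  Pow1 c (fun t => (c, t)) y = (/ y * Pow1 c (fun t => 1 - (c, t))%C (/ y))%C.
Proof.
  intros Hc Hy.
  pose proof (is_J_Pow1 c c y _ Hc (good_exponent_w c Hc)) as H.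
  pose proof (is_J_Pow1 c (1 - c) (/ y) _ Hc (good_exponent_1w c Hc)) as H2.
  apply (is_J_scal c (/ y)%C) in H2.
  apply (is_J_unique c _ _ _ H). revert H2. apply is_J_ext. intros t.
  rewrite RCpow_inv_l by auto.
  replace (- (1 - (c, t) - 1))%C with ((c, t) : C) by (generalize ((c, t) : C); intros; ring).
  rewrite RCpow_pred by auto. ring.
Qed.

Definition Phi (c y : R) : C :=
  (Pow0 c (fun t => 1 - (c, t)) y - Pow0 c (fun t => (c, t)) y)%C.

(** Separately the two integrals are [4 PI ln y / (y ^ 2 - 1)] and [y] times this; the difference
    cancels the factor [y - 1]. This is how antisymmetrising produces [ln y / (1 + y)]. *)
Lemma Pow1_diff (c y : R) : 0 < c < 1 -> 0 < y ->
  (Pow1 c (fun t => 1 - (c, t)) y - Pow1 c (fun t => (c, t)) y)%C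
  = RtoC (- 4 * PI * (ln y / (1 + y))).
Proof.
  (* [kap_integral] excludes [ln y = 0]; at [y = 1] the two terms coincide by [Pow1_w]. *)
  intros Hc Hy. destruct (Req_dec y 1) as [->|Hy1].
  - rewrite Pow1_w by lra. rewrite Rinv_1, ln_1. replace (/ 1)%C with (RtoC 1) by field.
    replace (-4 * PI * (0 / (1 + 1))) with 0 by field. ring.
  - assert (Hl : ln y <> 0).
    { intros E. apply Hy1. rewrite <- (exp_ln y), E by auto. apply exp_0. }
    rewrite Pow1_w by lra.
    rewrite !Pow1_1w; auto.
    2: now apply Rinv_0_lt_compat.
    2: rewrite ln_Rinv by auto; lra.
    rewrite ln_Rinv, Ropp_involutive, exp_Ropp, exp_ln by auto.
    assert (E : sinh (- ln y) = - sinh (ln y)) by (unfold sinh; rewrite Ropp_involutive; field).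
    rewrite E.
    assert (Es : sinh (ln y) = (y - / y) / 2).
    { unfold sinh. rewrite exp_Ropp, exp_ln by auto. reflexivity. }
    rewrite Es, <- RtoC_inv, <- RtoC_mult, <- RtoC_minus by lra. f_equal.
    field. repeat split; try lra. intros E2. apply Hy1. nra.
Qed.

Lemma is_derive_Phi (c y : R) : 0 < c < 1 -> 0 < y ->
  is_deriveC (Phi c) y (RtoC (- 4 * PI * (ln y / (1 + y)))).
Proof.
  intros Hc Hy. rewrite <- (Pow1_diff c) by auto. unfold Phi.
  apply is_derive_CR_minus.
  - apply (is_derive_Pow0 c (1 - c)); auto. now apply good_exponent_1w.
  - apply (is_derive_Pow0 c c); auto. now apply good_exponent_w.
Qed.

Lemma Rpower_le_1 (y a b : R) : 0 < y <= 1 -> b <= a -> Rpower y a <= Rpower y b.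
Proof.
  intros Hy Hab. unfold Rpower. apply exp_le.
  assert (ln y <= 0).
  { rewrite <- ln_1. destruct (Req_dec y 1) as [->|]; [lra|]. left. apply ln_increasing; lra. }
  nra.
Qed.

Lemma Phi_bound (c : R) : 0 < c < 1 ->
  exists K, forall y, 0 < y <= 1 -> Cmod (Phi c y) <= K * Rpower y (Rmin c (1 - c)).
Proof.
  intros Hc. pose proof (kap_const_pos c 0 ltac:(lra)) as Hk. pose proof PI_RGT_0 as HP.
  exists (kap_const c 0 * PI / (1 - c) + kap_const c 0 * PI / c). intros y Hy.
  eapply Rle_trans; [apply Cmod_triangle|]. rewrite Cmod_opp, Rmult_plus_distr_r.
  apply Rplus_le_compat.
  - eapply Rle_trans; [apply (Pow0_bound c (1 - c)); auto; now apply good_exponent_1w|].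
    apply Rmult_le_compat_l; [apply Rdiv_le_0_compat; nra|].
    apply Rpower_le_1; auto. apply Rmin_r.
  - eapply Rle_trans; [apply (Pow0_bound c c); auto; now apply good_exponent_w|].
    apply Rmult_le_compat_l; [apply Rdiv_le_0_compat; nra|].
    apply Rpower_le_1; auto. apply Rmin_l.
Qed.

(** The function is constant, and the constant is tested at the points [1 / (n + 1)], where the
    power bound tends to zero. *)
Lemma constant_on_pos (f : R -> R) (q K : R) : 0 < q ->
  (forall y, 0 < y -> is_derive f y 0) ->
  (forall y, 0 < y <= 1 -> Rabs (f y) <= K * Rpower y q) ->
  forall y, 0 < y -> f y = 0.
Proof.
  intros Hq Hd HK y Hy.
  assert (Hc : forall z, 0 < z -> z < y -> f z = f y).
  { intros z Hz Hzy. apply (eq_is_derive (V := RN)); auto.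
    intros t Ht. apply Hd. lra. }
  assert (Hb : forall n, Rabs (f y) <= Rabs K * Rpower (INR (S n)) (- q) \/ / INR (S n) >= y).
  { intros n. pose proof (INR_S_ge_1 n) as Hn.
    assert (Hi : 0 < / INR (S n)) by (apply Rinv_0_lt_compat; lra).
    destruct (Rlt_dec (/ INR (S n)) y) as [H|H]; [left|right; lra].
    rewrite <- (Hc _ Hi H).
    assert (Hi1 : / INR (S n) <= 1) by (rewrite <- Rinv_1; apply Rinv_le_contravar; lra).
    eapply Rle_trans; [apply HK; lra|].
    replace (Rpower (/ INR (S n)) q) with (Rpower (INR (S n)) (- q)).
    - apply Rmult_le_compat_r; [left; apply exp_pos | apply Rle_abs].
    - unfold Rpower. rewrite ln_Rinv by lra. f_equal. ring. }
  assert (Hz : Rabs (f y) <= 0).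
  { apply (is_lim_seq_le_loc (fun _ => Rabs (f y)) (fun n => Rabs K * Rpower (INR (S n)) (- q))
      (Rabs (f y)) 0).
    - assert (Hi : is_lim_seq (fun n => / INR (S n)) 0).
      { replace (Finite 0) with (Rbar_inv p_infty) by reflexivity.
        apply is_lim_seq_inv; [|discriminate].
        apply (is_lim_seq_incr_1 INR). apply is_lim_seq_INR. }
      apply is_lim_seq_spec in Hi. destruct (Hi (mkposreal y Hy)) as [N HN].
      exists N. intros n Hn. specialize (HN n Hn). cbn [pos] in HN.
      rewrite Rminus_0_r in HN. destruct (Hb n) as [H|H]; auto.
      pose proof (Rle_abs (/ INR (S n))). lra.
    - apply is_lim_seq_const.
    - replace (Finite 0) with (Rbar_mult (Rabs K) 0) by (simpl; f_equal; ring).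
      apply is_lim_seq_scal_l. now apply is_lim_seq_Rpower_neg. }
  destruct (Req_dec (f y) 0) as [E|E]; auto. apply Rabs_pos_lt in E. lra.
Qed.

(** [ell] is the primitive of [ln y / (1 + y)] that vanishes at 0. The power bound, inherited from
    [y ^ c] and [y ^ (1 - c)], normalises it and also forces the imaginary part of [Phi], whose
    derivative is zero, to vanish. *)
Lemma Phi_real (c : R) : 0 < c < 1 ->
  exists ell : R -> R, (forall y, 0 < y -> is_derive ell y (ln y / (1 + y))) /\
    (exists q K, 0 < q /\ forall y, 0 < y <= 1 -> Rabs (ell y) <= K * Rpower y q) /\
    (forall y, 0 < y -> Phi c y = RtoC (- 4 * PI * ell y)).
Proof.
  intros Hc. pose proof PI_RGT_0 as HP. destruct (Phi_bound c Hc) as [K HK].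
  assert (Hq : 0 < Rmin c (1 - c)) by (apply Rmin_pos; lra).
  exists (fun y => / (- 4 * PI) * Re (Phi c y)). split; [|split].
  - intros y Hy. pose proof (is_derive_CR_Re _ _ _ (is_derive_Phi c y Hc Hy)) as H.
    replace (ln y / (1 + y)) with (/ (-4 * PI) * Re (RtoC (- 4 * PI * (ln y / (1 + y))))).
    + now apply is_derive_scal.
    + unfold Re; simpl. field. lra.
  - exists (Rmin c (1 - c)), (/ (4 * PI) * K). split; auto. intros y Hy.
    rewrite Rabs_mult.
    replace (Rabs (/ (-4 * PI))) with (/ (4 * PI)).
    + rewrite Rmult_assoc. apply Rmult_le_compat_l; [left; apply Rinv_0_lt_compat; lra|].
      eapply Rle_trans; [apply re_le_Cmod | now apply HK].
    + replace (/ (-4 * PI)) with (- / (4 * PI)) by (field; lra).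
      rewrite Rabs_Ropp, Rabs_pos_eq; auto. left. apply Rinv_0_lt_compat. lra.
  - intros y Hy. rewrite (C_eta (Phi c y)).
    assert (E : Im (Phi c y) = 0).
    { apply (constant_on_pos (fun y => Im (Phi c y)) (Rmin c (1 - c)) K); auto.
      - intros z Hz. apply (is_derive_CR_Im _ _ _ (is_derive_Phi c z Hc Hz)).
      - intros z Hz. eapply Rle_trans; [apply im_le_Cmod | now apply HK]. }
    rewrite E. apply injective_projections; simpl; [field; lra | reflexivity].
Qed.

(** * Approximants of zeta and the resulting double sum *)

Definition zeta_approx (M : nat) (s : C) : C :=
  (csum (fun k => RCpow (INR (S k)) (- s)) (S M) - RCpow (INR (S M)) (1 - s) * / (1 - s))%C.

Definition HM (c x : R) (M : nat) : C :=
  Jint c (fun t => zeta_approx M (c, t) * zeta_approx M (1 - (c, t)) * RCpow x (- (c, t)))%C.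

(** The integral of [zeta_approx M w * zeta_approx M (1 - w) * x ^ (- w)], multiplied out: Dirichlet
    sum against Dirichlet sum, the two mixed terms, and the product of the correction terms. The
    last is [N x ^ (- w) / (w (1 - w))] with [N = M + 1], split by [1 / w + 1 / (1 - w)]. *)
Definition Hsum (c x : R) (M : nat) : C :=
  (csum (fun i => csum (fun j => / INR (S j) * Pow1 c (fun t => 1 - (c, t)) (x * INR (S i) / INR (S j))%R) (S M)) (S M)
   - / x * csum (fun j => Pow0 c (fun t => 1 - (c, t)) (INR (S M) * x / INR (S j))%R) (S M)
   - csum (fun i => Pow0 c (fun t => (c, t)) (INR (S M) / (x * INR (S i)))%R) (S M)
   + INR (S M) * (/ x * Pow0 c (fun t => 1 - (c, t)) x + Pow0 c (fun t => (c, t)) (/ x)%R))%C.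

Lemma RtoC_neq_0 (r : R) : r <> 0 -> RtoC r <> 0%C.
Proof. intros H E. apply H. now injection E. Qed.

Lemma is_J_HM (c x : R) (M : nat) : 0 < c < 1 -> 0 < x ->
  is_J c (fun t => zeta_approx M (c, t) * zeta_approx M (1 - (c, t)) * RCpow x (- (c, t)))%C
    (Hsum c x M).
Proof.
  intros Hc Hx. unfold Hsum.
  pose proof (good_exponent_w c Hc) as Gw. pose proof (good_exponent_1w c Hc) as G1.
  assert (HM0 : 0 < INR (S M)) by (pose proof (INR_S_ge_1 M); lra).
  eapply is_J_ext.
  2:{ apply is_J_plus; [apply is_J_minus; [apply is_J_minus|]|].
      - apply (is_J_csum c (fun i t => csum (fun j => / INR (S j) *
          RCpow (x * INR (S i) / INR (S j))%R (1 - (c, t) - 1)) (S M))%C).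
        intros i. apply (is_J_csum c (fun j t => / INR (S j) *
          RCpow (x * INR (S i) / INR (S j))%R (1 - (c, t) - 1))%C).
        intros j. apply is_J_scal. now apply (is_J_Pow1 c (1 - c)).
      - apply is_J_scal. apply (is_J_csum c (fun j t =>
          RCpow (INR (S M) * x / INR (S j))%R (1 - (c, t)) * / (1 - (c, t)))%C).
        intros j. now apply (is_J_Pow0 c (1 - c)).
      - apply (is_J_csum c (fun i t => RCpow (INR (S M) / (x * INR (S i)))%R (c, t) * / (c, t))%C).
        intros i. now apply (is_J_Pow0 c c).
      - apply is_J_scal. apply is_J_plus.
        + apply is_J_scal. apply (is_J_Pow0 c (1 - c)); auto.
        + apply (is_J_Pow0 c c); auto. }
  intros t. cbv beta. set (w := (c, t) : C).
  assert (Hw : w <> 0%C) by (apply Re_pos_neq_0; simpl; lra).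
  assert (H1w : (1 - w)%C <> 0%C) by (apply Re_pos_neq_0; simpl; lra).
  unfold zeta_approx. replace (1 - (1 - w))%C with w by ring.
  set (X := RCpow x (- w)). set (T := INR (S M)) in *.
  assert (Hj : forall j, 0 < INR (S j)) by (intros j; pose proof (INR_S_ge_1 j); lra).
  assert (Hinv : forall a, 0 < a -> RCpow (/ a) w = RCpow a (- w)).
  { intros a Ha. now apply RCpow_inv_l. }
  assert (HX1 : (RCpow x (1 - w) = x * X)%C).
  { unfold X, Cminus. rewrite RCpow_plus, RCpow_1 by auto. reflexivity. }
  assert (E1 : forall i j, (/ INR (S j) * RCpow (x * INR (S i) / INR (S j))%R (1 - w - 1))%C
    = (X * RCpow (INR (S i)) (- w) * RCpow (INR (S j)) (- (1 - w)))%C).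
  { intros i j. replace (1 - w - 1)%C with (- w)%C by ring. unfold Rdiv.
    rewrite !RCpow_mul_l, RCpow_inv_l; auto; [|apply Rmult_lt_0_compat; auto|now apply Rinv_0_lt_compat].
    fold X. replace (- (1 - w))%C with (- - w - 1)%C by ring.
    rewrite RCpow_pred by auto. ring. }
  assert (E2 : forall j, (RCpow (T * x / INR (S j))%R (1 - w) * / (1 - w))%C
    = ((x * X * RCpow T (1 - w) * / (1 - w)) * RCpow (INR (S j)) (- (1 - w)))%C).
  { intros j. unfold Rdiv.
    rewrite !RCpow_mul_l, RCpow_inv_l; auto; [|apply Rmult_lt_0_compat; auto|now apply Rinv_0_lt_compat].
    rewrite HX1. ring. }
  assert (E3 : forall i, (RCpow (T / (x * INR (S i)))%R w * / w)%C
    = ((X * RCpow T w * / w) * RCpow (INR (S i)) (- w))%C).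
  { intros i. unfold Rdiv.
    rewrite RCpow_mul_l, Hinv, RCpow_mul_l; auto; [|apply Rmult_lt_0_compat; auto|].
    - fold X. ring.
    - apply Rinv_0_lt_compat, Rmult_lt_0_compat; auto. }
  rewrite (csum_ext _ (fun i => (X * csum (fun j => RCpow (INR (S j)) (- (1 - w))) (S M)) * RCpow (INR (S i)) (- w))%C).
  2:{ intros i _. rewrite (csum_ext _ _ _ (fun j _ => E1 i j)).
      rewrite (csum_scal (X * RCpow (INR (S i)) (- w))%C). ring. }
  rewrite csum_scal.
  rewrite (csum_ext _ _ _ (fun j _ => E2 j)), csum_scal.
  rewrite (csum_ext _ _ _ (fun i _ => E3 i)), csum_scal.
  rewrite (Hinv x Hx). fold X. rewrite HX1.
  assert (ET : (RCpow T (1 - w) * RCpow T w)%C = RtoC T).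
  { rewrite <- RCpow_plus. replace (1 - w + w)%C with (RtoC 1) by ring. now apply RCpow_1. }
  set (A := csum (fun j => RCpow (INR (S j)) (- (1 - w))) (S M)).
  set (B := csum (fun j => RCpow (INR (S j)) (- w)) (S M)).
  assert (Hx0 : RtoC x <> 0%C) by (apply RtoC_neq_0; lra).
  transitivity (X * A * B - X * RCpow T (1 - w) * / (1 - w) * A - X * RCpow T w * / w * B
    + (RCpow T (1 - w) * RCpow T w) * X * (/ (1 - w) * / w))%C; [|ring].
  rewrite ET. field. auto.
Qed.

Definition TM (ell : R -> R) (x : R) (M : nat) : R :=
  rsum (fun i => rsum (fun j => / INR (S j) * (ln (x * INR (S i) / INR (S j)) /
      (1 + x * INR (S i) / INR (S j)))) (S M)) (S M)
  - / x * rsum (fun j => ell (INR (S M) * x / INR (S j))) (S M)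
  + rsum (fun i => ell (INR (S M) / (x * INR (S i)))) (S M)
  + INR (S M) * (/ x * ell x - ell (/ x)).

(** Each [P] at [x] meets a [Q] at [1 / x] with the same argument, and conversely, so only the
    differences [P - Q] and [p - q] remain. For the double sum the match uses [Pow1_w] after an
    exchange of the two indices. *)
Lemma Hsum_antisymmetric (c x : R) (ell : R -> R) (M : nat) : 0 < c < 1 -> 0 < x ->
  (forall y, 0 < y -> Phi c y = RtoC (- 4 * PI * ell y)) ->
  (Hsum c x M - / x * Hsum c (/ x) M)%C = RtoC (- 4 * PI * TM ell x M).
Proof.
  intros Hc Hx He.
  assert (Hx0 : RtoC x <> 0%C) by (apply RtoC_neq_0; lra).
  assert (Hj : forall j, 0 < INR (S j)) by (intros j; pose proof (INR_S_ge_1 j); lra).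
  set (P := Pow0 c (fun t => 1 - (c, t))%C) in *. set (Q := Pow0 c (fun t => (c, t))) in *.
  set (p := Pow1 c (fun t => 1 - (c, t))%C) in *. set (q := Pow1 c (fun t => (c, t))) in *.
  assert (HPhi : forall y, 0 < y -> (P y - Q y)%C = RtoC (- 4 * PI * ell y)) by (intros; now apply He).
  assert (Hpq : forall y, 0 < y -> (p y - q y)%C = RtoC (- 4 * PI * (ln y / (1 + y))))
    by (intros; now apply Pow1_diff).
  set (T := INR (S M)).
  assert (HT : 0 < T) by apply Hj.
  assert (ED : (/ x * csum (fun i => csum (fun j => / INR (S j) * p (/ x * INR (S i) / INR (S j))%R) (S M)) (S M))%C
    = csum (fun i => csum (fun j => / INR (S j) * q (x * INR (S i) / INR (S j))%R) (S M))%C (S M)).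
  { rewrite csum_exchange, <- csum_scal. apply csum_ext. intros i _.
    rewrite <- csum_scal. apply csum_ext. intros j _.
    unfold q. rewrite Pow1_w; auto.
    2:{ apply Rdiv_lt_0_compat; auto. apply Rmult_lt_0_compat; auto. }
    fold p. replace (/ (x * INR (S i) / INR (S j))) with (/ x * INR (S j) / INR (S i))
      by (field; split; [apply Rgt_not_eq, Hj | split; [apply Rgt_not_eq, Hj | lra]]).
    pose proof (Hj i). pose proof (Hj j).
    rewrite <- !RtoC_inv; try lra.
    2:{ apply Rgt_not_eq, Rdiv_lt_0_compat; auto. apply Rmult_lt_0_compat; auto. }
    rewrite !Cmult_assoc, <- !RtoC_mult. f_equal. f_equal. field. lra. }
  unfold Hsum. fold P Q p q T.
  rewrite <- (RtoC_inv (/ x)) by (apply Rinv_neq_0_compat; lra). rewrite !Rinv_inv.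
  rewrite (csum_ext (fun j => P (T * / x / INR (S j))) (fun i => P (T / (x * INR (S i))))).
  2:{ intros k _. f_equal. pose proof (Hj k). field; repeat split; lra. }
  rewrite (csum_ext (fun i => Q (T / (/ x * INR (S i)))) (fun j => Q (T * x / INR (S j)))).
  2:{ intros k _. f_equal. pose proof (Hj k). field; repeat split; lra. }
  set (SP := csum (fun i => csum (fun j => / INR (S j) * p (x * INR (S i) / INR (S j))%R) (S M))%C (S M)).
  set (SQ := csum (fun i => csum (fun j => / INR (S j) * p (/ x * INR (S i) / INR (S j))%R) (S M))%C (S M)) in *.
  set (A1 := csum (fun j => P (T * x / INR (S j))) (S M)).
  set (A2 := csum (fun i => Q (T / (x * INR (S i)))) (S M)).
  set (B1 := csum (fun i => P (T / (x * INR (S i)))) (S M)).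
  set (B2 := csum (fun j => Q (T * x / INR (S j))) (S M)).
  transitivity ((SP - / x * SQ) - / x * (A1 - B2) + (B1 - A2)
    + T * (/ x * (P x - Q x) - (P (/ x)%R - Q (/ x)%R)))%C.
  { field. auto. }
  rewrite ED. unfold SP, A1, A2, B1, B2.
  rewrite <- !csum_minus.
  rewrite (csum_ext _ (fun i => RtoC (rsum (fun j => / INR (S j) *
    (- 4 * PI * (ln (x * INR (S i) / INR (S j)) / (1 + x * INR (S i) / INR (S j))))) (S M)))).
  2:{ intros i _. rewrite <- csum_minus, <- csum_RtoC. apply csum_ext. intros j _.
      pose proof (Hj j). pose proof (Hj i).
      rewrite RtoC_mult, <- Hpq.
      - rewrite RtoC_inv by lra. ring.
      - apply Rdiv_lt_0_compat; auto. apply Rmult_lt_0_compat; auto. }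
  rewrite (csum_ext (fun k => P (T * x / INR (S k))%R - Q (T * x / INR (S k))%R)%C
    (fun k => RtoC (- 4 * PI * ell (T * x / INR (S k))))).
  2:{ intros j _. apply HPhi. apply Rdiv_lt_0_compat; auto. apply Rmult_lt_0_compat; auto. }
  rewrite (csum_ext (fun k => P (T / (x * INR (S k)))%R - Q (T / (x * INR (S k)))%R)%C
    (fun k => RtoC (- 4 * PI * ell (T / (x * INR (S k)))))).
  2:{ intros j _. apply HPhi. apply Rdiv_lt_0_compat; auto. apply Rmult_lt_0_compat; auto. }
  rewrite !HPhi; auto; [|now apply Rinv_0_lt_compat].
  rewrite !csum_RtoC, !rsum_scal, <- (RtoC_inv x) by lra.
  repeat (rewrite <- RtoC_mult || rewrite <- RtoC_minus || rewrite <- RtoC_plus).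
  f_equal. unfold TM. fold T.
  rewrite (rsum_ext (fun i => rsum (fun j => / INR (S j) *
    (- 4 * PI * (ln (x * INR (S i) / INR (S j)) / (1 + x * INR (S i) / INR (S j))))) (S M))
    (fun i => - 4 * PI * rsum (fun j => / INR (S j) *
    (ln (x * INR (S i) / INR (S j)) / (1 + x * INR (S i) / INR (S j)))) (S M))).
  2:{ intros i _. rewrite <- rsum_scal. apply rsum_ext. intros j _. ring. }
  rewrite rsum_scal. ring.
Qed.

(** * Convergence of the approximants on the line *)

Lemma taylor_at_continuous (h : C -> C) (s : C) : taylor_at h s ->
  exists r D, 0 < r /\ forall z, Cmod z < r -> Cmod (h (s + z)%C - h s)%C <= D * Cmod z.
Proof.
  intros (a & r & D & Hr & H). exists r, (D / r). split; auto. intros z Hz.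
  assert (E : h s = a O).
  { specialize (H 0%C 1%nat). rewrite Cmod_0 in H. specialize (H Hr). simpl in H.
    replace (s + 0)%C with s in H by ring.
    replace (h s - (0 + a O * 1))%C with (h s - a O)%C in H by ring.
    replace (D * (0 / r * 1)) with 0 in H by (field; lra).
    assert (Hz0 : Cmod (h s - a O) = 0) by (apply Rle_antisym; [exact H | apply Cmod_ge_0]).
    apply Cmod_eq_0 in Hz0. replace (h s) with ((h s - a O) + a O)%C by ring. rewrite Hz0. ring. }
  specialize (H z 1%nat Hz). simpl in H. rewrite E.
  replace (h (s + z) - (0 + a O * 1))%C with (h (s + z) - a O)%C in H by ring.
  replace (D / r * Cmod z) with (D * (Cmod z / r * 1)) by (field; lra). exact H.
Qed.

Lemma continuous_taylor_line (h : C -> C) (g : R -> C) (t : R) :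
  taylor_at h (g t) -> continuousC g t -> continuousC (fun t => h (g t)) t.
Proof.
  intros Hh Hg. destruct (taylor_at_continuous h _ Hh) as (r & D & Hr & H).
  intros P [eps HP]. unfold filtermap.
  assert (Hd : 0 < Rmin r (eps / (Rabs D + 1)) / 2).
  { pose proof (Rabs_pos D). pose proof (cond_pos eps).
    assert (0 < Rmin r (eps / (Rabs D + 1))) by (apply Rmin_pos; auto; apply Rdiv_lt_0_compat; lra).
    lra. }
  specialize (Hg (ball (M := CR) (g t) (mkposreal _ Hd)) (locally_ball (T := CR) _ _)).
  unfold filtermap in Hg. revert Hg. apply filter_imp. intros u Hu.
  apply HP. apply ball_CR. apply ball_CR_inv in Hu. cbn [pos] in Hu.
  pose proof (Rmin_l r (eps / (Rabs D + 1))). pose proof (Rmin_r r (eps / (Rabs D + 1))).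
  pose proof (Rabs_pos D). pose proof (cond_pos eps). pose proof (Rle_abs D).
  replace (g u) with (g t + (g u - g t))%C by ring.
  eapply Rle_lt_trans; [apply H; lra|].
  pose proof (Cmod_ge_0 (g u - g t)).
  assert (Cmod (g u - g t) < eps / (Rabs D + 1)) by lra.
  assert (eps / (Rabs D + 1) * (Rabs D + 1) = eps) by (field; lra). nra.
Qed.

Lemma zeta_approx_eq (M : nat) (s : C) : s <> 1%C ->
  zeta_approx M s = (1 + / (s - 1) - s * csum (fun k => zeta_cell k s) M)%C.
Proof. intros Hs. rewrite <- dirichlet_partial by auto. reflexivity. Qed.

Lemma strip_neq_1 (s : C) : Re s < 1 -> s <> 1%C.
Proof. intros H E. rewrite E in H. simpl in H. lra. Qed.

Lemma zeta_approx_error (M : nat) (s : C) : 0 < Re s < 1 ->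
  Cmod (zeta_ext s - zeta_approx M s)%C <= Cmod s * (Rpower (INR (S M)) (- Re s) / Re s).
Proof.
  intros Hs. rewrite zeta_approx_eq by (apply strip_neq_1; lra). unfold zeta_ext.
  replace (1 + / (s - 1) - s * zeta_tail s - (1 + / (s - 1) - s * csum (fun k => zeta_cell k s) M))%C
    with (- (s * (zeta_tail s - csum (fun k => zeta_cell k s) M)))%C by ring.
  rewrite Cmod_opp, Cmod_mult. apply Rmult_le_compat_l; [apply Cmod_ge_0|].
  apply zeta_tail_bound. lra.
Qed.

Lemma zeta_ext_bound (s : C) : 0 < Re s < 1 ->
  Cmod (zeta_ext s) <= 1 + / (1 - Re s) + Cmod s * / Re s.
Proof.
  intros Hs. unfold zeta_ext. eapply Rle_trans; [apply Cmod_triangle|]. rewrite Cmod_opp.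
  assert (Hs1 : (s - 1)%C <> 0%C).
  { intros E. apply (strip_neq_1 s); [lra|]. replace s with (s - 1 + 1)%C by ring. rewrite E. ring. }
  apply Rplus_le_compat.
  - eapply Rle_trans; [apply Cmod_triangle|]. rewrite Cmod_1, Cmod_inv by auto.
    apply Rplus_le_compat_l, Rinv_le_contravar; [lra|].
    pose proof (re_le_Cmod (s - 1)). change (Re (s - 1)) with (Re s - 1) in H.
    pose proof (Rle_abs (- (Re s - 1))). rewrite Rabs_Ropp in H0. lra.
  - rewrite Cmod_mult. apply Rmult_le_compat_l; [apply Cmod_ge_0|].
    destruct (zeta_tail_bound s) as [_ H]; [lra|]. specialize (H O). simpl csum in H.
    replace (zeta_tail s - 0)%C with (zeta_tail s) in H by ring.
    eapply Rle_trans; [exact H|]. right. simpl INR. unfold Rpower. rewrite ln_1, Rmult_0_r, exp_0.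
    field. lra.
Qed.

Lemma Cmod_pair_le (a t : R) : 0 < a < 1 -> Cmod (a, t) <= 1 + Rabs t.
Proof.
  intros Ha. eapply Rle_trans; [apply Cmod_le_Re_Im|]. unfold Re, Im; simpl fst; simpl snd.
  rewrite (Rabs_pos_eq a) by lra. lra.
Qed.

(** Constant in the bound [1 + Rabs t] for zeta on the line of abscissa [c]: [1 + / (1 - c)] from
    the polar part and [/ c] from the tail. *)
Definition zeta_bd (c : R) : R := 1 + / (1 - c) + / c.

Lemma zeta_bd_ge (c : R) : 0 < c < 1 -> 1 <= zeta_bd c.
Proof.
  intros Hc. unfold zeta_bd. assert (0 < / (1 - c)) by (apply Rinv_0_lt_compat; lra).
  assert (0 < / c) by (apply Rinv_0_lt_compat; lra). lra.
Qed.

Lemma zeta_ext_line (a t : R) : 0 < a < 1 ->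
  Cmod (zeta_ext (a, t)) <= zeta_bd a * (1 + Rabs t).
Proof.
  intros Ha. eapply Rle_trans; [apply zeta_ext_bound; simpl; lra|]. simpl Re.
  pose proof (Cmod_pair_le a t Ha). pose proof (Rabs_pos t). unfold zeta_bd.
  assert (0 < / (1 - a)) by (apply Rinv_0_lt_compat; lra).
  assert (0 < / a) by (apply Rinv_0_lt_compat; lra).
  change (fst (a, t)) with a. unfold Re; simpl fst. nra.
Qed.

Lemma zeta_approx_error_line (M : nat) (a t : R) : 0 < a < 1 ->
  Cmod (zeta_ext (a, t) - zeta_approx M (a, t))%C
  <= Rpower (INR (S M)) (- a) / a * (1 + Rabs t).
Proof.
  intros Ha. eapply Rle_trans; [apply zeta_approx_error; simpl; lra|].
  unfold Re; simpl fst. rewrite Rmult_comm. apply Rmult_le_compat_l.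
  - apply Rdiv_le_0_compat; [left; apply exp_pos | lra].
  - now apply Cmod_pair_le.
Qed.

Lemma Rpower_S_le_1 (M : nat) (a : R) : 0 < a -> Rpower (INR (S M)) (- a) <= 1.
Proof.
  intros Ha. pose proof (INR_S_ge_1 M). unfold Rpower. rewrite <- exp_0. apply exp_le.
  assert (0 <= ln (INR (S M))).
  { rewrite <- ln_1. destruct (Req_dec (INR (S M)) 1) as [->|]; [lra|]. left. apply ln_increasing; lra. }
  nra.
Qed.

Lemma zeta_approx_line (M : nat) (a t : R) : 0 < a < 1 ->
  Cmod (zeta_approx M (a, t)) <= 2 * zeta_bd a * (1 + Rabs t).
Proof.
  intros Ha.
  replace (zeta_approx M (a, t)) with
    (zeta_ext (a, t) - (zeta_ext (a, t) - zeta_approx M (a, t)))%C by ring.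
  eapply Rle_trans; [apply Cmod_triangle|]. rewrite Cmod_opp.
  pose proof (zeta_ext_line a t Ha). pose proof (zeta_approx_error_line M a t Ha).
  pose proof (Rabs_pos t). pose proof (Rpower_S_le_1 M a ltac:(lra)).
  assert (0 < / a) by (apply Rinv_0_lt_compat; lra).
  assert (0 < / (1 - a)) by (apply Rinv_0_lt_compat; lra).
  assert (Rpower (INR (S M)) (- a) / a <= zeta_bd a).
  { unfold Rdiv, zeta_bd. pose proof (exp_pos (- a * ln (INR (S M)))). nra. }
  nra.
Qed.

Definition H_integrand (c x t : R) : C :=
  (zeta_ext (c, t) * zeta_ext (1 - (c, t)) * RCpow x (- (c, t)))%C.

Lemma one_minus_line (c t : R) : (1 - (c, t))%C = (1 - c, - t).
Proof. apply injective_projections; simpl; ring. Qed.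

Lemma sqr_one_plus_abs (t : R) : (1 + Rabs t) * (1 + Rabs t) <= 2 * (1 + t ^ 2).
Proof. rewrite <- (pow2_abs t). pose proof (pow2_ge_0 (Rabs t - 1)). nra. Qed.

Lemma Cmod_RCpow_line (c x t : R) : Cmod (RCpow x (- (c, t))) = Rpower x (- c).
Proof. now rewrite Cmod_RCpow. Qed.

Lemma Jint_H (c x : R) : 0 < c < 1 -> 0 < x ->
  is_J c (H_integrand c x) (Jint c (H_integrand c x)).
Proof.
  intros Hc Hx.
  apply (Jint_correct c (2 * (zeta_bd c * zeta_bd (1 - c)) * Rpower x (- c))); auto.
  - intros t. unfold H_integrand. apply continuous_CR_mult; [apply continuous_CR_mult|].
    + apply (continuous_taylor_line zeta_ext (fun t => (c, t))); [|apply continuous_line].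
      apply taylor_at_zeta_ext; [simpl; lra | apply strip_neq_1; simpl; lra].
    + apply (continuous_taylor_line zeta_ext (fun t => (1 - (c, t))%C)).
      * apply taylor_at_zeta_ext; [simpl; lra | apply strip_neq_1; simpl; lra].
      * apply continuous_CR_minus; [apply continuous_CR_const | apply continuous_line].
    + apply (continuous_RCpow_exponent x (fun t => (- (c, t))%C)).
      apply (continuous_opp (V := CR)). apply continuous_line.
  - intros t. unfold H_integrand. rewrite !Cmod_mult, Cmod_RCpow_line, one_minus_line.
    pose proof (zeta_ext_line c t Hc) as H1.
    pose proof (zeta_ext_line (1 - c) (- t) ltac:(lra)) as H2. rewrite Rabs_Ropp in H2.
    pose proof (sqr_one_plus_abs t) as H3. pose proof (Rabs_pos t).
    pose proof (zeta_bd_ge c Hc). pose proof (zeta_bd_ge (1 - c) ltac:(lra)).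
    assert (Hp : 0 < Rpower x (- c)) by apply exp_pos.
    replace (2 * (zeta_bd c * zeta_bd (1 - c)) * Rpower x (- c) * (1 + t ^ 2))
      with (zeta_bd c * zeta_bd (1 - c) * (2 * (1 + t ^ 2)) * Rpower x (- c)) by ring.
    apply Rmult_le_compat_r; [lra|].
    apply Rle_trans with ((zeta_bd c * (1 + Rabs t)) * (zeta_bd (1 - c) * (1 + Rabs t))).
    + apply Rmult_le_compat; auto; apply Cmod_ge_0.
    + replace (zeta_bd c * (1 + Rabs t) * (zeta_bd (1 - c) * (1 + Rabs t)))
        with (zeta_bd c * zeta_bd (1 - c) * ((1 + Rabs t) * (1 + Rabs t))) by ring.
      apply Rmult_le_compat_l; auto. nra.
Qed.

(** The errors of the two approximants are of order [N ^ (- c)] and [N ^ (- (1 - c))], each times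
    [1 + Rabs t]. Multiplied by the linear bound for the other factor they stay within the
    [1 + t ^ 2] that the kernel integrates. Both exponents are negative because [0 < c < 1]. *)
Lemma H_limit (c x : R) : 0 < c < 1 -> 0 < x ->
  is_Clim (Hsum c x) (Jint c (H_integrand c x)).
Proof.
  intros Hc Hx.
  set (e := fun M => Rpower (INR (S M)) (- c) / c).
  set (e' := fun M => Rpower (INR (S M)) (- (1 - c)) / (1 - c)).
  set (B := zeta_bd c). set (B' := zeta_bd (1 - c)).
  apply (is_Clim_of_bound _ _ (fun M => kap_const c 0
    * (2 * (B * e' M + e M * (2 * B')) * Rpower x (- c)) * PI)).
  - assert (He : is_lim_seq e 0) by (apply is_lim_seq_Rpower_neg_div; lra).
    assert (He' : is_lim_seq e' 0) by (apply is_lim_seq_Rpower_neg_div; lra).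
    apply (is_lim_seq_ext (fun M => kap_const c 0 * 2 * Rpower x (- c) * PI
      * (B * e' M + 2 * B' * e M))); [intros; ring|].
    replace (Finite 0) with (Rbar_mult (kap_const c 0 * 2 * Rpower x (- c) * PI) (B * 0 + 2 * B' * 0))
      by (simpl; f_equal; ring).
    apply is_lim_seq_scal_l.
    apply is_lim_seq_plus'.
    + apply (is_lim_seq_scal_l _ B 0 He').
    + apply (is_lim_seq_scal_l _ (2 * B') 0 He).
  - intros M. pose proof (is_J_HM c x M Hc Hx) as H1. pose proof (Jint_H c x Hc Hx) as H2.
    pose proof (is_J_minus _ _ _ _ _ H1 H2) as H3.
    apply (is_J_bound c _ _ _ Hc H3). intros t. unfold H_integrand. rewrite !one_minus_line.
    set (w := (c, t) : C). set (v := (1 - c, - t) : C).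
    replace (zeta_approx M w * zeta_approx M v * RCpow x (- w) - zeta_ext w * zeta_ext v * RCpow x (- w))%C
      with (- ((zeta_ext w * (zeta_ext v - zeta_approx M v)
        + (zeta_ext w - zeta_approx M w) * zeta_approx M v) * RCpow x (- w)))%C by ring.
    rewrite Cmod_opp, Cmod_mult. unfold w at 4. rewrite Cmod_RCpow_line.
    assert (Hp : 0 < Rpower x (- c)) by apply exp_pos.
    replace (2 * (B * e' M + e M * (2 * B')) * Rpower x (- c) * (1 + t ^ 2))
      with ((B * e' M + e M * (2 * B')) * (2 * (1 + t ^ 2)) * Rpower x (- c)) by ring.
    apply Rmult_le_compat_r; [lra|].
    eapply Rle_trans; [apply Cmod_triangle|]. rewrite !Cmod_mult.
    pose proof (zeta_ext_line c t Hc) as K1. pose proof (zeta_approx_error_line M c t Hc) as K2.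
    pose proof (zeta_approx_error_line M (1 - c) (- t) ltac:(lra)) as K3.
    pose proof (zeta_approx_line M (1 - c) (- t) ltac:(lra)) as K4.
    rewrite Rabs_Ropp in K3, K4. fold w v B B' in K1, K2, K3, K4.
    fold (e M) in K2. fold (e' M) in K3.
    pose proof (sqr_one_plus_abs t) as HS. pose proof (Rabs_pos t) as Ht.
    pose proof (zeta_bd_ge c Hc) as HB. pose proof (zeta_bd_ge (1 - c) ltac:(lra)) as HB'. fold B in HB. fold B' in HB'.
    assert (He : 0 <= e M) by (apply Rdiv_le_0_compat; [left; apply exp_pos | lra]).
    assert (He' : 0 <= e' M) by (apply Rdiv_le_0_compat; [left; apply exp_pos | lra]).
    set (u := 1 + Rabs t) in *.
    apply Rle_trans with ((B * u) * (e' M * u) + (e M * u) * (2 * B' * u)).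
    + apply Rplus_le_compat; apply Rmult_le_compat; auto; apply Cmod_ge_0.
    + replace (B * u * (e' M * u) + e M * u * (2 * B' * u))
        with ((B * e' M + e M * (2 * B')) * (u * u)) by ring.
      apply Rmult_le_compat_l; auto. nra.
Qed.

(** The cosine in the cotangent cancels against [sin (PI w) = 2 sin (PI w / 2) cos (PI w / 2)]; in
    the open strip neither factor vanishes. *)
Lemma kernel_eq (w : C) : 0 < Re w < 1 ->
  (/ Csin (PI * w) * (PI * Ccot (PI * w / 2)) * PI)%C = kap 0 w.
Proof.
  intros Hw. unfold kap, sn, Ccot.
  assert (Hs : Csin (PI * w / 2) <> 0%C).
  { destruct w as [s t]. simpl in Hw. apply (sn_neq_0 (Rmin s (1 / 2)) s t).
    - split; [apply Rmin_pos; lra | pose proof (Rmin_r s (1 / 2)); lra].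
    - split; [apply Rmin_l | pose proof (Rmin_r s (1 / 2)); lra]. }
  assert (Hcos : Ccos (PI * w / 2) <> 0%C).
  { destruct w as [s t]. simpl in Hw. rewrite half_PI_mul, Ccos_eq. intros E.
    apply (f_equal Re) in E. unfold Re in E; simpl in E.
    pose proof (cosh_pos (PI * t / 2)). pose proof PI_RGT_0.
    assert (0 < cos (PI * s / 2)) by (apply cos_gt_0; nra). nra. }
  assert (Hdbl : Csin (PI * w) = (2 * Csin (PI * w / 2) * Ccos (PI * w / 2))%C).
  { unfold Csin, Ccos. set (z := (PI * w / 2)%C).
    replace (PI * w)%C with (z + z)%C by (unfold z; field).
    replace (Ci * (z + z))%C with (Ci * z + Ci * z)%C by ring.
    replace (- (Ci * z + Ci * z))%C with (- (Ci * z) + - (Ci * z))%C by ring.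
    rewrite !Cexp_plus. set (a := Cexp (Ci * z)). set (b := Cexp (- (Ci * z))).
    field. intros E. apply (f_equal Im) in E. unfold Im in E; simpl in E. lra. }
  rewrite Hdbl. replace (- (w * 0))%C with (RtoC 0) by ring. rewrite Cexp_0.
  replace (RtoC (PI ^ 2 / 2)) with (PI * PI * / 2)%C.
  - field. auto.
  - rewrite <- RtoC_inv, <- !RtoC_mult by lra. f_equal. field.
Qed.

Lemma scrH_eq (zeta : C -> C) (c x : R) : is_riemann_zeta zeta -> 0 < c < 1 -> 0 < x ->
  scrH zeta c x = (/ RtoC (2 * PI) * Jint c (H_integrand c x))%C.
Proof.
  intros Hz Hc Hx. pose proof PI_RGT_0 as HP.
  assert (HR : RInt_gen (V := CR) (fun t : R => (fun w => PI * zeta w * zeta (1 - w) / Csin (PI * w)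
     * (PI * Ccot (PI * w / 2)) * RCpow x (- w))%C (c, t))
     (Rbar_locally m_infty) (Rbar_locally p_infty) = Jint c (H_integrand c x)).
  { apply (is_RInt_gen_unique (V := CR)).
    pose proof (Jint_H c x Hc Hx) as H. revert H.
    apply (is_RInt_R_ext (V := CR)). intros t. eq_C. unfold H_integrand.
    rewrite <- kernel_eq by (simpl; lra).
    rewrite (zeta_unique zeta Hz (c, t)); [|simpl; lra|apply strip_neq_1; simpl; lra].
    rewrite (zeta_unique zeta Hz (1 - (c, t))%C); [|simpl; lra|apply strip_neq_1; simpl; lra].
    unfold Cdiv. ring. }
  unfold scrH, vertical_integral. rewrite HR.
  assert (Ci <> 0%C) by (intros E; apply (f_equal Im) in E; unfold Im in E; simpl in E; lra).
  assert (RtoC PI <> 0%C) by (apply RtoC_neq_0; lra).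
  rewrite RtoC_mult. field. auto.
Qed.

(** The truncated combination [- 4 * PI * TM] is real for every [M], so its limit [D] is real and
    [TM] itself converges. Dividing by [2 PI] turns [- 4 PI tau] into [- 2 tau]. *)
Theorem scrH_antisymmetric (zeta : C -> C) (c : R) : is_riemann_zeta zeta -> 0 < c < 1 ->
  exists ell : R -> R, (forall y, 0 < y -> is_derive ell y (ln y / (1 + y))) /\
    (exists q K, 0 < q /\ forall y, 0 < y <= 1 -> Rabs (ell y) <= K * Rpower y q) /\
    forall x, 0 < x -> exists tau : R, is_lim_seq (TM ell x) tau /\
      (scrH zeta c x - / x * scrH zeta c (/ x))%C = RtoC (- 2 * tau).
Proof.
  intros Hz Hc. pose proof PI_RGT_0 as HP.
  destruct (Phi_real c Hc) as (ell & H1 & H2 & H3).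
  exists ell. split; [exact H1|split; [exact H2|]]. intros x Hx.
  assert (Hx' : 0 < / x) by now apply Rinv_0_lt_compat.
  pose proof (H_limit c x Hc Hx) as L1.
  pose proof (is_Clim_scal (/ x)%C _ _ (H_limit c (/ x) Hc Hx')) as L2.
  pose proof (is_Clim_minus _ _ _ _ L1 L2) as L3.
  set (D := (Jint c (H_integrand c x) - / x * Jint c (H_integrand c (/ x)))%C) in *.
  assert (L4 : is_Clim (fun M => RtoC (- 4 * PI * TM ell x M)) D).
  { eapply is_Clim_ext; [|exact L3]. intros M. cbv beta.
    now rewrite (Hsum_antisymmetric c x ell M Hc Hx H3). }
  pose proof (is_Clim_Re _ _ L4) as LR. pose proof (is_Clim_Im _ _ L4) as LI.
  assert (EI : Im D = 0).
  { apply (is_lim_seq_uniq _ _ _ LI). apply is_lim_seq_const. }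
  exists (/ (- 4 * PI) * Re D). split.
  - apply (is_lim_seq_ext (fun M => / (- 4 * PI) * Re (RtoC (- 4 * PI * TM ell x M)))).
    + intros M. unfold Re; simpl. field. lra.
    + apply (is_lim_seq_scal_l _ (/ (- 4 * PI)) (Re D) LR).
  - rewrite !scrH_eq by auto.
    assert (Hx0 : RtoC x <> 0%C) by (apply RtoC_neq_0; lra).
    assert (H0 : RtoC (2 * PI) <> 0%C) by (apply RtoC_neq_0; lra).
    transitivity (/ RtoC (2 * PI) * D)%C; [unfold D; ring|].
    rewrite (C_eta D), EI, <- RtoC_inv by lra.
    apply injective_projections; simpl; field; lra.
Qed.

(** * The Gamma and digamma functions *)

(* The integrand of Gamma(x) after the substitution [t = exp v]. *)
Definition gamma_log (x v : R) : R := exp (x * v - exp v).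

Lemma gamma_log_bound (x : R) : 0 < x ->
  exists C k, 0 < k /\ forall v, gamma_log x v <= C * exp (- (k * Rabs v)).
Proof.
  (* For [v >= 0] the bound [exp (- exp v) <= fact n * exp (- n v)] with [n > x + 1] beats
     [exp (x v)] by [exp (- v)]; for [v < 0] the factor [exp (x v)] decays by itself. *)
  intros Hx. destruct (INR_unbounded (x + 1)) as [n Hn].
  exists (INR (fact n)), (Rmin x 1). split; [apply Rmin_pos; lra|]. intros v.
  assert (Hf : 1 <= INR (fact n)).
  { change 1 with (INR 1). apply le_INR. apply lt_O_fact. }
  pose proof (Rmin_l x 1). pose proof (Rmin_r x 1). unfold gamma_log.
  destruct (Rle_dec 0 v) as [Hv|Hv].
  - rewrite (Rabs_pos_eq v) by lra.
    assert (H1 : exp (- exp v) <= INR (fact n) * exp (- (INR n * v))).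
    { pose proof (pow_div_fact_le_exp (exp v) n ltac:(left; apply exp_pos)) as H1.
      rewrite <- exp_INR_mult in H1. rewrite !exp_Ropp.
      pose proof (exp_pos (INR n * v)) as E1. pose proof (exp_pos (exp v)) as E2.
      apply Rmult_le_reg_r with (exp (exp v) * exp (INR n * v)); [nra|].
      replace (/ exp (exp v) * (exp (exp v) * exp (INR n * v))) with (exp (INR n * v)) by (field; lra).
      replace (INR (fact n) * / exp (INR n * v) * (exp (exp v) * exp (INR n * v)))
        with (INR (fact n) * exp (exp v)) by (field; lra).
      apply Rmult_le_reg_r with (/ INR (fact n)); [apply Rinv_0_lt_compat; lra|].
      replace (INR (fact n) * exp (exp v) * / INR (fact n)) with (exp (exp v)) by (field; lra).
      exact H1. }
    replace (x * v - exp v) with (x * v + - exp v) by ring. rewrite exp_plus.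
    apply Rle_trans with (exp (x * v) * (INR (fact n) * exp (- (INR n * v)))).
    + apply Rmult_le_compat_l; [left; apply exp_pos | exact H1].
    + replace (exp (x * v) * (INR (fact n) * exp (- (INR n * v))))
        with (INR (fact n) * (exp (x * v) * exp (- (INR n * v)))) by ring.
      rewrite <- exp_plus. apply Rmult_le_compat_l; [lra|]. apply exp_le. nra.
  - rewrite (Rabs_left v) by lra.
    apply Rle_trans with (1 * exp (- (Rmin x 1 * - v))); [|apply Rmult_le_compat_r; [left; apply exp_pos | lra]].
    rewrite Rmult_1_l. apply exp_le. pose proof (exp_pos v). nra.
Qed.

Lemma gamma_log_cauchy (x : R) : 0 < x ->
  exists C, 0 < C /\ forall v, gamma_log x v <= C / (1 + v ^ 2).
Proof.
  intros Hx. destruct (gamma_log_bound x Hx) as (C & k & Hk & H).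
  assert (HC : 0 < C).
  { specialize (H 0). rewrite Rabs_R0, Rmult_0_r, Ropp_0, exp_0 in H.
    unfold gamma_log in H. pose proof (exp_pos (x * 0 - exp 0)). lra. }
  assert (0 < 1 + 2 / k ^ 2).
  { assert (0 < 2 / k ^ 2) by (apply Rdiv_lt_0_compat; [lra | now apply pow_lt]). lra. }
  exists (C * (1 + 2 / k ^ 2)). split; [nra|].
  intros v. eapply Rle_trans; [apply H|].
  unfold Rdiv. rewrite Rmult_assoc. apply Rmult_le_compat_l; [lra|].
  apply exp_neg_le_cauchy, Hk.
Qed.

Lemma gamma_log_pos (x v : R) : 0 < gamma_log x v.
Proof. apply exp_pos. Qed.

Lemma continuous_gamma_log (x v : R) : continuous (gamma_log x) v.
Proof.
  apply continuous_of_ex_derive. unfold gamma_log. auto_derive. auto.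
Qed.

Definition GR (x : R) : R :=
  RInt_gen (gamma_log x) (Rbar_locally m_infty) (Rbar_locally p_infty).

Lemma GR_correct (x : R) : 0 < x -> is_RInt_R (gamma_log x) (GR x).
Proof.
  intros Hx. unfold GR, is_RInt_R. apply (RInt_gen_correct (V := RC)).
  destruct (gamma_log_cauchy x Hx) as (C & HC & H).
  apply (is_RInt_R_ex (V := RC) _ C).
  - apply continuous_gamma_log.
  - intros t. change (Rabs (gamma_log x t) <= C / (1 + t ^ 2)).
    rewrite Rabs_pos_eq; [apply H | left; apply gamma_log_pos].
Qed.

Lemma is_RInt_R_ge_RInt (f : R -> R) (l a b : R) : a <= b ->
  (forall t, continuous f t) -> (forall t, 0 <= f t) -> is_RInt_R f l -> RInt f a b <= l.
Proof.
  intros Hab Hc Hf Hl. apply Rnot_lt_le. intros Hlt.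
  assert (He : 0 < RInt f a b - l) by lra.
  destruct (is_RInt_R_elim (V := RN) f l Hl (mkposreal _ He)) as [A HA].
  set (a' := - (Rabs A + Rabs a + 1)). set (b' := Rabs A + Rabs b + 1).
  pose proof (Rle_abs A). pose proof (Rle_abs b). pose proof (Rle_abs (- a)).
  rewrite Rabs_Ropp in H1. pose proof (Rabs_pos A). pose proof (Rabs_pos a). pose proof (Rabs_pos b).
  destruct (HA a' b') as [y [Hy Hb]]; [unfold a'; lra | unfold b'; lra |].
  change (Rabs (y - l) < RInt f a b - l) in Hb. apply Rabs_def2 in Hb.
  assert (Hex : forall u v, ex_RInt f u v) by (intros; apply (ex_RInt_cont (V := RC)), Hc).
  assert (Hpos : forall u v, u <= v -> 0 <= RInt f u v).
  { intros u v Huv. apply RInt_ge_0; auto. }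
  rewrite <- (is_RInt_unique _ _ _ _ Hy) in Hb.
  rewrite <- (RInt_Chasles f a' a b'), <- (RInt_Chasles f a b b') in Hb by auto.
  unfold plus in Hb; simpl in Hb.
  pose proof (Hpos a' a ltac:(unfold a'; lra)). pose proof (Hpos b b' ltac:(unfold b'; lra)). lra.
Qed.

Lemma GR_pos (x : R) : 0 < x -> 0 < GR x.
Proof.
  intros Hx. eapply Rlt_le_trans; [|apply (is_RInt_R_ge_RInt (gamma_log x) (GR x) 0 1 Rle_0_1)].
  - apply RInt_gt_0; [lra | |].
    + intros t _. apply gamma_log_pos.
    + intros t _. apply continuous_gamma_log.
  - apply continuous_gamma_log.
  - intros t. left. apply gamma_log_pos.
  - now apply GR_correct.
Qed.

Lemma filterlim_R_0 (f : R -> R) (K : R) (F : (R -> Prop) -> Prop) {FF : Filter F} :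
  (forall t, Rabs (f t) <= K / (1 + t ^ 2)) ->
  (forall M, F (fun t => M < Rabs t)) -> filterlim f F (locally 0).
Proof.
  intros Hf HF P [eps HP]. unfold filtermap.
  assert (HK : 0 <= K).
  { specialize (Hf 0). pose proof (Rabs_pos (f 0)).
    replace (K / (1 + 0 ^ 2)) with K in Hf by field. lra. }
  pose proof (cond_pos eps) as He.
  generalize (HF (1 + K / eps)). apply filter_imp. intros t Ht. apply HP.
  change (Rabs (f t - 0) < eps). rewrite Rminus_0_r.
  eapply Rle_lt_trans; [apply Hf|].
  pose proof (one_plus_sqr_pos t).
  apply Rmult_lt_reg_r with (1 + t ^ 2); auto.
  unfold Rdiv at 1. rewrite Rmult_assoc, Rinv_l, Rmult_1_r by lra.
  rewrite <- (pow2_abs t).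
  assert (0 <= K / eps) by (apply Rdiv_le_0_compat; lra).
  assert (E : K = eps * (K / eps)) by (field; lra).
  assert (K / eps < Rabs t) by lra. assert (1 < Rabs t) by lra.
  assert (Rabs t < Rabs t ^ 2) by nra. nra.
Qed.

Lemma m_infty_Rabs (M : R) : Rbar_locally m_infty (fun t => M < Rabs t).
Proof.
  exists (- Rabs M). intros t Ht. pose proof (Rle_abs M). pose proof (Rabs_pos M).
  rewrite Rabs_left by lra. lra.
Qed.

Lemma p_infty_Rabs (M : R) : Rbar_locally p_infty (fun t => M < Rabs t).
Proof.
  exists (Rabs M). intros t Ht. pose proof (Rle_abs M). pose proof (Rabs_pos M).
  rewrite Rabs_pos_eq by lra. lra.
Qed.

Lemma GR_succ (x : R) : 0 < x -> GR (x + 1) = x * GR x.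
Proof.
  intros Hx. destruct (gamma_log_cauchy x Hx) as (C & HC & H).
  assert (Hb : forall t, Rabs (gamma_log x t) <= C / (1 + t ^ 2)).
  { intros t. rewrite Rabs_pos_eq; [apply H | left; apply gamma_log_pos]. }
  assert (H1 : is_RInt_R (fun v => x * gamma_log x v - gamma_log (x + 1) v) (minus (0 : R) 0)).
  { apply (is_RInt_R_derive (V := RC) (gamma_log x)).
    - intros v. unfold gamma_log. auto_derive; auto.
      replace ((x + 1) * v - exp v) with (x * v - exp v + v) by ring. rewrite (exp_plus (x * v - exp v) v).
      unfold Rminus. ring.
    - intros v. apply continuous_of_ex_derive. unfold gamma_log. auto_derive. auto.
    - apply (filterlim_R_0 (gamma_log x) C (Rbar_locally m_infty) Hb m_infty_Rabs).
    - apply (filterlim_R_0 (gamma_log x) C (Rbar_locally p_infty) Hb p_infty_Rabs). }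
  pose proof (is_RInt_R_scal (V := RN) _ x _ (GR_correct x Hx)) as H2.
  pose proof (is_RInt_R_minus (V := RN) _ _ _ _ H2 (GR_correct (x + 1) ltac:(lra))) as H3.
  pose proof (is_RInt_R_unique (V := RC) _ _ _ H1 H3) as E.
  change (0 - 0 = x * GR x - GR (x + 1)) in E. lra.
Qed.

(** * Log-convexity and the limit formula for log Gamma *)

Lemma exp_convex (h u : R) : 0 <= h <= 1 -> exp (h * u) <= 1 - h + h * exp u.
Proof.
  intros Hh.
  assert (H1 : 1 <= (1 - h) * exp (- (h * u)) + h * exp (u - h * u)).
  { pose proof (exp_ineq1_le (- (h * u))). pose proof (exp_ineq1_le (u - h * u)).
    assert ((1 - h) * (1 + - (h * u)) <= (1 - h) * exp (- (h * u))) by (apply Rmult_le_compat_l; lra).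
    assert (h * (1 + (u - h * u)) <= h * exp (u - h * u)) by (apply Rmult_le_compat_l; lra). nra. }
  apply Rle_trans with (exp (h * u) * ((1 - h) * exp (- (h * u)) + h * exp (u - h * u))).
  - pose proof (exp_pos (h * u)). nra.
  - right. replace (exp (h * u) * ((1 - h) * exp (- (h * u)) + h * exp (u - h * u)))
      with ((1 - h) * (exp (h * u) * exp (- (h * u))) + h * (exp (h * u) * exp (u - h * u))) by ring.
    rewrite <- !exp_plus. replace (h * u + - (h * u)) with 0 by ring.
    replace (h * u + (u - h * u)) with u by ring. rewrite exp_0. ring.
Qed.

(** The inequality behind the Bohr-Mollerup theorem. Convexity of [exp] at [v - ln x] bounds the
    integrand by a combination of those of [GR x] and [GR (x + 1) = x * GR x], weighted so that the
    total is exactly [x ^ h * GR x]. *)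
Lemma GR_log_convex (x h : R) : 0 < x -> 0 <= h <= 1 -> GR (x + h) <= Rpower x h * GR x.
Proof.
  intros Hx Hh.
  pose proof (is_RInt_R_scal (V := RN) _ (Rpower x h * (1 - h)) _ (GR_correct x Hx)) as H1.
  pose proof (is_RInt_R_scal (V := RN) _ (Rpower x h * (h / x)) _
    (GR_correct (x + 1) ltac:(lra))) as H2.
  pose proof (is_RInt_R_plus (V := RN) _ _ _ _ H1 H2) as H3.
  pose proof (is_RInt_R_norm_le (V := RC) _ _ _ _
    (GR_correct (x + h) ltac:(lra)) H3) as H4.
  change ((forall t, Rabs (gamma_log (x + h) t) <= Rpower x h * (1 - h) * gamma_log x t +
    Rpower x h * (h / x) * gamma_log (x + 1) t) -> Rabs (GR (x + h)) <=
    Rpower x h * (1 - h) * GR x + Rpower x h * (h / x) * GR (x + 1)) in H4.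
  assert (E : Rpower x h * (1 - h) * GR x + Rpower x h * (h / x) * GR (x + 1) = Rpower x h * GR x).
  { rewrite GR_succ by auto. field. lra. }
  rewrite E in H4. eapply Rle_trans; [apply Rle_abs | apply H4]. intros v.
  rewrite Rabs_pos_eq by (left; apply gamma_log_pos).
  pose proof (exp_convex h (v - ln x) Hh) as Hc.
  unfold gamma_log. replace ((x + h) * v - exp v) with (h * ln x + h * (v - ln x) + (x * v - exp v)) by ring.
  replace ((x + 1) * v - exp v) with (v + (x * v - exp v)) by ring.
  rewrite !exp_plus. fold (Rpower x h).
  assert (Ee : exp (v - ln x) = exp v * / x).
  { unfold Rminus. rewrite exp_plus, exp_Ropp, exp_ln by auto. reflexivity. }
  rewrite Ee in Hc.
  replace (Rpower x h * (1 - h) * exp (x * v - exp v) + Rpower x h * (h / x) * (exp v * exp (x * v - exp v)))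
    with (Rpower x h * (1 - h + h * (exp v * / x)) * exp (x * v - exp v)) by (field; lra).
  apply Rmult_le_compat_r; [left; apply exp_pos|].
  apply Rmult_le_compat_l; [left; apply exp_pos | exact Hc].
Qed.

Definition LG (x : R) : R := ln (GR x).

Lemma LG_upper (x h : R) : 0 < x -> 0 <= h <= 1 -> LG (x + h) - LG x <= h * ln x.
Proof.
  intros Hx Hh. unfold LG. pose proof (GR_pos x Hx). pose proof (GR_pos (x + h) ltac:(lra)).
  pose proof (GR_log_convex x h Hx Hh) as H1.
  assert (H2 : ln (GR (x + h)) <= ln (Rpower x h * GR x)).
  { destruct H1 as [H1 | ->]; [left; now apply ln_increasing | lra]. }
  rewrite ln_mult in H2; auto; [|apply exp_pos].
  unfold Rpower in H2. rewrite ln_exp in H2. lra.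
Qed.

Lemma LG_succ (x : R) : 0 < x -> LG (x + 1) = LG x + ln x.
Proof.
  intros Hx. unfold LG. rewrite GR_succ, ln_mult by (auto using GR_pos). ring.
Qed.

(** The upper bound applied at [x + h] with step [1 - h], which ends at [x + 1], where the
    functional equation is available. *)
Lemma LG_lower (x h : R) : 0 < x -> 0 <= h <= 1 -> h * ln x - / x <= LG (x + h) - LG x.
Proof.
  intros Hx Hh.
  pose proof (LG_upper (x + h) (1 - h) ltac:(lra) ltac:(lra)) as H.
  replace (x + h + (1 - h)) with (x + 1) in H by ring. rewrite LG_succ in H by auto.
  assert (H1 : ln (x + h) <= ln x + h / x).
  { replace (x + h) with (x * (1 + h / x)) by (field; lra).
    assert (0 <= h / x) by (apply Rdiv_le_0_compat; lra).
    rewrite ln_mult by lra. apply Rplus_le_compat_l.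
    rewrite <- (ln_exp (h / x)) at 2.
    destruct (exp_ineq1_le (h / x)) as [H2 | H2].
    - left. apply ln_increasing; lra.
    - rewrite H2. lra. }
  assert ((1 - h) * ln (x + h) <= (1 - h) * (ln x + h / x)) by (apply Rmult_le_compat_l; lra).
  assert ((1 - h) * (h / x) <= / x).
  { unfold Rdiv. rewrite <- Rmult_assoc. rewrite <- (Rmult_1_l (/ x)) at 2.
    apply Rmult_le_compat_r; [left; now apply Rinv_0_lt_compat | nra]. }
  lra.
Qed.

Lemma LG_add_nat (x : R) (N : nat) : 0 < x -> LG (x + INR N) = LG x + rsum (fun k => ln (x + INR k)) N.
Proof.
  intros Hx. induction N as [|N IH]; [simpl; rewrite Rplus_0_r; ring|].
  rewrite S_INR, <- Rplus_assoc, LG_succ, IH by (pose proof (pos_INR N); lra). simpl. ring.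
Qed.

Lemma is_lim_seq_inv_add (x : R) : is_lim_seq (fun N => / (x + INR N)) 0.
Proof.
  replace (Finite 0) with (Rbar_inv p_infty) by reflexivity.
  apply is_lim_seq_inv; [|discriminate].
  replace p_infty with (Rbar_plus x p_infty) by reflexivity.
  apply (is_lim_seq_plus (fun _ => x) INR x p_infty p_infty).
  - apply is_lim_seq_const.
  - apply is_lim_seq_INR.
  - reflexivity.
Qed.

(** Shifting by [N] squeezes the increment of [LG] around [h * ln (x + N)] with error [1 / (x + N)];
    the functional equation brings it back to [x]. *)
Lemma LG_limit_nonneg (x h : R) : 0 < x -> 0 <= h <= 1 ->
  is_lim_seq (fun N => h * ln (x + INR N) - rsum (fun k => ln (x + h + INR k) - ln (x + INR k)) N)
    (LG (x + h) - LG x).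
Proof.
  intros Hx Hh. apply (is_lim_seq_le_0 _ (fun N => / (x + INR N))); [|apply is_lim_seq_inv_add].
  intros N. pose proof (pos_INR N) as HN.
  pose proof (LG_upper (x + INR N) h ltac:(lra) Hh) as H1.
  pose proof (LG_lower (x + INR N) h ltac:(lra) Hh) as H2.
  replace (x + INR N + h) with (x + h + INR N) in H1, H2 by ring.
  rewrite !LG_add_nat in H1, H2 by lra. rewrite rsum_minus.
  assert (0 < / (x + INR N)) by (apply Rinv_0_lt_compat; lra).
  apply Rabs_le. lra.
Qed.

Lemma ln_ratio_lim (x h : R) : 0 < x -> 0 < x + h ->
  is_lim_seq (fun N => ln (x + h + INR N) - ln (x + INR N)) 0.
Proof.
  intros Hx Hxh.
  apply (is_lim_seq_le_0 _ (fun N => Rabs h * (/ (x + INR N) + / (x + h + INR N)))).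
  - intros N. pose proof (pos_INR N) as HN. rewrite Rminus_0_r.
    assert (H : forall a b, 0 < a -> 0 < b -> ln b - ln a <= (b - a) / a).
    { intros a b Ha Hb. replace (ln b - ln a) with (ln (b / a)) by (apply ln_div; auto).
      rewrite <- (ln_exp ((b - a) / a)).
      pose proof (exp_ineq1_le ((b - a) / a)) as E.
      replace (1 + (b - a) / a) with (b / a) in E by (field; lra).
      assert (0 < b / a) by (now apply Rdiv_lt_0_compat).
      destruct E as [E | E]; [left; now apply ln_increasing | rewrite E; lra]. }
    pose proof (H (x + INR N) (x + h + INR N) ltac:(lra) ltac:(lra)) as H1.
    pose proof (H (x + h + INR N) (x + INR N) ltac:(lra) ltac:(lra)) as H2.
    replace (x + h + INR N - (x + INR N)) with h in H1 by ring.
    replace (x + INR N - (x + h + INR N)) with (- h) in H2 by ring.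
    unfold Rdiv in H1, H2.
    assert (P1 : 0 < / (x + INR N)) by (apply Rinv_0_lt_compat; lra).
    assert (P2 : 0 < / (x + h + INR N)) by (apply Rinv_0_lt_compat; lra).
    pose proof (Rle_abs h). pose proof (Rle_abs (- h)). rewrite Rabs_Ropp in H3.
    pose proof (Rabs_pos h). apply Rabs_le. nra.
  - replace (Finite 0) with (Rbar_mult (Rabs h) (0 + 0)) by (simpl; f_equal; ring).
    apply is_lim_seq_scal_l. apply is_lim_seq_plus'; apply is_lim_seq_inv_add.
Qed.

(** A negative step is a positive one from [x + h]; the change of base point costs [h] times the
    logarithm of a ratio that tends to 1. *)
Lemma LG_limit (x h : R) : 0 < x -> 0 < x + h -> Rabs h <= 1 ->
  is_lim_seq (fun N => h * ln (x + INR N) - rsum (fun k => ln (x + h + INR k) - ln (x + INR k)) N)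
    (LG (x + h) - LG x).
Proof.
  intros Hx Hxh Hh. destruct (Rle_dec 0 h) as [H0|H0].
  { apply LG_limit_nonneg; auto. rewrite Rabs_pos_eq in Hh; lra. }
  rewrite Rabs_left in Hh by lra.
  pose proof (LG_limit_nonneg (x + h) (- h) Hxh ltac:(lra)) as H1.
  replace (x + h + - h) with x in H1 by ring.
  apply (is_lim_seq_scal_l _ (-1)) in H1.
  pose proof (is_lim_seq_scal_l _ (- h) _ (ln_ratio_lim x h Hx Hxh)) as H2.
  simpl in H1, H2. rewrite Rmult_0_r in H2.
  pose proof (is_lim_seq_plus' _ _ _ _ H1 H2) as H3.
  replace (LG (x + h) - LG x) with (-1 * (LG x - LG (x + h)) + 0) by ring.
  eapply is_lim_seq_ext; [|exact H3]. intros N. cbv beta.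
  rewrite !rsum_minus.
  ring.
Qed.

Lemma ln_1p_bounds (u : R) : -1 < u -> u / (1 + u) <= ln (1 + u) <= u.
Proof.
  intros Hu.
  assert (H : forall v, -1 < v -> ln (1 + v) <= v).
  { intros v Hv. rewrite <- (ln_exp v) at 2. destruct (exp_ineq1_le v) as [E | E].
    - left. apply ln_increasing; lra.
    - rewrite E. lra. }
  split; [|now apply H].
  assert (Hi : 0 < / (1 + u)) by (apply Rinv_0_lt_compat; lra).
  specialize (H (/ (1 + u) - 1) ltac:(lra)).
  replace (1 + (/ (1 + u) - 1)) with (/ (1 + u)) in H by ring.
  rewrite ln_Rinv in H by lra.
  replace (u / (1 + u)) with (- (/ (1 + u) - 1)) by (field; lra). lra.
Qed.

Lemma ln_1p_quadratic (u : R) : - (1 / 2) <= u -> Rabs (ln (1 + u) - u) <= 2 * u ^ 2.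
Proof.
  intros Hu. destruct (ln_1p_bounds u ltac:(lra)) as [H1 H2].
  assert (H3 : u - 2 * u ^ 2 <= u / (1 + u)).
  { apply Rmult_le_reg_r with (1 + u); [lra|]. unfold Rdiv. rewrite Rmult_assoc, Rinv_l by lra.
    assert (0 <= u ^ 2 * (1 + 2 * u)) by (apply Rmult_le_pos; [apply pow2_ge_0 | lra]). nra. }
  apply Rabs_le. lra.
Qed.

Lemma digamma_terms (x : R) : 0 < x ->
  exists psi : R, is_lim_seq (fun N => ln (x + INR N) - rsum (fun k => / (x + INR k)) N) psi.
Proof.
  intros Hx.
  destruct (rsum_telescope_conv (fun k => ln (x + INR (S k)) - ln (x + INR k) - / (x + INR k))
    (fun k => / (x + INR k))) as [l [Hl _]].
  - intros k. pose proof (pos_INR k) as Hk. rewrite S_INR. set (a := x + INR k).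
    assert (Ha : 0 < a) by (unfold a; lra).
    assert (Hi : 0 < / a) by now apply Rinv_0_lt_compat.
    replace (x + (INR k + 1)) with (a * (1 + / a)) by (unfold a in *; field; lra).
    rewrite ln_mult by lra. destruct (ln_1p_bounds (/ a) ltac:(lra)) as [H1 H2].
    replace (/ a / (1 + / a)) with (/ (a * (1 + / a))) in H1 by (field; lra).
    rewrite Rabs_left1; lra.
  - apply is_lim_seq_inv_add.
  - exists (ln x + l).
    apply (is_lim_seq_ext (fun N => ln x + rsum (fun k => ln (x + INR (S k)) - ln (x + INR k) - / (x + INR k)) N)).
    + intros N. induction N as [|N IH]; [simpl; rewrite (Rplus_0_r x); ring|].
      change (rsum (fun k => ln (x + INR (S k)) - ln (x + INR k) - / (x + INR k)) (S N))
        with (rsum (fun k => ln (x + INR (S k)) - ln (x + INR k) - / (x + INR k)) N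
          + (ln (x + INR (S N)) - ln (x + INR N) - / (x + INR N))).
      change (rsum (fun k => / (x + INR k)) (S N)) with (rsum (fun k => / (x + INR k)) N + / (x + INR N)).
      lra.
    + apply is_lim_seq_plus'; [apply is_lim_seq_const | exact Hl].
Qed.

Lemma sum_inv_sqr_bound (x : R) : 0 < x ->
  exists S2, forall N, rsum (fun k => / (x + INR k) ^ 2) N <= S2.
Proof.
  intros Hx. exists (/ x ^ 2 + / x). intros N.
  assert (H : forall N, rsum (fun k => / (x + INR k) ^ 2) (S N) <= / x ^ 2 + / x - / (x + INR N)).
  { induction N0 as [|n IH].
    - simpl. rewrite !Rplus_0_r. lra.
    - change (rsum (fun k => / (x + INR k) ^ 2) (S (S n))) with
        (rsum (fun k => / (x + INR k) ^ 2) (S n) + / (x + INR (S n)) ^ 2).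
      pose proof (pos_INR n). rewrite S_INR. set (a := x + INR n) in *.
      assert (Ha : 0 < a) by (unfold a; lra).
      replace (x + (INR n + 1)) with (a + 1) by (unfold a; ring).
      assert (/ (a + 1) ^ 2 <= / a - / (a + 1)).
      { replace (/ a - / (a + 1)) with (/ (a * (a + 1))) by (field; lra).
        apply Rinv_le_contravar; nra. }
      lra. }
  destruct N as [|N].
  - simpl. assert (0 < / x) by now apply Rinv_0_lt_compat.
    assert (0 < / x ^ 2) by (apply Rinv_0_lt_compat; now apply pow_lt). simpl in *. lra.
  - specialize (H N). assert (0 < / (x + INR N)).
    { apply Rinv_0_lt_compat. pose proof (pos_INR N). lra. } lra.
Qed.

(** Termwise, the increment minus its linear part is [ln (1 + h / a) - h / a] with [a = x + k], at
    most [2 h ^ 2 / a ^ 2]. The sums of [1 / a ^ 2] are bounded, so the quadratic estimate survives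
    the limit. *)
Lemma is_derive_LG (x psi : R) : 0 < x ->
  is_lim_seq (fun N => ln (x + INR N) - rsum (fun k => / (x + INR k)) N) psi ->
  is_derive LG x psi.
Proof.
  intros Hx Hpsi. destruct (sum_inv_sqr_bound x Hx) as [S2 HS].
  (* With [Rabs h < x / 2] all ratios [h / a] stay above [- 1 / 2], as [ln_1p_quadratic] asks; the
     bound 1 is for [LG_limit]. *)
  apply (is_derive_quadratic (V := RN) LG x psi (2 * S2) (Rmin 1 (x / 2))).
  { apply Rmin_pos; lra. }
  intros h Hh. pose proof (Rmin_l 1 (x / 2)). pose proof (Rmin_r 1 (x / 2)).
  assert (Hh2 : Rabs h < x / 2) by lra. apply Rabs_def2 in Hh2.
  pose proof (LG_limit x h Hx ltac:(lra) ltac:(lra)) as HL.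
  pose proof (is_lim_seq_scal_l _ h _ Hpsi) as Hp. simpl in Hp.
  pose proof (is_lim_seq_minus' _ _ _ _ HL Hp) as HD.
  change (Rabs (LG (x + h) - LG x - h * psi) <= 2 * S2 * h ^ 2).
  apply (is_lim_seq_abs _ (LG (x + h) - LG x - h * psi)) in HD.
  apply (is_lim_seq_le _ (fun _ => 2 * S2 * h ^ 2) _ _) with (2 := HD) (3 := is_lim_seq_const _).
  intros N.
  replace (h * ln (x + INR N) - rsum (fun k => ln (x + h + INR k) - ln (x + INR k)) N -
    h * (ln (x + INR N) - rsum (fun k => / (x + INR k)) N))
    with (- (rsum (fun k => ln (x + h + INR k) - ln (x + INR k) - h * / (x + INR k)) N)).
  2:{ rewrite (rsum_minus (fun k => ln (x + h + INR k) - ln (x + INR k))), rsum_scal. ring. }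
  rewrite Rabs_Ropp.
  apply Rle_trans with (rsum (fun k => 2 * h ^ 2 * / (x + INR k) ^ 2) N).
  - apply rsum_abs_le. intros k. pose proof (pos_INR k). set (a := x + INR k).
    assert (Ha : x <= a) by (unfold a; lra).
    replace (x + h + INR k) with (a * (1 + h / a)) by (unfold a in *; field; lra).
    assert (Hu : - (1 / 2) <= h / a).
    { apply Rmult_le_reg_r with a; [lra|]. unfold Rdiv at 2. rewrite Rmult_assoc, Rinv_l; lra. }
    rewrite ln_mult by lra.
    replace (ln a + ln (1 + h / a) - ln a - h * / a) with (ln (1 + h / a) - h / a) by (unfold Rdiv; ring).
    eapply Rle_trans; [apply ln_1p_quadratic, Hu|]. right. field. lra.
  - rewrite rsum_scal. specialize (HS N). pose proof (pow2_ge_0 h). nra.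
Qed.

(** Substitution [t = exp v]: the one-sided filter at 0 becomes the filter at minus infinity. *)
Lemma Gamma_GR (x : R) : 0 < x -> Gamma x = GR x.
Proof.
  intros Hx. unfold Gamma. apply (is_RInt_gen_unique (V := RC)).
  intros P [eps HP]. unfold filtermapi.
  destruct (is_RInt_R_elim (V := RN) _ _ (GR_correct x Hx) eps) as [A HA].
  apply (Filter_prod _ _ _ (fun a => 0 < a < exp (- Rmax A 0)) (fun b => exp (Rmax A 0) < b)).
  - exists (mkposreal _ (exp_pos (- Rmax A 0))). intros y Hy Hy0.
    change (Rabs (y - 0) < exp (- Rmax A 0)) in Hy. rewrite Rminus_0_r in Hy.
    rewrite Rabs_pos_eq in Hy by lra. lra.
  - now exists (exp (Rmax A 0)).
  - intros a b Ha Hb. pose proof (Rmax_l A 0). pose proof (Rmax_r A 0).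
    assert (Hb0 : 0 < b) by (eapply Rlt_trans; [apply exp_pos | exact Hb]).
    assert (La : ln a < - A).
    { assert (ln a < - Rmax A 0); [|lra]. rewrite <- (ln_exp (- Rmax A 0)). apply ln_increasing; lra. }
    assert (Lb : A < ln b).
    { assert (Rmax A 0 < ln b); [|lra]. rewrite <- (ln_exp (Rmax A 0)). apply ln_increasing; [apply exp_pos | lra]. }
    destruct (HA (ln a) (ln b) La Lb) as [y [Hy Hby]].
    exists y. split; [|apply HP, Hby]. simpl.
    set (f := fun t => Rpower t (x - 1) * exp (- t)).
    assert (Hf : forall t, 0 < t -> continuous f t).
    { intros t Ht. apply continuous_of_ex_derive. unfold f, Rpower. auto_derive. auto. }
    assert (Hc : is_RInt (fun v => scal (exp v) (f (exp v))) (ln a) (ln b) (RInt f (exp (ln a)) (exp (ln b)))).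
    { apply (is_RInt_comp (V := RC) f exp exp).
      - intros v _. apply Hf, exp_pos.
      - intros v _. split; [apply is_derive_exp|].
        apply continuous_of_ex_derive. auto_derive. auto. }
    rewrite !exp_ln in Hc by lra.
    assert (E : RInt f a b = y).
    { rewrite <- (is_RInt_unique _ _ _ _ Hc), <- (is_RInt_unique _ _ _ _ Hy).
      apply RInt_ext. intros v _. unfold f, gamma_log, scal; simpl; unfold mult; simpl.
      unfold Rpower. rewrite ln_exp, <- exp_plus, <- exp_plus. f_equal. ring. }
    rewrite <- E. apply (RInt_correct (V := RC) f).
    apply (ex_RInt_continuous (V := RC)). intros t Ht. apply Hf.
    unfold Rmin in Ht. destruct (Rle_dec a b); lra.
Qed.

Theorem digamma_limit (x : R) : 0 < x ->
  is_lim_seq (fun N => ln (x + INR N) - rsum (fun k => / (x + INR k)) N) (digamma x).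
Proof.
  intros Hx. destruct (digamma_terms x Hx) as [psi Hpsi].
  assert (E : digamma x = psi); [|now rewrite E].
  assert (Hd : is_derive Gamma x (psi * GR x)).
  { apply (is_derive_ext_loc (fun x => exp (LG x))).
    - exists (mkposreal x Hx). intros y Hy. change (Rabs (y - x) < x) in Hy.
      apply Rabs_def2 in Hy. rewrite Gamma_GR by (simpl in *; lra). unfold LG. apply exp_ln, GR_pos.
      simpl in *; lra.
    - replace (GR x) with (exp (LG x)) by (unfold LG; apply exp_ln, GR_pos, Hx).
      apply (is_derive_comp (V := RN) exp LG x (exp (LG x)) psi).
      + apply is_derive_exp.
      + now apply is_derive_LG. }
  unfold digamma. rewrite (is_derive_unique _ _ _ Hd), Gamma_GR by auto.
  pose proof (GR_pos x Hx). field. lra.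
Qed.

(** * Real integrals over the line and elementary examples *)

Lemma RR_plus (f g : R -> R) (a b : R) :
  is_RInt_R f a -> is_RInt_R g b -> is_RInt_R (fun t => f t + g t) (a + b).
Proof. exact (is_RInt_R_plus (V := RN) f g a b). Qed.

Lemma RR_minus (f g : R -> R) (a b : R) :
  is_RInt_R f a -> is_RInt_R g b -> is_RInt_R (fun t => f t - g t) (a - b).
Proof. exact (is_RInt_R_minus (V := RN) f g a b). Qed.

Lemma RR_scal (f : R -> R) (k a : R) : is_RInt_R f a -> is_RInt_R (fun t => k * f t) (k * a).
Proof. exact (is_RInt_R_scal (V := RN) f k a). Qed.

Lemma RR_ext (f g : R -> R) (a : R) : (forall t, f t = g t) -> is_RInt_R f a -> is_RInt_R g a.
Proof. exact (is_RInt_R_ext (V := RN) f g a). Qed.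

Lemma RR_unique (f : R -> R) (a b : R) : is_RInt_R f a -> is_RInt_R f b -> a = b.
Proof. exact (is_RInt_R_unique (V := RC) f a b). Qed.

Lemma RR_abs_le (f g : R -> R) (a b : R) :
  is_RInt_R f a -> is_RInt_R g b -> (forall t, Rabs (f t) <= g t) -> Rabs a <= b.
Proof. exact (is_RInt_R_norm_le (V := RC) f g a b). Qed.

Lemma RR_le (f g : R -> R) (a b : R) :
  is_RInt_R f a -> is_RInt_R g b -> (forall t, f t <= g t) -> a <= b.
Proof.
  intros Hf Hg H. pose proof (RR_minus _ _ _ _ Hg Hf) as Hd.
  assert (Rabs (b - a) <= b - a).
  { apply (RR_abs_le _ _ _ _ Hd Hd). intros t. rewrite Rabs_pos_eq; specialize (H t); lra. }
  pose proof (Rabs_pos (b - a)). lra.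
Qed.

Lemma RR_ex (f : R -> R) (C : R) : (forall t, continuous f t) ->
  (forall t, Rabs (f t) <= C / (1 + t ^ 2)) -> exists l : R, is_RInt_R f l.
Proof. exact (is_RInt_R_ex (V := RC) f C). Qed.

Lemma exp_decay_cauchy (f : R -> R) (C k : R) : 0 < k ->
  (forall t, Rabs (f t) <= C * exp (- (k * Rabs t))) ->
  forall t, Rabs (f t) <= C * (1 + 2 / k ^ 2) / (1 + t ^ 2).
Proof.
  intros Hk H t. eapply Rle_trans; [apply H|].
  assert (HC : 0 <= C).
  { specialize (H 0). pose proof (Rabs_pos (f 0)). rewrite Rabs_R0, Rmult_0_r, Ropp_0, exp_0 in H. lra. }
  unfold Rdiv at 1. rewrite Rmult_assoc. apply Rmult_le_compat_l; auto.
  apply exp_neg_le_cauchy, Hk.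
Qed.

Lemma RR_ex_exp (f : R -> R) (C k : R) : 0 < k -> (forall t, continuous f t) ->
  (forall t, Rabs (f t) <= C * exp (- (k * Rabs t))) -> exists l : R, is_RInt_R f l.
Proof. intros Hk Hc H. apply (RR_ex f _ Hc (exp_decay_cauchy f C k Hk H)). Qed.

Lemma filterlim_0_p_infty (f : R -> R) (C k b : R) : 0 < k ->
  (forall v, b <= v -> Rabs (f v) <= C * exp (- (k * v))) ->
  filterlim f (Rbar_locally p_infty) (locally 0).
Proof.
  intros Hk H. apply (filterlim_0_bound f (fun v => C * exp (- (k * v))) (Rbar_locally p_infty)).
  - exists b. intros v Hv. apply H. lra.
  - rewrite <- (Rmult_0_r C).
    apply (filterlim_comp _ _ _ (fun v => exp (- (k * v))) (Rmult C) _ (locally 0)).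
    + now apply filterlim_exp_neg.
    + apply (continuous_of_ex_derive (Rmult C) 0). auto_derive. auto.
Qed.

Lemma filterlim_0_m_infty (f : R -> R) (C k b : R) : 0 < k ->
  (forall v, v <= b -> Rabs (f v) <= C * exp (k * v)) ->
  filterlim f (Rbar_locally m_infty) (locally 0).
Proof.
  intros Hk H.
  apply (filterlim_ext (fun v => f (- - v))); [intros v; now rewrite Ropp_involutive|].
  apply (filterlim_comp _ _ _ Ropp (fun v => f (- v)) _ (Rbar_locally p_infty)).
  - apply (filterlim_Rbar_opp m_infty).
  - apply (filterlim_0_p_infty _ C k (- b) Hk). intros v Hv.
    replace (- (k * v)) with (k * - v) by ring. apply H. lra.
Qed.

Lemma filterlim_R_shift (f : R -> R) (l : R) (F : (R -> Prop) -> Prop) {FF : Filter F} :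
  filterlim (fun v => f v - l) F (locally 0) -> filterlim f F (locally l).
Proof.
  intros H. apply (filterlim_ext (fun v => (f v - l) + l)); [intros; ring|].
  replace (locally l) with (locally (0 + l)) by (now rewrite Rplus_0_l).
  apply (filterlim_comp _ _ _ (fun v => f v - l) (fun z => z + l) _ (locally 0)); auto.
  apply (continuous_of_ex_derive (fun z => z + l) 0). auto_derive. auto.
Qed.

Lemma RR_derive (F f : R -> R) (la lb : R) :
  (forall t, is_derive F t (f t)) -> (forall t, continuous f t) ->
  filterlim F (Rbar_locally m_infty) (locally la) ->
  filterlim F (Rbar_locally p_infty) (locally lb) -> is_RInt_R f (lb - la).
Proof. exact (is_RInt_R_derive (V := RC) F f la lb). Qed.

Lemma one_minus_exp_neg (z : R) : 0 <= z -> 0 <= 1 - exp (- z) <= z.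
Proof.
  intros Hz. pose proof (exp_ineq1_le (- z)).
  assert (exp (- z) <= exp 0) by (apply exp_le; lra). rewrite exp_0 in H0. lra.
Qed.

Lemma exp_neg_le_inv (z : R) : 0 < z -> exp (- z) <= / z.
Proof.
  intros Hz. rewrite exp_Ropp. apply Rinv_le_contravar; auto.
  pose proof (exp_ineq1_le z). lra.
Qed.

Lemma exp_exp_m_infty (y v : R) : 0 < y -> Rabs (1 - exp (- (y * exp v))) <= y * exp (1 * v).
Proof.
  intros Hy. rewrite Rmult_1_l. pose proof (exp_pos v).
  destruct (one_minus_exp_neg (y * exp v) ltac:(nra)). rewrite Rabs_pos_eq; lra.
Qed.

Lemma exp_exp_p_infty (y v : R) : 0 < y -> Rabs (exp (- (y * exp v))) <= / y * exp (- (1 * v)).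
Proof.
  intros Hy. pose proof (exp_pos v). rewrite Rabs_pos_eq by (left; apply exp_pos).
  rewrite Rmult_1_l, (exp_Ropp v), <- Rinv_mult by lra. apply exp_neg_le_inv. nra.
Qed.

Lemma exp_integral (y : R) : 0 < y -> is_RInt_R (fun v => exp v * exp (- (y * exp v))) (/ y).
Proof.
  intros Hy.
  replace (/ y) with (/ y - 0) by ring.
  apply (RR_derive (fun v => / y * (1 - exp (- (y * exp v))))).
  - intros v. auto_derive; auto. field. lra.
  - intros v. apply continuous_of_ex_derive. auto_derive. auto.
  - apply (filterlim_0_m_infty _ 1 1 0); [lra|]. intros v _.
    rewrite Rabs_mult, (Rabs_pos_eq (/ y)) by (left; now apply Rinv_0_lt_compat).
    pose proof (exp_exp_m_infty y v Hy) as H.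
    apply (Rmult_le_compat_l (/ y)) in H; [|left; now apply Rinv_0_lt_compat].
    rewrite <- Rmult_assoc, Rinv_l in H; lra.
  - apply filterlim_R_shift. apply Rbar_locally_filter.
    apply (filterlim_0_p_infty _ (/ y * / y) 1 0); [lra|]. intros v _.
    replace (/ y * (1 - exp (- (y * exp v))) - / y) with (- (/ y * exp (- (y * exp v)))) by ring.
    rewrite Rabs_Ropp, Rabs_mult, (Rabs_pos_eq (/ y)), Rmult_assoc by (left; now apply Rinv_0_lt_compat).
    apply Rmult_le_compat_l; [left; now apply Rinv_0_lt_compat | now apply exp_exp_p_infty].
Qed.

Lemma is_derive_RInt_from_0 (f : R -> R) (x : R) : (forall t, continuous f t) ->
  is_derive (fun u => RInt f 0 u) x (f x).
Proof.
  intros Hc. apply (is_derive_RInt (V := RN) f (fun u => RInt f 0 u) 0 x).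
  - exists (mkposreal 1 Rlt_0_1). intros u _. apply (RInt_correct (V := RC)).
    apply (ex_RInt_cont (V := RC)), Hc.
  - apply Hc.
Qed.

(** Frullani's integral of [(exp (- a t) - exp (- b t)) / t] in the variable [v = ln t]. Both terms
    are translates of one function [P], so a primitive is [Q (v + ln a) - Q (v + ln b)]. At minus
    infinity [P] tends to 1 and this primitive to [ln a - ln b]; at plus infinity it tends to 0. *)
Lemma frullani (a b : R) : 0 < a -> 0 < b ->
  is_RInt_R (fun v => exp (- (a * exp v)) - exp (- (b * exp v))) (ln b - ln a).
Proof.
  intros Ha Hb. set (P := fun v => exp (- exp v)).
  assert (HP : forall t, continuous P t).
  { intros t. apply continuous_of_ex_derive. unfold P. auto_derive. auto. }
  set (Q := fun u => RInt P 0 u).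
  assert (HQ : forall t, is_derive Q t (P t)) by (intros; now apply is_derive_RInt_from_0).
  assert (Ea : forall c v, 0 < c -> P (v + ln c) = exp (- (c * exp v))).
  { intros c v Hc. unfold P. rewrite exp_plus, exp_ln by auto. do 2 f_equal. ring. }
  replace (ln b - ln a) with (0 - (ln a - ln b)) by ring.
  assert (Hmv : forall v, exists c, Rmin (v + ln b) (v + ln a) <= c <= Rmax (v + ln b) (v + ln a)
    /\ Q (v + ln a) - Q (v + ln b) = P c * (ln a - ln b)).
  { intros v. destruct (mean_value Q P (v + ln b) (v + ln a) HQ) as [c [Hc E]].
    exists c. split; auto. rewrite E. ring. }
  apply (RR_derive (fun v => Q (v + ln a) - Q (v + ln b))).
  - intros v. rewrite <- (Ea a v Ha), <- (Ea b v Hb).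
    apply (is_derive_minus (V := RN) (fun v => Q (v + ln a)) (fun v => Q (v + ln b))).
    + rewrite <- (Rmult_1_l (P (v + ln a))).
      apply (is_derive_comp (V := RN) Q (fun v => v + ln a)); [apply HQ|]. auto_derive; auto.
    + rewrite <- (Rmult_1_l (P (v + ln b))).
      apply (is_derive_comp (V := RN) Q (fun v => v + ln b)); [apply HQ|]. auto_derive; auto.
  - intros v. apply continuous_of_ex_derive. auto_derive. auto.
  - apply filterlim_R_shift; [apply Rbar_locally_filter|].
    apply (filterlim_0_m_infty _ (Rabs (ln a - ln b) * exp (Rmax (ln b) (ln a))) 1 0); [lra|].
    intros v _. destruct (Hmv v) as [c [[_ Hc] ->]].
    replace (P c * (ln a - ln b) - (ln a - ln b)) with (- ((ln a - ln b) * (1 - exp (- (1 * exp c)))))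
      by (unfold P; rewrite Rmult_1_l; ring).
    rewrite Rabs_Ropp, Rabs_mult, Rmult_assoc. apply Rmult_le_compat_l; [apply Rabs_pos|].
    eapply Rle_trans; [apply exp_exp_m_infty; lra|].
    rewrite !Rmult_1_l, <- exp_plus. apply exp_le. eapply Rle_trans; [exact Hc|].
    apply Rmax_lub; [pose proof (Rmax_l (ln b) (ln a)) | pose proof (Rmax_r (ln b) (ln a))]; lra.
  - apply (filterlim_0_p_infty _ (Rabs (ln a - ln b) * exp (- Rmin (ln b) (ln a))) 1 0); [lra|].
    intros v _. destruct (Hmv v) as [c [[Hc _] ->]].
    replace (P c * (ln a - ln b)) with ((ln a - ln b) * exp (- (1 * exp c)))
      by (unfold P; rewrite Rmult_1_l; ring).
    rewrite Rabs_mult, Rmult_assoc. apply Rmult_le_compat_l; [apply Rabs_pos|].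
    eapply Rle_trans; [apply exp_exp_p_infty; lra|].
    rewrite Rinv_1, !Rmult_1_l, <- exp_plus. apply exp_le.
    assert (v + Rmin (ln b) (ln a) <= Rmin (v + ln b) (v + ln a)).
    { apply Rmin_glb; [pose proof (Rmin_l (ln b) (ln a)) | pose proof (Rmin_r (ln b) (ln a))]; lra. }
    lra.
Qed.

(** * Laplace and Mellin transforms attached to digamma *)

(* [gdig y] is [ln y - psi (y + 1)]. *)
Definition gdig (y : R) : R := ln y - / y - digamma y.

(** The truncation of [gdig] after [N] terms; it also occurs when one index of the double sum is
    summed out. *)
Definition gM (N : nat) (y : R) : R :=
  rsum (fun k => / (y + INR (S k))) N - (ln (y + INR N) - ln y).

Lemma gM_limit (y : R) : 0 < y -> is_lim_seq (fun N => gM N y) (gdig y).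
Proof.
  intros Hy. unfold gdig.
  replace (ln y - / y - digamma y) with (ln y - / y - digamma y + 0) by ring.
  apply (is_lim_seq_ext (fun N => (ln y - / y - (ln (y + INR N) - rsum (fun k => / (y + INR k)) N))
    + / (y + INR N))).
  - intros N. unfold gM.
    assert (E : rsum (fun k => / (y + INR (S k))) N
      = rsum (fun k => / (y + INR k)) N - / y + / (y + INR N)).
    { induction N as [|N IH]; [simpl; rewrite Rplus_0_r; ring|]. cbn [rsum]. rewrite IH. ring. }
    rewrite E. ring.
  - apply is_lim_seq_plus'; [|apply is_lim_seq_inv_add].
    apply is_lim_seq_minus'; [apply is_lim_seq_const | now apply digamma_limit].
Qed.

Lemma gM_add (N P : nat) (y : R) : gM (N + P) y = gM N y + gM P (y + INR N).
Proof.
  unfold gM. rewrite plus_INR, Rplus_assoc.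
  assert (E : rsum (fun k => / (y + INR (S k))) (N + P) = rsum (fun k => / (y + INR (S k))) N
    + rsum (fun k => / (y + INR N + INR (S k))) P).
  { induction P as [|P IH]; [rewrite Nat.add_0_r; simpl; ring|].
    rewrite Nat.add_succ_r. cbn [rsum]. rewrite IH.
    replace (y + INR N + INR (S P)) with (y + INR (S (N + P))); [ring|].
    rewrite !S_INR, plus_INR. ring. }
  rewrite E. ring.
Qed.

(** Let the second index of the cocycle relation [gM_add] tend to infinity. *)
Lemma gM_eq (N : nat) (y : R) : 0 < y -> gM N y = gdig y - gdig (y + INR N).
Proof.
  intros Hy. pose proof (pos_INR N).
  pose proof (gM_limit (y + INR N) ltac:(lra)) as H1.
  pose proof (is_lim_seq_plus' _ _ _ _ (is_lim_seq_const (gM N y)) H1) as H2.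
  assert (E : gdig y = gM N y + gdig (y + INR N)); [|lra].
  apply (is_lim_seq_uniq (fun P => gM N y + gM P (y + INR N))); auto.
  apply (is_lim_seq_ext (fun P => gM (P + N) y)).
  - intros P. rewrite Nat.add_comm. apply gM_add.
  - apply (is_lim_seq_incr_n (fun P => gM P y) N). now apply gM_limit.
Qed.

Lemma gM_S (N : nat) (y : R) : gM (S N) y = gM N y + (/ (y + INR (S N)) - (ln (y + INR (S N)) - ln (y + INR N))).
Proof. unfold gM. cbn [rsum]. ring. Qed.

Lemma gM_bounds (N : nat) (y : R) : 0 < y -> / (y + INR N) - / y <= gM N y <= 0.
Proof.
  intros Hy. induction N as [|N IH].
  - unfold gM. simpl. rewrite Rplus_0_r. lra.
  - rewrite gM_S. pose proof (pos_INR N). rewrite S_INR. set (a := y + INR N) in *.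
    assert (Ha : 0 < a) by (unfold a; lra).
    replace (y + (INR N + 1)) with (a * (1 + / a)) by (unfold a in *; field; lra).
    assert (Hi : 0 < / a) by now apply Rinv_0_lt_compat.
    rewrite ln_mult by lra. destruct (ln_1p_bounds (/ a) ltac:(lra)) as [H1 H2].
    replace (/ a / (1 + / a)) with (/ (a * (1 + / a))) in H1 by (field; lra). lra.
Qed.

Lemma gdig_bounds (y : R) : 0 < y -> - / y <= gdig y <= 0.
Proof.
  intros Hy. pose proof (gM_limit y Hy) as Hl. split.
  - apply (is_lim_seq_le (fun _ => - / y) (fun N => gM N y) (- / y) (gdig y));
      [|apply is_lim_seq_const | auto].
    intros N. destruct (gM_bounds N y Hy). pose proof (pos_INR N).
    assert (0 < / (y + INR N)) by (apply Rinv_0_lt_compat; lra). lra.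
  - apply (is_lim_seq_le (fun N => gM N y) (fun _ => 0) (gdig y) 0);
      [|auto | apply is_lim_seq_const].
    intros N. apply gM_bounds, Hy.
Qed.

(** The bound [- 1 / y] is too weak near 0, where only a logarithm occurs. One step of [gM_eq] moves
    the argument to [y + 1]; the terms [1 / (y + 1)] cancel and [ln y - ln (y + 1)] remains. *)
Lemma gdig_lower (y : R) : 0 < y <= 1 -> ln y - 1 <= gdig y.
Proof.
  intros Hy. pose proof (gM_eq 1 y ltac:(lra)) as E. unfold gM in E. simpl in E.
  destruct (gdig_bounds (y + 1) ltac:(lra)) as [H _].
  destruct (ln_1p_bounds y ltac:(lra)) as [_ H1]. rewrite (Rplus_comm y 1) in *. lra.
Qed.

(** Binet's function [1 / (exp t - 1) - 1 / t + 1 / 2] at [t = exp v]. Mellin integrals are written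
    additively in [v], where dilations become translations. *)
Definition W (v : R) : R := 1 / (exp (exp v) - 1) - 1 / exp v + 1 / 2.

(** Truncated partial fraction expansion of [W]; its frequencies [2 PI n] are the source of the zeta
    factor in the Mellin transform. *)
Definition Wp (N : nat) (v : R) : R :=
  rsum (fun k => 2 * exp v / (exp v ^ 2 + freq k ^ 2)) N.

Lemma Wp_lim (v : R) : is_lim_seq (fun N => Wp N v) (W v).
Proof. apply coth_partial_fractions, exp_pos. Qed.

Lemma Wp_term_pos (v : R) (k : nat) : 0 < 2 * exp v / (exp v ^ 2 + freq k ^ 2).
Proof.
  pose proof (exp_pos v). pose proof (freq_pos k).
  apply Rdiv_lt_0_compat; [lra|]. nra.
Qed.

Lemma Wp_le_W (N : nat) (v : R) : Wp N v <= W v.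
Proof.
  apply (is_lim_seq_incr_compare (fun N => Wp N v)); [apply Wp_lim|].
  intros n. unfold Wp. cbn [rsum]. pose proof (Wp_term_pos v n). lra.
Qed.

Lemma Wp_pos (N : nat) (v : R) : 0 <= Wp N v.
Proof.
  induction N as [|N IH]; [unfold Wp; simpl; lra|]. unfold Wp in *. cbn [rsum]. pose proof (Wp_term_pos v N). lra.
Qed.

Lemma W_pos (v : R) : 0 <= W v.
Proof. eapply Rle_trans; [apply (Wp_pos 0 v) | apply Wp_le_W]. Qed.

(** Discarding [exp v ^ 2] in the denominators bounds the tail by that of the series of inverse
    squares, whose sum is [basel]. At [N = 0] this becomes [W v <= exp v / 12]. *)
Lemma W_tail (N : nat) (v : R) :
  W v - Wp N v <= exp v / (2 * PI ^ 2) * (PI ^ 2 / 6 - rsum (fun k => / INR (S k) ^ 2) N).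
Proof.
  set (u := fun N => exp v / (2 * PI ^ 2) * rsum (fun k => / INR (S k) ^ 2) N - Wp N v).
  assert (Hl : is_lim_seq u (exp v / (2 * PI ^ 2) * (PI ^ 2 / 6) - W v)).
  { apply is_lim_seq_minus'; [|apply Wp_lim].
    apply (is_lim_seq_scal_l _ _ _ basel). }
  assert (H : u N <= exp v / (2 * PI ^ 2) * (PI ^ 2 / 6) - W v).
  { apply (is_lim_seq_incr_compare u _ Hl). intros n. unfold u, Wp. cbn [rsum].
    assert (2 * exp v / (exp v ^ 2 + freq n ^ 2) <= exp v / (2 * PI ^ 2) * / INR (S n) ^ 2); [|lra].
    pose proof (exp_pos v). pose proof (freq_pos n). pose proof PI_RGT_0.
    pose proof (INR_S_ge_1 n).
    replace (exp v / (2 * PI ^ 2) * / INR (S n) ^ 2) with (2 * exp v * / (freq n ^ 2))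
      by (unfold freq; field; split; lra).
    apply Rmult_le_compat_l; [lra|]. apply Rinv_le_contravar; nra. }
  unfold u in H. lra.
Qed.

Lemma W_le_exp (v : R) : W v <= exp v / 12.
Proof.
  pose proof (W_tail 0 v) as H. unfold Wp in H. simpl rsum in H. pose proof PI_RGT_0.
  replace (exp v / (2 * PI ^ 2) * (PI ^ 2 / 6 - 0)) with (exp v / 12) in H by (field; lra). lra.
Qed.

Lemma exp_exp_gt_1 (v : R) : exp v < exp (exp v) - 1.
Proof. pose proof (exp_ineq1 (exp v)) as H. pose proof (exp_pos v). lra. Qed.

Lemma W_le_half (v : R) : W v <= / 2.
Proof.
  unfold W. pose proof (exp_pos v). pose proof (exp_exp_gt_1 v).
  assert (1 / (exp (exp v) - 1) <= 1 / exp v); [|lra].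
  unfold Rdiv. rewrite !Rmult_1_l. apply Rinv_le_contravar; lra.
Qed.

Lemma continuous_W (v : R) : continuous W v.
Proof.
  apply continuous_of_ex_derive. unfold W. pose proof (exp_pos v). pose proof (exp_exp_gt_1 v).
  auto_derive. repeat split; lra.
Qed.

Lemma gamma_log_1_exp (y v : R) : 0 < y ->
  gamma_log 1 (v + ln y) = y * (exp v * exp (- (y * exp v))).
Proof.
  intros Hy. unfold gamma_log, Rminus. rewrite Rmult_1_l, !exp_plus, exp_ln by auto.
  rewrite (Rmult_comm (exp v) y), Rmult_assoc. reflexivity.
Qed.

Lemma GR_1 : GR 1 = 1.
Proof.
  apply (RR_unique (gamma_log 1)); [apply GR_correct; lra|].
  rewrite <- Rinv_1 at 2. apply (RR_ext (fun v => exp v * exp (- (1 * exp v)))).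
  - intros v. unfold gamma_log, Rminus. rewrite exp_plus, !Rmult_1_l. reflexivity.
  - apply exp_integral. lra.
Qed.

(** Translating by [ln y] turns the Laplace weight into [gamma_log 1]. The two bounds on [W] then
    give [GR 1 / (2 y)] and [GR 2 / (12 y ^ 2)], with both Gamma values equal to 1. *)
Lemma laplace_W_ex (y : R) : 0 < y ->
  exists I, is_RInt_R (fun v => exp v * exp (- (y * exp v)) * W v) I /\ 0 <= I <= / (2 * y)
    /\ I <= / (12 * y ^ 2).
Proof.
  intros Hy. destruct (gamma_log_cauchy 1 ltac:(lra)) as (C & HC & Hb).
  destruct (RR_ex (fun u => gamma_log 1 u * W (u - ln y)) C) as [l Hl].
  - intros u. apply continuous_multR; [apply continuous_gamma_log|].
    apply (continuous_comp (fun u => u - ln y) W); [|apply continuous_W].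
    apply continuous_of_ex_derive. auto_derive. auto.
  - intros u. pose proof (gamma_log_pos 1 u). pose proof (W_pos (u - ln y)). pose proof (W_le_half (u - ln y)).
    rewrite Rabs_pos_eq by nra. specialize (Hb u). nra.
  - pose proof (is_RInt_R_translate (V := RN) _ (ln y) _ Hl) as H1. simpl in H1.
    apply (RR_scal _ (/ y)) in H1.
    assert (Hy' : 0 < / y) by now apply Rinv_0_lt_compat.
    assert (HI : is_RInt_R (fun v => exp v * exp (- (y * exp v)) * W v) (/ y * l)).
    { revert H1. apply RR_ext. intros v. rewrite gamma_log_1_exp by auto.
      replace (v + ln y - ln y) with v by ring. field. lra. }
    exists (/ y * l). split; [exact HI|].
    assert (0 <= l).
    { pose proof (RR_scal _ 0 _ Hl) as H0. rewrite Rmult_0_l in H0.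
      apply (RR_le _ _ _ _ H0 Hl). intros u.
      pose proof (gamma_log_pos 1 u). pose proof (W_pos (u - ln y)). nra. }
    split; [split|].
    + nra.
    + pose proof (RR_scal _ (/ 2) _ (GR_correct 1 ltac:(lra))) as H2.
      assert (l <= / 2 * GR 1).
      { apply (RR_le _ _ _ _ Hl H2). intros u. pose proof (gamma_log_pos 1 u).
        pose proof (W_le_half (u - ln y)). nra. }
      rewrite GR_1 in H0. rewrite Rinv_mult. nra.
    + pose proof (RR_scal _ (/ (12 * y)) _ (GR_correct (1 + 1) ltac:(lra))) as H2.
      rewrite GR_succ, GR_1 in H2 by lra.
      assert (l <= / (12 * y) * (1 * 1)).
      { apply (RR_le _ _ _ _ Hl H2). intros u. pose proof (gamma_log_pos 1 u).
        pose proof (W_le_exp (u - ln y)) as H3.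
        replace (gamma_log (1 + 1) u) with (gamma_log 1 u * exp u).
        2:{ unfold gamma_log. rewrite <- exp_plus. f_equal. ring. }
        unfold Rminus in H3. rewrite exp_plus, exp_Ropp, exp_ln in H3 by auto.
        replace (/ (12 * y) * (gamma_log 1 u * exp u)) with (gamma_log 1 u * (exp u * / y / 12)) by (field; lra).
        apply Rmult_le_compat_l; [lra | exact H3]. }
      replace (/ (12 * y ^ 2)) with (/ y * (/ (12 * y) * (1 * 1))) by (field; lra).
      apply Rmult_le_compat_l; lra.
Qed.

(** The negative of [psi y + 1 / (2 y) - ln y], the unweighted summand of [phi_log]. *)
Definition Vd (y : R) : R := gdig y + / (2 * y).

(** The difference contains [1 - exp (- t)], which clears the denominator [exp t - 1]; what is left
    are exponentials and a Frullani integral. *)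
Lemma laplace_W_step (y I J : R) : 0 < y ->
  is_RInt_R (fun v => exp v * exp (- (y * exp v)) * W v) I ->
  is_RInt_R (fun v => exp v * exp (- ((y + 1) * exp v)) * W v) J ->
  I - J = / 2 * (/ y + / (y + 1)) - (ln (y + 1) - ln y).
Proof.
  intros Hy HI HJ. pose proof (RR_minus _ _ _ _ HI HJ) as H1.
  pose proof (exp_integral y Hy) as E1. pose proof (exp_integral (y + 1) ltac:(lra)) as E2.
  pose proof (RR_scal _ (/ 2) _ (RR_plus _ _ _ _ E1 E2)) as H2.
  pose proof (RR_minus _ _ _ _ H2 (frullani y (y + 1) Hy ltac:(lra))) as H3.
  refine (RR_unique _ _ _ H1 _). revert H3. apply RR_ext. intros v.
  replace (- ((y + 1) * exp v)) with (- (y * exp v) + - exp v) by ring.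
  rewrite exp_plus, (exp_Ropp (exp v)). unfold W.
  pose proof (exp_pos v). pose proof (exp_exp_gt_1 v). field. repeat split; lra.
Qed.

(** Both sides obey the same difference equation in [y] and tend to zero along [y + N]. *)
Theorem Vd_laplace (y : R) : 0 < y -> is_RInt_R (fun v => exp v * exp (- (y * exp v)) * W v) (Vd y).
Proof.
  intros Hy.
  assert (Hall : forall N, exists I, is_RInt_R (fun v => exp v * exp (- ((y + INR N) * exp v)) * W v) I
    /\ 0 <= I <= / (2 * (y + INR N))).
  { intros N. pose proof (pos_INR N). destruct (laplace_W_ex (y + INR N) ltac:(lra)) as [I [H1 [H2 _]]].
    now exists I. }
  destruct (Hall 0%nat) as [I0 [HI0 _]]. simpl in HI0. rewrite Rplus_0_r in HI0.
  assert (E : forall N I, is_RInt_R (fun v => exp v * exp (- ((y + INR N) * exp v)) * W v) I ->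
    I0 - I = gM N y + / (2 * y) - / (2 * (y + INR N))).
  { induction N as [|N IH]; intros I HI.
    - simpl in HI. rewrite Rplus_0_r in HI. rewrite (RR_unique _ _ _ HI HI0).
      unfold gM. simpl. rewrite Rplus_0_r. ring.
    - destruct (Hall N) as [J [HJ _]]. specialize (IH J HJ). pose proof (pos_INR N).
      rewrite S_INR, <- Rplus_assoc in HI |- *.
      pose proof (laplace_W_step (y + INR N) J I ltac:(lra) HJ HI) as H1.
      rewrite gM_S, S_INR, <- Rplus_assoc.
      replace (I0 - I) with ((I0 - J) + (J - I)) by ring. rewrite IH, H1. field. lra. }
  assert (EV : Vd y = I0); [|now rewrite EV].
  apply (is_lim_seq_uniq (fun N => gM N y + / (2 * y))).
  - unfold Vd. apply is_lim_seq_plus'; [now apply gM_limit | apply is_lim_seq_const].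
  - apply (is_lim_seq_le_0 _ (fun N => / (y + INR N))); [|apply is_lim_seq_inv_add].
    intros N. destruct (Hall N) as [J [HJ HJb]]. specialize (E N J HJ). pose proof (pos_INR N).
    rewrite Rinv_mult in HJb, E.
    assert (0 < / (y + INR N)) by (apply Rinv_0_lt_compat; lra).
    apply Rabs_le. rewrite !Rinv_mult in *. lra.
Qed.

Lemma Vd_bounds (y : R) : 0 < y -> 0 <= Vd y <= / (12 * y ^ 2).
Proof.
  intros Hy. destruct (laplace_W_ex y Hy) as [I [HI [H1 H2]]].
  rewrite (RR_unique _ _ _ (Vd_laplace y Hy) HI). lra.
Qed.

Lemma gdig_laplace (y : R) : 0 < y ->
  is_RInt_R (fun v => exp v * exp (- (y * exp v)) * (W v - / 2)) (gdig y).
Proof.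
  intros Hy. pose proof (RR_minus _ _ _ _ (Vd_laplace y Hy) (RR_scal _ (/ 2) _ (exp_integral y Hy))) as H.
  replace (gdig y) with (Vd y - / 2 * / y) by (unfold Vd; field; lra).
  revert H. apply RR_ext. intros v. ring.
Qed.

(** In the Laplace representation the weight of [gdig y] is [W - 1 / 2 <= 0] and that of
    [gdig y + / y] is [W + 1 / 2 >= 0]. The opposite monotonicities give [gdig] the modulus of
    continuity of [/ y]. *)
Lemma gdig_mono (y z : R) : 0 < y <= z -> gdig y <= gdig z /\ gdig z + / z <= gdig y + / y.
Proof.
  intros H.
  assert (He : forall v, exp (- (z * exp v)) <= exp (- (y * exp v))).
  { intros v. apply exp_le. pose proof (exp_pos v). nra. }
  split.
  - apply (RR_le _ _ _ _ (gdig_laplace y ltac:(lra)) (gdig_laplace z ltac:(lra))). intros v.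
    pose proof (W_le_half v). pose proof (exp_pos v). specialize (He v).
    assert (0 <= exp v * (exp (- (y * exp v)) - exp (- (z * exp v)))) by nra. nra.
  - pose proof (RR_plus _ _ _ _ (gdig_laplace y ltac:(lra)) (exp_integral y ltac:(lra))) as H1.
    pose proof (RR_plus _ _ _ _ (gdig_laplace z ltac:(lra)) (exp_integral z ltac:(lra))) as H2.
    apply (RR_le _ _ _ _ H2 H1). intros v.
    pose proof (W_pos v). pose proof (exp_pos v). specialize (He v).
    assert (0 <= exp v * (exp (- (y * exp v)) - exp (- (z * exp v)))) by nra. nra.
Qed.

Lemma continuous_gdig (y : R) : 0 < y -> continuous gdig y.
Proof.
  intros Hy. assert (Hi : continuous (fun z => / z) y).
  { apply continuous_of_ex_derive. auto_derive. lra. }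
  intros P [eps HP]. unfold filtermap.
  assert (H1 : locally y (fun z => ball (/ y) eps (/ z))) by apply (Hi _ (locally_ball (/ y) eps)).
  assert (H2 : locally y (fun z => 0 < z)).
  { exists (mkposreal y Hy). intros z Hz. change (Rabs (z - y) < y) in Hz. apply Rabs_def2 in Hz. lra. }
  generalize (filter_and _ _ H1 H2). apply filter_imp. intros z [Hz Hz0]. apply HP.
  change (Rabs (/ z - / y) < eps) in Hz. change (Rabs (gdig z - gdig y) < eps).
  eapply Rle_lt_trans; [|exact Hz].
  destruct (Rle_dec y z) as [H|H].
  - destruct (gdig_mono y z ltac:(lra)). rewrite Rabs_pos_eq, Rabs_left1; lra.
  - destruct (gdig_mono z y ltac:(lra)). rewrite Rabs_left1, Rabs_pos_eq; lra.
Qed.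

(** * Tails of primitives and the Mellin transform of a convolution *)

Lemma nondecreasing_left (f df : R -> R) (b : R) :
  (forall t, is_derive f t (df t)) -> (forall t, t <= b -> 0 <= df t) ->
  forall w u, w <= u -> u <= b -> f w <= f u.
Proof.
  intros Hd Hp w u Hw Hu. destruct (mean_value f df w u Hd) as [c [Hc E]].
  rewrite Rmin_left, Rmax_right in Hc by lra. specialize (Hp c ltac:(lra)).
  assert (0 <= df c * (u - w)) by (apply Rmult_le_pos; lra). lra.
Qed.

(** Here [c] is the integral of [p] over the negative half-line, so [c + RInt p 0 u] is the
    primitive vanishing at minus infinity. Added to or subtracted from [A / k * exp (k * u)] it
    gives nondecreasing functions, which are nonnegative because of their behaviour at minus
    infinity. *)
Lemma antiderivative_left (p : R -> R) (c k A b : R) : 0 < k ->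
  (forall t, continuous p t) -> is_RInt_H (fun t => p (- t)) c ->
  (forall u, u <= b -> Rabs (p u) <= A * exp (k * u)) ->
  forall u, u <= b -> Rabs (c + RInt p 0 u) <= A / k * exp (k * u).
Proof.
  intros Hk Hc Hi Hb u Hu.
  assert (Hlim : forall eta, 0 < eta -> exists w, w < u /\ Rabs (c + RInt p 0 w) < eta).
  { intros eta He. destruct (is_RInt_H_elim _ _ Hi (mkposreal eta He)) as [T HT].
    set (z := Rabs T + Rabs u + 1). pose proof (Rle_abs T). pose proof (Rle_abs (- u)).
    rewrite Rabs_Ropp in H0. pose proof (Rabs_pos u). pose proof (Rabs_pos T).
    destruct (HT z ltac:(unfold z; lra)) as [y [Hy Hye]]. simpl in Hye.
    exists (- z). split; [unfold z; lra|].
    assert (E : RInt p 0 (- z) = - y).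
    { apply is_RInt_unique.
      assert (H3 : is_RInt (fun t => opp (p (- - t))) 0 (- z) y).
      { apply (is_RInt_comp_opp (V := RN) (fun t => p (- t))).
        rewrite Ropp_0, Ropp_involutive. exact Hy. }
      apply (is_RInt_opp (V := RN)) in H3.
      eapply (is_RInt_ext (V := RN)); [|exact H3].
      intros t _. cbv beta. rewrite opp_opp, Ropp_involutive. reflexivity. }
    rewrite E. replace (c + - y) with (- (y - c)) by ring. now rewrite Rabs_Ropp. }
  assert (Hs : forall s, (s = 1 \/ s = -1) -> 0 <= A / k * exp (k * u) + s * (c + RInt p 0 u)).
  { intros s Hs. apply Rnot_lt_le. intros Hn.
    set (D := fun v => A / k * exp (k * v) + s * (c + RInt p 0 v)) in *.
    destruct (Hlim (- D u) ltac:(unfold D; lra)) as [w [Hw Hwe]].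
    assert (H1 : D w <= D u).
    { apply (nondecreasing_left D (fun v => A * exp (k * v) + s * p v) b); try lra.
      - intros t. pose proof (is_derive_RInt_from_0 p t Hc) as Hd.
        unfold D. apply (is_derive_plus (V := RN) (fun v => A / k * exp (k * v))
          (fun v => s * (c + RInt p 0 v))).
        + auto_derive; auto. field. lra.
        + apply (is_derive_scal (fun v => c + RInt p 0 v)).
          rewrite <- (Rplus_0_l (p t)).
          apply (is_derive_plus (V := RN) (fun _ => c) (fun v => RInt p 0 v)); auto.
          apply (is_derive_const (V := RN)).
      - intros t Ht. specialize (Hb t Ht). apply Rabs_le_between in Hb.
        destruct Hs as [-> | ->]; lra. }
    assert (HA : 0 <= A / k * exp (k * w)).
    { specialize (Hb w ltac:(lra)). pose proof (Rabs_pos (p w)). pose proof (exp_pos (k * w)).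
      assert (0 <= A) by nra. apply Rmult_le_pos; [apply Rdiv_le_0_compat; lra | lra]. }
    apply Rabs_def2 in Hwe. unfold D in *. destruct Hs as [-> | ->]; lra. }
  pose proof (Hs 1 ltac:(auto)). pose proof (Hs (-1) ltac:(auto)). apply Rabs_le. lra.
Qed.

Lemma is_RInt_H_ex_exp (f : R -> R) (C k : R) : 0 < k -> (forall t, continuous f t) ->
  (forall t, 0 <= t -> Rabs (f t) <= C * exp (- (k * t))) -> exists l, is_RInt_H f l.
Proof.
  intros Hk Hc H. apply (is_RInt_H_ex f (C * (1 + 2 / k ^ 2)) Hc). intros t Ht.
  eapply Rle_trans; [apply H, Ht|].
  assert (HC : 0 <= C).
  { specialize (H 0 (Rle_refl 0)). pose proof (Rabs_pos (f 0)). rewrite Rmult_0_r, Ropp_0, exp_0 in H. lra. }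
  unfold Rdiv at 1. rewrite Rmult_assoc. apply Rmult_le_compat_l; auto.
  pose proof (exp_neg_le_cauchy k t Hk) as H1. now rewrite Rabs_pos_eq in H1 by lra.
Qed.

Lemma continuous_opp_arg (p : R -> R) (t : R) :
  (forall t, continuous p t) -> continuous (fun t => p (- t)) t.
Proof.
  intros Hc. apply (continuous_comp Ropp p); [|apply Hc].
  apply continuous_of_ex_derive. auto_derive. auto.
Qed.

(** The right tail is the left tail of the reflected function: the primitive [Q2] of the latter
    satisfies [Q u + Q2 (- u) = P]. *)
Lemma antiderivative_tails (p : R -> R) (k A : R) : 0 < k ->
  (forall t, continuous p t) -> (forall u, Rabs (p u) <= A * exp (- (k * Rabs u))) ->
  exists (Q : R -> R) (P : R), is_RInt_R p P /\ (forall u, is_derive Q u (p u)) /\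
    (forall u, Rabs (Q u) <= A / k * exp (k * u)) /\
    (forall u, Rabs (P - Q u) <= A / k * exp (- (k * u))).
Proof.
  intros Hk Hc Hb.
  assert (HA : 0 <= A).
  { specialize (Hb 0). pose proof (Rabs_pos (p 0)). rewrite Rabs_R0, Rmult_0_r, Ropp_0, exp_0 in Hb. lra. }
  assert (Hbl : forall u, Rabs (p u) <= A * exp (k * u)).
  { intros u. eapply Rle_trans; [apply Hb|]. apply Rmult_le_compat_l; auto. apply exp_le.
    pose proof (Rle_abs (- u)). rewrite Rabs_Ropp in H. nra. }
  assert (Hbr : forall u, Rabs (p (- u)) <= A * exp (k * u)).
  { intros u. eapply Rle_trans; [apply Hb|]. apply Rmult_le_compat_l; auto. apply exp_le.
    rewrite Rabs_Ropp. pose proof (Rle_abs (- u)). rewrite Rabs_Ropp in H. nra. }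
  assert (Hc' : forall t, continuous (fun t => p (- t)) t) by (intros; now apply continuous_opp_arg).
  destruct (is_RInt_H_ex_exp (fun t => p (- t)) A k Hk Hc') as [c1 Hc1].
  { intros t Ht. pose proof (Hb (- t)). now rewrite Rabs_Ropp, (Rabs_pos_eq t) in H by lra. }
  destruct (is_RInt_H_ex_exp p A k Hk Hc) as [c2 Hc2].
  { intros t Ht. pose proof (Hb t). now rewrite (Rabs_pos_eq t) in H by lra. }
  set (Q := fun u => c1 + RInt p 0 u). set (Q2 := fun u => c2 + RInt (fun t => p (- t)) 0 u).
  assert (HQd : forall u, is_derive Q u (p u)).
  { intros u. unfold Q. rewrite <- (Rplus_0_l (p u)).
    apply (is_derive_plus (V := RN) (fun _ => c1) (fun v => RInt p 0 v)).
    - apply (is_derive_const (V := RN)).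
    - now apply is_derive_RInt_from_0. }
  assert (HQ : forall u, Rabs (Q u) <= A / k * exp (k * u)).
  { intros u. now apply (antiderivative_left p c1 k A u). }
  assert (HQ2 : forall u, Rabs (Q2 u) <= A / k * exp (k * u)).
  { intros u. apply (antiderivative_left (fun t => p (- t)) c2 k A u); auto; [|lra].
    apply (is_RInt_H_ext p); [intros t _; now rewrite Ropp_involutive | exact Hc2]. }
  assert (HK : forall u, Q u + Q2 (- u) = c1 + c2).
  { intros u. unfold Q, Q2.
    assert (E : RInt (fun t => p (- t)) 0 (- u) = - RInt p 0 u).
    { apply is_RInt_unique.
      assert (H3 : is_RInt p 0 u (RInt p 0 u)).
      { apply (RInt_correct (V := RC)), (ex_RInt_cont (V := RC)), Hc. }
      assert (H4 : is_RInt (fun t => opp (p (- t))) 0 (- u) (RInt p 0 u)).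
      { apply (is_RInt_comp_opp (V := RN) p). now rewrite Ropp_0, Ropp_involutive. }
      apply (is_RInt_opp (V := RN)) in H4.
      eapply (is_RInt_ext (V := RN)); [|exact H4].
      intros t _. cbv beta. rewrite opp_opp. reflexivity. }
    rewrite E. ring. }
  assert (HP : forall u, Rabs (c1 + c2 - Q u) <= A / k * exp (- (k * u))).
  { intros u. rewrite <- (HK u). replace (Q u + Q2 (- u) - Q u) with (Q2 (- u)) by ring.
    replace (- (k * u)) with (k * - u) by ring. apply HQ2. }
  exists Q, (c1 + c2). split; [|exact (conj HQd (conj HQ HP))].
  replace (c1 + c2) with (c1 + c2 - 0) by ring.
  apply (RR_derive Q); auto.
  - apply (filterlim_0_m_infty _ (A / k) k 0 Hk). intros v _. apply HQ.
  - apply filterlim_R_shift; [apply Rbar_locally_filter|].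
    apply (filterlim_0_p_infty _ (A / k) k 0 Hk). intros v _.
    rewrite <- Rabs_Ropp. replace (- (Q v - (c1 + c2))) with (c1 + c2 - Q v) by ring. apply HP.
Qed.

Lemma second_difference (Q p dp : R -> R) (D : R) :
  (forall u, is_derive Q u (p u)) -> (forall u, is_derive p u (dp u)) ->
  (forall u, Rabs (dp u) <= D) ->
  forall u h, Rabs (Q (u + h) - Q u - h * p u) <= D * h ^ 2.
Proof.
  intros HQ Hp HD u h.
  destruct (mean_value Q p u (u + h) HQ) as [c [Hc ->]].
  replace (u + h - u) with h by ring.
  destruct (mean_value p dp u c Hp) as [d [_ E]].
  replace (p c * h - h * p u) with (h * (p c - p u)) by ring.
  rewrite E, !Rabs_mult. specialize (HD d).
  assert (Rabs (c - u) <= Rabs h).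
  { destruct Hc as [H1 H2]. unfold Rmin, Rmax, Rabs in *.
    destruct (Rle_dec u (u + h)); destruct (Rcase_abs h); destruct (Rcase_abs (c - u)); lra. }
  rewrite <- (pow2_abs h). pose proof (Rabs_pos h). pose proof (Rabs_pos (c - u)). pose proof (Rabs_pos (dp d)).
  assert (Rabs (dp d) * Rabs (c - u) <= D * Rabs h) by (apply Rmult_le_compat; lra). nra.
Qed.

Lemma exp_abs_shift (k a b t : R) : 0 < k ->
  exp (k * (t + a)) * exp (- (2 * k * Rabs t)) <= exp (k * a) * exp (- (k * Rabs t)) /\
  exp (- (k * (t + b))) * exp (- (2 * k * Rabs t)) <= exp (- (k * b)) * exp (- (k * Rabs t)).
Proof.
  intros Hk. rewrite <- !exp_plus.
  pose proof (Rle_abs t). pose proof (Rle_abs (- t)). rewrite Rabs_Ropp in H0.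
  split; apply exp_le; nra.
Qed.

(* Fubini without double integrals: [int Q(t+v) r(t) dt], with [Q' = p], is an antiderivative of [c]. *)
Lemma convolution_integral (p dp r c : R -> R) (A B D k P I : R) : 0 < k ->
  (forall u, is_derive p u (dp u)) -> (forall u, Rabs (dp u) <= D) ->
  (forall t, continuous r t) -> (forall t, continuous c t) ->
  (forall u, Rabs (p u) <= A * exp (- (k * Rabs u))) ->
  (forall t, Rabs (r t) <= B * exp (- (2 * k * Rabs t))) ->
  (forall v, is_RInt_R (fun t => p (t + v) * r t) (c v)) ->
  is_RInt_R p P -> is_RInt_R r I -> is_RInt_R c (P * I).
Proof.
  intros Hk Hdp HD Hr Hc Hpb Hrb Hconv HP HI.
  assert (Hp : forall t, continuous p t).
  { intros t. apply continuous_of_ex_derive. now exists (dp t). }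
  destruct (antiderivative_tails p k A Hk Hp Hpb) as (Q & P' & HP' & HQd & HQl & HQr).
  rewrite <- (RR_unique _ _ _ HP HP') in HQr. clear P' HP'.
  assert (HB : 0 <= B).
  { specialize (Hrb 0). pose proof (Rabs_pos (r 0)). rewrite Rabs_R0, Rmult_0_r, Ropp_0, exp_0 in Hrb. lra. }
  assert (HA : 0 <= A / k).
  { specialize (HQl 0). pose proof (Rabs_pos (Q 0)). rewrite Rmult_0_r, exp_0 in HQl. lra. }
  assert (HQc : forall t, continuous Q t).
  { intros t. apply continuous_of_ex_derive. now exists (p t). }
  assert (Hex : forall v, exists F, is_RInt_R (fun t => Q (t + v) * r t) F).
  { intros v. apply (RR_ex_exp _ (A / k * exp (k * v) * B) k Hk).
    - intros t. apply continuous_multR; [|apply Hr].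
      apply (continuous_comp (fun t => t + v) Q); [|apply HQc].
      apply continuous_of_ex_derive. auto_derive. auto.
    - intros t. rewrite Rabs_mult. destruct (exp_abs_shift k v v t Hk) as [H1 _].
      apply Rle_trans with ((A / k * exp (k * (t + v))) * (B * exp (- (2 * k * Rabs t)))).
      + apply Rmult_le_compat; try apply Rabs_pos; [apply HQl | apply Hrb].
      + apply (Rmult_le_compat_l (A / k * B)) in H1; [lra | now apply Rmult_le_pos]. }
  set (Phi := fun v => RInt_gen (fun t => Q (t + v) * r t) (Rbar_locally m_infty) (Rbar_locally p_infty)).
  assert (HPhi : forall v, is_RInt_R (fun t => Q (t + v) * r t) (Phi v)).
  { intros v. unfold Phi, is_RInt_R. apply (RInt_gen_correct (V := RC)), Hex. }
  destruct (RR_ex_exp (fun t => exp (- (k * Rabs t))) 1 k Hk) as [K HK].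
  { intros t. apply (continuous_comp (fun t => - (k * Rabs t)) exp).
    - apply (continuous_opp (fun t => k * Rabs t)). apply (continuous_scal_r k (fun t => Rabs t)).
      apply continuous_Rabs.
    - apply continuous_of_ex_derive. auto_derive. auto. }
  { intros t. rewrite Rabs_pos_eq, Rmult_1_l; [lra | left; apply exp_pos]. }
  replace (P * I) with (P * I - 0) by ring.
  apply (RR_derive Phi); auto.
  - intros v. apply (is_derive_RInt_R (V := RC) (fun v t => Q (t + v) * r t)
      (fun t => p (t + v) * r t) Phi (c v) v (D * (B * (1 + 2 / (2 * k) ^ 2))) 1 Rlt_0_1); auto.
    intros h t _.
    change (Rabs (Q (t + (v + h)) * r t - Q (t + v) * r t - h * (p (t + v) * r t)) <=
      D * (B * (1 + 2 / (2 * k) ^ 2)) * h ^ 2 / (1 + t ^ 2)).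
    rewrite <- Rplus_assoc.
    replace (Q (t + v + h) * r t - Q (t + v) * r t - h * (p (t + v) * r t))
      with ((Q (t + v + h) - Q (t + v) - h * p (t + v)) * r t) by ring.
    rewrite Rabs_mult.
    replace (D * (B * (1 + 2 / (2 * k) ^ 2)) * h ^ 2 / (1 + t ^ 2))
      with (D * h ^ 2 * (B * (1 + 2 / (2 * k) ^ 2) / (1 + t ^ 2))) by (unfold Rdiv; ring).
    apply Rmult_le_compat; try apply Rabs_pos.
    + now apply (second_difference Q p dp D).
    + apply (exp_decay_cauchy r B (2 * k)); auto. lra.
  - apply (filterlim_0_m_infty _ (A / k * B * K) k 0 Hk). intros v _.
    pose proof (RR_scal _ (A / k * B * exp (k * v)) _ HK) as H1.
    replace (A / k * B * K * exp (k * v)) with (A / k * B * exp (k * v) * K) by ring.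
    apply (RR_abs_le _ _ _ _ (HPhi v) H1). intros t. rewrite Rabs_mult.
    destruct (exp_abs_shift k v v t Hk) as [H2 _].
    apply Rle_trans with ((A / k * exp (k * (t + v))) * (B * exp (- (2 * k * Rabs t)))).
    + apply Rmult_le_compat; try apply Rabs_pos; [apply HQl | apply Hrb].
    + apply (Rmult_le_compat_l (A / k * B)) in H2; [lra | now apply Rmult_le_pos].
  - apply filterlim_R_shift; [apply Rbar_locally_filter|].
    apply (filterlim_0_p_infty _ (A / k * B * K) k 0 Hk). intros v _.
    pose proof (RR_scal _ (A / k * B * exp (- (k * v))) _ HK) as H1.
    replace (A / k * B * K * exp (- (k * v))) with (A / k * B * exp (- (k * v)) * K) by ring.
    rewrite <- Rabs_Ropp.
    pose proof (RR_minus _ _ _ _ (RR_scal _ P _ HI) (HPhi v)) as H3.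
    replace (- (Phi v - P * I)) with (P * I - Phi v) by ring.
    apply (RR_abs_le _ _ _ _ H3 H1). intros t.
    replace (P * r t - Q (t + v) * r t) with ((P - Q (t + v)) * r t) by ring. rewrite Rabs_mult.
    destruct (exp_abs_shift k v v t Hk) as [_ H2].
    apply Rle_trans with ((A / k * exp (- (k * (t + v)))) * (B * exp (- (2 * k * Rabs t)))).
    + apply Rmult_le_compat; try apply Rabs_pos; [apply HQr | apply Hrb].
    + apply (Rmult_le_compat_l (A / k * B)) in H2; [lra | now apply Rmult_le_pos].
Qed.

(* The logarithmic variable [v = ln y]; [kk] decays at [-oo] and [hh] at [+oo]. *)
Definition kk (v : R) : R := exp v * gdig (exp v).
Definition hh (v : R) : R := kk v + / 2.

Lemma hh_Vd (v : R) : hh v = exp v * Vd (exp v).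
Proof. unfold hh, kk, Vd. pose proof (exp_pos v). field. lra. Qed.

Lemma kk_bounds (v : R) : -1 <= kk v <= 0.
Proof.
  pose proof (exp_pos v) as He. destruct (gdig_bounds (exp v) He) as [H1 H2]. unfold kk.
  apply (Rmult_le_compat_l (exp v)) in H1; [|lra].
  replace (exp v * - / exp v) with (-1) in H1 by (field; lra). nra.
Qed.

Lemma hh_bounds (v : R) : 0 <= hh v <= exp (- v) / 12.
Proof.
  pose proof (exp_pos v) as He. destruct (Vd_bounds (exp v) He) as [H1 H2]. rewrite hh_Vd.
  apply (Rmult_le_compat_l (exp v)) in H2; [|lra].
  rewrite exp_Ropp. replace (exp v * / (12 * exp v ^ 2)) with (/ exp v / 12) in H2 by (field; lra). nra.
Qed.

(** Near zero [y * gdig y] is of the order of [y * ln y]; the logarithm is traded for half of the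
    exponential rate through [1 - v <= 2 exp (- v / 2)]. *)
Lemma kk_decay (v : R) : v <= 0 -> Rabs (kk v) <= 2 * exp (v / 2).
Proof.
  intros Hv. pose proof (exp_pos v) as He.
  assert (exp v <= 1) by (rewrite <- exp_0; now apply exp_le).
  pose proof (gdig_lower (exp v) ltac:(lra)) as H1. rewrite ln_exp in H1.
  destruct (kk_bounds v) as [_ H2]. rewrite Rabs_left1 by auto. unfold kk in *.
  pose proof (exp_ineq1_le (- (v / 2))) as H3.
  assert (E : exp v = exp (v / 2) * exp (v / 2)) by (rewrite <- exp_plus; f_equal; field).
  assert (E2 : exp (v / 2) * exp (- (v / 2)) = 1) by (rewrite <- exp_plus, Rplus_opp_r; apply exp_0).
  pose proof (exp_pos (v / 2)).
  assert (exp v * (- gdig (exp v)) <= exp v * (2 * exp (- (v / 2)))) by (apply Rmult_le_compat_l; lra).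
  rewrite E in H4 at 3. nra.
Qed.

Lemma continuous_kk (v : R) : continuous kk v.
Proof.
  apply continuous_multR.
  - apply continuous_of_ex_derive. auto_derive. auto.
  - apply (continuous_comp exp gdig); [|apply continuous_gdig, exp_pos].
    apply continuous_of_ex_derive. auto_derive. auto.
Qed.

Lemma continuous_hh (v : R) : continuous hh v.
Proof.
  apply (continuous_plus (V := RN) kk (fun _ => / 2)).
  - apply continuous_kk.
  - apply continuous_const.
Qed.

(** Multiplied by [y], the Laplace kernel depends on the product [y t] only, so in logarithmic
    variables the transform is a convolution, and its Mellin transform factors. *)
Lemma hh_convolution (v : R) : is_RInt_R (fun t => gamma_log 1 (t + v) * W t) (hh v).
Proof.
  rewrite hh_Vd. pose proof (exp_pos v) as He.
  pose proof (RR_scal _ (exp v) _ (Vd_laplace (exp v) He)) as H. revert H. apply RR_ext. intros t.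
  pose proof (gamma_log_1_exp (exp v) t He) as H. rewrite ln_exp in H. rewrite H. ring.
Qed.

Lemma W_mellin_decay (e t : R) : 0 < e <= 1 / 2 -> Rabs (exp (- (e * t)) * W t) <= exp (- (e * Rabs t)).
Proof.
  intros He. pose proof (W_pos t). pose proof (W_le_half t). pose proof (W_le_exp t).
  pose proof (exp_pos (- (e * t))).
  rewrite Rabs_pos_eq by nra. destruct (Rle_dec 0 t) as [Ht|Ht].
  - rewrite Rabs_pos_eq by auto. nra.
  - rewrite Rabs_left by lra. apply Rle_trans with (exp (- (e * t)) * exp t).
    + pose proof (exp_pos t). apply Rmult_le_compat_l; lra.
    + rewrite <- exp_plus. apply exp_le. nra.
Qed.

Definition Wmellin (e : R) : R :=
  RInt_gen (fun t => exp (- (e * t)) * W t) (Rbar_locally m_infty) (Rbar_locally p_infty).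

Lemma Wmellin_correct (e : R) : 0 < e <= 1 / 2 ->
  is_RInt_R (fun t => exp (- (e * t)) * W t) (Wmellin e).
Proof.
  intros He. unfold Wmellin, is_RInt_R. apply (RInt_gen_correct (V := RC)).
  apply (RR_ex_exp _ 1 e); [lra | |].
  - intros t. apply continuous_multR; [|apply continuous_W].
    apply continuous_of_ex_derive. auto_derive. auto.
  - intros t. rewrite Rmult_1_l. now apply W_mellin_decay.
Qed.

(** After multiplication by [exp (e * v)] the two factors of the convolution are [gamma_log (1 + e)]
    and [exp (- (e * t)) * W t]; their integrals are a Gamma value and a Mellin transform of Binet's
    function. *)
Theorem mellin_hh (e : R) : 0 < e <= 1 / 2 ->
  is_RInt_R (fun v => exp (e * v) * hh v) (GR (1 + e) * Wmellin e).
Proof.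
  intros He. destruct (gamma_log_bound (1 + e) ltac:(lra)) as (A & k0 & Hk0 & HA).
  destruct (gamma_log_cauchy (1 + e) ltac:(lra)) as (D1 & HD1 & Hb1).
  destruct (gamma_log_cauchy (1 + e + 1) ltac:(lra)) as (D2 & HD2 & Hb2).
  (* [convolution_integral] wants decay at rate [2 k] of the second factor, which decays at rate
     [e]; hence [e / 2]. *)
  set (k := Rmin k0 (e / 2)).
  assert (Hk : 0 < k) by (apply Rmin_pos; lra).
  pose proof (Rmin_l k0 (e / 2)) as Hl. pose proof (Rmin_r k0 (e / 2)) as Hr. fold k in Hl, Hr.
  assert (HA0 : 0 <= A).
  { specialize (HA 0). pose proof (gamma_log_pos (1 + e) 0). rewrite Rabs_R0, Rmult_0_r, Ropp_0, exp_0 in HA. lra. }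
  assert (Hw : forall D t, 0 < D -> D / (1 + t ^ 2) <= D).
  { intros D t HD. apply Rmult_le_reg_r with (1 + t ^ 2); [apply one_plus_sqr_pos|].
    unfold Rdiv. rewrite Rmult_assoc, Rinv_l by (pose proof (one_plus_sqr_pos t); lra).
    pose proof (pow2_ge_0 t). nra. }
  apply (convolution_integral (gamma_log (1 + e))
    (fun u => (1 + e) * gamma_log (1 + e) u - gamma_log (1 + e + 1) u)
    (fun t => exp (- (e * t)) * W t) _ A 1 ((1 + e) * D1 + D2) k); auto.
  - intros u. unfold gamma_log. auto_derive; auto.
    replace ((1 + e + 1) * u - exp u) with ((1 + e) * u - exp u + u) by ring.
    rewrite (exp_plus ((1 + e) * u - exp u) u). unfold Rminus. ring.
  - intros u. pose proof (gamma_log_pos (1 + e) u). pose proof (gamma_log_pos (1 + e + 1) u).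
    specialize (Hb1 u). specialize (Hb2 u). pose proof (Hw D1 u HD1). pose proof (Hw D2 u HD2).
    apply Rabs_le. nra.
  - intros t. apply continuous_multR; [|apply continuous_W].
    apply continuous_of_ex_derive. auto_derive. auto.
  - intros t. apply continuous_multR; [|apply continuous_hh].
    apply continuous_of_ex_derive. auto_derive. auto.
  - intros u. rewrite Rabs_pos_eq by (left; apply gamma_log_pos).
    eapply Rle_trans; [apply HA|]. apply Rmult_le_compat_l; auto. apply exp_le.
    pose proof (Rabs_pos u). nra.
  - intros t. eapply Rle_trans; [now apply W_mellin_decay|]. rewrite Rmult_1_l. apply exp_le.
    pose proof (Rabs_pos t). nra.
  - intros v. pose proof (RR_scal _ (exp (e * v)) _ (hh_convolution v)) as H. revert H.
    apply RR_ext. intros t. unfold gamma_log.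
    replace ((1 + e) * (t + v) - exp (t + v)) with (e * t + e * v + (1 * (t + v) - exp (t + v))) by ring.
    rewrite !exp_plus, exp_Ropp. pose proof (exp_pos (e * t)). field. lra.
  - apply GR_correct. lra.
  - now apply Wmellin_correct.
Qed.

Lemma mean_value_on (f df : R -> R) (a b : R) : a <= b ->
  (forall x, a <= x <= b -> is_derive f x (df x)) ->
  exists c, a <= c <= b /\ f b - f a = df c * (b - a).
Proof.
  intros Hab Hd. destruct (MVT_gen f a b df) as [c [Hc E]].
  - rewrite Rmin_left, Rmax_right by auto. intros x Hx. apply Hd. lra.
  - rewrite Rmin_left, Rmax_right by auto. intros x Hx. apply continuity_pt_filterlim.
    apply continuous_of_ex_derive. exists (df x). now apply Hd.
  - rewrite Rmin_left, Rmax_right in Hc by auto. now exists c.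
Qed.

(** * Second-order expansions *)

Lemma exp_taylor_1 (x : R) : 0 <= exp x - 1 - x <= x ^ 2 * exp (Rabs x).
Proof.
  pose proof (exp_ineq1_le x) as H1. pose proof (exp_ineq1_le (- x)) as H2.
  rewrite exp_Ropp in H2. pose proof (exp_pos x) as He.
  assert (H3 : exp x - 1 <= x * exp x).
  { apply (Rmult_le_compat_l (exp x)) in H2; [|lra]. rewrite Rinv_r in H2; lra. }
  assert (H4 : 1 <= exp (Rabs x)) by (rewrite <- exp_0; apply exp_le, Rabs_pos).
  split; [lra|]. destruct (Rle_dec 0 x) as [Hx|Hx].
  - rewrite Rabs_pos_eq by auto. nra.
  - assert (x ^ 2 * 1 <= x ^ 2 * exp (Rabs x)) by (apply Rmult_le_compat_l; [apply pow2_ge_0 | auto]).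
    nra.
Qed.

Lemma exp_taylor_2 (x : R) : Rabs (exp x - 1 - x - x ^ 2 / 2) <= Rabs x ^ 3 * exp (Rabs x).
Proof.
  destruct (mean_value (fun x => exp x - 1 - x - x ^ 2 / 2) (fun x => exp x - 1 - x) 0 x) as [c [Hc E]].
  { intros t. auto_derive; auto. field. }
  rewrite exp_0 in E. replace (1 - 1 - 0 - 0 ^ 2 / 2) with 0 in E by field.
  rewrite !Rminus_0_r in E. rewrite E, Rabs_mult.
  destruct (exp_taylor_1 c) as [H1 H2]. rewrite (Rabs_pos_eq (exp c - 1 - c)) by auto.
  assert (Hcx : Rabs c <= Rabs x).
  { unfold Rmin, Rmax, Rabs in *. destruct (Rle_dec 0 x), (Rcase_abs c), (Rcase_abs x); lra. }
  rewrite <- pow2_abs in H2. pose proof (Rabs_pos c). pose proof (Rabs_pos x).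
  assert (Rabs c ^ 2 * exp (Rabs c) <= Rabs x ^ 2 * exp (Rabs x)).
  { apply Rmult_le_compat; [apply pow2_ge_0 | left; apply exp_pos | now apply pow_incr | now apply exp_le]. }
  replace (Rabs x ^ 3 * exp (Rabs x)) with (Rabs x ^ 2 * exp (Rabs x) * Rabs x) by ring.
  apply Rmult_le_compat_r; lra.
Qed.

(* [f e = a0 + a1 e + a2 e^2 + O(e^3)] as [e] decreases to [0]. *)
Definition T2 (f : R -> R) (a0 a1 a2 : R) : Prop :=
  exists K, 0 <= K /\ forall e, 0 < e <= 1 / 4 -> Rabs (f e - (a0 + a1 * e + a2 * e ^ 2)) <= K * e ^ 3.

Lemma T2_ext (f g : R -> R) (a0 a1 a2 : R) :
  (forall e, 0 < e <= 1 / 4 -> f e = g e) -> T2 f a0 a1 a2 -> T2 g a0 a1 a2.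
Proof. intros H [K [HK Hf]]. exists K. split; auto. intros e He. rewrite <- H; auto. Qed.

Lemma T2_mul (f g : R -> R) (a0 a1 a2 b0 b1 b2 : R) :
  T2 f a0 a1 a2 -> T2 g b0 b1 b2 ->
  T2 (fun e => f e * g e) (a0 * b0) (a0 * b1 + a1 * b0) (a0 * b2 + a1 * b1 + a2 * b0).
Proof.
  intros [K [HK Hf]] [M [HM Hg]].
  set (A := Rabs a0 + Rabs a1 + Rabs a2). set (B := Rabs b0 + Rabs b1 + Rabs b2).
  exists (K * (B + M) + A * M + (Rabs (a1 * b2 + a2 * b1) + Rabs (a2 * b2))).
  pose proof (Rabs_pos a0). pose proof (Rabs_pos a1). pose proof (Rabs_pos a2).
  pose proof (Rabs_pos b0). pose proof (Rabs_pos b1). pose proof (Rabs_pos b2).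
  pose proof (Rabs_pos (a1 * b2 + a2 * b1)). pose proof (Rabs_pos (a2 * b2)).
  assert (HA : 0 <= A) by (unfold A; lra). assert (HB : 0 <= B) by (unfold B; lra).
  split; [nra|]. intros e He. specialize (Hf e He). specialize (Hg e He).
  assert (He2 : 0 <= e ^ 2 <= 1) by nra. assert (He3 : 0 <= e ^ 3 <= 1).
  { replace (e ^ 3) with (e * e ^ 2) by ring. nra. }
  assert (Hpoly : forall c0 c1 c2, Rabs (c0 + c1 * e + c2 * e ^ 2) <= Rabs c0 + Rabs c1 + Rabs c2).
  { intros c0 c1 c2. eapply Rle_trans; [apply Rabs_triang|].
    eapply Rle_trans; [apply Rplus_le_compat_r, Rabs_triang|].
    rewrite !Rabs_mult, (Rabs_pos_eq e), (Rabs_pos_eq (e ^ 2)) by lra.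
    pose proof (Rabs_pos c1). pose proof (Rabs_pos c2). nra. }
  pose proof (Hpoly a0 a1 a2) as HPa. pose proof (Hpoly b0 b1 b2) as HPb. fold A in HPa. fold B in HPb.
  set (p := a0 + a1 * e + a2 * e ^ 2) in *. set (q := b0 + b1 * e + b2 * e ^ 2) in *.
  replace (f e * g e - (a0 * b0 + (a0 * b1 + a1 * b0) * e + (a0 * b2 + a1 * b1 + a2 * b0) * e ^ 2))
    with ((f e - p) * g e + p * (g e - q) + ((a1 * b2 + a2 * b1) + (a2 * b2) * e) * e ^ 3)
    by (unfold p, q; ring).
  assert (Hge : Rabs (g e) <= B + M).
  { replace (g e) with (q + (g e - q)) by ring. eapply Rle_trans; [apply Rabs_triang|]. nra. }
  assert (H7 : Rabs ((f e - p) * g e) <= K * e ^ 3 * (B + M)).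
  { rewrite Rabs_mult. apply Rmult_le_compat; auto; apply Rabs_pos. }
  assert (H8 : Rabs (p * (g e - q)) <= A * (M * e ^ 3)).
  { rewrite Rabs_mult. apply Rmult_le_compat; auto; apply Rabs_pos. }
  assert (H9 : Rabs (((a1 * b2 + a2 * b1) + (a2 * b2) * e) * e ^ 3)
    <= (Rabs (a1 * b2 + a2 * b1) + Rabs (a2 * b2)) * e ^ 3).
  { rewrite Rabs_mult, (Rabs_pos_eq (e ^ 3)) by lra. apply Rmult_le_compat_r; [lra|].
    eapply Rle_trans; [apply Rabs_triang|]. rewrite (Rabs_mult (a2 * b2)), (Rabs_pos_eq e) by lra. nra. }
  eapply Rle_trans; [apply Rabs_triang|].
  eapply Rle_trans; [apply Rplus_le_compat_r, Rabs_triang|]. lra.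
Qed.

(** [exp_taylor_2] is applied at [f e], which is of order [e], so its cubic error is of order
    [e ^ 3]; the square of [f] is expanded by [T2_mul]. *)
Lemma T2_exp (f : R -> R) (b1 b2 : R) : T2 f 0 b1 b2 ->
  T2 (fun e => exp (f e)) 1 b1 (b2 + b1 ^ 2 / 2).
Proof.
  intros Hf. pose proof (T2_mul _ _ _ _ _ _ _ _ Hf Hf) as [K2 [HK2 H2]].
  destruct Hf as [K [HK Hf]].
  set (A := Rabs b1 + Rabs b2 + K).
  pose proof (Rabs_pos b1). pose proof (Rabs_pos b2).
  exists (A ^ 3 * exp A + K + K2). assert (HA : 0 <= A) by (unfold A; lra).
  assert (HA3 : 0 <= A ^ 3) by now apply pow_le. pose proof (exp_pos A).
  split; [nra|]. intros e He. specialize (Hf e He). specialize (H2 e He). cbv beta in H2.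
  assert (He2 : 0 <= e ^ 2 <= e) by nra. assert (He3 : 0 <= e ^ 3 <= e).
  { replace (e ^ 3) with (e * e ^ 2) by ring. nra. }
  assert (Hfe : Rabs (f e) <= A * e).
  { replace (f e) with ((f e - (0 + b1 * e + b2 * e ^ 2)) + (b1 * e + b2 * e ^ 2)) by ring.
    eapply Rle_trans; [apply Rabs_triang|].
    assert (Rabs (b1 * e + b2 * e ^ 2) <= Rabs b1 * e + Rabs b2 * e).
    { eapply Rle_trans; [apply Rabs_triang|]. rewrite !Rabs_mult, (Rabs_pos_eq e), (Rabs_pos_eq (e ^ 2)) by lra. nra. }
    assert (K * e ^ 3 <= K * e) by nra. unfold A. lra. }
  pose proof (exp_taylor_2 (f e)) as Ht.
  assert (Ht2 : Rabs (f e) ^ 3 * exp (Rabs (f e)) <= (A * e) ^ 3 * exp A).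
  { apply Rmult_le_compat; [apply pow_le, Rabs_pos | left; apply exp_pos | |].
    - apply pow_incr. split; [apply Rabs_pos | auto].
    - apply exp_le. nra. }
  replace (exp (f e) - (1 + b1 * e + (b2 + b1 ^ 2 / 2) * e ^ 2))
    with ((exp (f e) - 1 - f e - f e ^ 2 / 2) + (f e - (0 + b1 * e + b2 * e ^ 2))
      + / 2 * (f e * f e - (0 * 0 + (0 * b1 + b1 * 0) * e + (0 * b2 + b1 * b1 + b2 * 0) * e ^ 2))) by field.
  eapply Rle_trans; [apply Rabs_triang|].
  eapply Rle_trans; [apply Rplus_le_compat_r, Rabs_triang|].
  rewrite (Rabs_mult (/ 2)), (Rabs_pos_eq (/ 2)) by lra.
  replace ((A * e) ^ 3 * exp A) with (A ^ 3 * exp A * e ^ 3) in Ht2 by ring.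
  assert (0 <= K2 * e ^ 3) by nra. lra.
Qed.

Lemma T2_unique (f : R -> R) (a0 a1 a2 b0 b1 b2 : R) :
  T2 f a0 a1 a2 -> T2 f b0 b1 b2 -> a0 = b0 /\ a1 = b1 /\ a2 = b2.
Proof.
  intros [K [HK Hf]] [M [HM Hg]].
  assert (H : forall e, 0 < e <= 1 / 4 ->
    Rabs ((a0 - b0) + (a1 - b1) * e + (a2 - b2) * e ^ 2) <= (K + M) * e ^ 3).
  { intros e He. specialize (Hf e He). specialize (Hg e He).
    replace ((a0 - b0) + (a1 - b1) * e + (a2 - b2) * e ^ 2)
      with ((f e - (b0 + b1 * e + b2 * e ^ 2)) - (f e - (a0 + a1 * e + a2 * e ^ 2))) by ring.
    eapply Rle_trans; [apply Rabs_triang|]. rewrite Rabs_Ropp. lra. }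
  assert (Hz : forall c D, 0 <= D -> (forall e, 0 < e <= 1 / 4 -> Rabs c <= D * e) -> c = 0).
  { intros c D HD Hc. destruct (Req_dec c 0) as [->|Hn]; auto. exfalso.
    pose proof (Rabs_pos_lt c Hn) as Hp.
    set (e := Rmin (1 / 4) (Rabs c / (2 * (D + 1)))).
    assert (H1 : 0 < Rabs c / (2 * (D + 1))) by (apply Rdiv_lt_0_compat; lra).
    assert (He : 0 < e) by (apply Rmin_pos; lra).
    specialize (Hc e ltac:(split; [auto | apply Rmin_l])).
    pose proof (Rmin_r (1 / 4) (Rabs c / (2 * (D + 1)))) as H2. fold e in H2.
    assert (H3 : D * e <= D * (Rabs c / (2 * (D + 1)))) by (apply Rmult_le_compat_l; auto).
    assert (H4 : D * (Rabs c / (2 * (D + 1))) = Rabs c / 2 * (D / (D + 1))) by (field; lra).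
    assert (H5 : D / (D + 1) <= 1) by (apply Rmult_le_reg_r with (D + 1); [lra|]; unfold Rdiv; rewrite Rmult_assoc, Rinv_l; lra).
    nra. }
  pose proof (Rabs_pos (a1 - b1)). pose proof (Rabs_pos (a2 - b2)).
  assert (E0 : a0 - b0 = 0).
  { apply (Hz _ (K + M + Rabs (a1 - b1) + Rabs (a2 - b2))); [lra|]. intros e He. specialize (H e He).
    replace (a0 - b0) with ((a0 - b0 + (a1 - b1) * e + (a2 - b2) * e ^ 2)
      - ((a1 - b1) + (a2 - b2) * e) * e) by ring.
    eapply Rle_trans; [apply Rabs_triang|]. rewrite Rabs_Ropp, Rabs_mult, (Rabs_pos_eq e) by lra.
    pose proof (Rabs_triang (a1 - b1) ((a2 - b2) * e)) as Ht. rewrite Rabs_mult, (Rabs_pos_eq e) in Ht by lra.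
    assert (Rabs (a1 - b1 + (a2 - b2) * e) * e <= (Rabs (a1 - b1) + Rabs (a2 - b2)) * e).
    { apply Rmult_le_compat_r; [lra|]. nra. }
    assert ((K + M) * e ^ 3 <= (K + M) * e).
    { apply Rmult_le_compat_l; [lra|]. assert (e ^ 2 <= 1) by nra. replace (e ^ 3) with (e * e ^ 2) by ring. nra. }
    lra. }
  assert (E1 : a1 - b1 = 0).
  { apply (Hz _ (K + M + Rabs (a2 - b2))); [lra|]. intros e He. specialize (H e He). rewrite E0 in H.
    apply Rmult_le_reg_r with e; [lra|].
    replace (Rabs (a1 - b1) * e) with (Rabs ((0 + (a1 - b1) * e + (a2 - b2) * e ^ 2) - (a2 - b2) * e * e)).
      2:{ transitivity (Rabs ((a1 - b1) * e)); [f_equal; ring | rewrite Rabs_mult, (Rabs_pos_eq e); lra]. }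
    eapply Rle_trans; [apply Rabs_triang|]. rewrite Rabs_Ropp, !Rabs_mult, (Rabs_pos_eq e) by lra.
    assert ((K + M) * e ^ 3 <= (K + M) * e * e).
    { rewrite Rmult_assoc. apply Rmult_le_compat_l; [lra|]. assert (e ^ 2 <= 1) by nra.
      replace (e ^ 3) with (e * e * e) by ring. nra. }
    lra. }
  assert (E2 : a2 - b2 = 0).
  { apply (Hz _ (K + M)); [lra|]. intros e He. specialize (H e He). rewrite E0, E1 in H.
    apply Rmult_le_reg_r with (e ^ 2); [apply pow_lt; lra|].
    replace (0 + 0 * e + (a2 - b2) * e ^ 2) with ((a2 - b2) * e ^ 2) in H by ring.
    rewrite Rabs_mult, (Rabs_pos_eq (e ^ 2)) in H by apply pow2_ge_0.
    replace ((K + M) * e * e ^ 2) with ((K + M) * e ^ 3) by ring. exact H. }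
  lra.
Qed.

Lemma ln_1p_taylor_2 (u : R) : 0 <= u -> Rabs (ln (1 + u) - u + u ^ 2 / 2) <= u ^ 3.
Proof.
  intros Hu.
  destruct (mean_value_on (fun u => ln (1 + u) - u + u ^ 2 / 2) (fun u => u ^ 2 / (1 + u)) 0 u Hu) as [c [Hc E]].
  { intros t Ht. auto_derive; [lra|]. field. lra. }
  rewrite Rplus_0_r, ln_1 in E. replace (0 - 0 + 0 ^ 2 / 2) with 0 in E by field.
  rewrite !Rminus_0_r in E. rewrite E.
  assert (0 <= c ^ 2 / (1 + c) <= c ^ 2).
  { pose proof (pow2_ge_0 c). split; [apply Rdiv_le_0_compat; lra|].
    apply Rmult_le_reg_r with (1 + c); [lra|]. unfold Rdiv. rewrite Rmult_assoc, Rinv_l by lra. nra. }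
  rewrite Rabs_pos_eq by nra. replace (u ^ 3) with (u ^ 2 * u) by ring.
  apply Rmult_le_compat_r; auto. assert (c ^ 2 <= u ^ 2) by (apply pow_incr; lra). lra.
Qed.

(** [euler_gamma] is defined through [real] of a [Lim_seq], so convergence has to be supplied; it
    comes from [digamma_limit] at 1. Here [N] terms are paired with [ln (N + 1)], whereas the
    definition pairs [n + 1] terms with [ln (n + 1)]; [ln_ratio_lim] makes up for the shift. *)
Lemma euler_gamma_lim : is_lim_seq (fun N => rsum (fun k => / INR (S k)) N - ln (1 + INR N)) euler_gamma.
Proof.
  pose proof (digamma_limit 1 Rlt_0_1) as H. apply (is_lim_seq_scal_l _ (-1)) in H.
  change (Rbar_mult (-1) (digamma 1)) with (Finite (-1 * digamma 1)) in H.
  assert (H1 : is_lim_seq (fun N => rsum (fun k => / INR (S k)) N - ln (1 + INR N)) (-1 * digamma 1)).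
  { eapply is_lim_seq_ext; [|exact H]. intros N. cbv beta.
    rewrite (rsum_ext (fun k => / (1 + INR k)) (fun k => / INR (S k))); [ring|].
    intros k _. rewrite S_INR. f_equal. ring. }
  assert (E : euler_gamma = -1 * digamma 1); [|now rewrite E].
  unfold euler_gamma.
  assert (H2 : is_lim_seq (fun n => sum_f_R0 (fun k => / INR (S k)) n - ln (INR (S n))) (-1 * digamma 1)).
  { pose proof (is_lim_seq_plus' _ _ _ _ (proj1 (is_lim_seq_incr_1 _ _) H1) (ln_ratio_lim 1 1 Rlt_0_1 ltac:(lra))) as H2.
    rewrite Rplus_0_r in H2. eapply is_lim_seq_ext; [|exact H2]. intros n. cbv beta.
    rewrite sum_f_R0_rsum, S_INR.
    replace (1 + (INR n + 1)) with (1 + 1 + INR n) by ring.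
    replace (1 + INR n) with (INR n + 1) by ring. ring. }
  now rewrite (is_lim_seq_unique _ _ H2).
Qed.

Lemma sum_inv_cubes_bound (N : nat) : 0 <= rsum (fun k => / INR (S k) ^ 3) N <= PI ^ 2 / 6.
Proof.
  split.
  - induction N as [|N IH]; [simpl; lra|]. cbn [rsum].
    assert (0 < / INR (S N) ^ 3) by (apply Rinv_0_lt_compat, pow_lt; pose proof (INR_S_ge_1 N); lra). lra.
  - apply Rle_trans with (rsum (fun k => / INR (S k) ^ 2) N).
    + apply rsum_le. intros k _. pose proof (INR_S_ge_1 k).
      apply Rinv_le_contravar; [apply pow_lt; lra|]. apply Rle_pow; [auto | lia].
    + apply (is_lim_seq_incr_compare _ _ basel). intros n. cbn [rsum].
      assert (0 < / INR (S n) ^ 2) by (apply Rinv_0_lt_compat, pow_lt; pose proof (INR_S_ge_1 n); lra). lra.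
Qed.

Lemma LG_1 : LG 1 = 0.
Proof. unfold LG. rewrite GR_1. apply ln_1. Qed.

(** Termwise expansion of the limit formula [LG_limit] at [x = 1]: [ln (1 + e / n)] contributes
    [e / n], [- e ^ 2 / (2 n ^ 2)] and a cubic error, so gamma and half of [PI ^ 2 / 6] appear. *)
Lemma T2_LG : T2 (fun e => LG (1 + e)) 0 (- euler_gamma) (PI ^ 2 / 12).
Proof.
  exists (PI ^ 2 / 6). split; [pose proof PI_RGT_0; nra|]. intros e He.
  pose proof (LG_limit 1 e Rlt_0_1 ltac:(lra) ltac:(rewrite Rabs_pos_eq; lra)) as H1.
  rewrite LG_1, Rminus_0_r in H1.
  pose proof (is_lim_seq_scal_l _ e _ euler_gamma_lim) as H2.
  pose proof (is_lim_seq_scal_l _ (e ^ 2 / 2) _ basel) as H3.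
  simpl Rbar_mult in H2, H3.
  pose proof (is_lim_seq_minus' _ _ _ _ (is_lim_seq_plus' _ _ _ _ H1 H2) H3) as H4.
  replace (LG (1 + e) - (0 + - euler_gamma * e + PI ^ 2 / 12 * e ^ 2))
    with (LG (1 + e) + e * euler_gamma - e ^ 2 / 2 * (PI ^ 2 / 6)) by field.
  apply (is_lim_seq_abs _ (Finite _)) in H4.
  apply (is_lim_seq_le _ (fun _ => PI ^ 2 / 6 * e ^ 3) (Rabs _) (PI ^ 2 / 6 * e ^ 3))
    with (2 := H4) (3 := is_lim_seq_const _).
  intros N.
  replace (e * ln (1 + INR N) - rsum (fun k => ln (1 + e + INR k) - ln (1 + INR k)) N +
    e * (rsum (fun k => / INR (S k)) N - ln (1 + INR N)) - e ^ 2 / 2 * rsum (fun k => / INR (S k) ^ 2) N)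
  with (- rsum (fun k => ln (1 + e + INR k) - ln (1 + INR k) - e * / INR (S k) + e ^ 2 / 2 * / INR (S k) ^ 2) N).
  2:{ rewrite (rsum_plus (fun k => ln (1 + e + INR k) - ln (1 + INR k) - e * / INR (S k))).
      rewrite (rsum_minus (fun k => ln (1 + e + INR k) - ln (1 + INR k))), !rsum_scal. ring. }
  rewrite Rabs_Ropp.
  apply Rle_trans with (rsum (fun k => e ^ 3 * / INR (S k) ^ 3) N).
  - apply rsum_abs_le. intros k. pose proof (INR_S_ge_1 k) as Hk.
    replace (1 + e + INR k) with (INR (S k) * (1 + e / INR (S k))) by (rewrite S_INR in *; field; lra).
    replace (1 + INR k) with (INR (S k)) by (rewrite S_INR; ring).
    assert (Hu : 0 <= e / INR (S k)) by (apply Rdiv_le_0_compat; lra).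
    rewrite ln_mult by lra. pose proof (ln_1p_taylor_2 _ Hu) as H5.
    replace (e ^ 3 * / INR (S k) ^ 3) with ((e / INR (S k)) ^ 3) by (field; lra).
    replace (ln (INR (S k)) + ln (1 + e / INR (S k)) - ln (INR (S k)) - e * / INR (S k) + e ^ 2 / 2 * / INR (S k) ^ 2)
      with (ln (1 + e / INR (S k)) - e / INR (S k) + (e / INR (S k)) ^ 2 / 2) by (field; lra).
    exact H5.
  - rewrite rsum_scal. destruct (sum_inv_cubes_bound N).
    assert (0 <= e ^ 3) by (apply pow_le; lra). nra.
Qed.

Lemma T2_GR : T2 (fun e => GR (1 + e)) 1 (- euler_gamma) (PI ^ 2 / 12 + (- euler_gamma) ^ 2 / 2).
Proof.
  apply (T2_ext (fun e => exp (LG (1 + e)))).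
  - intros e He. unfold LG. apply exp_ln, GR_pos. lra.
  - apply T2_exp, T2_LG.
Qed.

(** * Moments of the hyperbolic secant *)

Lemma sech_bound (v : R) : 0 < / cosh v <= 2 * exp (- Rabs v).
Proof.
  pose proof (cosh_pos v) as Hc. split; [now apply Rinv_0_lt_compat|].
  apply Rmult_le_reg_l with (cosh v); auto. rewrite Rinv_r by lra.
  replace 1 with (exp (Rabs v) * exp (- Rabs v)) by (rewrite <- exp_plus, Rplus_opp_r; apply exp_0).
  pose proof (exp_pos (- Rabs v)).
  replace (cosh v * (2 * exp (- Rabs v))) with (2 * cosh v * exp (- Rabs v)) by ring.
  apply Rmult_le_compat_r; [lra|]. unfold cosh. pose proof (exp_pos v). pose proof (exp_pos (- v)).
  unfold Rabs. destruct (Rcase_abs v); lra.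
Qed.

Lemma continuous_sech (v : R) : continuous (fun v => / cosh v) v.
Proof.
  apply continuous_of_ex_derive. pose proof (cosh_pos v). unfold cosh in *. auto_derive. lra.
Qed.

Lemma sech_mul_exp_bound (e v : R) : -1 / 4 <= e <= 1 / 4 -> Rabs (exp (e * v) * / cosh v) <= 2 * exp (- (1 / 2 * Rabs v)).
Proof.
  intros He. destruct (sech_bound v) as [H1 H2]. rewrite Rabs_pos_eq.
  2:{ apply Rmult_le_pos; [left; apply exp_pos | lra]. }
  apply Rle_trans with (exp (1 / 2 * Rabs v) * (2 * exp (- Rabs v))).
  - apply Rmult_le_compat; try lra; [left; apply exp_pos|]. apply exp_le.
    pose proof (Rle_abs v). pose proof (Rle_abs (- v)). rewrite Rabs_Ropp in *. nra.
  - right. replace (exp (1 / 2 * Rabs v) * (2 * exp (- Rabs v))) with (2 * (exp (1 / 2 * Rabs v) * exp (- Rabs v))) by ring.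
    rewrite <- exp_plus. f_equal. f_equal. field.
Qed.

Definition sech_mellin (e : R) : R :=
  RInt_gen (fun v => exp (- e * v) * / cosh v) (Rbar_locally m_infty) (Rbar_locally p_infty).

Lemma sech_mellin_correct (e : R) : 0 <= e <= 1 / 4 ->
  is_RInt_R (fun v => exp (- e * v) * / cosh v) (sech_mellin e).
Proof.
  intros He. unfold sech_mellin, is_RInt_R. apply (RInt_gen_correct (V := RC)).
  apply (RR_ex_exp _ 2 (1 / 2)); [lra | |].
  - intros v. apply continuous_multR; [|apply continuous_sech].
    apply continuous_of_ex_derive. auto_derive. auto.
  - intros v. apply sech_mul_exp_bound. lra.
Qed.

Lemma atan_le (x : R) : 0 <= x -> 0 <= atan x <= x.
Proof.
  intros Hx. destruct (mean_value_on atan (fun u => / (1 + u ^ 2)) 0 x Hx) as [c [Hc E]].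
  { intros t _. auto_derive; auto. unfold Rsqr. field. nra. }
  rewrite atan_0, !Rminus_0_r in E. rewrite E.
  assert (0 < / (1 + c ^ 2) <= 1).
  { pose proof (one_plus_sqr_pos c). split; [now apply Rinv_0_lt_compat|].
    rewrite <- Rinv_1. apply Rinv_le_contravar; [lra|]. pose proof (pow2_ge_0 c). lra. }
  nra.
Qed.

Lemma sech_integral : is_RInt_R (fun v => / cosh v) PI.
Proof.
  replace PI with (PI - 0) by ring.
  apply (RR_derive (fun v => 2 * atan (exp v))).
  - intros v. unfold cosh. auto_derive; auto. rewrite exp_Ropp. unfold Rsqr.
    pose proof (exp_pos v). field. repeat split; nra.
  - intros v. apply continuous_sech.
  - apply (filterlim_0_m_infty _ 2 1 0); [lra|]. intros v _. pose proof (exp_pos v).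
    destruct (atan_le (exp v) ltac:(lra)). rewrite Rmult_1_l, Rabs_pos_eq; lra.
  - apply filterlim_R_shift; [apply Rbar_locally_filter|].
    apply (filterlim_0_p_infty _ 2 1 0); [lra|]. intros v _. pose proof (exp_pos v).
    pose proof (atan_inv (exp v) ltac:(lra)) as E. rewrite <- exp_Ropp in E.
    replace (2 * atan (exp v) - PI) with (- (2 * atan (exp (- v)))) by lra.
    pose proof (exp_pos (- v)). destruct (atan_le (exp (- v)) ltac:(lra)).
    rewrite Rabs_Ropp, Rmult_1_l, Rabs_pos_eq; lra.
Qed.

Lemma sqr_exp_integral (c : R) : 0 < c -> is_RInt_H (fun t => t ^ 2 * exp (- (c * t))) (2 / c ^ 3).
Proof.
  intros Hc. set (F := fun t => - ((t ^ 2 / c + 2 * t / c ^ 2 + 2 / c ^ 3) * exp (- (c * t)))).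
  replace (2 / c ^ 3) with (0 - F 0).
  2:{ unfold F. replace (- (c * 0)) with 0 by ring; rewrite exp_0. field. lra. }
  apply is_RInt_H_derive.
  - intros t _. unfold F. auto_derive; auto. field. lra.
  - intros t _. apply continuous_of_ex_derive. auto_derive. auto.
  (* With [s = c t / 2] the polynomial is [(4 s ^ 2 + 4 s + 2) / c ^ 3]. Since [s ^ 2 <= 2 exp s],
     while [s] and 1 are at most [exp s], it is at most [(8 + 4 + 2) exp s / c ^ 3]. *)
  - apply (filterlim_0_p_infty _ (8 / c ^ 3 + 4 / c ^ 3 + 2 / c ^ 3) (c / 2) 0); [lra|]. intros t Ht.
    unfold F. rewrite Rabs_Ropp.
    assert (Hc3 : 0 < / c ^ 3) by (apply Rinv_0_lt_compat, pow_lt, Hc).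
    pose proof (exp_pos (- (c * t))).
    assert (0 <= t ^ 2 / c + 2 * t / c ^ 2 + 2 / c ^ 3).
    { assert (0 <= t ^ 2 / c) by (apply Rdiv_le_0_compat; nra).
      assert (0 <= 2 * t / c ^ 2) by (apply Rdiv_le_0_compat; [lra | now apply pow_lt]).
      assert (0 <= 2 / c ^ 3) by (apply Rdiv_le_0_compat; [lra | now apply pow_lt]). lra. }
    rewrite Rabs_pos_eq by (apply Rmult_le_pos; lra).
    replace (- (c * t)) with (c / 2 * t + - (c * t) + - (c / 2 * t)) by field. rewrite (exp_plus _ (- (c / 2 * t))).
    rewrite <- Rmult_assoc. apply Rmult_le_compat_r; [left; apply exp_pos|].
    replace (c / 2 * t + - (c * t)) with (- (c / 2 * t)) by field.
    assert (Hs : 0 <= c / 2 * t) by (apply Rmult_le_pos; lra).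
    set (s := c / 2 * t) in *.
    replace (t ^ 2 / c + 2 * t / c ^ 2 + 2 / c ^ 3) with ((4 * s ^ 2 + 4 * s + 2) * / c ^ 3) by (unfold s; field; lra).
    pose proof (pow_div_fact_le_exp s 2 Hs) as H2. pose proof (exp_ineq1_le s) as H3. simpl fact in H2.
    replace (INR 2) with 2 in H2 by (simpl; ring).
    assert (Hx : 1 <= exp s) by lra.
    rewrite exp_Ropp. apply Rmult_le_reg_r with (exp s); [lra|].
    rewrite Rmult_assoc, Rinv_l, Rmult_1_r by lra.
    replace ((8 / c ^ 3 + 4 / c ^ 3 + 2 / c ^ 3) * exp s) with ((14 * exp s) * / c ^ 3) by (field; lra).
    apply Rmult_le_compat_r; lra.
Qed.

(** Geometric series in [y ^ 2], since [1 / cosh v = 2 y / (1 + y ^ 2)] with [y = exp (- v)]. *)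
Lemma sech_series (v : R) (K : nat) : 0 <= v ->
  Rabs (v ^ 2 * / cosh v - rsum (fun j => 2 * (-1) ^ j * (v ^ 2 * exp (- ((2 * INR j + 1) * v)))) K)
    <= 2 * (v ^ 2 * exp (- ((2 * INR K + 1) * v))).
Proof.
  intros Hv. set (y := exp (- v)). assert (Hy : 0 < y) by apply exp_pos.
  pose proof (geometric_remainder (y ^ 2) K ltac:(nra)) as H.
  assert (Ej : forall j, exp (- ((2 * INR j + 1) * v)) = (y ^ 2) ^ S j / y).
  { intros j. replace (- ((2 * INR j + 1) * v)) with (INR (2 * j + 1) * - v).
    - rewrite exp_INR_mult. fold y. replace (S j) with (j + 1)%nat by lia.
      rewrite <- pow_mult. replace (2 * (j + 1))%nat with (S (2 * j + 1)) by lia.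
      rewrite <- (tech_pow_Rmult y (2 * j + 1)). field. lra.
    - rewrite plus_INR, mult_INR. simpl. ring. }
  assert (Ec : / cosh v = 2 * y ^ 2 / (1 + y ^ 2) / y).
  { unfold cosh. replace (exp v) with (/ y) by (unfold y; rewrite exp_Ropp, Rinv_inv; reflexivity).
    fold y. field. repeat split; nra. }
  rewrite Ec, H, Ej.
  assert (Es : rsum (fun j => 2 * (-1) ^ j * (v ^ 2 * exp (- ((2 * INR j + 1) * v)))) K
    = v ^ 2 / y * rsum (fun k => 2 * (-1) ^ k * (y ^ 2) ^ S k) K).
  { rewrite <- rsum_scal. apply rsum_ext. intros j _. rewrite Ej. field. lra. }
  rewrite Es.
  set (S1 := rsum (fun k => 2 * (-1) ^ k * (y ^ 2) ^ S k) K). set (X := (y ^ 2) ^ S K).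
  replace (v ^ 2 * ((S1 + 2 * (-1) ^ K * X / (1 + y ^ 2)) / y) - v ^ 2 / y * S1)
    with ((-1) ^ K * (2 * (v ^ 2 * (X / y)) * / (1 + y ^ 2))) by (field; split; nra).
  assert (HX : 0 < X) by (unfold X; apply pow_lt; nra).
  rewrite Rabs_mult, pow_1_abs, Rmult_1_l.
  assert (0 <= v ^ 2 * (X / y)).
  { apply Rmult_le_pos; [apply pow2_ge_0|]. apply Rdiv_le_0_compat; lra. }
  assert (0 < / (1 + y ^ 2) <= 1).
  { assert (0 < y ^ 2) by (apply pow_lt; auto). split; [apply Rinv_0_lt_compat; lra|].
    rewrite <- Rinv_1. apply Rinv_le_contravar; lra. }
  rewrite Rabs_pos_eq by nra. nra.
Qed.

(** Termwise, [v ^ 2 * exp (- (2 j + 1) v)] integrates to [2 / (2 j + 1) ^ 3], so the half-line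
    integral is four times the alternating sum of inverse odd cubes. *)
Lemma sech_second_moment : is_RInt_R (fun v => v ^ 2 * / cosh v) (PI ^ 3 / 4).
Proof.
  replace (PI ^ 3 / 4) with (2 * (4 * (PI ^ 3 / 32))) by field.
  apply is_RInt_R_even.
  { intros t. rewrite cosh_neg. f_equal. ring. }
  destruct (is_RInt_H_ex_exp (fun v => v ^ 2 * / cosh v) 16 (1 / 2)) as [l Hl]; [lra | | |].
  - intros t. apply continuous_multR; [|apply continuous_sech].
    apply continuous_of_ex_derive. auto_derive. auto.
  - intros t Ht. destruct (sech_bound t) as [H1 H2]. rewrite (Rabs_pos_eq t) in H2 by auto.
    rewrite Rabs_pos_eq by (apply Rmult_le_pos; [apply pow2_ge_0 | lra]).
    pose proof (pow_div_fact_le_exp (t / 2) 2 ltac:(lra)) as H3. simpl fact in H3.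
    replace (INR 2) with 2 in H3 by (simpl; ring).
    replace (- (1 / 2 * t)) with (t / 2 + - t) by field. rewrite exp_plus.
    pose proof (exp_pos (- t)).
    apply Rle_trans with (t ^ 2 * (2 * exp (- t))); [apply Rmult_le_compat_l; [apply pow2_ge_0 | lra]|].
    assert (t ^ 2 <= 8 * exp (t / 2)) by nra. nra.
  - replace (4 * (PI ^ 3 / 32)) with l; [exact Hl|].
    assert (Hlim : is_lim_seq (rsum (fun j => 4 * ((-1) ^ j / (2 * INR j + 1) ^ 3))) l).
    { apply (is_lim_seq_le_0 _ (fun K => 4 * / (2 * INR K + 1))).
      - intros K.
        assert (Hj : forall j, 0 < 2 * INR j + 1) by (intros j; pose proof (pos_INR j); lra).
        pose proof (is_RInt_H_rsum (fun j v => 2 * (-1) ^ j * (v ^ 2 * exp (- ((2 * INR j + 1) * v))))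
          (fun j => 2 * (-1) ^ j * (2 / (2 * INR j + 1) ^ 3)) K
          (fun j => is_RInt_H_scal _ _ _ (sqr_exp_integral _ (Hj j)))) as H1.
        pose proof (is_RInt_H_minus _ _ _ _ Hl H1) as H2.
        pose proof (is_RInt_H_scal _ 2 _ (sqr_exp_integral _ (Hj K))) as H3.
        pose proof (is_RInt_H_norm_le _ _ _ _ H2 H3 (fun v Hv => sech_series v K Hv)) as H4.
        rewrite (rsum_ext _ (fun j => 2 * (-1) ^ j * (2 / (2 * INR j + 1) ^ 3))).
        2:{ intros j _. specialize (Hj j). field. lra. }
        rewrite <- Rabs_Ropp, Ropp_minus_distr. eapply Rle_trans; [exact H4|].
        specialize (Hj K). pose proof (pos_INR K).
        replace (2 * (2 / (2 * INR K + 1) ^ 3)) with (4 * / (2 * INR K + 1) ^ 3) by (field; lra).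
        apply Rmult_le_compat_l; [lra|]. apply Rinv_le_contravar; [auto|].
        rewrite <- (pow_1 (2 * INR K + 1)) at 1. apply Rle_pow; [lra | lia].
      - replace (Finite 0) with (Rbar_mult 4 0) by (simpl; f_equal; ring).
        apply is_lim_seq_scal_l, is_lim_seq_inv_odd. }
    apply (is_lim_seq_uniq _ _ _ Hlim).
    pose proof (is_lim_seq_scal_l _ 4 _ alternating_cubes) as H. simpl Rbar_mult in H.
    eapply is_lim_seq_ext; [|exact H]. intros K. cbv beta. now rewrite rsum_scal.
Qed.

Lemma sech_first_moment : is_RInt_R (fun v => v * / cosh v) 0.
Proof.
  destruct (RR_ex_exp (fun v => v * / cosh v) 4 (1 / 2)) as [l Hl]; [lra | | |].
  - intros t. apply continuous_multR; [apply continuous_id | apply continuous_sech].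
  - intros t. destruct (sech_bound t) as [H1 H2].
    rewrite Rabs_mult, (Rabs_pos_eq (/ cosh t)) by lra.
    pose proof (exp_ineq1_le (Rabs t / 2)) as H3. pose proof (Rabs_pos t).
    replace (- (1 / 2 * Rabs t)) with (Rabs t / 2 + - Rabs t) by field. rewrite exp_plus.
    pose proof (exp_pos (- Rabs t)).
    apply Rle_trans with (Rabs t * (2 * exp (- Rabs t))); [apply Rmult_le_compat_l; lra|]. nra.
  - pose proof (is_RInt_R_reflect (V := RN) _ _ Hl) as H1. simpl in H1.
    apply (RR_scal _ (-1)) in H1.
    assert (E : l = -1 * l).
    { apply (RR_unique _ _ _ Hl). revert H1. apply RR_ext. intros t. rewrite cosh_neg. ring. }
    replace 0 with l by lra. exact Hl.
Qed.

(** These are the first terms of [PI / cos (PI e / 2)], found from the moments of order 0, 1 and 2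
    by expanding [exp (- e v)]. The constant is [768 = 2 * 64 * 6], from
    [(Rabs v / 4) ^ 3 / 6 <= exp (Rabs v / 4)] and [1 / cosh v <= 2 exp (- Rabs v)]. *)
Lemma T2_sech_mellin : T2 sech_mellin PI 0 (PI ^ 3 / 8).
Proof.
  destruct (RR_ex_exp (fun v => exp (- (1 / 4 * Rabs v))) 1 (1 / 4) ltac:(lra)) as [K HK].
  { intros t. apply (continuous_comp (fun t => - (1 / 4 * Rabs t)) exp).
    - apply (continuous_opp (fun t => 1 / 4 * Rabs t)). apply (continuous_scal_r (1 / 4) (fun t => Rabs t)).
      apply continuous_Rabs.
    - apply continuous_of_ex_derive. auto_derive. auto. }
  { intros t. rewrite Rabs_pos_eq, Rmult_1_l; [lra | left; apply exp_pos]. }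
  assert (HK0 : 0 <= K).
  { pose proof (RR_scal _ 0 _ HK) as H0. rewrite Rmult_0_l in H0.
    apply (RR_le _ _ _ _ H0 HK). intros t. pose proof (exp_pos (- (1 / 4 * Rabs t))). lra. }
  exists (768 * K). split; [lra|]. intros e He.
  pose proof (sech_mellin_correct e ltac:(lra)) as H1.
  pose proof (RR_plus _ _ _ _ sech_integral (RR_plus _ _ _ _ (RR_scal _ (- e) _ sech_first_moment)
    (RR_scal _ (e ^ 2 / 2) _ sech_second_moment))) as H2.
  pose proof (RR_minus _ _ _ _ H1 H2) as H3.
  replace (sech_mellin e - (PI + 0 * e + PI ^ 3 / 8 * e ^ 2))
    with (sech_mellin e - (PI + (- e * 0 + e ^ 2 / 2 * (PI ^ 3 / 4)))) by field.
  replace (768 * K * e ^ 3) with (768 * e ^ 3 * K) by ring.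
  apply (RR_abs_le _ _ _ _ H3 (RR_scal _ (768 * e ^ 3) _ HK)). intros v.
  destruct (sech_bound v) as [H4 H5].
  replace (exp (- e * v) * / cosh v - (/ cosh v + (- e * (v * / cosh v) + e ^ 2 / 2 * (v ^ 2 * / cosh v))))
    with ((exp (- e * v) - 1 - - e * v - (- e * v) ^ 2 / 2) * / cosh v) by (pose proof (cosh_pos v); field; lra).
  rewrite Rabs_mult, (Rabs_pos_eq (/ cosh v)) by lra.
  pose proof (exp_taylor_2 (- e * v)) as H6.
  rewrite Rabs_mult, Rabs_Ropp, (Rabs_pos_eq e) in H6 by lra.
  pose proof (pow_div_fact_le_exp (Rabs v / 4) 3 ltac:(pose proof (Rabs_pos v); lra)) as H7. simpl fact in H7.
  replace (INR 6) with 6 in H7 by (simpl; ring).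
  assert (H8 : (e * Rabs v) ^ 3 <= 384 * e ^ 3 * exp (Rabs v / 4)).
  { replace ((e * Rabs v) ^ 3) with (384 * e ^ 3 * ((Rabs v / 4) ^ 3 / 6)) by field.
    apply Rmult_le_compat_l; auto. assert (0 <= e ^ 3) by (apply pow_le; lra). lra. }
  assert (H9 : exp (e * Rabs v) <= exp (Rabs v / 4)) by (apply exp_le; pose proof (Rabs_pos v); nra).
  assert (He3 : 0 <= e ^ 3) by (apply pow_le; lra).
  apply Rle_trans with ((384 * e ^ 3 * exp (Rabs v / 4) * exp (Rabs v / 4)) * (2 * exp (- Rabs v))).
  - apply Rmult_le_compat; [apply Rabs_pos | lra | | exact H5].
    eapply Rle_trans; [exact H6|]. apply Rmult_le_compat; auto.
    + apply pow_le. pose proof (Rabs_pos v). nra.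
    + left. apply exp_pos.
  - replace (384 * e ^ 3 * exp (Rabs v / 4) * exp (Rabs v / 4) * (2 * exp (- Rabs v)))
      with (768 * e ^ 3 * (exp (Rabs v / 4) * exp (Rabs v / 4) * exp (- Rabs v))) by ring.
    rewrite <- !exp_plus. apply Rmult_le_compat_l; [lra|]. apply exp_le. pose proof (Rabs_pos v). lra.
Qed.

(** [2 t / (t ^ 2 + f ^ 2)] at [t = exp v] is [1 / f] times [1 / cosh (v - ln f)]; translating by
    [ln f] extracts the power [f ^ (-1-e)], the general term of a zeta series. *)
Lemma Wp_term_mellin (e : R) (k : nat) : 0 <= e <= 1 / 4 ->
  is_RInt_R (fun v => exp (- (e * v)) * (2 * exp v / (exp v ^ 2 + freq k ^ 2)))
    (exp (- ((1 + e) * ln (freq k))) * sech_mellin e).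
Proof.
  intros He. pose proof (freq_pos k) as Hf.
  pose proof (is_RInt_R_translate (V := RN) _ (- ln (freq k)) _ (sech_mellin_correct e He)) as H.
  simpl in H. apply (RR_scal _ (exp (- ((1 + e) * ln (freq k))))) in H.
  revert H. apply RR_ext. intros v. unfold cosh.
  replace (- (v + - ln (freq k))) with (ln (freq k) + - v) by ring.
  replace (- e * (v + - ln (freq k))) with (- (e * v) + e * ln (freq k)) by ring.
  replace (- ((1 + e) * ln (freq k))) with (- (e * ln (freq k)) + - ln (freq k)) by ring.
  rewrite !exp_plus, !exp_Ropp, exp_ln by auto.
  pose proof (exp_pos v). pose proof (exp_pos (e * v)). pose proof (exp_pos (e * ln (freq k))).
  assert (0 < exp v ^ 2 + freq k ^ 2) by nra.
  field. repeat split; try lra; nra.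
Qed.

(** Dominated convergence with majorant [exp (- (e * v)) * W v]; on compact sets [W_tail] gives
    uniform convergence. *)
Theorem Wmellin_sum (e : R) : 0 < e <= 1 / 4 ->
  is_lim_seq (fun N => rsum (fun k => exp (- ((1 + e) * ln (freq k)))) N * sech_mellin e) (Wmellin e).
Proof.
  intros He.
  assert (HN : forall N, is_RInt_R (fun v => exp (- (e * v)) * Wp N v)
    (rsum (fun k => exp (- ((1 + e) * ln (freq k)))) N * sech_mellin e)).
  { induction N as [|N IH].
    - simpl. rewrite Rmult_0_l. pose proof (RR_scal _ 0 _ (Wmellin_correct e ltac:(lra))) as H.
      rewrite Rmult_0_l in H. revert H. apply RR_ext. intros v. unfold Wp. simpl. ring.
    - pose proof (RR_plus _ _ _ _ IH (Wp_term_mellin e N ltac:(lra))) as H.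
      cbn [rsum]. rewrite Rmult_plus_distr_r. revert H. apply RR_ext. intros v. unfold Wp. cbn [rsum]. ring. }
  assert (HD : is_lim_seq (fun N => norm (Wmellin e - rsum (fun k => exp (- ((1 + e) * ln (freq k)))) N * sech_mellin e)) 0).
  { apply (is_RInt_R_dominated_0 (V := RC)
      (fun N v => exp (- (e * v)) * W v - exp (- (e * v)) * Wp N v) _ (1 * (1 + 2 / e ^ 2))).
    - intros N. apply RR_minus; [apply Wmellin_correct; lra | apply HN].
    - intros N t. apply (exp_decay_cauchy (fun t => exp (- (e * t)) * W t - exp (- (e * t)) * Wp N t) 1 e); [lra|].
      clear t. intros t. rewrite Rmult_1_l. eapply Rle_trans; [|apply W_mellin_decay; lra].
      pose proof (exp_pos (- (e * t))). pose proof (Wp_pos N t). pose proof (Wp_le_W N t).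
      rewrite !Rabs_pos_eq; nra.
    - intros T eps Heps.
      set (c := exp (e * Rabs T) * (exp (Rabs T) / (2 * PI ^ 2))).
      assert (Hc : 0 < c).
      { unfold c. pose proof PI_RGT_0. apply Rmult_lt_0_compat; [apply exp_pos|].
        apply Rdiv_lt_0_compat; [apply exp_pos | nra]. }
      destruct (proj2 (is_lim_seq_spec _ _) basel (mkposreal _ (Rdiv_lt_0_compat _ _ Heps Hc))) as [N0 HN0].
      exists N0. intros n t Hn Ht. specialize (HN0 n Hn).
      change (Rabs (rsum (fun k => / INR (S k) ^ 2) n - PI ^ 2 / 6) < eps / c) in HN0.
      apply Rabs_def2 in HN0.
      change (Rabs (exp (- (e * t)) * W t - exp (- (e * t)) * Wp n t) <= eps).
      rewrite <- Rmult_minus_distr_l. pose proof (Wp_le_W n t). pose proof (W_tail n t) as H1.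
      pose proof (exp_pos (- (e * t))).
      assert (HT : - Rabs T <= t <= Rabs T).
      { pose proof (Rle_abs T). apply Rabs_le_between in Ht. lra. }
      set (d := PI ^ 2 / 6 - rsum (fun k => / INR (S k) ^ 2) n) in *.
      assert (Hd : d <= eps / c) by (unfold d; lra).
      assert (Hec : 0 <= eps / c) by (apply Rdiv_le_0_compat; lra).
      assert (HP : 0 < / (2 * PI ^ 2)) by (apply Rinv_0_lt_compat; pose proof PI_RGT_0; nra).
      rewrite Rabs_pos_eq by nra.
      assert (H2 : W t - Wp n t <= exp (Rabs T) / (2 * PI ^ 2) * (eps / c)).
      { eapply Rle_trans; [exact H1|].
        apply Rle_trans with (exp t / (2 * PI ^ 2) * (eps / c)).
        - apply Rmult_le_compat_l; auto. unfold Rdiv. pose proof (exp_pos t). nra.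
        - apply Rmult_le_compat_r; auto. unfold Rdiv. apply Rmult_le_compat_r; [lra|]. apply exp_le. lra. }
      assert (H3 : exp (- (e * t)) <= exp (e * Rabs T)) by (apply exp_le; nra).
      apply Rle_trans with (exp (e * Rabs T) * (exp (Rabs T) / (2 * PI ^ 2) * (eps / c))).
      + apply Rmult_le_compat; lra.
      + right. unfold c. pose proof (exp_pos (e * Rabs T)). pose proof (exp_pos (Rabs T)). pose proof PI_RGT_0.
        field. repeat split; lra. }
  apply (is_lim_seq_le_0 _ _ _ (fun N => Req_le _ _ (eq_trans (Rabs_minus_sym _ _) eq_refl)) HD).
Qed.

(** * Logarithmic sums and zeta near 1 *)

Lemma ln_ge_0 (x : R) : 1 <= x -> 0 <= ln x.
Proof. intros [Hx | <-]; [rewrite <- ln_1; left; apply ln_increasing; lra | rewrite ln_1; lra]. Qed.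

Lemma ln_le_compat (x y : R) : 0 < x <= y -> ln x <= ln y.
Proof. intros [Hx [Hxy | <-]]; [left; now apply ln_increasing | lra]. Qed.

(** The primitive of [- ((1 + ln u) / u) ^ 2] that vanishes at infinity, a telescoping majorant for
    terms of size [ln n ^ 2 / n ^ 2]. *)
Definition logtail (u : R) : R := (ln u ^ 2 + 4 * ln u + 5) / u.

Lemma is_derive_logtail (u : R) : 0 < u -> is_derive logtail u (- ((1 + ln u) / u) ^ 2).
Proof. intros Hu. unfold logtail. auto_derive; [lra|]. field. lra. Qed.

Lemma ln_div_decreasing (n u : R) : 1 <= n <= u -> (1 + ln u) / u <= (1 + ln n) / n.
Proof.
  intros H. destruct (mean_value_on (fun u => (1 + ln u) / u) (fun u => - ln u / u ^ 2) n u) as [c [Hc E]]; [lra | |].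
  { intros t Ht. auto_derive; [lra|]. field. lra. }
  pose proof (ln_ge_0 c ltac:(lra)).
  assert (0 <= ln c / c ^ 2) by (apply Rdiv_le_0_compat; [lra | apply pow_lt; lra]).
  replace (- ln c / c ^ 2) with (- (ln c / c ^ 2)) in E by (unfold Rdiv; ring). nra.
Qed.

Lemma logtail_lim : is_lim_seq (fun k => logtail (INR (S k))) 0.
Proof.
  apply (is_lim_seq_le_0 _ (fun k => 16 * Rpower (INR (S k)) (- (1 / 2)))).
  - intros k. rewrite Rminus_0_r. pose proof (INR_S_ge_1 k) as Hn. set (n := INR (S k)) in *.
    pose proof (ln_ge_0 n Hn) as Hl. unfold logtail, Rpower.
    assert (H : 4 + ln n <= 4 * exp (ln n / 4)) by (pose proof (exp_ineq1_le (ln n / 4)); lra).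
    assert (H2 : ln n ^ 2 + 4 * ln n + 5 <= 16 * exp (ln n / 2)).
    { replace (ln n / 2) with (ln n / 4 + ln n / 4) by field. rewrite exp_plus. nra. }
    replace (16 * exp (- (1 / 2) * ln n)) with (16 * exp (ln n / 2) * / n).
    + rewrite Rabs_pos_eq by (apply Rdiv_le_0_compat; nra).
      apply Rmult_le_compat_r; [left; apply Rinv_0_lt_compat; lra | exact H2].
    + replace (/ n) with (exp (- ln n)) by (rewrite exp_Ropp, exp_ln; [reflexivity | lra]).
      rewrite Rmult_assoc, <- exp_plus. do 2 f_equal. field.
  - replace (Finite 0) with (Rbar_mult 16 0) by (simpl; f_equal; ring).
    apply is_lim_seq_scal_l. apply is_lim_seq_Rpower_neg. lra.
Qed.

Lemma log_ratio_cell (n d g : R) : 1 <= n <= d -> n <= g <= n + 1 ->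
  (1 + ln d) / d <= 2 * ((1 + ln g) / g).
Proof.
  intros Hd Hg. apply Rle_trans with ((1 + ln n) / n); [apply ln_div_decreasing; lra|].
  pose proof (ln_le_compat n g ltac:(lra)) as Hl. pose proof (ln_ge_0 n ltac:(lra)).
  apply Rle_trans with ((1 + ln g) * / n).
  - apply Rmult_le_compat_r; [left; apply Rinv_0_lt_compat; lra | lra].
  - replace (2 * ((1 + ln g) / g)) with ((1 + ln g) * (2 * / g)) by (field; lra).
    apply Rmult_le_compat_l; [lra|].
    apply Rmult_le_reg_r with (n * g); [nra|].
    replace (/ n * (n * g)) with g by (field; lra).
    replace (2 * / g * (n * g)) with (2 * n) by (field; lra). lra.
Qed.

(** One cell of Euler-Maclaurin summation of order 0. The derivative of [f] at [d] is compared with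
    that of [logtail] at another point [g] of the cell; [log_ratio_cell] loses a factor 2, which is
    squared to 4. *)
Lemma log_cell (F f df : R -> R) (K : R) (k : nat) :
  (forall u, 1 <= u -> is_derive F u (f u)) -> (forall u, 1 <= u -> is_derive f u (df u)) ->
  (forall u, 1 <= u -> Rabs (df u) <= K * ((1 + ln u) / u) ^ 2) ->
  Rabs (f (INR (S k)) - (F (INR (S (S k))) - F (INR (S k))))
    <= 4 * K * logtail (INR (S k)) - 4 * K * logtail (INR (S (S k))).
Proof.
  intros HF Hf Hb. pose proof (INR_S_ge_1 k) as Hn. rewrite (S_INR (S k)). set (n := INR (S k)) in *.
  assert (HK : 0 <= K).
  { specialize (Hb 1 (Rle_refl 1)). rewrite ln_1 in Hb. pose proof (Rabs_pos (df 1)).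
    replace ((1 + 0) / 1) with 1 in Hb by field. lra. }
  destruct (mean_value_on F f n (n + 1)) as [c [Hc ->]]; [lra | intros; apply HF; lra |].
  destruct (mean_value_on f df n c) as [d [Hd E]]; [lra | intros; apply Hf; lra |].
  destruct (mean_value_on logtail (fun u => - ((1 + ln u) / u) ^ 2) n (n + 1)) as [g [Hg Eg]];
    [lra | intros; apply is_derive_logtail; lra |].
  replace (f n - f c * (n + 1 - n)) with (- (df d * (c - n))) by lra.
  rewrite Rabs_Ropp, Rabs_mult, (Rabs_pos_eq (c - n)) by lra.
  replace (4 * K * logtail n - 4 * K * logtail (n + 1)) with (4 * K * ((1 + ln g) / g) ^ 2) by (rewrite <- Rmult_minus_distr_l; replace (logtail n - logtail (n + 1)) with (- (logtail (n + 1) - logtail n)) by ring; rewrite Eg; ring).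
  specialize (Hb d ltac:(lra)).
  assert (Hq : forall u, 1 <= u -> 0 <= (1 + ln u) / u).
  { intros u Hu. pose proof (ln_ge_0 u Hu). apply Rdiv_le_0_compat; lra. }
  pose proof (log_ratio_cell n d g ltac:(lra) ltac:(lra)) as H1.
  assert (H2 : ((1 + ln d) / d) ^ 2 <= (2 * ((1 + ln g) / g)) ^ 2) by (apply pow_incr; split; [apply Hq; lra | auto]).
  assert (H3 : K * ((1 + ln d) / d) ^ 2 <= K * (2 * ((1 + ln g) / g)) ^ 2) by (apply Rmult_le_compat_l; auto).
  pose proof (Rabs_pos (df d)).
  apply Rle_trans with (Rabs (df d) * 1); [apply Rmult_le_compat_l; lra|].
  replace (4 * K * ((1 + ln g) / g) ^ 2) with (K * (2 * ((1 + ln g) / g)) ^ 2) by ring. lra.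
Qed.

(** The bound is the whole telescoped majorant, [4 * K * logtail 1 = 20 * K]. *)
Lemma log_cells_limit (F f df : R -> R) (K : R) :
  (forall u, 1 <= u -> is_derive F u (f u)) -> (forall u, 1 <= u -> is_derive f u (df u)) ->
  (forall u, 1 <= u -> Rabs (df u) <= K * ((1 + ln u) / u) ^ 2) ->
  exists l : R, is_lim_seq (fun N => rsum (fun k => f (INR (S k))) N - (F (INR (S N)) - F 1)) l
    /\ Rabs l <= 20 * K.
Proof.
  intros HF Hf Hb.
  destruct (rsum_telescope_conv (fun k => f (INR (S k)) - (F (INR (S (S k))) - F (INR (S k))))
    (fun k => 4 * K * logtail (INR (S k)))) as [l [Hl Hl0]].
  - intros k. now apply (log_cell F f df).
  - replace (Finite 0) with (Rbar_mult (4 * K) 0) by (simpl; f_equal; ring).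
    apply is_lim_seq_scal_l, logtail_lim.
  - exists l. split.
    + eapply is_lim_seq_ext; [|exact Hl]. intros N. cbv beta. rewrite rsum_minus. f_equal.
      pose proof (rsum_telescope (fun k => - F (INR (S k))) N) as E. cbv beta in E.
      change (INR 1) with 1 in E.
      rewrite (rsum_ext _ (fun k => F (INR (S (S k))) - F (INR (S k)))) in E by (intros; ring). rewrite E. ring.
    + specialize (Hl0 0%nat). simpl rsum in Hl0. rewrite Rminus_0_r in Hl0.
      unfold logtail in Hl0. change (INR 1) with 1 in Hl0. rewrite ln_1 in Hl0.
      replace (4 * K * ((0 ^ 2 + 4 * 0 + 5) / 1)) with (20 * K) in Hl0 by field. exact Hl0.
Qed.

(** The first Stieltjes constant. Its existence is enough: it enters the expansion of zeta at 1 and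
    the limit of the digamma cells, and drops out of the combination [g1 / 2 + (d1 - c1)]. *)
Lemma stieltjes_constant : exists g1 : R,
  is_lim_seq (fun N => rsum (fun k => ln (INR (S k)) / INR (S k)) N - ln (INR (S N)) ^ 2 / 2) g1.
Proof.
  destruct (log_cells_limit (fun u => ln u ^ 2 / 2) (fun u => ln u / u) (fun u => (1 - ln u) / u ^ 2) 1)
    as [l [Hl _]].
  - intros u Hu. auto_derive; [lra|]. field. lra.
  - intros u Hu. auto_derive; [lra|]. field. lra.
  - intros u Hu. pose proof (ln_ge_0 u Hu). rewrite Rmult_1_l.
    replace (((1 + ln u) / u) ^ 2) with ((1 + ln u) ^ 2 * / u ^ 2) by (field; lra).
    unfold Rdiv. rewrite Rabs_mult.
    assert (0 < / u ^ 2) by (apply Rinv_0_lt_compat, pow_lt; lra).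
    rewrite (Rabs_pos_eq (/ u ^ 2)) by lra. apply Rmult_le_compat_r; [lra|]. apply Rabs_le. nra.
  - exists l. eapply is_lim_seq_ext; [|exact Hl]. intros N. cbv beta. rewrite ln_1. field.
Qed.

(** Sum and integral are compared for [n ^ (-1-e) - 1 / n + e ln n / n], that is, [1 / n] times the
    first-order Taylor remainder of [n ^ (-e)] in [e]. Its derivative is at most
    [e ^ 2 ((1 + ln u) / u) ^ 2], so the discrepancy is at most [20 e ^ 2]. The subtracted terms
    contribute gamma and the Stieltjes constant, the integral contributes [1 / e]. *)
Lemma zeta_near_1 (g1 : R) :
  is_lim_seq (fun N => rsum (fun k => ln (INR (S k)) / INR (S k)) N - ln (INR (S N)) ^ 2 / 2) g1 ->
  forall e, 0 < e <= 1 / 4 -> exists z : R,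
    is_lim_seq (fun N => rsum (fun k => exp (- ((1 + e) * ln (INR (S k))))) N) z
    /\ Rabs (e * z - (1 + euler_gamma * e + - g1 * e ^ 2)) <= 20 * e ^ 3.
Proof.
  intros Hg1 e He.
  destruct (log_cells_limit (fun u => - ((exp (- (e * ln u)) - 1) / e) - ln u + e * (ln u ^ 2 / 2))
    (fun u => (exp (- (e * ln u)) - 1 + e * ln u) / u)
    (fun u => (e * (1 - exp (- (e * ln u))) - (exp (- (e * ln u)) - 1 + e * ln u)) / u ^ 2) (e ^ 2))
    as [l [Hl Hlb]].
  - intros u Hu. auto_derive; [lra|]. field. lra.
  - intros u Hu. auto_derive; [lra|]. field. lra.
  - intros u Hu. pose proof (ln_ge_0 u Hu) as Hln. set (x := e * ln u).
    assert (Hx : 0 <= x) by (unfold x; nra).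
    destruct (one_minus_exp_neg x Hx) as [H1 H2].
    assert (H3 : 0 <= exp (- x) - 1 + x <= x ^ 2).
    { pose proof (exp_ineq1_le (- x)) as H4. pose proof (exp_ineq1_le x) as H5.
      assert (E : exp (- x) * exp x = 1) by (rewrite <- exp_plus, Rplus_opp_l; apply exp_0).
      split; [lra|]. pose proof (exp_pos (- x)).
      assert (exp (- x) * (1 + x) <= 1) by (rewrite <- E; apply Rmult_le_compat_l; lra).
      nra. }
    replace (e ^ 2 * ((1 + ln u) / u) ^ 2) with (e ^ 2 * (1 + ln u) ^ 2 * / u ^ 2) by (field; lra).
    unfold Rdiv. rewrite Rabs_mult.
    assert (0 < / u ^ 2) by (apply Rinv_0_lt_compat, pow_lt; lra).
    rewrite (Rabs_pos_eq (/ u ^ 2)) by lra. apply Rmult_le_compat_r; [lra|].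
    assert (E1 : e * x = e ^ 2 * ln u) by (unfold x; ring).
    assert (E2 : x ^ 2 = e ^ 2 * ln u ^ 2) by (unfold x; ring).
    assert (0 <= e ^ 2) by apply pow2_ge_0.
    assert (0 <= e * (1 - exp (- x)) <= e * x) by nra.
    replace (e ^ 2 * (1 + ln u) ^ 2) with (e ^ 2 + 2 * (e ^ 2 * ln u) + e ^ 2 * ln u ^ 2) by ring.
    assert (0 <= e ^ 2 * ln u) by nra. assert (0 <= e ^ 2 * ln u ^ 2) by (rewrite <- E2; apply pow2_ge_0).
    apply Rabs_le. lra.
  - exists (l + / e + euler_gamma - e * g1). split.
    2:{ replace (e * (l + / e + euler_gamma - e * g1) - (1 + euler_gamma * e + - g1 * e ^ 2)) with (e * l) by (field; lra).
        rewrite Rabs_mult, (Rabs_pos_eq e) by lra.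
        replace (20 * e ^ 3) with (e * (20 * e ^ 2)) by ring. apply Rmult_le_compat_l; lra. }
    pose proof (is_lim_seq_Rpower_neg e ltac:(lra)) as Hp.
    pose proof (is_lim_seq_minus' _ _ _ _ (is_lim_seq_const (/ e)) (is_lim_seq_scal_l _ (/ e) _ Hp)) as H1.
    simpl Rbar_mult in H1. rewrite Rmult_0_r, Rminus_0_r in H1.
    pose proof (is_lim_seq_scal_l _ e _ Hg1) as H2. simpl Rbar_mult in H2.
    pose proof (is_lim_seq_minus' _ _ _ _ (is_lim_seq_plus' _ _ _ _ (is_lim_seq_plus' _ _ _ _ Hl H1) euler_gamma_lim) H2) as H3.
    eapply is_lim_seq_ext; [|exact H3]. intros N. cbv beta. rewrite ln_1.
    replace (- (e * 0)) with 0 by ring. rewrite exp_0.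
    replace (1 + INR N) with (INR (S N)) by (rewrite S_INR; ring).
    unfold Rpower. replace (- e * ln (INR (S N))) with (- (e * ln (INR (S N)))) by ring.
    rewrite (rsum_ext (fun k => (exp (- (e * ln (INR (S k)))) - 1 + e * ln (INR (S k))) / INR (S k))
      (fun k => exp (- ((1 + e) * ln (INR (S k)))) - / INR (S k) + e * (ln (INR (S k)) / INR (S k)))).
    + rewrite (rsum_plus (fun k => exp (- ((1 + e) * ln (INR (S k)))) - / INR (S k))), rsum_minus, rsum_scal.
      field. lra.
    + intros k _. pose proof (INR_S_ge_1 k).
      replace (- ((1 + e) * ln (INR (S k)))) with (- (e * ln (INR (S k))) + - ln (INR (S k))) by ring.
      rewrite (exp_plus _ (- ln (INR (S k)))), (exp_Ropp (ln (INR (S k)))), exp_ln by lra. field. lra.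
Qed.

(** * Regularised moments and their Laurent expansion *)

Lemma id_le_exp (t : R) : 0 <= t -> t <= 4 * exp (t / 4).
Proof. intros Ht. pose proof (exp_ineq1_le (t / 4)). lra. Qed.

Lemma sqr_le_exp (t : R) : 0 <= t -> t ^ 2 <= 128 * exp (t / 8).
Proof.
  intros Ht. pose proof (pow_div_fact_le_exp (t / 8) 2 ltac:(lra)) as H. simpl fact in H.
  replace (INR 2) with 2 in H by (simpl; ring). nra.
Qed.

Lemma moment_ex (f : R -> R) (B : R) : (forall t, continuous f t) ->
  (forall t, 0 <= t -> Rabs (f t) <= B * exp (- (t / 2))) ->
  exists a0 a1 : R, is_RInt_H f a0 /\ is_RInt_H (fun t => t * f t) a1.
Proof.
  intros Hc Hb.
  assert (HB : 0 <= B).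
  { specialize (Hb 0 (Rle_refl 0)). replace (- (0 / 2)) with 0 in Hb by field. rewrite exp_0 in Hb.
    pose proof (Rabs_pos (f 0)). lra. }
  destruct (is_RInt_H_ex_exp f B (1 / 2)) as [a0 H0]; [lra | auto | |].
  { intros t Ht. replace (- (1 / 2 * t)) with (- (t / 2)) by field. auto. }
  destruct (is_RInt_H_ex_exp (fun t => t * f t) (4 * B) (1 / 4)) as [a1 H1]; [lra | | |].
  { intros t. apply continuous_multR; [apply continuous_id | apply Hc]. }
  { intros t Ht. rewrite Rabs_mult, (Rabs_pos_eq t) by auto. pose proof (id_le_exp t Ht).
    apply Rle_trans with (4 * exp (t / 4) * (B * exp (- (t / 2)))).
    - apply Rmult_le_compat; auto; apply Rabs_pos.
    - right. replace (- (1 / 4 * t)) with (t / 4 + - (t / 2)) by field. rewrite exp_plus. ring. }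
  now exists a0, a1.
Qed.

(** First-order Taylor expansion of [exp (s * t)] under the integral. The exponential rates [1 / 8]
    for [t ^ 2], [1 / 4] for [exp (e t)] and [- 1 / 2] for [f] leave [exp (- t / 8)], with integral
    8; hence [1024 = 128 * 8]. *)
Lemma half_mellin_taylor (f : R -> R) (B a0 a1 e s I : R) :
  (forall t, 0 <= t -> Rabs (f t) <= B * exp (- (t / 2))) ->
  is_RInt_H f a0 -> is_RInt_H (fun t => t * f t) a1 -> 0 < e <= 1 / 4 -> Rabs s = e ->
  is_RInt_H (fun t => exp (s * t) * f t) I ->
  Rabs (I - a0 - s * a1) <= 1024 * B * e ^ 2.
Proof.
  intros Hb H0 H1 He Hs HI.
  pose proof (is_RInt_H_minus _ _ _ _ (is_RInt_H_minus _ _ _ _ HI H0) (is_RInt_H_scal _ s _ H1)) as H2.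
  assert (HB : 0 <= B).
  { specialize (Hb 0 (Rle_refl 0)). replace (- (0 / 2)) with 0 in Hb by field. rewrite exp_0 in Hb.
    pose proof (Rabs_pos (f 0)). lra. }
  pose proof (is_RInt_H_scal _ (128 * B * e ^ 2) _ (is_RInt_H_exp (1 / 8) ltac:(lra))) as H3.
  replace (1024 * B * e ^ 2) with (128 * B * e ^ 2 * / (1 / 8)) by field.
  apply (is_RInt_H_norm_le _ _ _ _ H2 H3). intros t Ht.
  replace (exp (s * t) * f t - f t - s * (t * f t)) with ((exp (s * t) - 1 - s * t) * f t) by ring.
  destruct (exp_taylor_1 (s * t)) as [H4 H5]. rewrite Rabs_mult, (Rabs_pos_eq (exp (s * t) - 1 - s * t)) by auto.
  rewrite <- pow2_abs, Rabs_mult, Hs, (Rabs_pos_eq t) in H5 by auto.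
  specialize (Hb t Ht). pose proof (sqr_le_exp t Ht) as H6.
  assert (H7 : exp (e * t) <= exp (t / 4)) by (apply exp_le; nra).
  apply Rle_trans with ((e ^ 2 * (128 * exp (t / 8)) * exp (t / 4)) * (B * exp (- (t / 2)))).
  - apply Rmult_le_compat; auto; [apply Rabs_pos|]. eapply Rle_trans; [exact H5|].
    apply Rmult_le_compat; [apply pow2_ge_0 | left; apply exp_pos | | exact H7].
    replace ((e * t) ^ 2) with (e ^ 2 * t ^ 2) by ring. apply Rmult_le_compat_l; [apply pow2_ge_0 | auto].
  - right. replace (- (1 / 8 * t)) with (t / 8 + t / 4 + - (t / 2)) by field. rewrite !exp_plus. ring.
Qed.

Lemma kk_left_decay (t : R) : 0 <= t -> Rabs (kk (- t)) <= 2 * exp (- (t / 2)).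
Proof. intros Ht. replace (- (t / 2)) with (- t / 2) by field. apply kk_decay. lra. Qed.

Lemma hh_right_decay (t : R) : 0 <= t -> Rabs (hh t) <= 2 * exp (- (t / 2)).
Proof.
  intros Ht. destruct (hh_bounds t). rewrite Rabs_pos_eq by auto.
  assert (exp (- t) <= exp (- (t / 2))) by (apply exp_le; lra). pose proof (exp_pos (- (t / 2))). lra.
Qed.

(** On the left half-line [hh] tends to [1 / 2]; there it is written [kk + 1 / 2], whose constant
    integrates to the pole [1 / (2 e)]. The left moments are taken at exponent [- e], so the
    first-order one enters with a minus sign. *)
Lemma T2_mellin_hh (c0 c1 d0 d1 : R) :
  is_RInt_H (fun t => kk (- t)) c0 -> is_RInt_H (fun t => t * kk (- t)) c1 ->
  is_RInt_H hh d0 -> is_RInt_H (fun t => t * hh t) d1 ->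
  T2 (fun e => e * (GR (1 + e) * Wmellin e)) (1 / 2) (c0 + d0) (d1 - c1).
Proof.
  intros Hc0 Hc1 Hd0 Hd1. exists 4096. split; [lra|]. intros e He.
  assert (Hkc : forall t, continuous (fun t => kk (- t)) t) by (intros; apply continuous_opp_arg, continuous_kk).
  destruct (is_RInt_H_ex_exp (fun t => exp (- e * t) * kk (- t)) 2 (1 / 2)) as [I1 HI1]; [lra | | |].
  { intros t. apply continuous_multR; [|apply Hkc].
    apply continuous_of_ex_derive. auto_derive. auto. }
  { intros t Ht. rewrite Rabs_mult, (Rabs_pos_eq (exp _)) by (left; apply exp_pos).
    pose proof (kk_left_decay t Ht) as H. replace (- (1 / 2 * t)) with (- (t / 2)) by field.
    assert (exp (- e * t) <= exp 0) by (apply exp_le; nra). rewrite exp_0 in H0.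
    pose proof (exp_pos (- e * t)). pose proof (Rabs_pos (kk (- t))). nra. }
  destruct (is_RInt_H_ex_exp (fun t => exp (e * t) * hh t) 2 (1 / 4)) as [I2 HI2]; [lra | | |].
  { intros t. apply continuous_multR; [|apply continuous_hh].
    apply continuous_of_ex_derive. auto_derive. auto. }
  { intros t Ht. rewrite Rabs_mult, (Rabs_pos_eq (exp _)) by (left; apply exp_pos).
    pose proof (hh_right_decay t Ht) as H.
    replace (- (1 / 4 * t)) with (t / 4 + - (t / 2)) by field. rewrite exp_plus.
    assert (exp (e * t) <= exp (t / 4)) by (apply exp_le; nra).
    replace (2 * (exp (t / 4) * exp (- (t / 2)))) with (exp (t / 4) * (2 * exp (- (t / 2)))) by ring.
    apply Rmult_le_compat; auto; [left; apply exp_pos | apply Rabs_pos]. }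
  assert (E : GR (1 + e) * Wmellin e = (I1 + / 2 * / e) + I2).
  { apply (RR_unique _ _ _ (mellin_hh e ltac:(lra))). apply is_RInt_R_halves; [|exact HI2].
    apply (is_RInt_H_ext (fun t => exp (- e * t) * kk (- t) + / 2 * exp (- (e * t)))).
    - intros t _. unfold hh. replace (e * - t) with (- e * t) by ring. replace (- (e * t)) with (- e * t) by ring. ring.
    - apply is_RInt_H_plus; [exact HI1|]. apply is_RInt_H_scal, is_RInt_H_exp. lra. }
  rewrite E.
  pose proof (half_mellin_taylor _ 2 _ _ e (- e) _ kk_left_decay Hc0 Hc1 He ltac:(rewrite Rabs_Ropp, Rabs_pos_eq; lra) HI1) as H1.
  pose proof (half_mellin_taylor _ 2 _ _ e e _ hh_right_decay Hd0 Hd1 He ltac:(rewrite Rabs_pos_eq; lra) HI2) as H2.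
  replace (e * (I1 + / 2 * / e + I2) - (1 / 2 + (c0 + d0) * e + (d1 - c1) * e ^ 2))
    with (e * ((I1 - c0 - - e * c1) + (I2 - d0 - e * d1))) by (field; lra).
  rewrite Rabs_mult, (Rabs_pos_eq e) by lra.
  replace (4096 * e ^ 3) with (e * (4096 * e ^ 2)) by ring. apply Rmult_le_compat_l; [lra|].
  eapply Rle_trans; [apply Rabs_triang|]. lra.
Qed.

Lemma T2_linear (b : R) : T2 (fun e => b * e) 0 b 0.
Proof.
  exists 0. split; [lra|]. intros e _. replace (b * e - (0 + b * e + 0 * e ^ 2)) with 0 by ring.
  rewrite Rabs_R0. lra.
Qed.

Lemma T2_const (b : R) : T2 (fun _ => b) b 0 0.
Proof.
  exists 0. split; [lra|]. intros e _. replace (b - (b + 0 * e + 0 * e ^ 2)) with 0 by ring.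
  rewrite Rabs_R0. lra.
Qed.

(* The Laurent expansions at [s = 1] of both sides of
   [int y^(s-1) (g y + 1/(2y)) dy = Gamma(s) (2 pi)^(-s) zeta(s) int exp(-(s-1)v)/cosh v dv]. *)
Theorem moment_constants (c0 c1 d0 d1 g1 : R) :
  is_RInt_H (fun t => kk (- t)) c0 -> is_RInt_H (fun t => t * kk (- t)) c1 ->
  is_RInt_H hh d0 -> is_RInt_H (fun t => t * hh t) d1 ->
  is_lim_seq (fun N => rsum (fun k => ln (INR (S k)) / INR (S k)) N - ln (INR (S N)) ^ 2 / 2) g1 ->
  c0 + d0 = - ln (2 * PI) / 2 /\
  g1 / 2 + (d1 - c1) = - euler_gamma ^ 2 / 4 + 5 * PI ^ 2 / 48 + ln (2 * PI) ^ 2 / 4.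
Proof.
  intros Hc0 Hc1 Hd0 Hd1 Hg1.
  pose proof (T2_mellin_hh _ _ _ _ Hc0 Hc1 Hd0 Hd1) as HL.
  pose proof PI_RGT_0 as Hpi. set (L := ln (2 * PI)).
  set (zf := fun e => real (Lim_seq (fun N => rsum (fun k => exp (- ((1 + e) * ln (INR (S k))))) N))).
  assert (Hz : forall e, 0 < e <= 1 / 4 ->
    is_lim_seq (fun N => rsum (fun k => exp (- ((1 + e) * ln (INR (S k))))) N) (zf e)
    /\ Rabs (e * zf e - (1 + euler_gamma * e + - g1 * e ^ 2)) <= 20 * e ^ 3).
  { intros e He. destruct (zeta_near_1 g1 Hg1 e He) as [z [H1 H2]].
    assert (E : zf e = z) by (unfold zf; now rewrite (is_lim_seq_unique _ _ H1)).
    now rewrite E. }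
  assert (HZ : T2 (fun e => e * zf e) 1 euler_gamma (- g1)).
  { exists 20. split; [lra|]. intros e He. apply Hz, He. }
  assert (HP : T2 (fun e => exp (- L * e)) 1 (- L) (0 + (- L) ^ 2 / 2)) by apply T2_exp, T2_linear.
  pose proof (T2_mul _ _ _ _ _ _ _ _ (T2_mul _ _ _ _ _ _ _ _ T2_GR T2_sech_mellin)
    (T2_mul _ _ _ _ _ _ _ _ (T2_mul _ _ _ _ _ _ _ _ (T2_const (/ (2 * PI))) HP) HZ)) as HR.
  apply (T2_ext _ (fun e => e * (GR (1 + e) * Wmellin e))) in HR.
  2:{ intros e He. cbv beta.
      assert (E : Wmellin e = exp (- ((1 + e) * L)) * zf e * sech_mellin e).
      { apply (is_lim_seq_uniq _ _ _ (Wmellin_sum e He)).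
        pose proof (is_lim_seq_scal_r _ (sech_mellin e) _
          (is_lim_seq_scal_l _ (exp (- ((1 + e) * L))) _ (proj1 (Hz e He)))) as H.
        simpl Rbar_mult in H. eapply is_lim_seq_ext; [|exact H]. intros N. cbv beta.
        rewrite <- rsum_scal. f_equal. apply rsum_ext. intros k _.
        unfold freq, L. pose proof (INR_S_ge_1 k). rewrite (ln_mult (2 * PI)) by lra.
        rewrite <- exp_plus. f_equal. ring. }
      rewrite E. replace (- ((1 + e) * L)) with (- L + - L * e) by ring. rewrite exp_plus.
      replace (exp (- L)) with (/ (2 * PI)) by (unfold L; rewrite exp_Ropp, exp_ln; [reflexivity | lra]).
      ring. }
  destruct (T2_unique _ _ _ _ _ _ _ HL HR) as [_ [E1 E2]].
  split.
  - rewrite E1. fold L. field. lra.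
  - rewrite E2. fold L. field. lra.
Qed.

(** * Passage to the limit *)

(** A primitive of [p (ln y) / y]. With [c] the integral of [p] over the negative half-line it is
    the one that vanishes at 0. *)
Definition log_prim (p : R -> R) (c y : R) : R := c + RInt p 0 (ln y).

Lemma is_derive_log_prim (p : R -> R) (c y : R) : (forall t, continuous p t) -> 0 < y ->
  is_derive (log_prim p c) y (p (ln y) / y).
Proof.
  intros Hc Hy. unfold log_prim. rewrite <- (Rplus_0_l (p (ln y) / y)).
  apply (is_derive_plus (V := RN) (fun _ => c) (fun y => RInt p 0 (ln y))).
  - apply (is_derive_const (V := RN)).
  - unfold Rdiv. rewrite Rmult_comm.
    apply (is_derive_comp (V := RN) (fun v => RInt p 0 v) ln).
    + now apply is_derive_RInt_from_0.
    + apply is_derive_Reals, derivable_pt_lim_ln, Hy.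
Qed.

Lemma log_prim_small (p : R -> R) (c k A y : R) : 0 < k -> (forall t, continuous p t) ->
  is_RInt_H (fun t => p (- t)) c -> (forall u, u <= 0 -> Rabs (p u) <= A * exp (k * u)) ->
  0 < y <= 1 -> Rabs (log_prim p c y) <= A / k * Rpower y k.
Proof.
  intros Hk Hc Hi Hb Hy. unfold log_prim, Rpower.
  apply (antiderivative_left p c k A 0); auto.
  rewrite <- ln_1. apply ln_le_compat. lra.
Qed.

Lemma is_RInt_H_lim (f : R -> R) (l : R) (b : nat -> R) :
  is_RInt_H f l -> is_lim_seq b p_infty -> is_lim_seq (fun N => RInt f 0 (b N)) l.
Proof.
  intros Hf Hb. apply is_lim_seq_spec. intros eps.
  destruct (is_RInt_H_elim _ _ Hf eps) as [A HA].
  destruct (proj2 (is_lim_seq_spec _ _) Hb A) as [N0 HN0].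
  exists N0. intros n Hn. destruct (HA (b n) (HN0 n Hn)) as [y [Hy He]].
  now rewrite (is_RInt_unique _ _ _ _ Hy).
Qed.

Lemma ln_nat_mul_lim (x : R) : 0 < x -> is_lim_seq (fun N => ln (INR (S N) * x)) p_infty.
Proof.
  intros Hx. apply (is_lim_seq_ext (fun N => ln x + ln (INR (S N)))).
  { intros N. pose proof (INR_S_ge_1 N). rewrite ln_mult by lra. ring. }
  apply (is_lim_seq_plus (fun _ => ln x) (fun N => ln (INR (S N))) (ln x) p_infty p_infty).
  - apply is_lim_seq_const.
  - apply (is_lim_comp_seq ln (fun N => INR (S N)) p_infty p_infty).
    + apply is_lim_ln_p.
    + now exists 0%nat.
    + apply (is_lim_seq_incr_1 INR), is_lim_seq_INR.
  - reflexivity.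
Qed.

Lemma RInt_kk_hh (L : R) : RInt kk 0 L = RInt hh 0 L - L / 2.
Proof.
  apply is_RInt_unique. replace (L / 2) with (/ 2 * (L - 0)) by field.
  apply (is_RInt_ext (V := RN) (fun v => minus (hh v) (/ 2))).
  - intros v _. unfold hh. change (kk v + / 2 - / 2 = kk v). ring.
  - apply (is_RInt_minus (V := RN)).
    + apply (RInt_correct (V := RC)), (ex_RInt_cont (V := RC)), continuous_hh.
    + rewrite Rmult_comm. apply (is_RInt_const (V := RN) 0 L (/ 2)).
Qed.

Lemma continuous_id_mul (f : R -> R) (t : R) : (forall t, continuous f t) ->
  continuous (fun t => t * f t) t.
Proof. intros H. apply continuous_multR; [apply continuous_id | apply H]. Qed.

Lemma RInt_id_kk_hh (L : R) : RInt (fun v => v * kk v) 0 L = RInt (fun v => v * hh v) 0 L - L ^ 2 / 4.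
Proof.
  apply is_RInt_unique.
  apply (is_RInt_ext (V := RN) (fun v => minus (v * hh v) (v / 2))).
  - intros v _. unfold hh. change (v * (kk v + / 2) - v / 2 = v * kk v). field.
  - apply (is_RInt_minus (V := RN)).
    + apply (RInt_correct (V := RC)), (ex_RInt_cont (V := RC)).
      intros t. apply continuous_id_mul, continuous_hh.
    + replace (L ^ 2 / 4) with (minus (L ^ 2 / 4) (0 ^ 2 / 4)).
      2:{ change (L ^ 2 / 4 - 0 ^ 2 / 4 = L ^ 2 / 4). field. }
      apply (is_RInt_derive (V := RC) (fun v => v ^ 2 / 4) (fun v => v / 2)).
      * intros v _. auto_derive; auto. field.
      * intros v _. apply continuous_of_ex_derive. auto_derive. auto.
Qed.

(** [k0] and [k1 ell] are primitives of [ln (1 + 1 / z)] and [ln z * ln (1 + 1 / z)], the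
    logarithmic part of [gM] in the scaled variable [z = y / N]; they vanish at 0 as soon as [ell]
    does. *)
Definition k0 (z : R) : R := (1 + z) * ln (1 + z) - z * ln z.
Definition k1 (ell : R -> R) (z : R) : R :=
  z * ln z * ln (1 + z) - (1 + z) * ln (1 + z) + z * ln z - z * ln z ^ 2 + ell z.

(** Primitives of [gM N y] and, for [gMprim1], of [ln y * gM N y], again vanishing at 0. They are
    given in closed form because the boundary terms of [TM] consist of exactly these pieces. *)
Definition gMprim0 (N : nat) (y : R) : R :=
  rsum (fun j => ln (1 + y / INR (S j))) N - INR N * k0 (y / INR N).
Definition gMprim1 (ell : R -> R) (N : nat) (y : R) : R :=
  rsum (fun j => ell (y / INR (S j)) + ln (INR (S j)) * ln (1 + y / INR (S j))) N
  - INR N * (ln (INR N) * k0 (y / INR N) + k1 ell (y / INR N)).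

Lemma is_derive_R_eq (f : R -> R) (x a b : R) : is_derive f x a -> a = b -> is_derive f x b.
Proof. now intros H <-. Qed.

Lemma is_derive_gMprim0 (N : nat) (y : R) : (0 < N)%nat -> 0 < y -> is_derive (gMprim0 N) y (gM N y).
Proof.
  intros HN Hy. assert (HT : 0 < INR N) by now apply lt_0_INR.
  assert (Hz : 0 < y / INR N) by now apply Rdiv_lt_0_compat.
  unfold gMprim0, gM.
  apply (is_derive_minus (V := RN) (fun y => rsum (fun j => ln (1 + y / INR (S j))) N)
    (fun y => INR N * k0 (y / INR N))).
  - apply (is_derive_rsum (fun j y => ln (1 + y / INR (S j))) (fun j y => / (y + INR (S j)))).
    intros j. pose proof (INR_S_ge_1 j). assert (0 < y / INR (S j)) by (apply Rdiv_lt_0_compat; lra).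
    cbv beta. set (n := INR (S j)) in *. clearbody n. auto_derive; [lra|]. field. lra.
  - unfold k0. auto_derive; [repeat split; lra|].
    replace (ln (y + INR N)) with (ln (1 + y / INR N) + ln (INR N)).
    2:{ rewrite <- ln_mult by lra. f_equal. field. lra. }
    replace (ln y) with (ln (y / INR N) + ln (INR N)).
    2:{ rewrite <- ln_mult by lra. f_equal. field. lra. }
    unfold Rdiv in *. field. split; lra.
Qed.

Lemma is_derive_gMprim1 (ell : R -> R) (N : nat) (y : R) :
  (forall y, 0 < y -> is_derive ell y (ln y / (1 + y))) ->
  (0 < N)%nat -> 0 < y -> is_derive (gMprim1 ell N) y (ln y * gM N y).
Proof.
  intros Hell HN Hy. assert (HT : 0 < INR N) by now apply lt_0_INR.
  assert (Hz : 0 < y / INR N) by now apply Rdiv_lt_0_compat.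
  assert (Hex : forall t, 0 < t -> ex_derive ell t) by (intros t Ht; eexists; now apply Hell).
  assert (Hde : forall t, 0 < t -> Derive ell t = ln t / (1 + t)) by (intros t Ht; now apply is_derive_unique, Hell).
  unfold gMprim1, gM. rewrite Rmult_minus_distr_l, <- rsum_scal.
  apply (is_derive_minus (V := RN)
    (fun y => rsum (fun j => ell (y / INR (S j)) + ln (INR (S j)) * ln (1 + y / INR (S j))) N)
    (fun y => INR N * (ln (INR N) * k0 (y / INR N) + k1 ell (y / INR N)))).
  - apply (is_derive_rsum (fun j y => ell (y / INR (S j)) + ln (INR (S j)) * ln (1 + y / INR (S j)))
      (fun j y => ln y * / (y + INR (S j)))).
    intros j. pose proof (INR_S_ge_1 j). assert (Hj : 0 < y / INR (S j)) by (apply Rdiv_lt_0_compat; lra).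
    cbv beta. set (n := INR (S j)) in *. clearbody n. auto_derive; [repeat split; auto; lra|]. rewrite Hde by auto.
    change (y * / n) with (y / n). rewrite ln_div by lra. field. lra.
  - unfold k0, k1. auto_derive; [repeat split; auto; lra|]. rewrite Hde by auto.
    replace (ln (y + INR N)) with (ln (1 + y / INR N) + ln (INR N)).
    2:{ rewrite <- ln_mult by lra. f_equal. field. lra. }
    replace (ln y) with (ln (y / INR N) + ln (INR N)).
    2:{ rewrite <- ln_mult by lra. f_equal. field. lra. }
    unfold Rdiv in *. field. repeat split; lra.
Qed.

(** When [P0] and [P1] are the primitives of [g y] and [ln y * g y] that vanish at 0, this is the
    sum over [1 <= n <= N] of [(ln n + a) g (x n)] minus the integral of [(ln u + a) g (x u)] over
    [[0, N]]. The constant [a] stays free so that weighted and unweighted sums come from one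
    statement. *)
Definition cells (g P0 P1 : R -> R) (a x : R) (N : nat) : R :=
  rsum (fun i => (ln (INR (S i)) + a) * g (x * INR (S i))) N
  - / x * (P1 (INR N * x) + (a - ln x) * P0 (INR N * x)).

Lemma ln_one_plus_div (a b : R) : 0 < a -> 0 < b -> ln (1 + a / b) = ln (b + a) - ln b.
Proof. intros Ha Hb. rewrite <- ln_div by lra. f_equal. field. lra. Qed.

(** [ln (x i / j)] splits into [(ln i + ln x) - ln j]. The first part is summed over [j], the second
    over [i]; the inner sums are values of [gM] up to logarithms, and these logarithms together with
    the [ell] terms make up the primitives in [cells]. *)
Lemma TM_cells (ell : R -> R) (x : R) (M : nat) : 0 < x ->
  TM ell x M = cells (gM (S M)) (gMprim0 (S M)) (gMprim1 ell (S M)) (ln x) x (S M)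
    - / x * cells (gM (S M)) (gMprim0 (S M)) (gMprim1 ell (S M)) 0 (/ x) (S M).
Proof.
  intros Hx. unfold TM, cells. set (N := S M). pose proof (INR_S_ge_1 M) as HT. fold N in HT.
  assert (Hi : 0 < / x) by now apply Rinv_0_lt_compat.
  assert (HS : forall i, 0 < INR (S i)) by (intros i; pose proof (INR_S_ge_1 i); lra).
  set (Q := fun i j : nat => / (x * INR (S i) + INR (S j))).
  assert (E1 : rsum (fun i => rsum (fun j => / INR (S j) * (ln (x * INR (S i) / INR (S j)) /
      (1 + x * INR (S i) / INR (S j)))) N) N
    = rsum (fun i => (ln (INR (S i)) + ln x) * rsum (fun j => Q i j) N) N
      - rsum (fun i => rsum (fun j => ln (INR (S j)) * Q i j) N) N).
  { rewrite <- rsum_minus. apply rsum_ext. intros i _. rewrite <- rsum_scal, <- rsum_minus.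
    apply rsum_ext. intros j _. pose proof (HS i). pose proof (HS j).
    assert (0 < x * INR (S i)) by (apply Rmult_lt_0_compat; lra).
    rewrite ln_div, (ln_mult x) by lra. unfold Q. field. lra. }
  assert (E2 : rsum (fun i => (ln (INR (S i)) + ln x) * gM N (x * INR (S i))) N
    = rsum (fun i => (ln (INR (S i)) + ln x) * rsum (fun j => Q i j) N) N
      - rsum (fun i => (ln (INR (S i)) + ln x) * ln (1 + INR N * / x / INR (S i))) N).
  { rewrite <- rsum_minus. apply rsum_ext. intros i _. unfold gM. fold (Q i). pose proof (HS i).
    assert (0 < x * INR (S i)) by (apply Rmult_lt_0_compat; lra).
    replace (INR N * / x / INR (S i)) with (INR N / (x * INR (S i))) by (field; lra).
    rewrite ln_one_plus_div by lra. unfold Q. ring. }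
  assert (E3 : rsum (fun j => (ln (INR (S j)) + 0) * gM N (/ x * INR (S j))) N
    = x * rsum (fun i => rsum (fun j => ln (INR (S j)) * Q i j) N) N
      - rsum (fun j => ln (INR (S j)) * ln (1 + INR N * x / INR (S j))) N).
  { rewrite rsum_exchange, <- rsum_scal, <- rsum_minus. apply rsum_ext. intros j _. unfold gM. pose proof (HS j).
    assert (0 < / x * INR (S j)) by (apply Rmult_lt_0_compat; lra).
    replace (INR N * x / INR (S j)) with (INR N / (/ x * INR (S j))) by (field; lra).
    rewrite ln_one_plus_div by lra.
    rewrite rsum_scal, (rsum_ext (fun k => / (/ x * INR (S j) + INR (S k))) (fun i => x * Q i j)).
    - rewrite rsum_scal. ring.
    - intros i _. pose proof (HS i). unfold Q. field. nra. }
  rewrite E1, E2, E3. unfold gMprim1, gMprim0. rewrite !rsum_plus.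
  replace (INR N * x / INR N) with x by (field; lra).
  replace (INR N * / x / INR N) with (/ x) by (field; lra).
  rewrite (rsum_ext (fun i => ell (INR N / (x * INR (S i)))) (fun j => ell (INR N * / x / INR (S j)))).
  2:{ intros i _. pose proof (HS i). f_equal. field. lra. }
  rewrite (rsum_ext (fun i => (ln (INR (S i)) + ln x) * ln (1 + INR N * / x / INR (S i)))
    (fun i => ln (INR (S i)) * ln (1 + INR N * / x / INR (S i)) + ln x * ln (1 + INR N * / x / INR (S i))))
    by (intros; ring).
  rewrite rsum_plus, rsum_scal. unfold k0, k1.
  replace (1 + / x) with ((1 + x) / x) by (field; lra).
  rewrite ln_div, ln_Rinv by lra. field. lra.
Qed.

(** Going from [a = 0] to [a = 1] adds the unweighted sum, built on [1 / (x i + j)]. Exchanging the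
    indices turns this into [/ x] times the same expression at [/ x]. It is the truncated form of
    the reflection formula for unweighted digamma sums. *)
Lemma cells_symmetric (ell : R -> R) (x : R) (M : nat) : 0 < x ->
  let c := cells (gM (S M)) (gMprim0 (S M)) (gMprim1 ell (S M)) in
  c 1 x (S M) - c 0 x (S M) = / x * (c 1 (/ x) (S M) - c 0 (/ x) (S M)).
Proof.
  intros Hx c. unfold c, cells. set (N := S M). pose proof (INR_S_ge_1 M) as HT. fold N in HT.
  assert (Hi : 0 < / x) by now apply Rinv_0_lt_compat.
  assert (HS : forall i, 0 < INR (S i)) by (intros i; pose proof (INR_S_ge_1 i); lra).
  set (Q := fun i j : nat => / (x * INR (S i) + INR (S j))).
  assert (E0 : forall y, rsum (fun i => (ln (INR (S i)) + 1) * gM N (y * INR (S i))) N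
    = rsum (fun i => (ln (INR (S i)) + 0) * gM N (y * INR (S i))) N + rsum (fun i => gM N (y * INR (S i))) N).
  { intros y. rewrite <- rsum_plus. apply rsum_ext. intros; ring. }
  assert (E2 : rsum (fun i => gM N (x * INR (S i))) N
    = rsum (fun i => rsum (fun j => Q i j) N) N - rsum (fun i => ln (1 + INR N * / x / INR (S i))) N).
  { rewrite <- rsum_minus. apply rsum_ext. intros i _. unfold gM. fold (Q i). pose proof (HS i).
    assert (0 < x * INR (S i)) by (apply Rmult_lt_0_compat; lra).
    replace (INR N * / x / INR (S i)) with (INR N / (x * INR (S i))) by (field; lra).
    rewrite ln_one_plus_div by lra. unfold Q. ring. }
  assert (E3 : rsum (fun j => gM N (/ x * INR (S j))) N
    = x * rsum (fun i => rsum (fun j => Q i j) N) N - rsum (fun j => ln (1 + INR N * x / INR (S j))) N).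
  { rewrite rsum_exchange, <- rsum_scal, <- rsum_minus. apply rsum_ext. intros j _. unfold gM. pose proof (HS j).
    assert (0 < / x * INR (S j)) by (apply Rmult_lt_0_compat; lra).
    replace (INR N * x / INR (S j)) with (INR N / (/ x * INR (S j))) by (field; lra).
    rewrite ln_one_plus_div by lra.
    rewrite (rsum_ext (fun k => / (/ x * INR (S j) + INR (S k))) (fun i => x * Q i j)).
    - rewrite rsum_scal. ring.
    - intros i _. pose proof (HS i). unfold Q. field. nra. }
  rewrite !E0, E2, E3. unfold gMprim0.
  replace (INR N * x / INR N) with x by (field; lra).
  replace (INR N * / x / INR N) with (/ x) by (field; lra).
  unfold k0. replace (1 + / x) with ((1 + x) / x) by (field; lra).
  rewrite ln_div, ln_Rinv by lra. field. lra.
Qed.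

(** * Functions vanishing to the right of 0 *)

Definition vanishes_0 (f : R -> R) : Prop :=
  forall eta, 0 < eta -> exists d, 0 < d /\ forall y, 0 < y < d -> Rabs (f y) < eta.

Lemma vanishes_plus (f g : R -> R) : vanishes_0 f -> vanishes_0 g -> vanishes_0 (fun y => f y + g y).
Proof.
  intros Hf Hg eta He. destruct (Hf (eta / 2) ltac:(lra)) as [d1 [H1 H1']].
  destruct (Hg (eta / 2) ltac:(lra)) as [d2 [H2 H2']].
  exists (Rmin d1 d2). split; [now apply Rmin_pos|]. intros y Hy.
  pose proof (Rmin_l d1 d2). pose proof (Rmin_r d1 d2).
  specialize (H1' y ltac:(lra)). specialize (H2' y ltac:(lra)).
  eapply Rle_lt_trans; [apply Rabs_triang|]. lra.
Qed.

Lemma vanishes_scal (k : R) (f : R -> R) : vanishes_0 f -> vanishes_0 (fun y => k * f y).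
Proof.
  intros Hf eta He. pose proof (Rabs_pos k).
  destruct (Hf (eta / (Rabs k + 1)) ltac:(apply Rdiv_lt_0_compat; lra)) as [d [H1 H2]].
  exists d. split; auto. intros y Hy. specialize (H2 y Hy). rewrite Rabs_mult.
  pose proof (Rabs_pos (f y)).
  apply Rle_lt_trans with ((Rabs k + 1) * Rabs (f y)); [apply Rmult_le_compat_r; lra|].
  apply (Rmult_lt_compat_l (Rabs k + 1)) in H2; [|lra].
  replace ((Rabs k + 1) * (eta / (Rabs k + 1))) with eta in H2 by (field; lra). exact H2.
Qed.

Lemma vanishes_ext (f g : R -> R) : (forall y, f y = g y) -> vanishes_0 f -> vanishes_0 g.
Proof.
  intros H Hf eta He. destruct (Hf eta He) as [d [H1 H2]]. exists d. split; auto.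
  intros y Hy. rewrite <- H. auto.
Qed.

Lemma vanishes_minus (f g : R -> R) : vanishes_0 f -> vanishes_0 g -> vanishes_0 (fun y => f y - g y).
Proof.
  intros Hf Hg. apply (vanishes_ext (fun y => f y + -1 * g y)); [intros; ring|].
  now apply vanishes_plus, vanishes_scal.
Qed.

Lemma vanishes_dilate (c : R) (f : R -> R) : 0 < c -> vanishes_0 f -> vanishes_0 (fun y => f (y * c)).
Proof.
  intros Hc Hf eta He. destruct (Hf eta He) as [d [H1 H2]]. exists (d / c).
  split; [now apply Rdiv_lt_0_compat|]. intros y Hy. apply H2. split; [nra|].
  apply Rmult_lt_reg_r with (/ c); [now apply Rinv_0_lt_compat|].
  rewrite Rmult_assoc, Rinv_r, Rmult_1_r by lra. apply Hy.
Qed.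

Lemma vanishes_rsum (f : nat -> R -> R) (N : nat) :
  (forall k, vanishes_0 (f k)) -> vanishes_0 (fun y => rsum (fun k => f k y) N).
Proof.
  intros Hf. induction N as [|N IH].
  - intros eta He. exists 1. split; [lra|]. intros. simpl. now rewrite Rabs_R0.
  - cbn [rsum]. now apply vanishes_plus.
Qed.

Lemma vanishes_power (f : R -> R) (K q : R) : 0 < q ->
  (forall y, 0 < y <= 1 -> Rabs (f y) <= K * Rpower y q) -> vanishes_0 f.
Proof.
  intros Hq Hf eta He.
  assert (HK : 0 <= K).
  { specialize (Hf 1 ltac:(lra)). unfold Rpower in Hf. rewrite ln_1, Rmult_0_r, exp_0 in Hf.
    pose proof (Rabs_pos (f 1)). lra. }
  set (d := exp (ln (eta / (K + 1)) / q)).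
  assert (Hek : 0 < eta / (K + 1)) by (apply Rdiv_lt_0_compat; lra).
  exists (Rmin 1 d). split; [apply Rmin_pos; [lra | apply exp_pos]|]. intros y Hy.
  pose proof (Rmin_l 1 d). pose proof (Rmin_r 1 d).
  eapply Rle_lt_trans; [apply Hf; lra|].
  assert (H1 : Rpower y q < eta / (K + 1)).
  { unfold Rpower. rewrite <- (exp_ln (eta / (K + 1))) by auto. apply exp_increasing.
    assert (ln y < ln (eta / (K + 1)) / q).
    { rewrite <- (ln_exp (ln (eta / (K + 1)) / q)). apply ln_increasing; [lra|]. fold d. lra. }
    apply (Rmult_lt_compat_l q) in H1; auto.
    replace (q * (ln (eta / (K + 1)) / q)) with (ln (eta / (K + 1))) in H1 by (field; lra). exact H1. }
  assert (0 < Rpower y q) by apply exp_pos.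
  apply Rle_lt_trans with ((K + 1) * Rpower y q); [nra|].
  apply (Rmult_lt_compat_l (K + 1)) in H1; [|lra].
  replace ((K + 1) * (eta / (K + 1))) with eta in H1 by (field; lra). exact H1.
Qed.

Lemma neg_ln_le (z k : R) : 0 < z -> 0 < k -> - ln z <= / k * Rpower z (- k).
Proof.
  intros Hz Hk. unfold Rpower. pose proof (exp_ineq1_le (- k * ln z)) as H.
  apply Rmult_le_reg_l with k; auto. rewrite <- Rmult_assoc, Rinv_r, Rmult_1_l by lra. lra.
Qed.

Lemma vanishes_id : vanishes_0 (fun y => y).
Proof.
  intros eta He. exists eta. split; auto. intros y Hy. rewrite Rabs_pos_eq; lra.
Qed.

Lemma vanishes_le (f g : R -> R) :
  (forall y, 0 < y <= 1 -> Rabs (f y) <= Rabs (g y)) -> vanishes_0 g -> vanishes_0 f.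
Proof.
  intros H Hg eta He. destruct (Hg eta He) as [d [H1 H2]]. exists (Rmin 1 d).
  split; [apply Rmin_pos; lra|]. intros y Hy. pose proof (Rmin_l 1 d). pose proof (Rmin_r 1 d).
  eapply Rle_lt_trans; [apply H; lra | apply H2; lra].
Qed.

Lemma ln_nonpos (z : R) : 0 < z <= 1 -> ln z <= 0.
Proof. intros Hz. rewrite <- ln_1. apply ln_le_compat. lra. Qed.

Lemma vanishes_x_ln2 : vanishes_0 (fun z => z * ln z ^ 2).
Proof.
  apply (vanishes_power _ 16 (1 / 2)); [lra|]. intros z Hz.
  (* [- ln z <= 4 z ^ (- 1 / 4)]; its square costs [z ^ (1 / 2)] and leaves [16 z ^ (1 / 2)]. *)
  pose proof (neg_ln_le z (1 / 4) ltac:(lra) ltac:(lra)) as H. pose proof (ln_nonpos z Hz).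
  rewrite Rabs_pos_eq by (apply Rmult_le_pos; [lra | apply pow2_ge_0]).
  assert (H1 : ln z ^ 2 <= (4 * Rpower z (- (1 / 4))) ^ 2).
  { replace (ln z ^ 2) with ((- ln z) ^ 2) by ring. apply pow_incr. split; [lra|].
    replace (/ (1 / 4)) with 4 in H by field. exact H. }
  apply Rle_trans with (z * (4 * Rpower z (- (1 / 4))) ^ 2); [apply Rmult_le_compat_l; lra|].
  right. replace (z * (4 * Rpower z (- (1 / 4))) ^ 2) with (16 * (z * (Rpower z (- (1 / 4)) * Rpower z (- (1 / 4))))) by ring.
  rewrite <- Rpower_plus. rewrite <- (Rpower_1 z) at 1 by lra. rewrite <- Rpower_plus. f_equal. f_equal. field.
Qed.

Lemma vanishes_x_ln : vanishes_0 (fun z => z * ln z).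
Proof.
  apply (vanishes_power _ 2 (1 / 2)); [lra|]. intros z Hz.
  pose proof (neg_ln_le z (1 / 2) ltac:(lra) ltac:(lra)) as H. pose proof (ln_nonpos z Hz).
  replace (/ (1 / 2)) with 2 in H by field.
  rewrite Rabs_left1 by nra.
  apply Rle_trans with (z * (2 * Rpower z (- (1 / 2)))); [nra|].
  right. replace (z * (2 * Rpower z (- (1 / 2)))) with (2 * (z * Rpower z (- (1 / 2)))) by ring.
  rewrite <- (Rpower_1 z) at 1 by lra. rewrite <- Rpower_plus. f_equal. f_equal. field.
Qed.

Lemma ln_1p_abs (z : R) : 0 <= z -> Rabs (ln (1 + z)) <= z.
Proof.
  intros Hz. destruct (ln_1p_bounds z ltac:(lra)) as [_ H]. rewrite Rabs_pos_eq; auto.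
  apply ln_ge_0. lra.
Qed.

Lemma vanishes_ln_1p : vanishes_0 (fun z => ln (1 + z)).
Proof.
  apply (vanishes_le _ (fun y => y)); [|apply vanishes_id]. intros y Hy.
  rewrite (Rabs_pos_eq y) by lra. apply ln_1p_abs. lra.
Qed.

Lemma vanishes_1p_ln_1p : vanishes_0 (fun z => (1 + z) * ln (1 + z)).
Proof.
  apply (vanishes_le _ (fun y => 2 * y)); [|apply vanishes_scal, vanishes_id]. intros y Hy.
  rewrite (Rabs_pos_eq (2 * y)), Rabs_mult, (Rabs_pos_eq (1 + y)) by lra.
  pose proof (ln_1p_abs y ltac:(lra)). pose proof (Rabs_pos (ln (1 + y))). nra.
Qed.

Lemma vanishes_k0 : vanishes_0 k0.
Proof. apply vanishes_minus; [apply vanishes_1p_ln_1p | apply vanishes_x_ln]. Qed.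

Lemma vanishes_k1 (ell : R -> R) : vanishes_0 ell -> vanishes_0 (k1 ell).
Proof.
  intros Hl. apply vanishes_plus; auto. apply vanishes_minus; [|apply vanishes_x_ln2].
  apply vanishes_plus; [|apply vanishes_x_ln]. apply vanishes_minus; [|apply vanishes_1p_ln_1p].
  apply (vanishes_le _ (fun z => z * ln z)); [|apply vanishes_x_ln]. intros y Hy.
  rewrite Rabs_mult. pose proof (ln_1p_abs y ltac:(lra)). pose proof (Rabs_pos (y * ln y)).
  pose proof (Rabs_pos (ln (1 + y))). nra.
Qed.

Lemma vanishes_gMprim0 (N : nat) : (0 < N)%nat -> vanishes_0 (gMprim0 N).
Proof.
  intros HN. assert (HT : 0 < / INR N) by (apply Rinv_0_lt_compat; now apply lt_0_INR).
  unfold gMprim0. apply vanishes_minus.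
  - apply (vanishes_rsum (fun j y => ln (1 + y / INR (S j)))). intros k. pose proof (INR_S_ge_1 k).
    apply (vanishes_dilate (/ INR (S k)) (fun z => ln (1 + z))); [apply Rinv_0_lt_compat; lra | apply vanishes_ln_1p].
  - apply vanishes_scal. apply (vanishes_dilate (/ INR N) k0 HT), vanishes_k0.
Qed.

Lemma vanishes_gMprim1 (ell : R -> R) (N : nat) : vanishes_0 ell -> (0 < N)%nat -> vanishes_0 (gMprim1 ell N).
Proof.
  intros Hl HN. assert (HT : 0 < / INR N) by (apply Rinv_0_lt_compat; now apply lt_0_INR).
  unfold gMprim1. apply vanishes_minus.
  - apply (vanishes_rsum (fun j y => ell (y / INR (S j)) + ln (INR (S j)) * ln (1 + y / INR (S j)))).
    intros k. pose proof (INR_S_ge_1 k).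
    assert (Hk : 0 < / INR (S k)) by (apply Rinv_0_lt_compat; lra).
    apply vanishes_plus; [now apply (vanishes_dilate (/ INR (S k)) ell)|].
    apply vanishes_scal, (vanishes_dilate (/ INR (S k)) (fun z => ln (1 + z)) Hk), vanishes_ln_1p.
  - apply vanishes_scal, vanishes_plus.
    + apply vanishes_scal, (vanishes_dilate (/ INR N) k0 HT), vanishes_k0.
    + apply (vanishes_dilate (/ INR N) (k1 ell) HT), vanishes_k1, Hl.
Qed.

(** Monotonicity with the initial value replaced by a limit at 0, since the logarithmic functions to
    which it is applied are not differentiable there. *)
Lemma nondecreasing_from_0 (f df : R -> R) (u : R) : vanishes_0 f -> 0 < u ->
  (forall t, 0 < t <= u -> is_derive f t (df t)) -> (forall t, 0 < t <= u -> 0 <= df t) -> 0 <= f u.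
Proof.
  intros Hv Hu Hd Hp. apply Rnot_lt_le. intros Hn.
  destruct (Hv (- f u) ltac:(lra)) as [d [Hd0 Hd1]].
  set (w := Rmin (d / 2) u). assert (Hw : 0 < w) by (apply Rmin_pos; lra).
  pose proof (Rmin_l (d / 2) u) as H1. pose proof (Rmin_r (d / 2) u) as H2. fold w in H1, H2.
  specialize (Hd1 w ltac:(lra)). apply Rabs_def2 in Hd1.
  destruct (mean_value_on f df w u H2) as [c [Hc E]]; [intros; apply Hd; lra|].
  specialize (Hp c ltac:(lra)). assert (0 <= df c * (u - w)) by (apply Rmult_le_pos; lra). lra.
Qed.

(* Euler-Maclaurin of order 0: the shifted [gdig] is monotone and at most [1 / T] in size. *)
Lemma shifted_cells_bound (B : R -> R) (x a : R) (N : nat) : 0 < x -> (0 < N)%nat ->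
  vanishes_0 B ->
  (forall u, 0 < u -> is_derive B u ((ln u + a) * gdig (u * x + INR N))) ->
  Rabs (rsum (fun i => (ln (INR (S i)) + a) * gdig (x * INR (S i) + INR N)) N - B (INR N))
    <= (3 * Rabs a + 1) * logtail (INR N).
Proof.
  intros Hx HN HB Hd. set (T := INR N) in *.
  assert (HT : 1 <= T) by (apply (le_INR 1); lia).
  pose proof (Rabs_pos a) as Ha. pose proof (Rle_abs a) as Ha1. pose proof (Rle_abs (- a)) as Ha2.
  rewrite Rabs_Ropp in Ha2. pose proof (ln_ge_0 T HT) as HlT.
  assert (HiT : 0 < / T) by (apply Rinv_0_lt_compat; lra).
  set (h := fun u => gdig (u * x + T)).
  assert (Hh : forall u, 0 < u -> - / T <= h u <= 0).
  { intros u Hu. assert (0 < u * x) by nra. destruct (gdig_bounds (u * x + T) ltac:(lra)) as [H1 H2].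
    split; [|exact H2]. assert (/ (u * x + T) <= / T) by (apply Rinv_le_contravar; lra). unfold h. lra. }
  assert (Hm : forall u v, 0 < u <= v -> h u <= h v).
  { intros u v Huv. apply gdig_mono. assert (0 < u * x) by nra. assert (u * x <= v * x) by nra. lra. }
  assert (H1 : Rabs (B 1) <= (Rabs a + 1) * / T).
  { assert (Hs : forall s, (s = 1 \/ s = -1) -> 0 <= / T * ((Rabs a + 1) * 1 - 1 * ln 1) + s * B 1).
    { intros s Hs. apply (nondecreasing_from_0 (fun u => / T * ((Rabs a + 1) * u - u * ln u) + s * B u)
        (fun u => / T * (Rabs a - ln u) + s * ((ln u + a) * h u)) 1); [| lra | |].
      - apply vanishes_plus; [|now apply vanishes_scal]. apply vanishes_scal, vanishes_minus.
        + apply vanishes_scal, vanishes_id.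
        + apply vanishes_x_ln.
      - intros t Ht. apply (is_derive_plus (V := RN) (fun u => / T * ((Rabs a + 1) * u - u * ln u))
          (fun u => s * B u)).
        + auto_derive; [lra|]. field. lra.
        + apply (is_derive_scal B). apply Hd. lra.
      - intros t Ht. pose proof (ln_nonpos t Ht). specialize (Hh t ltac:(lra)).
        assert (Rabs ((ln t + a) * h t) <= (Rabs a - ln t) * / T).
        { rewrite Rabs_mult. apply Rmult_le_compat; try apply Rabs_pos.
          - apply Rabs_le. lra.
          - apply Rabs_le. lra. }
        apply Rabs_le_between in H0. destruct Hs as [-> | ->]; lra. }
    pose proof (Hs 1 ltac:(auto)) as E1. pose proof (Hs (-1) ltac:(auto)) as E2.
    rewrite ln_1 in E1, E2. apply Rabs_le. lra. }
  assert (HP : forall P, (S P <= N)%nat ->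
    Rabs (rsum (fun i => (ln (INR (S i)) + a) * h (INR (S i))) (S P) - B (INR (S P)))
      <= (2 * Rabs a + 1) * / T + (ln T + Rabs a) * (h (INR (S P)) - h 1) + ln (INR (S P)) * / T).
  { induction P as [|P IH]; intros HPN.
    - cbn [rsum]. change (INR 1) with 1. rewrite ln_1.
      replace (0 + (0 + a) * h 1 - B 1) with (a * h 1 - B 1) by ring.
      eapply Rle_trans; [apply Rabs_triang|]. rewrite Rabs_Ropp, Rabs_mult.
      specialize (Hh 1 Rlt_0_1). assert (Rabs (h 1) <= / T) by (apply Rabs_le; lra).
      assert (Rabs a * Rabs (h 1) <= Rabs a * / T) by (apply Rmult_le_compat_l; lra). lra.
    - specialize (IH ltac:(lia)). rewrite (S_INR (S P)).
      change (rsum (fun i => (ln (INR (S i)) + a) * h (INR (S i))) (S (S P))) with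
        (rsum (fun i => (ln (INR (S i)) + a) * h (INR (S i))) (S P) + (ln (INR (S (S P))) + a) * h (INR (S (S P)))).
      rewrite (S_INR (S P)). pose proof (INR_S_ge_1 P) as Hn.
      assert (HnT : INR (S P) + 1 <= T) by (rewrite <- S_INR; now apply le_INR).
      set (n := INR (S P)) in *.
      destruct (mean_value_on B (fun u => (ln u + a) * h u) n (n + 1)) as [c [Hc E]];
        [lra | intros; apply Hd; lra |].
      replace (n + 1 - n) with 1 in E by ring. rewrite Rmult_1_r in E.
      set (S0 := rsum (fun i => (ln (INR (S i)) + a) * h (INR (S i))) (S P)) in *.
      replace (S0 + (ln (n + 1) + a) * h (n + 1) - B (n + 1))
        with ((S0 - B n) + ((ln (n + 1) + a) * (h (n + 1) - h c) + (ln (n + 1) - ln c) * h c)) by lra.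
      pose proof (ln_le_compat n c ltac:(lra)) as L1. pose proof (ln_le_compat c (n + 1) ltac:(lra)) as L2.
      pose proof (ln_le_compat (n + 1) T ltac:(lra)) as L3. pose proof (ln_ge_0 n Hn).
      pose proof (Hm n c ltac:(lra)) as M1. pose proof (Hm c (n + 1) ltac:(lra)) as M2.
      specialize (Hh c ltac:(lra)).
      assert (R1 : Rabs ((ln (n + 1) + a) * (h (n + 1) - h c)) <= (ln T + Rabs a) * (h (n + 1) - h n)).
      { rewrite Rabs_mult. apply Rmult_le_compat; try apply Rabs_pos.
        - apply Rabs_le. lra.
        - rewrite Rabs_pos_eq; lra. }
      assert (R2 : Rabs ((ln (n + 1) - ln c) * h c) <= (ln (n + 1) - ln n) * / T).
      { rewrite Rabs_mult. apply Rmult_le_compat; try apply Rabs_pos; [rewrite Rabs_pos_eq; lra | apply Rabs_le; lra]. }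
      eapply Rle_trans; [apply Rabs_triang|].
      eapply Rle_trans; [apply Rplus_le_compat_l, Rabs_triang|]. lra. }
  destruct N as [|M]; [lia|]. specialize (HP M (le_n _)).
  replace (INR (S M)) with T in HP by reflexivity.
  rewrite (rsum_ext _ (fun i => (ln (INR (S i)) + a) * h (INR (S i)))).
  2:{ intros i _. unfold h. do 2 f_equal. ring. }
  eapply Rle_trans; [exact HP|].
  pose proof (Hh T ltac:(lra)). pose proof (Hh 1 Rlt_0_1).
  assert (R3 : (ln T + Rabs a) * (h T - h 1) <= (ln T + Rabs a) * / T) by (apply Rmult_le_compat_l; lra).
  apply Rle_trans with ((3 * Rabs a + 1 + 2 * ln T) * / T); [lra|].
  unfold logtail, Rdiv. rewrite <- Rmult_assoc. apply Rmult_le_compat_r; [lra|].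
  pose proof (pow2_ge_0 (ln T)). nra.
Qed.

(** By [gM_eq] the difference is again a sum minus an integral, now for the function [gdig (y + N)],
    whose primitive [D] vanishes at 0. [shifted_cells_bound] makes it of order [ln N ^ 2 / N]. *)
Lemma cells_gM_close (ell G0 G1 : R -> R) (a x : R) : 0 < x ->
  (forall y, 0 < y -> is_derive ell y (ln y / (1 + y))) -> vanishes_0 ell ->
  (forall y, 0 < y -> is_derive G0 y (gdig y)) -> vanishes_0 G0 ->
  (forall y, 0 < y -> is_derive G1 y (ln y * gdig y)) -> vanishes_0 G1 ->
  is_lim_seq (fun M => cells gdig G0 G1 a x (S M)
    - cells (gM (S M)) (gMprim0 (S M)) (gMprim1 ell (S M)) a x (S M)) 0.
Proof.
  intros Hx Hell Vell HG0 V0 HG1 V1.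
  apply (is_lim_seq_le_0 _ (fun M => (3 * Rabs a + 1) * logtail (INR (S M)))).
  2:{ replace (Finite 0) with (Rbar_mult (3 * Rabs a + 1) 0) by (simpl; f_equal; ring).
      apply is_lim_seq_scal_l, logtail_lim. }
  intros M. rewrite Rminus_0_r. set (N := S M). assert (HN : (0 < N)%nat) by (unfold N; lia).
  set (D := fun y => (G1 y - gMprim1 ell N y) + (a - ln x) * (G0 y - gMprim0 N y)).
  assert (HT : 0 < INR N) by now apply lt_0_INR.
  replace (cells gdig G0 G1 a x N - cells (gM N) (gMprim0 N) (gMprim1 ell N) a x N)
    with (rsum (fun i => (ln (INR (S i)) + a) * gdig (x * INR (S i) + INR N)) N - / x * D (INR N * x)).
  - apply (shifted_cells_bound (fun u => / x * D (u * x)) x a N Hx HN).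
    + apply vanishes_scal, (vanishes_dilate x D Hx). unfold D.
      apply vanishes_plus; [|apply vanishes_scal]; apply vanishes_minus; auto.
      * now apply vanishes_gMprim1.
      * now apply vanishes_gMprim0.
    + intros u Hu. assert (Hux : 0 < u * x) by nra.
      assert (HD : is_derive D (u * x) ((ln (u * x) * gdig (u * x) - ln (u * x) * gM N (u * x))
        + (a - ln x) * (gdig (u * x) - gM N (u * x)))).
      { unfold D. apply (is_derive_plus (V := RN) (fun y => G1 y - gMprim1 ell N y)
          (fun y => (a - ln x) * (G0 y - gMprim0 N y))).
        - apply (is_derive_minus (V := RN) G1 (gMprim1 ell N)); [now apply HG1|].
          now apply is_derive_gMprim1.
        - apply (is_derive_scal (fun y => G0 y - gMprim0 N y)).
          apply (is_derive_minus (V := RN) G0 (gMprim0 N)); [now apply HG0|].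
          now apply is_derive_gMprim0. }
      eapply is_derive_R_eq.
      * apply (is_derive_scal (fun u => D (u * x))).
        apply (is_derive_comp (V := RN) D (fun u => u * x)); [exact HD|].
        auto_derive; auto.
      * rewrite gM_eq, ln_mult by lra. unfold scal; simpl; unfold mult; simpl. field. lra.
  - unfold cells, D.
    rewrite (rsum_ext _ (fun i => (ln (INR (S i)) + a) * gdig (x * INR (S i)) - (ln (INR (S i)) + a) * gM N (x * INR (S i)))).
    + rewrite rsum_minus. ring.
    + intros i _. pose proof (INR_S_ge_1 i). rewrite gM_eq; [ring|]. apply Rmult_lt_0_compat; lra.
Qed.

(** * Limits of the cells and the final relation *)

Lemma Vd_sum_converges (x : R) (w : nat -> R) : 0 < x ->
  (forall k, Rabs (w k) <= (1 + ln (INR (S k))) ^ 2) ->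
  exists l : R, is_lim_seq (rsum (fun k => w k * Vd (x * INR (S k)))) l.
Proof.
  intros Hx Hw.
  destruct (rsum_telescope_conv (fun k => w k * Vd (x * INR (S k)))
    (fun k => 4 * (/ (12 * x ^ 2)) * logtail (INR (S k)))) as [l [Hl _]].
  - intros k. pose proof (INR_S_ge_1 k) as Hn.
    assert (Hc : 0 < / (12 * x ^ 2)) by (apply Rinv_0_lt_compat; nra).
    rewrite (S_INR (S k)). specialize (Hw k). set (n := INR (S k)) in *.
    destruct (mean_value_on logtail (fun u => - ((1 + ln u) / u) ^ 2) n (n + 1)) as [g [Hg Eg]];
      [lra | intros; apply is_derive_logtail; lra |].
    replace (4 * / (12 * x ^ 2) * logtail n - 4 * / (12 * x ^ 2) * logtail (n + 1))
      with (- (4 * / (12 * x ^ 2) * (logtail (n + 1) - logtail n))) by ring.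
    rewrite Eg. replace (n + 1 - n) with 1 by ring. rewrite Rabs_mult.
    assert (Hxn : 0 < x * n) by nra.
    destruct (Vd_bounds (x * n) Hxn) as [V1 V2]. rewrite (Rabs_pos_eq (Vd _)) by auto.
    pose proof (ln_ge_0 n Hn).
    assert (H1 : (1 + ln n) ^ 2 * / n ^ 2 <= 4 * ((1 + ln g) / g) ^ 2).
    { pose proof (log_ratio_cell n n g ltac:(lra) ltac:(lra)) as H2.
      replace ((1 + ln n) ^ 2 * / n ^ 2) with (((1 + ln n) * / n) ^ 2) by (field; lra).
      replace (4 * ((1 + ln g) / g) ^ 2) with ((2 * ((1 + ln g) / g)) ^ 2) by ring.
      apply pow_incr. split; auto. apply Rmult_le_pos; [lra | left; apply Rinv_0_lt_compat; lra]. }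
    apply Rle_trans with ((1 + ln n) ^ 2 * / (12 * (x * n) ^ 2)).
    + apply Rmult_le_compat; auto; apply Rabs_pos.
    + replace ((1 + ln n) ^ 2 * / (12 * (x * n) ^ 2)) with (/ (12 * x ^ 2) * ((1 + ln n) ^ 2 * / n ^ 2)) by (field; lra).
      apply (Rmult_le_compat_l (/ (12 * x ^ 2))) in H1; lra.
  - replace (Finite 0) with (Rbar_mult (4 * / (12 * x ^ 2)) 0) by (simpl; f_equal; ring).
    apply is_lim_seq_scal_l, logtail_lim.
  - now exists l.
Qed.

(** [ln (n * sqrt x) = ln n + ln x / 2] separates a weighted and an unweighted sum of [Vd], which is
    the negative of the digamma term. *)
Lemma phi_log_eq (x sv sl : R) : 0 < x ->
  is_lim_seq (rsum (fun k => 1 * Vd (x * INR (S k)))) sv ->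
  is_lim_seq (rsum (fun k => ln (INR (S k)) * Vd (x * INR (S k)))) sl ->
  phi_log x = - (sl + ln x / 2 * sv).
Proof.
  intros Hx Hv Hl. unfold phi_log, Series.
  pose proof (is_lim_seq_plus' _ _ _ _ Hl (is_lim_seq_scal_l _ (ln x / 2) _ Hv)) as H.
  apply (is_lim_seq_scal_l _ (-1)) in H. simpl Rbar_mult in H.
  apply is_lim_seq_incr_1 in H.
  rewrite (is_lim_seq_unique _ (Finite (-1 * (sl + ln x / 2 * sv)))).
  - simpl. ring.
  - eapply is_lim_seq_ext; [|exact H]. intros N. cbv beta.
    rewrite sum_n_rsum, <- rsum_scal, <- rsum_plus, <- rsum_scal. apply rsum_ext. intros k _.
    pose proof (INR_S_ge_1 k). cbv beta zeta. unfold Vd, gdig.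
    rewrite (ln_mult (INR (S k)) (sqrt x)) by (try apply sqrt_lt_R0; lra).
    replace (ln (sqrt x)) with (ln x / 2).
    2:{ rewrite <- (sqrt_sqrt x) at 1 by lra. rewrite ln_mult by (apply sqrt_lt_R0; lra). field. }
    rewrite (Rmult_comm x (INR (S k))). field. split; lra.
Qed.

(** With [gdig y = Vd y - 1 / (2 y)] the [Vd] part converges to [sl + a * sv]. The sums of
    [ln n / n] and [1 / n] diverge like powers of [ln N], and the same powers come out of the
    primitives when [kk] is replaced by [hh - 1 / 2]; gamma, [g1] and the moments are the finite
    parts. *)
Lemma cells_gdig_limit (c0 c1 d0 d1 g1 a x sv sl : R) : 0 < x ->
  is_RInt_H hh d0 -> is_RInt_H (fun t => t * hh t) d1 ->
  is_lim_seq (fun N => rsum (fun k => ln (INR (S k)) / INR (S k)) N - ln (INR (S N)) ^ 2 / 2) g1 ->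
  is_lim_seq (rsum (fun k => 1 * Vd (x * INR (S k)))) sv ->
  is_lim_seq (rsum (fun k => ln (INR (S k)) * Vd (x * INR (S k)))) sl ->
  is_lim_seq (fun M => cells gdig (log_prim kk c0) (log_prim (fun v => v * kk v) (- c1)) a x (S M))
    (sl + a * sv - / x * (g1 / 2 + (d1 - c1) + a * euler_gamma / 2 + (a - ln x) * (c0 + d0)
      + ln x ^ 2 / 4 - a * ln x / 2)).
Proof.
  intros Hx Hd0 Hd1 Hg1 Hsv Hsl.
  assert (Hg : is_lim_seq (fun M => rsum (fun k => ln (INR (S k)) / INR (S k)) (S M) - ln (INR (S M)) ^ 2 / 2) g1).
  { assert (Hz : is_lim_seq (fun M => ln (INR (S M)) / INR (S M)) 0).
    { apply (is_lim_seq_le_0 _ (fun k => logtail (INR (S k)))); [|apply logtail_lim].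
      intros k. rewrite Rminus_0_r. pose proof (INR_S_ge_1 k) as Hn. pose proof (ln_ge_0 _ Hn).
      rewrite Rabs_pos_eq by (apply Rdiv_le_0_compat; lra). unfold logtail, Rdiv.
      apply Rmult_le_compat_r; [left; apply Rinv_0_lt_compat; lra | pose proof (pow2_ge_0 (ln (INR (S k)))); lra]. }
    pose proof (is_lim_seq_plus' _ _ _ _ Hg1 Hz) as H. rewrite Rplus_0_r in H.
    eapply is_lim_seq_ext; [|exact H]. intros M. cbn [rsum]. ring. }
  assert (He : is_lim_seq (fun M => rsum (fun k => / INR (S k)) (S M) - ln (INR (S M))) euler_gamma).
  { pose proof (is_lim_seq_plus' _ _ _ _ euler_gamma_lim (is_lim_seq_inv_add 1)) as H. rewrite Rplus_0_r in H.
    eapply is_lim_seq_ext; [|exact H]. intros M. cbn [rsum]. rewrite S_INR.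
    replace (1 + INR M) with (INR M + 1) by ring. ring. }
  assert (HI0 : is_lim_seq (fun M => RInt hh 0 (ln (INR (S M) * x))) d0)
    by (apply is_RInt_H_lim; [exact Hd0 | now apply ln_nat_mul_lim]).
  assert (HI1 : is_lim_seq (fun M => RInt (fun v => v * hh v) 0 (ln (INR (S M) * x))) d1)
    by (apply (is_RInt_H_lim (fun v => v * hh v)); [exact Hd1 | now apply ln_nat_mul_lim]).
  apply is_lim_seq_incr_1 in Hsv. apply is_lim_seq_incr_1 in Hsl.
  pose proof (is_lim_seq_plus' _ _ _ _ Hsl (is_lim_seq_scal_l _ a _ Hsv)) as L1.
  pose proof (is_lim_seq_plus' _ _ _ _ (is_lim_seq_scal_l _ (/ 2) _ Hg) (is_lim_seq_scal_l _ (a / 2) _ He)) as L2.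
  pose proof (is_lim_seq_plus' _ _ _ _ HI1 (is_lim_seq_scal_l _ (a - ln x) _ HI0)) as L3.
  pose proof (is_lim_seq_plus' _ _ _ _ L2 L3) as L4.
  pose proof (is_lim_seq_minus' _ _ _ _ L1 (is_lim_seq_scal_l _ (/ x) _
    (is_lim_seq_plus' _ _ _ _ L4 (is_lim_seq_const (- c1 + (a - ln x) * c0 + ln x ^ 2 / 4 - a * ln x / 2))))) as L5.
  simpl Rbar_mult in L5.
  match type of L5 with is_lim_seq _ (Finite ?l) => match goal with |- is_lim_seq _ (Finite ?r) =>
    replace r with l by (field; lra) end end.
  eapply is_lim_seq_ext; [|exact L5]. intros M. cbv beta. unfold cells, log_prim.
  rewrite RInt_kk_hh, RInt_id_kk_hh. set (N := S M).
  rewrite (rsum_ext (fun i => (ln (INR (S i)) + a) * gdig (x * INR (S i)))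
    (fun i => (ln (INR (S i)) * Vd (x * INR (S i)) + a * (1 * Vd (x * INR (S i))))
      - / (2 * x) * (ln (INR (S i)) / INR (S i) + a * / INR (S i)))).
  - rewrite rsum_minus, rsum_plus, !rsum_scal, rsum_plus, rsum_scal.
    assert (HT : 0 < INR N) by (apply lt_0_INR; unfold N; lia).
    rewrite (ln_mult (INR N) x) by lra. field. lra.
  - intros i _. pose proof (INR_S_ge_1 i). unfold Vd. field. split; lra.
Qed.

(** Two relations are combined: [ET] from the weighted cells, with [a = ln x] at [x] and [a = 0] at
    [1 / x], and [EA] from the difference of [a = 1] and [a = 0]. The first carries the whole of
    [ln x] on [sv] and nothing on [sv'], while [phi_log] distributes it evenly with opposite signs;
    the second trades the excess. *)
Theorem TM_limit (ell : R -> R) (x tau : R) : 0 < x ->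
  (forall y, 0 < y -> is_derive ell y (ln y / (1 + y))) -> vanishes_0 ell ->
  is_lim_seq (TM ell x) tau ->
  let rho := fun x => phi_log x - / (48 * x) * (12 * euler_gamma ^ 2 - 5 * PI ^ 2)
    + / (4 * x) * (euler_gamma * ln x + ln (2 * PI) * ln (2 * PI * x)) in
  tau = - (rho x - / x * rho (/ x)).
Proof.
  intros Hx Hell Vell Htau rho.
  assert (Hy : 0 < / x) by now apply Rinv_0_lt_compat.
  assert (Hkc : forall t, continuous (fun t => kk (- t)) t) by (intros; apply continuous_opp_arg, continuous_kk).
  destruct (moment_ex (fun t => kk (- t)) 2 Hkc kk_left_decay) as (c0 & c1 & Hc0 & Hc1).
  destruct (moment_ex hh 2 continuous_hh hh_right_decay) as (d0 & d1 & Hd0 & Hd1).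
  destruct stieltjes_constant as [g1 Hg1].
  destruct (moment_constants c0 c1 d0 d1 g1 Hc0 Hc1 Hd0 Hd1 Hg1) as [ES EC].
  set (G0 := log_prim kk c0). set (G1 := log_prim (fun v => v * kk v) (- c1)).
  assert (HG0 : forall y, 0 < y -> is_derive G0 y (gdig y)).
  { intros y Hy'. eapply is_derive_R_eq; [apply is_derive_log_prim; auto; apply continuous_kk|].
    unfold kk. rewrite exp_ln by auto. field. lra. }
  assert (HG1 : forall y, 0 < y -> is_derive G1 y (ln y * gdig y)).
  { intros y Hy'. eapply is_derive_R_eq.
    - apply is_derive_log_prim; auto. intros t. apply continuous_id_mul, continuous_kk.
    - cbv beta. unfold kk. rewrite exp_ln by auto. field. lra. }
  assert (V0 : vanishes_0 G0).
  { apply (vanishes_power _ (2 / (1 / 2)) (1 / 2)); [lra|]. intros y Hy'.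
    apply log_prim_small; auto; [lra | apply continuous_kk |].
    intros u Hu. replace (1 / 2 * u) with (u / 2) by field. now apply kk_decay. }
  assert (V1 : vanishes_0 G1).
  { apply (vanishes_power _ (8 / (1 / 4)) (1 / 4)); [lra|]. intros y Hy'.
    apply log_prim_small; auto; [lra | | |].
    - intros t. apply continuous_id_mul, continuous_kk.
    - apply (is_RInt_H_ext (fun t => -1 * (t * kk (- t)))); [intros; ring|].
      replace (- c1) with (-1 * c1) by ring. now apply is_RInt_H_scal.
    - intros u Hu. rewrite Rabs_mult, (Rabs_left1 u) by auto.
      pose proof (kk_decay u Hu) as H1. pose proof (id_le_exp (- u) ltac:(lra)) as H2.
      apply Rle_trans with (4 * exp (- u / 4) * (2 * exp (u / 2))).
      + apply Rmult_le_compat; auto; [lra | apply Rabs_pos].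
      + right. replace (1 / 4 * u) with (- u / 4 + u / 2) by field. rewrite exp_plus. ring. }
  assert (Hs : forall x, 0 < x -> exists sv sl : R,
    is_lim_seq (rsum (fun k => 1 * Vd (x * INR (S k)))) sv /\
    is_lim_seq (rsum (fun k => ln (INR (S k)) * Vd (x * INR (S k)))) sl).
  { intros z Hz. destruct (Vd_sum_converges z (fun _ => 1) Hz) as [sv H1].
    { intros k. pose proof (ln_ge_0 _ (INR_S_ge_1 k)). rewrite Rabs_R1. nra. }
    destruct (Vd_sum_converges z (fun k => ln (INR (S k))) Hz) as [sl H2].
    { intros k. pose proof (ln_ge_0 _ (INR_S_ge_1 k)). rewrite Rabs_pos_eq by auto. nra. }
    now exists sv, sl. }
  destruct (Hs x Hx) as (sv & sl & Hsv & Hsl). destruct (Hs (/ x) Hy) as (sv' & sl' & Hsv' & Hsl').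
  assert (Hlim : forall a z sv sl : R, 0 < z ->
    is_lim_seq (rsum (fun k => 1 * Vd (z * INR (S k)))) sv ->
    is_lim_seq (rsum (fun k => ln (INR (S k)) * Vd (z * INR (S k)))) sl ->
    is_lim_seq (fun M => cells (gM (S M)) (gMprim0 (S M)) (gMprim1 ell (S M)) a z (S M))
      (sl + a * sv - / z * (g1 / 2 + (d1 - c1) + a * euler_gamma / 2 + (a - ln z) * (c0 + d0)
      + ln z ^ 2 / 4 - a * ln z / 2))).
  { intros a z v l Hz H1 H2.
    pose proof (is_lim_seq_minus' _ _ _ _ (cells_gdig_limit c0 c1 d0 d1 g1 a z v l Hz Hd0 Hd1 Hg1 H1 H2)
      (cells_gM_close ell G0 G1 a z Hz Hell Vell HG0 V0 HG1 V1)) as H.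
    rewrite Rminus_0_r in H. eapply is_lim_seq_ext; [|exact H]. intros M. cbv beta. fold G0 G1. ring. }
  pose proof (is_lim_seq_minus' _ _ _ _ (Hlim (ln x) x sv sl Hx Hsv Hsl)
    (is_lim_seq_scal_l _ (/ x) _ (Hlim 0 (/ x) sv' sl' Hy Hsv' Hsl'))) as LT.
  pose proof (is_lim_seq_minus' _ _ _ _ (Hlim 1 x sv sl Hx Hsv Hsl) (Hlim 0 x sv sl Hx Hsv Hsl)) as LA.
  pose proof (is_lim_seq_scal_l _ (/ x) _ (is_lim_seq_minus' _ _ _ _ (Hlim 1 (/ x) sv' sl' Hy Hsv' Hsl')
    (Hlim 0 (/ x) sv' sl' Hy Hsv' Hsl'))) as LB.
  simpl Rbar_mult in LT, LA, LB.
  apply (is_lim_seq_ext _ _ _ (fun M => cells_symmetric ell x M Hx)) in LA.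
  apply (is_lim_seq_ext _ _ _ (fun M => TM_cells ell x M Hx)) in Htau.
  pose proof (is_lim_seq_uniq _ _ _ LA LB) as EA. pose proof (is_lim_seq_uniq _ _ _ Htau LT) as ET.
  clear - EA ET ES EC Hx Hy Hsv Hsl Hsv' Hsl'.
  unfold rho. rewrite (phi_log_eq x sv sl), (phi_log_eq (/ x) sv' sl') by auto.
  pose proof PI_RGT_0. rewrite !(ln_mult (2 * PI)) by lra.
  rewrite ln_Rinv in * by auto. rewrite ES, EC in ET. rewrite ES in EA.
  set (X := ln x) in *. set (L := ln (2 * PI)) in *. set (gam := euler_gamma) in *.
  (* [EA] contains [sv] with coefficient 1 and is solved for it; after elimination the claim is a
     field identity. *)
  assert (Esv : sv = / x * sv' + / x * (gam / 2 + - L / 2 - X / 2) - (gam / 2 + - L / 2 + X / 2)).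
  { match type of EA with ?l = ?r => assert (EA' : l - r = 0) by lra end.
    replace sv with (sv - 0) by ring. rewrite <- EA'. field. lra. }
  rewrite ET, Esv. field. lra.
Qed.

Theorem theorem1p1 (zeta : C -> C) (c alpha beta : R)
    (hzeta : is_riemann_zeta zeta) (hc0 : 0 < c) (hc1 : c < 1)
    (halpha : 0 < alpha) (hbeta : 0 < beta) (hab : alpha * beta = 1) :
  (sqrt alpha * scrG zeta c alpha)%C = (sqrt beta * scrG zeta c beta)%C.
Proof.
  assert (Eb : beta = / alpha).
  { apply Rmult_eq_reg_l with alpha; [|lra]. rewrite hab, Rinv_r; lra. }
  subst beta.
  destruct (scrH_antisymmetric zeta c hzeta (conj hc0 hc1)) as (ell & Hell & (q & K & Hq & Hsmall) & HH).
  destruct (HH alpha halpha) as (tau & Htau & E).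
  pose proof (TM_limit ell alpha tau halpha Hell (vanishes_power ell K q Hq Hsmall) Htau) as Et.
  cbv zeta in Et.
  (* The part of [scrG] apart from the integral. Its antisymmetrised value is [- tau], against
     [- 2 tau] for [scrH], which enters with the factor [- 1 / 2]; so the two cancel. *)
  set (rho := fun x => phi_log x - / (48 * x) * (12 * euler_gamma ^ 2 - 5 * PI ^ 2)
    + / (4 * x) * (euler_gamma * ln x + ln (2 * PI) * ln (2 * PI * x))).
  change (tau = - (rho alpha - / alpha * rho (/ alpha))) in Et.
  assert (EG : forall x, 0 < x -> scrG zeta c x = (RtoC (rho x) - / 2 * scrH zeta c x)%C).
  { intros x Hx. unfold scrG, rho. rewrite RtoC_plus, RtoC_minus.
    replace (1 / (48 * x)) with (/ (48 * x)) by (field; lra).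
    replace (1 / (4 * x)) with (/ (4 * x)) by (field; lra).
    unfold Cdiv. ring. }
  (* This reduces the claim to [scrG] at [alpha] being [/ alpha] times [scrG] at [/ alpha]. *)
  assert (Es : sqrt (/ alpha) = sqrt alpha * / alpha).
  { rewrite sqrt_inv. pose proof (sqrt_lt_R0 alpha halpha).
    rewrite <- (sqrt_sqrt alpha) at 3 by lra. field. lra. }
  rewrite !EG, Es, RtoC_mult by (auto; now apply Rinv_0_lt_compat).
  assert (EH : scrH zeta c alpha = (/ alpha * scrH zeta c (/ alpha) + RtoC (-2 * tau))%C).
  { rewrite <- E, <- RtoC_inv by lra. ring. }
  rewrite EH, Et.
  rewrite (RtoC_mult (-2)), RtoC_opp, RtoC_minus, (RtoC_mult (/ alpha) (rho (/ alpha))).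
  rewrite !RtoC_inv by lra.
  replace (RtoC (-2)) with (- (2))%C by (now rewrite <- RtoC_opp).
  field.
  intros E0. apply (f_equal fst) in E0. simpl in E0. lra.
Qed.
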